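(* Let $K$ be a field. The relation types that occur for AS-Ore extensions over $K$ in $5$ variables with $3$ degree one generators are exactly $$(2,3,3,3,3,3),\qquad (2,2,3),\qquad (2,2,3,4).$$ Moreover, among universal enveloping algebras of $5$-dimensional $\mathbb{N}$-graded Lie algebras over $K$ that are generated in degree one with $3$ degree one generators, there is none with relation type $(2,2,3)$, while there exist ones with relation type $(2,2,3,4)$ and ones with relation type $(2,3,3,3,3,3)$.
   Context: Let $K$ be a field. For a ring $R$, a ring endomorphism $\sigma$ of $R$ and a $\sigma$-derivation $\delta$ of $R$ (i.e. $\delta$ is additive and $\delta(r_1r_2)=\sigma(r_1)\delta(r_2)+\delta(r_1)r_2$), the Ore extension $R[x,\sigma,\delta]$ is the ring whose elements are written uniquely as $\sum_{i=0}^m a_ix^i$ with $a_i\in R$, with multiplication satisfying $xr=\sigma(r)x+\delta(r)$ for $r\in R$. A graded iterated Ore extension over $K$ in $n$ variables is a $K$-algebra (so $K$ is central) $A=K[x_1][x_2,\sigma_2,\delta_2]\cdots[x_n,\sigma_n,\delta_n]$ obtained by iterating this construction, where $\sigma_j$ and $\delta_j$ are a ($K$-linear) endomorphism and a ($K$-linear) $\sigma_j$-derivation of $K_{(j-1)}:=K[x_1][x_2,\sigma_2,\delta_2]\cdots[x_{j-1},\sigma_{j-1},\delta_{j-1}]$, together with integers $\deg(x_i)\ge 1$ such that for all $j>i$, $\sigma_j(x_i)$ is homogeneous of degree $\deg(x_i)$ and $\delta_j(x_i)$ is homogeneous of degree $\deg(x_j)+\deg(x_i)$ (with $0$ homogeneous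 of every degree). Such $A$ is $\mathbb{N}$-graded and connected. An AS-Ore extension is a graded iterated Ore extension in which every $\sigma_j$ is injective and which is generated in degree one as a $K$-algebra. Its number of degree one generators is $b=\dim_K A_1$. ''Dimension 5'' in this setting means five variables. An $\mathbb{N}$-graded Lie algebra is a finite-dimensional Lie algebra over $K$ with a $K$-basis $x_1,\dots,x_n$ whose elements are assigned positive integer degrees such that $[x_j,x_i]$ is a linear combination of basis elements of degree $\deg(x_j)+\deg(x_i)$; its universal enveloping algebra is then $\mathbb{N}$-graded and connected. ''Generated in degree one'' means generated as a $K$-algebra by its degree one piece, and the number of degree one generators is the dimension of that piece. Relation type: for a connected graded $K$-algebra $A$ generated in degree one, write $A\cong K\langle y_1,\dots,y_b\rangle/I$ with all $y_i$ of degree one, $b=\dim_K A_1$, and $I$ a homogeneous two-sided ideal. The relation type of $A$ is the list $(a_1,\dots,a_n)$, $a_1\le\cdots\le a_n$, of the degrees of the elements of a minimal homogeneous generating set of $I$ (independent of choices). *)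

(* Defs.v *)
(* MathComp; the free associative algebra is multinomials' monoid algebra over
   a free monoid. *)
From mathcomp Require Import all_boot all_algebra.
From mathcomp Require Export monalg.

Set Implicit Arguments.
Unset Strict Implicit.
Unset Printing Implicit Defensive.

Import GRing.Theory.
Local Open Scope ring_scope.

Inductive subalgebra_generated_by (K : fieldType) (A : algType K)
    (S : A -> Prop) : A -> Prop :=
| SubalgIn a : S a -> subalgebra_generated_by S a
| SubalgOne : subalgebra_generated_by S 1
| SubalgAdd a b : subalgebra_generated_by S a ->
    subalgebra_generated_by S b -> subalgebra_generated_by S (a + b)
| SubalgMul a b : subalgebra_generated_by S a ->
    subalgebra_generated_by S b -> subalgebra_generated_by S (a * b)
| SubalgScale c a : subalgebra_generated_by S a ->
    subalgebra_generated_by S (c *: a).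

Inductive ideal_generated_by (R : nzRingType) (S : R -> Prop) : R -> Prop :=
| IdealIn f : S f -> ideal_generated_by S f
| IdealZero : ideal_generated_by S 0
| IdealAdd f g : ideal_generated_by S f -> ideal_generated_by S g ->
    ideal_generated_by S (f + g)
| IdealMulL h f : ideal_generated_by S f -> ideal_generated_by S (h * f)
| IdealMulR h f : ideal_generated_by S f -> ideal_generated_by S (f * h).

Definition generates_ideal (R : nzRingType) (S I : R -> Prop) : Prop :=
  forall f, I f <-> ideal_generated_by S f.

(* The family is indexed, so that a repeated entry violates minimality. *)
Definition minimal_ideal_generators (R : nzRingType) (n : nat)
    (r : 'I_n -> R) (I : R -> Prop) : Prop :=
  let subfamily (J : {set 'I_n}) := fun f => exists2 i, i \in J & f = r i in
  generates_ideal (subfamily [set: 'I_n]) I /\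
  forall J : {set 'I_n}, J \proper [set: 'I_n] ->
    ~ generates_ideal (subfamily J) I.

Definition subspace_dim (K : fieldType) (V : lmodType K) (S : V -> Prop)
    (b : nat) : Prop :=
  exists e : 'I_b -> V,
    (forall v, S v <-> exists c : 'I_b -> K, v = \sum_i c i *: e i) /\
    (forall c : 'I_b -> K, \sum_i c i *: e i = 0 -> forall i, c i = 0).

(* A grading of A is given by its family of homogeneous components:
   G d a means that a is homogeneous of degree d, and G d 0 holds for all d. *)
Definition generated_in_degree_one (K : fieldType) (A : algType K)
    (G : nat -> A -> Prop) : Prop :=
  forall a, subalgebra_generated_by (G 1%N) a.

(* Since horner evaluation keeps the coefficients on the left,
   (map_poly iota p).[x] is \sum_i iota p`_i * x ^+ i, also when x does not
   commute with the coefficients. *)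
Definition unique_expansions (R A : nzRingType) (iota : R -> A) (x : A)
  : Prop :=
  forall a : A, exists! p : {poly R}, (map_poly iota p).[x] = a.

Definition skew_derivation (K : fieldType) (R : algType K)
    (sigma : {lrmorphism R -> R}) (delta : {linear R -> R}) : Prop :=
  forall r1 r2, delta (r1 * r2) = sigma r1 * delta r2 + delta r1 * r2.

Definition ore_extension (K : fieldType) (R A : algType K)
    (iota : {lrmorphism R -> A})
    (sigma : {lrmorphism R -> R}) (delta : {linear R -> R}) (x : A) : Prop :=
  [/\ skew_derivation sigma delta,
      unique_expansions iota x
    & forall r, x * iota r = iota (sigma r) * x + iota (delta r)].

(* The grading in which \sum_i a_i x ^+ i is homogeneous of degree d iff each
   nonzero a_i is homogeneous of degree d - i * e, where e is the degree of x. *)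
Definition expansion_grading (R A : nzRingType) (G : nat -> R -> Prop)
    (iota : R -> A) (x : A) (e : nat) : nat -> A -> Prop :=
  fun d a => exists2 p : {poly R}, (map_poly iota p).[x] = a &
    forall i, p`_i = 0 \/ (exists2 c, (c + i * e)%N = d & G c p`_i).

Definition scalar_grading (K : fieldType) : nat -> K -> Prop :=
  fun d c => c = 0 \/ d = 0%N.

(* graded_iterated_ore vars G is the type of presentations of A as a graded
   iterated Ore extension in the variables vars, listed with their degrees;
   G is the resulting grading of A. *)
Inductive graded_iterated_ore (K : fieldType) :
    forall A : algType K, seq (A * nat) -> (nat -> A -> Prop) -> Type :=
| PolynomialRing (A : algType K) (x : A) (e : nat) :
    (0 < e)%N ->
    unique_expansions (in_alg A) x ->
    graded_iterated_ore [:: (x, e)]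
      (expansion_grading (@scalar_grading K) (in_alg A) x e)
| OreStep (R : algType K) (vars : seq (R * nat)) (G : nat -> R -> Prop)
    (A : algType K) (iota : {lrmorphism R -> A})
    (sigma : {lrmorphism R -> R}) (delta : {linear R -> R})
    (x : A) (e : nat) :
    graded_iterated_ore vars G ->
    (0 < e)%N ->
    ore_extension iota sigma delta x ->
    (forall v, v \in vars ->
      G v.2 (sigma v.1) /\ G (e + v.2)%N (delta v.1)) ->
    graded_iterated_ore (rcons [seq (iota v.1, v.2) | v <- vars] (x, e))
      (expansion_grading G iota x e).

Fixpoint sigmas_injective (K : fieldType) (A : algType K)
    (vars : seq (A * nat)) (G : nat -> A -> Prop)
    (T : graded_iterated_ore vars G) : Prop :=
  match T with
  | PolynomialRing _ _ _ _ _ => True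
  | OreStep _ _ _ _ _ sigma _ _ _ T' _ _ _ =>
      injective sigma /\ sigmas_injective T'
  end.

Definition AS_Ore_extension (K : fieldType) (n : nat) (A : algType K)
    (G : nat -> A -> Prop) : Prop :=
  exists (vars : seq (A * nat)) (T : graded_iterated_ore vars G),
    [/\ size vars = n, sigmas_injective T & generated_in_degree_one G].

Notation free_algebra K n := {malg K[{fmonom 'I_n}]}.

Definition free_gen (K : fieldType) (n : nat) (i : 'I_n) : free_algebra K n :=
  << fmu i >>.

Definition free_homogeneous (K : fieldType) (n : nat) (w : 'I_n -> nat)
    (d : nat) (f : free_algebra K n) : Prop :=
  forall m : {fmonom 'I_n}, f@_m != 0 ->
    (\sum_(i <- (m : seq 'I_n)) w i)%N = d.

Definition relation_type (K : fieldType) (A : algType K)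
    (G : nat -> A -> Prop) (a : seq nat) : Prop :=
  sorted leq a /\
  exists (b : nat) (pi : {lrmorphism free_algebra K b -> A})
         (r : 'I_(size a) -> free_algebra K b),
    [/\ subspace_dim (G 1%N) b,
        forall i, G 1%N (pi (free_gen K i)),
        forall u, exists f, pi f = u,
        forall k : 'I_(size a),
          free_homogeneous (fun=> 1%N) (nth 0%N a k) (r k)
      & minimal_ideal_generators r (fun f => pi f = 0)].

Definition lie_bracket (K : fieldType) (L : lmodType K) (br : L -> L -> L)
  : Prop :=
  [/\ forall u, linear (br u),
      forall v, linear (br^~ v),
      forall u, br u u = 0
    & forall u v t, br u (br v t) + br v (br t u) + br t (br u v) = 0].

Definition graded_lie_algebra (K : fieldType) (L : vectType K)
    (br : L -> L -> L) (n : nat) (x : n.-tuple L) (w : 'I_n -> nat) : Prop :=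
  [/\ lie_bracket br,
      basis_of fullv x,
      forall i, (0 < w i)%N
    & forall i j, br (tnth x j) (tnth x i)
        \in <<[seq tnth x k | k <- enum 'I_n & w k == (w j + w i)%N]>>%VS].

Definition lie_relator (K : fieldType) (L : vectType K)
    (br : L -> L -> L) (n : nat) (x : n.-tuple L) (i j : 'I_n)
  : free_algebra K n :=
  free_gen K j * free_gen K i - free_gen K i * free_gen K j
  - \sum_k coord x k (br (tnth x j) (tnth x i)) *: free_gen K k.

(* The tensor algebra of L is the free algebra on a basis x of L; pi identifies
   U with its quotient by the ideal generated by the v u - u v - [v, u]. *)
Definition universal_enveloping_algebra (K : fieldType) (L : vectType K)
    (br : L -> L -> L) (n : nat) (x : n.-tuple L)
    (U : algType K) (pi : {lrmorphism free_algebra K n -> U}) : Prop :=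
  (forall u, exists f, pi f = u) /\
  generates_ideal (fun f => exists i j, f = lie_relator br x i j)
    (fun f => pi f = 0).

Definition quotient_grading (K : fieldType) (n : nat) (w : 'I_n -> nat)
    (U : algType K) (pi : {lrmorphism free_algebra K n -> U})
  : nat -> U -> Prop :=
  fun d u => exists2 f, free_homogeneous w d f & pi f = u.

Definition graded_enveloping_algebra (K : fieldType) (n : nat) (U : algType K)
    (G : nat -> U -> Prop) : Prop :=
  exists (L : vectType K) (br : L -> L -> L) (x : n.-tuple L)
         (w : 'I_n -> nat) (pi : {lrmorphism free_algebra K n -> U}),
    [/\ graded_lie_algebra br x w,
        universal_enveloping_algebra br x pi
      & G = quotient_grading w pi].

(* Main.v *)
Require Import Defs.
From HB Require Import structures.
From mathcomp Require Import all_boot all_algebra finmap.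
From mathcomp Require Import zify ring.
From Stdlib Require Import Classical ClassicalEpsilon PropExtensionality FunctionalExtensionality.

(** Three assertions are combined: an AS-Ore extension in five variables with
three generators has one of the three types, each type occurs, and (2,2,3) does
not come from a Lie algebra.

The types of Ore extensions.  An iterated Ore extension A is treated as a tower
of graded steps starting from K.  A character of A_+ / (A_+ A_+) in degree k
(a cocycle of degree one) detects a generator of degree k; it extends along the
later steps unless the skew derivation produces that generator from variables
of smaller degree.  As A is generated in degree one, each variable of degree
above one has a degree that is the sum of two other variable degrees, and the
last variable has degree one.  With three variables of degree one, the degrees
are therefore (1,1,1,2,2) or (1,1,1,2,3) up to order [tower_degrees].

The quadratic relations have no linear syzygies [tower_no_linear_syzygy]: such
a syzygy would force the last skew derivation to map R_1 into R_1 R_1, where R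
is the tower without the last variable, and then A would not reach its
generators of degree two.  So the Hilbert series, which is that of the
polynomial ring on variables of these degrees, determines the number of minimal
relations of degree two and three: one and five in the first case, two and one
in the second.  Minimal relations of degree d are dual to the group H^2 of
2-cocycles of internal degree d modulo exact ones.  To compute H^2 for d >= 4,
a free resolution of K is built as an iterated mapping cone: its basis vectors
are the sets of variables, as in a Koszul complex, and its transpose resolves K
on the other side [cone_resolution, tower_resolution].  Pairing a cocycle with
the last two differentials, its contraction, is faithful on H^2
[contraction_exact] and takes values in a space indexed by the sets of three
variables of total degree l - d, where l is the sum of all degrees.  Such a set
has total degree at least 3, and for d = l - 3 the only one consists of the
variables of degree one; its contraction vanishes because there are no linear
syzygies [cubic_row_scalar].  This leaves d = 4 for the degrees (1,1,1,2,3),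
where l = 8; restriction to R and cup products show that H^2 then has dimension
at most one [cocycle2_pencil].  Hence the types are (2,3,3,3,3,3), or (2,2,3)
with at most one further relation of degree four [tower_relation_type].

The examples.  All three types are found in one family of iterated Ore
extensions in a, y, z, b, x with four parameters [relations, family_exists].
The universal property of Ore extensions turns the defining relations into a
presentation.  The degrees (1,2,2,1,1) force the first type.  For the degrees
(1,2,3,1,1) and one choice of parameters, the relations
x a = a x + b b,  x b = b x,  [b,a] a = a [b,a]  imply all others
[type_223_relations], which gives (2,2,3).  With trivial twists the algebras are
enveloping algebras, and for the degrees (1,2,3,1,1) the type of such an algebra
is (2,2,3,4), once (2,2,3) is excluded.

Enveloping algebras.  A Lie algebra L of dimension five, generated by three
elements of degree one, has weights (1,1,1,2,2) or (1,1,1,2,3).  In the first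
case the quadratic relations are the kernel of the bracket from the exterior
square of L_1 onto L_2, a line, so that there are not two of them
[two_quadratic_weights].  In the second case the relations of degree at most
three hold in an algebra of 5 x 5 matrices with a quadruple bracket of
generators that does not vanish there although it vanishes in L; a relation of
degree four is therefore missing [cubic_contradiction]. *)

Set Implicit Arguments.
Unset Strict Implicit.
Unset Printing Implicit Defensive.

Import GRing.Theory.
Local Open Scope ring_scope.

(** * Finite-dimensional subspaces *)

Lemma fchoice (T U : Type) (P : T -> U -> Prop) :
  (forall t, exists u, P t u) -> exists f, forall t, P t (f t).
Proof.
move=> H; exists (fun t => proj1_sig (constructive_indefinite_description _ (H t))).
by move=> t; case: constructive_indefinite_description.
Qed.

Section LinearAlgebra.
Variables (K : fieldType) (V : lmodType K).

Definition independent (I : finType) (e : I -> V) : Prop :=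
  forall c : I -> K, \sum_i c i *: e i = 0 -> forall i, c i = 0.

Definition spanned (I : finType) (e : I -> V) (v : V) : Prop :=
  exists c : I -> K, v = \sum_i c i *: e i.

Definition subspace (S : V -> Prop) : Prop :=
  S 0 /\ forall c u v, S u -> S v -> S (c *: u + v).

Lemma subspaceD S u v : subspace S -> S u -> S v -> S (u + v).
Proof. by case=> _ h Su Sv; rewrite -[u]scale1r; apply: h. Qed.

Lemma subspaceZ S c u : subspace S -> S u -> S (c *: u).
Proof. by case=> h0 h Su; rewrite -[_ *: _]addr0; apply: h. Qed.

Lemma subspaceN S u : subspace S -> S u -> S (- u).
Proof. by move=> h Su; rewrite -scaleN1r; apply: subspaceZ. Qed.

Lemma subspaceB S u v : subspace S -> S u -> S v -> S (u - v).
Proof. by move=> h Su Sv; apply: subspaceD => //; apply: subspaceN. Qed.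

Lemma subspace_sum S (I : Type) (r : seq I) (P : pred I) (f : I -> V) :
  subspace S -> (forall i, P i -> S (f i)) -> S (\sum_(i <- r | P i) f i).
Proof.
move=> h hf; elim/big_rec: _ => [|i u Pi Su]; first by case: h.
by apply: subspaceD => //; apply: hf.
Qed.

Lemma subspace_spanned (I : finType) (e : I -> V) : subspace (spanned e).
Proof.
split; first by exists (fun=> 0); rewrite big1 // => i _; rewrite scale0r.
move=> a u v [c ->] [d ->]; exists (fun i => a * c i + d i).
rewrite scaler_sumr -big_split; apply: eq_bigr => i _.
by rewrite scalerDl scalerA.
Qed.

Lemma spanned_gen (I : finType) (e : I -> V) i : spanned e (e i).
Proof.
exists (fun j => (j == i)%:R); rewrite (bigD1 i) //= eqxx scale1r big1 ?addr0 //.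
by move=> j /negPf ->; rewrite scale0r.
Qed.

Lemma spanned_sub (I : finType) (e : I -> V) S v :
  subspace S -> (forall i, S (e i)) -> spanned e v -> S v.
Proof.
by move=> hS he [c ->]; apply: subspace_sum => // i _; apply: subspaceZ.
Qed.

Lemma steinitz (I J : finType) (e : I -> V) (f : J -> V) :
  independent f -> (forall j, spanned e (f j)) -> (#|J| <= #|I|)%N.
Proof.
move=> indf spf; rewrite leqNgt; apply/negP => ltIJ.
have [C hC] := fchoice spf.
pose M : 'M[K]_(#|J|, #|I|) := \matrix_(j, i) C (enum_val j) (enum_val i).
have : kermx M != 0.
  by rewrite kermx_eq0 /row_free neq_ltn (leq_ltn_trans (rank_leq_col M) ltIJ).
case/rowV0Pn => w /sub_kermxP wM nzw.
case/negP: nzw; apply/eqP/rowP => j; rewrite mxE.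
have := indf (fun j => w 0 (enum_rank j)) _ (enum_val j).
rewrite enum_valK; apply.
under eq_bigr => k _ do rewrite hC scaler_sumr.
rewrite exchange_big big1 //= => i _.
under eq_bigr => k _ do rewrite scalerA.
rewrite -scaler_suml.
have /rowP/(_ (enum_rank i)) := wM; rewrite !mxE => h.
rewrite (reindex (@enum_val J J)) /=; last by apply: onW_bij; apply: enum_val_bij.
rewrite -[RHS](scale0r (e i)); congr (_ *: _); rewrite -[RHS]h; apply: eq_bigr => k _.
by rewrite mxE enum_valK enum_rankK.
Qed.

(** Finite bases may be indexed by any finite type, which is how direct sums
of subspaces and word bases are handled below. *)
Definition basis (I : finType) (e : I -> V) (S : V -> Prop) : Prop :=
  [/\ independent e, forall i, S (e i) & forall v, S v -> spanned e v].

Lemma basis_card (I J : finType) (e : I -> V) (f : J -> V) S :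
  basis e S -> basis f S -> #|I| = #|J|.
Proof.
move=> [ie Se spe] [jf Sf spf]; apply/eqP; rewrite eqn_leq.
by apply/andP; split; [apply: (steinitz (e := f) ie) => i; apply: spf
  | apply: (steinitz (e := e) jf) => i; apply: spe].
Qed.

Lemma basis_dim (I : finType) (e : I -> V) S :
  subspace S -> basis e S -> subspace_dim S #|I|.
Proof.
move=> hS [ie Se spe].
have re (c : I -> K) : \sum_i c i *: e i =
    \sum_(i < #|I|) c (enum_val i) *: e (enum_val i).
  by rewrite (reindex (@enum_val I I)) //; apply: onW_bij; apply: enum_val_bij.
exists (fun i => e (enum_val i)); split.
  move=> v; split=> [/spe[c ->]|[c ->]]; first by exists (fun i => c (enum_val i)).
  by apply: subspace_sum => // i _; apply: subspaceZ.
move=> c hc i; have := ie (fun i => c (enum_rank i)) _ (enum_val i).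
rewrite enum_valK; apply.
by rewrite re -[RHS]hc; apply: eq_bigr => j _; rewrite enum_valK.
Qed.

Lemma dim_basis (S : V -> Prop) n : subspace_dim S n -> exists e : 'I_n -> V, basis e S.
Proof.
case=> e [he ie]; exists e; split=> // [i|v /he //].
by apply/he; case: (spanned_gen e i) => c hc; exists c.
Qed.

Lemma dim_subspace (S : V -> Prop) n : subspace_dim S n -> subspace S.
Proof.
case=> e [he _]; have [h0 h] := subspace_spanned e; split; first by apply/he.
by move=> c u v /he hu /he hv; apply/he; apply: h.
Qed.

Lemma dim_uniq (S : V -> Prop) n m : subspace_dim S n -> subspace_dim S m -> n = m.
Proof.
move=> /dim_basis[e he] /dim_basis[f hf].
by rewrite -[n]card_ord -[m]card_ord (basis_card he hf).
Qed.

Lemma subspace_dim_eq (S S' : V -> Prop) n :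
  (forall v, S v <-> S' v) -> subspace_dim S n -> subspace_dim S' n.
Proof.
move=> h [e [he ie]]; exists e; split=> // v; split=> [/h/he //|hv].
by apply/h/he.
Qed.

(** A vector outside a subspace of a finitely spanned space is separated from
it by a functional: enlarge the subspace along the spanning family as long as
the vector is avoided; the vector then spans a complement. *)
Lemma separation (n : nat) (e : 'I_n -> V) (S N : V -> Prop) (r : V) :
  subspace S -> (forall v, S v -> spanned e v) -> subspace N ->
  S r -> ~ N r ->
  exists psi : V -> K,
    [/\ forall c u v, S u -> S v -> psi (c *: u + v) = c * psi u + psi v,
        forall v, S v -> N v -> psi v = 0 & psi r = 1].
Proof.
move=> sS spe sN Sr nNr.
pose add (M : V -> Prop) w v := exists c, M (v - c *: w).
have sub_add M w : subspace M -> subspace (add M w).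
  move=> sM; split; first by exists 0; rewrite scale0r subr0; case: sM.
  move=> a u v [c hc] [d hd]; exists (a * c + d).
  have -> : a *: u + v - (a * c + d) *: w = a *: (u - c *: w) + (v - d *: w).
    by rewrite scalerBr scalerDl scalerA opprD addrACA.
  by case: sM => _; apply.
have [M [sM NM nMr hM]] : exists M, [/\ subspace M, forall v, N v -> M v,
    ~ M r & forall i : 'I_n, add M r (e i)].
  suff /(_ n (leqnn n)) [M [sM NM nMr hM]] : forall k, (k <= n)%N -> exists M,
    [/\ subspace M, forall v, N v -> M v,
    ~ M r & forall i : 'I_n, (i < k)%N -> add M r (e i)].
    by exists M; split=> // i; apply: hM.
    elim=> [|k IH] lekn; first by exists N.
    have [M [sM NM nMr hM]] := IH (ltnW lekn).
    pose w := e (Ordinal lekn).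
    case: (excluded_middle_informative (add M w r)) => hr.
      exists M; split=> // i; rewrite ltnS leq_eqVlt => /orP[/eqP ik|/hM //].
      have -> : e i = w by congr e; apply: val_inj.
      case: hr => c hc; have nzc : c != 0.
        by apply/eqP => c0; apply: nMr; rewrite c0 scale0r subr0 in hc.
      exists c^-1; have := subspaceZ (- c^-1) sM hc.
      by rewrite scalerBr scalerA mulNr mulVf // !scaleNr opprK scale1r addrC.
    exists (add M w); split=> //; first exact: sub_add.
      by move=> v /NM Mv; exists 0; rewrite scale0r subr0.
    move=> i; rewrite ltnS leq_eqVlt => /orP[/eqP ik|/hM [c hc]].
      exists 0, 1; rewrite scale0r subr0 scale1r.
      have -> : e i = w by congr e; apply: val_inj.
      by rewrite subrr; case: sM.
    by exists c, 0; rewrite scale0r subr0.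
have dec v : exists c, S v -> M (v - c *: r).
  case: (excluded_middle_informative (S v)) => [Sv|nSv]; last by exists 0.
  have [d hd] : add M r v.
    by apply: spanned_sub (spe _ Sv) => //; apply: sub_add.
  by exists d.
have [psi hpsi] := fchoice dec.
have psiE v c : S v -> M (v - c *: r) -> psi v = c.
  move=> Sv Mc; apply/eqP; rewrite -subr_eq0; apply/negPn/negP => nz.
  apply: nMr; have := subspaceB sM Mc (hpsi _ Sv).
  rewrite opprB addrC subrKA -scalerBl.
  move=> h; rewrite -[r]scale1r -(mulVf nz) -scalerA; exact: subspaceZ.
exists psi; split=> [c u v Su Sv|v Sv Nv|].
- apply: psiE; first by case: sS => _; apply.
  have -> : c *: u + v - (c * psi u + psi v) *: r
          = c *: (u - psi u *: r) + (v - psi v *: r).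
    by rewrite scalerBr scalerDl scalerA opprD addrACA.
  by case: sM => _; apply; apply: hpsi.
- by apply: psiE => //; rewrite scale0r subr0; apply: NM.
by apply: psiE => //; rewrite scale1r subrr; case: sM.
Qed.

End LinearAlgebra.

(** Complementing a basis of the kernel by lifts of a basis of the image gives
a basis of the source. *)
Lemma rank_nullity (K : fieldType) (V W : lmodType K) (I J L : finType) (p : {linear W -> V})
    (S : W -> Prop) (T : V -> Prop)
    (e : I -> W) (f : J -> V) (k : L -> W) :
  subspace S -> basis e S -> basis f T -> (forall w, S w -> T (p w)) ->
  (forall v, T v -> exists2 w, S w & p w = v) ->
  basis k (fun w => S w /\ p w = 0) ->
  #|I| = (#|J| + #|L|)%N.
Proof.
move=> sS be [indf Tf spf] pT lift [indk Sk spk].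
have [g hg] := fchoice (fun j => let: ex_intro2 w a b := lift _ (Tf j) in
   ex_intro (fun w => S w /\ p w = f j) w (conj a b)).
rewrite -card_sum; apply: (basis_card be (f := fun s : J + L =>
  match s with inl j => g j | inr l => k l end)); split.
- move=> c; rewrite big_sumType /= => h0.
  have cJ j : c (inl j) = 0.
    apply: (indf (fun j => c (inl j))); have := congr1 p h0.
    rewrite linear0 linearD !linear_sum /= [X in _ + X]big1 ?addr0.
      by move=> h; rewrite -[RHS]h; apply: eq_bigr => i _; rewrite linearZ /= (hg i).2.
    by move=> l _; rewrite linearZ /= (Sk l).2 scaler0.
  case=> [//|l]; apply: (indk (fun l => c (inr l))).
  by rewrite -[RHS]h0 [X in _ = X + _]big1 ?add0r // => j _; rewrite cJ scale0r.
- by case=> [j|l]; [case: (hg j) | case: (Sk l)].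
move=> w Sw; have [c hc] := spf _ (pT _ Sw).
have [d hd] : spanned k (w - \sum_j c j *: g j).
  apply: spk; split.
    apply: subspaceB => //; apply: subspace_sum => // j _.
    by apply: subspaceZ => //; case: (hg j).
  rewrite linearB /= hc linear_sum -sumrB big1 // => j _.
  by rewrite linearZ /= (hg j).2 subrr.
exists (fun s => match s with inl j => c j | inr l => d l end).
by rewrite big_sumType /= -hd addrC subrK.
Qed.

(** * Graded Ore steps *)

Section Graded.
Variables (K : fieldType) (A : algType K) (G : nat -> A -> Prop).

(** As the components are predicates, the projections onto them have to be
asserted.  The clause on degree 0 says that A is connected. *)
Record graded : Prop := Graded {
  gr_sub : forall d, subspace (G d);
  gr_scal : forall a, G 0 a <-> exists c : K, a = c%:A;
  gr_mul : forall d d' a b, G d a -> G d' b -> G (d + d')%N (a * b);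
  gr_comp : exists comp : nat -> A -> A,
    (forall d c u v, comp d (c *: u + v) = c *: comp d u + comp d v) /\
    (forall d d' a, G d' a -> comp d a = if d == d' then a else 0);
  gr_total : forall a, exists (m : nat) (f : nat -> A),
    (forall d, G d (f d)) /\ a = \sum_(d < m) f d }.

(** Matrix entries have differences of degrees as degrees, which may be negative. *)
Definition GD (m n : nat) (a : A) : Prop :=
  if (n <= m)%N then G (m - n)%N a else a = 0.

Hypothesis gr : graded.

Lemma gr0 d : G d 0. Proof. by case: (gr_sub gr d). Qed.
Lemma grD d a b : G d a -> G d b -> G d (a + b).
Proof. exact: subspaceD (gr_sub gr d). Qed.
Lemma grZ d c a : G d a -> G d (c *: a).
Proof. exact: subspaceZ (gr_sub gr d). Qed.
Lemma grN d a : G d a -> G d (- a).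
Proof. exact: subspaceN (gr_sub gr d). Qed.
Lemma grB d a b : G d a -> G d b -> G d (a - b).
Proof. exact: subspaceB (gr_sub gr d). Qed.
Lemma gr_alg (c : K) : G 0 c%:A. Proof. by apply/(gr_scal gr); exists c. Qed.
Lemma gr1 : G 0 1. Proof. by rewrite -[1]scale1r; apply: gr_alg. Qed.

Lemma gr_uniq d d' a : G d a -> G d' a -> d != d' -> a = 0.
Proof.
have [comp [_ hc]] := gr_comp gr; move=> h h' /negPf nd.
by have := hc d _ _ h; rewrite eqxx (hc _ _ _ h') nd.
Qed.

Lemma subspaceGD m n : subspace (GD m n).
Proof.
rewrite /GD; case: leqP => _; first exact: gr_sub.
by split=> // c u v -> ->; rewrite scaler0 addr0.
Qed.

Lemma GD0 m n : GD m n 0. Proof. by case: (subspaceGD m n). Qed.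

Lemma GDM m n k a b : GD m n a -> GD n k b -> GD m k (a * b).
Proof.
rewrite /GD; case: (leqP n m) => [lenm|ltmn].
  case: (leqP k n) => [lekn ga gb|ltnk ga ->].
    rewrite (leq_trans lekn lenm); have -> : (m - k = (m - n) + (n - k))%N by lia.
    exact: gr_mul.
  by rewrite mulr0; case: leqP => // _; apply: gr0.
by move=> -> _; rewrite mul0r; case: leqP => // _; apply: gr0.
Qed.

Lemma GD_shift k m n a : GD (m + k) (n + k) a <-> GD m n a.
Proof. by rewrite /GD leq_add2r subnDr. Qed.

Lemma GDn0 m a : GD m 0 a <-> G m a.
Proof. by rewrite /GD leq0n subn0. Qed.

Lemma GDnn m c : GD m m c%:A.
Proof. by rewrite /GD leqnn subnn; apply: gr_alg. Qed.

Lemma GDnnP m a : GD m m a -> exists c : K, a = c%:A.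
Proof. by rewrite /GD leqnn subnn; move/(gr_scal gr). Qed.

Lemma GD_lt m n a : (m < n)%N -> GD m n a -> a = 0.
Proof. by rewrite ltnNge /GD => /negPf ->. Qed.

Lemma GDE d m n : (m = d + n)%N -> forall a, GD m n a <-> G d a.
Proof. by move=> -> a; rewrite /GD leq_addl addnK. Qed.

Lemma alg_inj0 (c : K) : c%:A = 0 :> A -> c = 0.
Proof.
by move/eqP; rewrite scaler_eq0 oner_eq0 orbF => /eqP.
Qed.

End Graded.

Arguments GD {K A} G m n a.

Definition finite_components (K : fieldType) (A : algType K)
    (G : nat -> A -> Prop) : Prop :=
  forall d, exists n, subspace_dim (G d) n.

(** One Ore step, together with its grading.  Every element is r + b x and also
r + x b; the second expansion uses that sigma is onto. *)
Record ore_step (K : fieldType) (R A : algType K) (iota : {lrmorphism R -> A})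
    (sigma : {lrmorphism R -> R}) (delta : {linear R -> R}) (x : A) (e : nat)
    (G : nat -> R -> Prop) (G' : nat -> A -> Prop) : Prop := OreStepData {
  os_gr : graded G;
  os_gr' : graded G';
  os_e : (0 < e)%N;
  os_skew : skew_derivation sigma delta;
  os_comm : forall r, x * iota r = iota (sigma r) * x + iota (delta r);
  os_sig : forall d r, G d r -> G d (sigma r);
  os_sig_onto : forall d r, G d r -> exists2 s, G d s & sigma s = r;
  os_inj : injective sigma;
  os_del : forall d r, G d r -> G (e + d)%N (delta r);
  os_iota : forall d r, G d r -> G' d (iota r);
  os_x : G' e x;
  os_decl : forall d a, G' d a ->
    exists r b, [/\ G d r, GD G' d e b & a = iota r + b * x];
  os_decr : forall d a, G' d a ->
    exists r b, [/\ G d r, GD G' d e b & a = iota r + x * b];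
  os_uniql : forall r b, iota r + b * x = 0 -> r = 0 /\ b = 0;
  os_uniqr : forall r b, iota r + x * b = 0 -> r = 0 /\ b = 0 }.

Section OreStep.
Variables (K : fieldType) (R A : algType K) (iota : {lrmorphism R -> A}).
Variables (sigma : {lrmorphism R -> R}) (delta : {linear R -> R}) (x : A).
Variables (e : nat) (G : nat -> R -> Prop).
Hypotheses (gr : graded G) (fin : finite_components G) (e_gt0 : (0 < e)%N).
Hypothesis ore : ore_extension iota sigma delta x.
Hypothesis sigG : forall d r, G d r -> G d (sigma r).
Hypothesis delG : forall d r, G d r -> G (e + d)%N (delta r).
Hypothesis sigI : injective sigma.

Let ev (p : {poly R}) : A := (map_poly iota p).[x].
Local Notation G' := (expansion_grading G iota x e).

Let skew := let: And3 s _ _ := ore in s.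
Let unexp := let: And3 _ u _ := ore in u.
Let comm := let: And3 _ _ c := ore in c.

Let evD p q : ev (p + q) = ev p + ev q.
Proof. by rewrite /ev rmorphD hornerD. Qed.

Let evC r : ev r%:P = iota r.
Proof. by rewrite /ev map_polyC hornerC. Qed.

Let evMX p : ev (p * 'X) = ev p * x.
Proof. by rewrite /ev rmorphM /= map_polyX hornerMX. Qed.

Let evCM r p : ev (r%:P * p) = iota r * ev p.
Proof.
by rewrite /ev rmorphM /= map_polyC mul_polyC hornerZ.
Qed.

Let ev_inj : injective ev.
Proof.
move=> p q epq; have [r [_ hr]] := unexp (ev p).
by rewrite -(hr p (erefl _)) -(hr q (esym epq)).
Qed.

Let ev_onto a : exists p, ev p = a.
Proof. by have [p [hp _]] := unexp a; exists p. Qed.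

Let ev0 : ev 0 = 0. Proof. by rewrite /ev rmorph0 horner0. Qed.

Let polysplit (p : {poly R}) : p = (p`_0)%:P + drop_poly 1 p * 'X.
Proof.
apply/polyP => -[|i]; rewrite coefD coefC coefMX ?addr0 //=.
by rewrite coef_drop_poly addn1 add0r.
Qed.

Let ev_split p : ev p = iota p`_0 + ev (drop_poly 1 p) * x.
Proof. by rewrite {1}(polysplit p) evD evC evMX. Qed.

Let GP d a : G' d a <-> exists2 p, ev p = a & forall i, GD G d (i * e) p`_i.
Proof.
split=> -[p pa hp]; exists p => // i; rewrite /GD.
  case: (hp i) => [->|[c <- gc]]; last by rewrite leq_addl addnK.
  by case: leqP => // _; apply: gr0.
have := hp i; rewrite /GD; case: leqP => [le gi|_ ->]; last by left.
by right; exists (d - i * e)%N => //; rewrite subnK.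
Qed.

Let xev (p : {poly R}) :
  x * ev p = ev (\poly_(i < (size p).+1)
     ((if i is j.+1 then sigma p`_j else 0) + delta p`_i)).
Proof.
have coefq (q : {poly R}) i : (\poly_(i < (size q).+1)
     ((if i is j.+1 then sigma q`_j else 0) + delta q`_i))`_i =
     (if i is j.+1 then sigma q`_j else 0) + delta q`_i.
  rewrite coef_poly; case: ltnP => // lt.
  case: i lt => [|i] lt; first by [].
  by rewrite !nth_default ?rmorph0 ?linear0 ?addr0 // ltnW.
elim/poly_ind: p => [|p c IH].
  rewrite ev0 mulr0 -[LHS]ev0; congr ev; apply/polyP => i.
  by rewrite coefq !coef0; case: i => [|i]; rewrite ?coef0 ?rmorph0 linear0 addr0.
rewrite evD evMX evC mulrDr mulrA IH comm -evMX -evC -evMX -[iota (delta c)]evC -!evD.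
congr ev; apply/polyP => i.
rewrite coefq !coefD !coefMX coefC coefq; case: i => [|i] /=.
  by rewrite !coefC /= !add0r.
rewrite !coefC /= !addr0 coefD coefMX coefC.
by case: i => [|i] /=; rewrite ?add0r ?addr0 // addrC.
Qed.

Let sub' d : subspace (G' d).
Proof.
split; first by apply/GP; exists 0 => // i; rewrite coef0; apply: GD0.
move=> c u v /GP[p <- hp] /GP[q <- hq]; apply/GP; exists ((c%:A)%:P * p + q).
  by rewrite evD evCM linearZ /= rmorph1 -scalerAl mul1r.
move=> i; rewrite coefD coefCM -scalerAl mul1r.
by case: (subspaceGD gr d (i * e)) => _; apply.
Qed.

Let Giota d r : G d r -> G' d (iota r).
Proof.
move=> gr_r; apply/GP; exists r%:P => // i; rewrite coefC.
by case: eqP => [->|_]; [rewrite mul0n; apply/GDn0 | apply: GD0].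
Qed.

Let GxM d b : G' d b -> G' (d + e)%N (x * b).
Proof.
case/GP=> p <- hp; apply/GP; rewrite xev; eexists; first by [].
move=> i; rewrite coef_poly; case: ltnP => _; last exact: GD0.
apply: (subspaceD (subspaceGD gr _ _)).
  case: i => [|i]; first exact: GD0.
  rewrite mulSnr; apply/GD_shift; have := hp i; rewrite /GD.
  by case: leqP => _ => [/sigG|->] //; rewrite rmorph0.
have := hp i; rewrite /GD; case: leqP => [le /delG|_ ->].
  by rewrite (leq_trans le) ?leq_addr // [(d + e)%N]addnC addnBA.
by rewrite linear0; case: leqP => // _; apply: gr0.
Qed.

Let GMx d b : G' d b -> G' (d + e)%N (b * x).
Proof.
case/GP=> p <- hp; apply/GP; exists (p * 'X); first by rewrite evMX.
move=> [|i]; rewrite coefMX /=; first exact: GD0.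
by rewrite mulSnr; apply/GD_shift.
Qed.

Let GiotaM d d' r b : G d r -> G' d' b -> G' (d + d')%N (iota r * b).
Proof.
move=> hr /GP[p <- hp]; apply/GP; exists (r%:P * p); first by rewrite evCM.
move=> i; rewrite coefCM; apply: (GDM gr (n := d')) => //.
by apply/GDE.
Qed.

Let dropG d (p : {poly R}) : (forall i, GD G d (i * e) p`_i) ->
  if (e <= d)%N then forall i, GD G (d - e) (i * e) (drop_poly 1 p)`_i
  else drop_poly 1 p = 0.
Proof.
move=> hp; case: leqP => le.
  move=> i; rewrite coef_drop_poly; apply/(GD_shift G e).
  by rewrite subnK // -mulSnr -addn1.
apply/polyP => i; rewrite coef_drop_poly coef0 addn1.
by apply: (GD_lt _ (hp i.+1)); lia.
Qed.

Let Gmul d d' a b : G' d a -> G' d' b -> G' (d + d')%N (a * b).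
Proof.
case/GP=> p <-; have [n] := ubnP (size p); elim: n p d d' b => // n IH p d d' b.
move=> szp hp hb; rewrite ev_split mulrDl -mulrA.
apply: (subspaceD (sub' _)).
  by apply: GiotaM => //; have /GDn0 := hp 0%N.
have := dropG hp; case: leqP => [le hd|_ ->].
  have -> : (d + d' = (d - e) + (d' + e))%N by lia.
  have [p0|nz] := eqVneq p 0.
    by rewrite p0 drop_poly0r ev0 mul0r; case: (sub' (d - e + (d' + e))).
  apply: IH => //; last exact: GxM.
  rewrite size_drop_poly; have := size_poly_gt0 p; rewrite nz; lia.
by rewrite ev0 mul0r; case: (sub' (d + d')).
Qed.

(** Multiplicativity of the grading comes from x r = sigma(r) x + delta(r), both
terms of which are homogeneous of degree e + deg(r). *)
Lemma expansion_graded : graded G'.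
Proof.
split=> //.
- move=> a; split.
    case/GP=> p <- hp; have /GDn0/(gr_scal gr)[c hc] := hp 0%N.
    exists c; rewrite ev_split; have := dropG hp.
    by rewrite leqNgt e_gt0 /= => ->; rewrite ev0 mul0r addr0 hc linearZ /= rmorph1.
  case=> c ->; have -> : c%:A = iota c%:A by rewrite linearZ /= rmorph1.
  by apply: Giota; apply: gr_alg.
- have [comp [lin hcomp]] := gr_comp gr.
  have comp0 d : comp d 0 = 0 by rewrite (hcomp _ d) ?eqxx //; apply: gr0.
  have [c hc] := fchoice ev_onto.
  have clin k u v : c (k *: u + v) = (k%:A)%:P * c u + c v.
    by apply: ev_inj; rewrite evD evCM !hc linearZ /= rmorph1 -scalerAl mul1r.
  pose cq d (p : {poly R}) : {poly R} := \poly_(i < size p)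
    (if (i * e <= d)%N then comp (d - i * e)%N p`_i else 0).
  have cqE d p i : (cq d p)`_i =
      if (i * e <= d)%N then comp (d - i * e)%N p`_i else 0.
    rewrite coef_poly; case: ltnP => // le; rewrite nth_default // comp0.
    by case: leqP.
  exists (fun d a => ev (cq d (c a))); split=> [d k u v|d d' a].
    have -> : k *: ev (cq d (c u)) = iota k%:A * ev (cq d (c u)).
      by rewrite linearZ /= rmorph1 -scalerAl mul1r.
    rewrite -evCM -evD; congr ev; apply/polyP => i.
    rewrite !(coefD, coefCM) !cqE clin coefD coefCM -scalerAl mul1r.
    by case: leqP => _; rewrite ?lin -?scalerAl ?mul1r // scaler0 addr0.
  case/GP=> p pa hp; have {pa} -> : a = ev p by [].
  have -> : c (ev p) = p by apply: ev_inj; rewrite hc.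
  transitivity (ev (if d == d' then p else 0)); last by case: eqP; rewrite ?ev0.
  congr ev; apply/polyP => i; rewrite cqE; have := hp i; rewrite /GD.
  case: (leqP (i * e) d') => [le' hi|lt' ->]; last first.
    by rewrite comp0 if_same; case: eqP => _; rewrite ?coef0 //;
       have := GD_lt lt' (hp i).
  case: leqP => [le|lt].
    rewrite (hcomp _ _ _ hi); have -> : (d - i * e == d' - i * e)%N = (d == d').
      by apply/eqP/eqP; lia.
    by case: eqP => //; rewrite coef0.
  by case: eqP => [dd'|]; rewrite ?coef0 //; lia.
move=> a; have [p <-] := ev_onto a.
pose Q a := exists m f, (forall d, G' d (f d)) /\ a = \sum_(d < m) f d.
have QD u v : Q u -> Q v -> Q (u + v).
  have ext w m f : (forall d, G' d (f d)) -> w = \sum_(d < m) f d ->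
      forall m', exists2 g, (forall d, G' d (g d)) & w = \sum_(d < m + m') g d.
    move=> hf -> m'; exists (fun d => if (d < m)%N then f d else 0).
      by move=> d; case: ltnP => // _; case: (sub' d).
    rewrite big_split_ord /= [X in _ + X]big1 ?addr0.
      by apply: eq_bigr => i _; rewrite ltn_ord.
    by move=> i _; rewrite ltnNge leq_addr.
  case=> m [f [hf hu]] [m' [f' [hf' hv]]].
  have [g hg ->] := ext _ _ _ hf hu m'; have [g' hg' ->] := ext _ _ _ hf' hv m.
  exists (m + m')%N, (fun d => g d + g' d); split.
    by move=> d; apply: (subspaceD (sub' d)).
  by rewrite addnC -big_split addnC.
have Qhom d u : G' d u -> Q u.
  move=> hu; exists d.+1, (fun k => if k == d then u else 0); split.
    by move=> k; case: eqP => [->|] //; case: (sub' k).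
  by rewrite big_ord_recr /= eqxx big1 ?add0r // => i _; rewrite ltn_eqF.
elim/poly_ind: p => [|p r IH]; first by rewrite ev0; apply: (Qhom 0%N); case: (sub' 0).
rewrite evD evMX evC; apply: (QD _ _ _ _).
  case: IH => m [f [hf ->]]; rewrite mulr_suml.
  elim/big_ind: _ => [||i _]; [by apply: (Qhom 0%N); case: (sub' 0%N)|exact: QD|].
  by apply: (Qhom (i + e)%N); apply: GMx.
have [m [f [hf ->]]] := gr_total gr r; rewrite rmorph_sum.
elim/big_ind: _ => [||i _]; [by apply: (Qhom 0%N); case: (sub' 0%N)|exact: QD|].
by apply: (Qhom i); apply: Giota.
Qed.

Let decl d a : G' d a ->
  exists r b, [/\ G d r, GD G' d e b & a = iota r + b * x].
Proof.
case/GP=> p <- hp; exists p`_0, (ev (drop_poly 1 p)); split.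
- by have /GDn0 := hp 0%N.
- rewrite /GD; have := dropG hp; case: leqP => _ hd; last by rewrite hd ev0.
  by apply/GP; eexists.
exact: ev_split.
Qed.

Let uniql r b : iota r + b * x = 0 -> r = 0 /\ b = 0.
Proof.
have [p <-] := ev_onto b; rewrite -evC -evMX -evD -ev0 => /ev_inj/polyP h.
have := h 0%N; rewrite coefD coefC coefMX coef0 addr0 => /= r0; split=> //.
congr ev; apply/polyP => i.
by have := h i.+1; rewrite coefD coefC coefMX !coef0 add0r.
Qed.

(** The injective maps sigma are bijective because they preserve the finite
dimensional homogeneous components. *)
Lemma endo_onto (V : lmodType K) (f : {linear V -> V}) (S : V -> Prop) n :
  subspace_dim S n -> injective f -> (forall v, S v -> S (f v)) ->
  forall v, S v -> exists2 u, S u & f u = v.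
Proof.
move=> dS fI fS v Sv; have sS := dim_subspace dS; have [b hb] := dim_basis dS.
have [ib Sb spb] := hb.
case: (excluded_middle_informative (spanned (fun i => f (b i)) v)) => [[c hc]|nsp].
  exists (\sum_i c i *: b i); first by apply: subspace_sum => // i _; apply: subspaceZ.
  by rewrite linear_sum hc; apply: eq_bigr => i _; rewrite linearZ.
have ifb : independent (fun i => f (b i)).
  move=> c h; apply: ib; apply: fI; rewrite linear0 -[RHS]h linear_sum.
  by apply: eq_bigr => i _; rewrite linearZ.
have : (#|{: unit + 'I_n}| <= #|'I_n|)%N.
  apply: (steinitz (e := b)
    (f := fun s => match s with inl _ => v | inr i => f (b i) end)); last first.
    by case=> [_|i]; apply: spb => //; apply: fS.
  move=> c; rewrite big_sumType /= (big_pred1 tt) /=; last by case.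
  move=> h; have c0 : c (inl tt) = 0.
    apply/eqP/negPn/negP => nz; apply: nsp.
    exists (fun i => - (c (inl tt))^-1 * c (inr i)).
    rewrite -[v]scale1r -(mulVf nz) -scalerA.
    move/eqP: h; rewrite addr_eq0 => /eqP ->.
    by rewrite scalerN -scaleNr scaler_sumr; apply: eq_bigr => i _; rewrite scalerA.
  case=> [[]//|i]; apply: (ifb (fun i => c (inr i))).
  by rewrite -[RHS]h c0 scale0r add0r.
by rewrite card_sum card_unit card_ord ltnn.
Qed.

Let sig_onto d r : G d r -> exists2 s, G d s & sigma s = r.
Proof.
have [n dn] := fin d; exact: (endo_onto dn sigI (sigG (d := d))).
Qed.

Let decr d a : G' d a ->
  exists r b, [/\ G d r, GD G' d e b & a = iota r + x * b].
Proof.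
have [n] := ubnP d; elim: n d a => // n IH d a ltd /decl[r [b [hr hb ->]]].
move: hb; rewrite /GD; case: leqP => [le hb|lt b0]; last first.
  by exists r, 0; rewrite b0 mul0r mulr0.
have [|r' [b' [hr' hb' ->]]] := IH (d - e)%N b _ hb; first by lia.
have [s hs sE] := sig_onto hr'.
exists (r - delta s), (iota s + b' * x); split.
- apply: (grB gr) => //; have -> : d = (e + (d - e))%N by lia.
  exact: delG.
- apply: (subspaceD (sub' _)); first exact: Giota.
  move: hb'; rewrite /GD; case: leqP => [le' /GMx|_ ->].
    by rewrite subnK.
  by rewrite mul0r; case: (sub' (d - e)).
rewrite rmorphB /= mulrDr comm sE mulrDl.
rewrite mulrA [iota r' * x + iota _]addrC -[iota (delta s) + _ + _]addrA.
by rewrite [RHS]addrA subrK.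
Qed.

Let uniqr r b : iota r + x * b = 0 -> r = 0 /\ b = 0.
Proof.
have [p <-] := ev_onto b; rewrite xev -evC -evD -ev0 => /ev_inj/polyP h.
suff p0 : p = 0.
  rewrite p0 in h *; rewrite ev0; split=> //; have := h 0%N.
  by rewrite coefD coefC coef_poly size_poly0 coef0 linear0 !addr0.
apply/eqP/negPn/negP => nz.
have := h (size p); rewrite coefD coef_poly ltnSn coefC coef0.
have szp : (size p = (size p).-1.+1) by have := size_poly_gt0 p; rewrite nz; lia.
rewrite [in X in X + _]szp /= add0r [p`_(size p)]nth_default // linear0 addr0.
rewrite {1}szp => /eqP; rewrite -[0](rmorph0 sigma) (inj_eq sigI) => /eqP.
by rewrite rmorph0; apply/eqP; rewrite -lead_coefE lead_coef_eq0.
Qed.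

Lemma ore_step_expansion :
  ore_step iota sigma delta x e G G'.
Proof.
split=> //; first exact: expansion_graded.
- by have /GMx := Giota (gr1 gr); rewrite rmorph1 mul1r add0n; apply.
Qed.

End OreStep.

(** * Towers, generators and dimensions *)

Section Components.
Variables (K : fieldType) (A : algType K) (G : nat -> A -> Prop).
Hypothesis gr : graded G.

Lemma graded_components : exists comp : nat -> A -> A,
  [/\ forall d c u v, comp d (c *: u + v) = c *: comp d u + comp d v,
      forall d d' a, G d' a -> comp d a = if d == d' then a else 0,
      forall d a, G d (comp d a),
      forall a, exists m, a = \sum_(d < m) comp d a
    & forall d a b, comp d (a * b) = \sum_(i < d.+1) comp i a * comp (d - i)%N b].
Proof.
have [comp [lin hom]] := gr_comp gr; exists comp.
have comp0 d : comp d 0 = 0 by rewrite (hom _ d) ?eqxx //; apply: gr0.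
have compD d u v : comp d (u + v) = comp d u + comp d v.
  by rewrite -[u]scale1r lin !scale1r.
have comp_sum d (I : Type) (r : seq I) (P : pred I) (F : I -> A) :
    comp d (\sum_(i <- r | P i) F i) = \sum_(i <- r | P i) comp d (F i).
  by apply: (big_morph (comp d) (compD d) (comp0 d)).
have compE m f d : (forall d, G d (f d)) ->
    comp d (\sum_(i < m) f i) = if (d < m)%N then f d else 0.
  move=> hf; rewrite comp_sum; under eq_bigr => i _ do rewrite (hom _ _ _ (hf i)).
  case: ltnP => lt.
    rewrite (bigD1 (Ordinal lt)) //= eqxx big1 ?addr0 // => i.
    by rewrite -val_eqE /= eq_sym => /negPf ->.
  by rewrite big1 // => i _; rewrite gtn_eqF // (leq_trans (ltn_ord i)).
have GC d a : G d (comp d a).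
  have [m [f [hf ->]]] := gr_total gr a; rewrite compE //.
  by case: ltnP => // _; apply: gr0.
split=> // [a|d a b].
  have [m [f [hf ->]]] := gr_total gr a; exists m.
  by apply: eq_bigr => i _; rewrite compE // ltn_ord.
have [m [f [hf ->]]] := gr_total gr a; have [n [g [hg ->]]] := gr_total gr b.
rewrite mulr_suml comp_sum.
transitivity (\sum_(i < m) \sum_(j < n) if d == (i + j)%N then f i * g j else 0).
  apply: eq_bigr => i _; rewrite mulr_sumr comp_sum; apply: eq_bigr => j _.
  by rewrite (hom _ _ _ (gr_mul gr (hf i) (hg j))).
transitivity (\sum_(i < m) if (i <= d)%N && (d - i < n)%N then f i * g (d - i)%N else 0).
  apply: eq_bigr => i _; case: andP => [[le lt]|nle].
    rewrite (bigD1 (Ordinal lt)) //= subnKC // eqxx big1 ?addr0 // => j.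
    by rewrite -val_eqE /= => ne; case: eqP => // dE; case/eqP: ne; lia.
  rewrite big1 // => j _; case: eqP => // dE; case: nle; split; first by lia.
  by rewrite dE addKn.
pose h i := if (i < m)%N then if (d - i < n)%N then f i * g (d - i)%N else 0 else 0.
transitivity (\sum_(i < m | (i < d.+1)%N) h i).
  rewrite [RHS]big_mkcond; apply: eq_bigr => i _; rewrite /h ltn_ord ltnS.
  by case: (i <= d)%N.
rewrite (big_ord_widen_cond _ (fun i => i < d.+1)%N h (leq_addr d.+1 m)).
transitivity (\sum_(i < d.+1) h i).
  rewrite [RHS](big_ord_widen _ h (leq_addl m d.+1)).
  rewrite [RHS](bigID (fun i : 'I__ => (i < m)%N)) /= [X in _ = _ + X]big1 ?addr0 //.
  by move=> i /andP[_ /negPf]; rewrite /h => ->.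
apply: eq_bigr => i _; rewrite /h !compE //.
by case: ltnP => _; case: ltnP => _; rewrite ?mul0r ?mulr0.
Qed.

(** Characters of A_+ / (A_+ A_+) in degree k: a nonzero one exists exactly when
degree k contains a generator. *)
Definition cocycle1 (k : nat) (al : A -> K) : Prop :=
  (forall c a b, G k a -> G k b -> al (c *: a + b) = c * al a + al b) /\
  (forall i j a b, (0 < i)%N -> (0 < j)%N -> (i + j)%N = k ->
     G i a -> G j b -> al (a * b) = 0).

Lemma cocycle1_0 k al : cocycle1 k al -> al 0 = 0.
Proof.
case=> lin _; have := lin (-1) 0 0 (gr0 gr k) (gr0 gr k).
by rewrite scaler0 addr0 mulN1r addNr.
Qed.

Lemma cocycle1D k al a b : cocycle1 k al -> G k a -> G k b ->
  al (a + b) = al a + al b.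
Proof.
by case=> lin _ ha hb; have := lin 1 a b ha hb; rewrite scale1r mul1r.
Qed.

Lemma cocycle1Z k al c a : cocycle1 k al -> G k a -> al (c *: a) = c * al a.
Proof.
move=> h ha; case: (h) => lin _; rewrite -[c *: a]addr0 lin //; last exact: gr0.
by rewrite (cocycle1_0 h) addr0.
Qed.

(** A product of more than one element of degree one is a product of two elements
of positive degree. *)
Lemma generated_cocycle1 k al : generated_in_degree_one G -> (1 < k)%N ->
  cocycle1 k al -> forall a, G k a -> al a = 0.
Proof.
move=> gen lt1k c1; have [comp [lin hom GC _ compM]] := graded_components.
suff h a : al (comp k a) = 0.
  by move=> a ga; rewrite -(h a) (hom _ _ _ ga) eqxx.
have compD d u v : comp d (u + v) = comp d u + comp d v.
  by rewrite -[u]scale1r lin !scale1r.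
have al_sum (F : nat -> A) n : (forall i, (i < n)%N -> G k (F i) /\ al (F i) = 0) ->
    al (\sum_(i < n) F i) = 0.
  elim: n => [|n IH] hF; first by rewrite big_ord0 (cocycle1_0 c1).
  rewrite big_ord_recr /= (cocycle1D c1); first 1 last.
  - apply: subspace_sum => [|i _]; first exact: gr_sub.
    by have [] := hF i (ltnW (ltn_ord i)).
  - by have [] := hF n.
  rewrite IH ?add0r; last by move=> i lt; apply: hF; apply: ltnW.
  by have [] := hF n.
elim: (gen a) => {a} [a ga||a b _ ha _ hb|a b _ ha _ hb|c a _ ha].
- by rewrite (hom _ _ _ ga) gtn_eqF // (cocycle1_0 c1).
- by rewrite (hom _ _ _ (gr1 gr)) gtn_eqF ?(cocycle1_0 c1) // ltnW.
- by rewrite compD (cocycle1D c1) // ha hb addr0.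
- rewrite compM; apply: (al_sum (fun i => comp i a * comp (k - i)%N b)) => i lt.
  have le : (i <= k)%N by [].
  split; first by rewrite -[in G _](subnKC le); apply: (gr_mul gr); apply: GC.
  have [i0|i_gt0] := posnP i.
    have /(gr_scal gr)[c hc] : G 0 (comp i a) by rewrite i0; apply: GC.
    by rewrite hc -scalerAl mul1r i0 subn0 (cocycle1Z _ c1) ?hb ?mulr0.
  have [ik|lt_ik] := eqVneq i k.
    have /(gr_scal gr)[c hc] : G 0 (comp (k - i)%N b) by rewrite ik subnn; apply: GC.
    by rewrite hc -scalerAr mulr1 ik (cocycle1Z _ c1) ?ha ?mulr0.
  by case: c1 => _ /(_ i (k - i)%N); apply => //; rewrite ?subn_gt0 ?subnKC // ltn_neqAle lt_ik.
- rewrite -[c *: a]addr0 lin (hom _ _ _ (gr0 gr k)) eqxx addr0.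
  by rewrite (cocycle1Z _ c1) // ha mulr0.
Qed.

End Components.

Section ScalarMap.
Variables (K : fieldType) (A : algType K).

Definition scalar_map : K^o -> A := fun c => c *: (1 : A).

Fact scalar_map_add : zmod_morphism scalar_map.
Proof. by move=> a b; rewrite /scalar_map scalerBl. Qed.
HB.instance Definition _ := GRing.isZmodMorphism.Build K^o A scalar_map scalar_map_add.

Fact scalar_map_mul : monoid_morphism scalar_map.
Proof.
split; first by rewrite /scalar_map scale1r.
by move=> a b; rewrite /scalar_map -scalerAl mul1r scalerA.
Qed.
HB.instance Definition _ := GRing.isMonoidMorphism.Build K^o A scalar_map scalar_map_mul.

Fact scalar_map_scale : scalable scalar_map.
Proof. by move=> a b; rewrite /scalar_map scalerA. Qed.
HB.instance Definition _ := GRing.isScalable.Build K K^o A *:%R scalar_map scalar_map_scale.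

End ScalarMap.

(** Starting from K itself makes all steps alike; the variables enter only
through their degrees. *)
Inductive tower (K : fieldType) :
    forall A : algType K, (nat -> A -> Prop) -> seq nat -> Prop :=
| TowerBase : @tower K K^o (@scalar_grading K) [::]
| TowerStep (R A : algType K) (iota : {lrmorphism R -> A})
    (sigma : {lrmorphism R -> R}) (delta : {linear R -> R}) (x : A) (e : nat)
    (G : nat -> R -> Prop) (G' : nat -> A -> Prop) (ds : seq nat) :
    tower G ds -> ore_step iota sigma delta x e G G' ->
    tower G' (rcons ds e).

Section BaseGrading.
Variable K : fieldType.

Lemma base_graded : @graded K K^o (@scalar_grading K).
Proof.
split.
- move=> d; split; first by left.
  move=> c u v [->|->] [->|h]; rewrite ?scaler0 ?addr0 ?add0r /scalar_grading; auto.
- move=> a; split=> [_|_]; last by right.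
  by exists a; rewrite /GRing.scale /= mulr1.
- move=> d d' a b [->|->] [->|->]; rewrite ?mul0r ?mulr0 /scalar_grading; auto.
- exists (fun d a => if d == 0%N then a else 0); split=> [d c u v|d d' a].
    by case: eqP; rewrite ?scaler0 ?addr0.
  by case=> [->|->]; rewrite ?if_same //.
- move=> a; exists 1%N, (fun d => if d == 0%N then a else 0); split.
    by case=> [|d]; [right | left].
  by rewrite big_ord1.
Qed.

Lemma tower_graded (A : algType K) (G : nat -> A -> Prop) ds :
  tower G ds -> graded G.
Proof. by case=> [|R B iota sigma delta x e H H' es _ []]; first exact: base_graded. Qed.

End BaseGrading.

Section StepFacts.
Variables (K : fieldType) (R A : algType K) (iota : {lrmorphism R -> A}).
Variables (sigma : {lrmorphism R -> R}) (delta : {linear R -> R}) (x : A).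
Variables (e : nat) (G : nat -> R -> Prop) (G' : nat -> A -> Prop).
Hypothesis st : ore_step iota sigma delta x e G G'.

Let gr := os_gr st.
Let gr' := os_gr' st.

Lemma step_dim d n m : subspace_dim (G d) n -> subspace_dim (GD G' d e) m ->
  subspace_dim (G' d) (n + m).
Proof.
move=> dn dm; have [b [ib Gb sb]] := dim_basis dn; have [c [ic Gc sc]] := dim_basis dm.
have h : basis (fun s : 'I_n + 'I_m => match s with inl i => iota (b i)
                                     | inr j => c j * x end) (G' d).
  split.
  - move=> k; rewrite big_sumType /= => h0.
    have [] := os_uniql st (r := \sum_i k (inl i) *: b i)
       (b := \sum_j k (inr j) *: c j).
      rewrite -[RHS]h0 linear_sum mulr_suml; congr (_ + _); apply: eq_bigr => i _.
        by rewrite linearZ.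
      by rewrite scalerAl.
    by move=> /ib hi /ic hj [i|j]; [apply: hi | apply: hj].
  - case=> [i|j]; first exact: (os_iota st).
    move: (Gc j); rewrite /GD; case: leqP => [le hc|_ ->].
      by rewrite -(subnK le); apply: (gr_mul gr') => //; apply: (os_x st).
    by rewrite mul0r; apply: gr0.
  move=> a /(os_decl st)[r [b' [/sb[k ->] /sc[l ->] ->]]].
  exists (fun s => match s with inl i => k i | inr j => l j end).
  rewrite big_sumType /= linear_sum mulr_suml; congr (_ + _); apply: eq_bigr => i _.
    by rewrite linearZ.
  by rewrite scalerAl.
by have := basis_dim (gr_sub gr' d) h; rewrite card_sum !card_ord.
Qed.

Lemma GD_dim0 d : (d < e)%N -> subspace_dim (GD G' d e) 0.
Proof.
move=> lt; exists (fun=> 0); split; last by move=> c _ [].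
move=> v; rewrite /GD leqNgt lt /=; split=> [->|[c ->]].
  by exists (fun=> 0); rewrite big_ord0.
by rewrite big_ord0.
Qed.

Lemma GD_dim d m : (e <= d)%N -> subspace_dim (G' (d - e)%N) m ->
  subspace_dim (GD G' d e) m.
Proof. by move=> le; apply: subspace_dim_eq => v; rewrite /GD le. Qed.

Lemma step_iota_inj : injective iota.
Proof.
move=> r s h; apply/eqP; rewrite -subr_eq0; apply/eqP.
by have [] := os_uniql st (r := r - s) (b := 0);
  rewrite ?rmorphB /= ?h ?subrr ?mul0r ?addr0.
Qed.

Lemma step_delta1 : delta 1 = 0.
Proof.
have := os_skew st 1 1; rewrite mul1r rmorph1 mul1r mulr1 => /esym/eqP.
by rewrite -subr_eq0 addrK => /eqP.
Qed.

Lemma step_deltac c : delta c%:A = 0.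
Proof. by rewrite linearZ /= step_delta1 scaler0. Qed.

Lemma step_uniql r b r' b' : iota r + b * x = iota r' + b' * x ->
  r = r' /\ b = b'.
Proof.
move=> h; have [] := os_uniql st (r := r - r') (b := b - b').
  by rewrite rmorphB mulrBl addrACA -opprD h subrr.
by move=> /eqP; rewrite subr_eq0 => /eqP -> /eqP; rewrite subr_eq0 => /eqP ->.
Qed.

Lemma step_uniqr r b r' b' : iota r + x * b = iota r' + x * b' ->
  r = r' /\ b = b'.
Proof.
move=> h; have [] := os_uniqr st (r := r - r') (b := b - b').
  by rewrite rmorphB mulrBr addrACA -opprD h subrr.
by move=> /eqP; rewrite subr_eq0 => /eqP -> /eqP; rewrite subr_eq0 => /eqP ->.
Qed.

Lemma cocycle1_restrict k al : cocycle1 G' k al -> cocycle1 G k (fun r => al (iota r)).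
Proof.
case=> lin mul; split=> [c a b ha hb|i j a b i0 j0 ij ha hb].
  by rewrite linearD linearZ lin //; apply: (os_iota st).
by rewrite rmorphM (mul i j) //; apply: (os_iota st).
Qed.

(** Both terms of delta(r q) = sigma(r) delta(q) + delta(r) q are products of
elements of positive degree. *)
Lemma cocycle1_delta k al : (e < k)%N -> cocycle1 G k al ->
  cocycle1 G (k - e) (fun r => al (delta r)).
Proof.
move=> lt c1; case: (c1) => lin mul.
have Gd r : G (k - e)%N r -> G k (delta r).
  by move/(os_del st); rewrite subnKC // ltnW.
split=> [c a b ha hb|i j a b i0 j0 ij ha hb].
  by rewrite linearD linearZ lin //; apply: Gd.
rewrite (os_skew st) (cocycle1D c1); first 1 last.
- have -> : k = (i + (e + j))%N by lia.
  by apply: (gr_mul gr); [apply: (os_sig st) | apply: (os_del st)].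
- have -> : k = (e + i + j)%N by lia.
  by apply: (gr_mul gr) => //; apply: (os_del st).
rewrite (mul i (e + j)%N) ?(mul (e + i)%N j) ?addr0 //; try lia.
- exact: (os_del st).
- exact: (os_sig st).
- exact: (os_del st).
Qed.

(** A cocycle extends by zero over the new variable unless the skew derivation
turns an element of lower degree into the generator it detects. *)
Lemma cocycle1_extend k al : (0 < k)%N -> cocycle1 G k al ->
  (forall r, GD G k e r -> al (delta r) = 0) ->
  exists2 al', cocycle1 G' k al' & forall r, G k r -> al' (iota r) = al r.
Proof.
move=> k0 c1 aldel; case: (c1) => lin mul.
have dec a : exists r, G' k a -> G k r /\ exists b, a = iota r + b * x.
  case: (excluded_middle_informative (G' k a)) => h; last by exists 0.
  by have [r [b [hr hb ->]]] := os_decl st h; exists r => _; split=> //; exists b.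
have [f hf] := fchoice dec; pose al' a := al (f a).
have fE r b : G' k (iota r + b * x) -> f (iota r + b * x) = r.
  by move=> /hf[_ [b']] /step_uniql[].
have al'i r : G k r -> al' (iota r) = al r.
  move=> hr; have := fE r 0; rewrite mul0r addr0 /al' => -> //.
  exact: (os_iota st).
have lin' c a b : G' k a -> G' k b -> al' (c *: a + b) = c * al' a + al' b.
  move=> ga gb; have [ha [a' ea]] := hf a ga; have [hb [b' eb]] := hf b gb.
  rewrite /al' -lin //; congr al; rewrite {1}ea {1}eb.
  have e1 : c *: (iota (f a) + a' * x) + (iota (f b) + b' * x) =
      iota (c *: f a + f b) + (c *: a' + b') * x.
    by rewrite scalerDr mulrDl -scalerAl addrACA linearP.
  rewrite e1 fE // -e1 -ea -eb.
  by case: (gr_sub gr' k) => _; apply.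
have al'x b : G' k (b * x) -> al' (b * x) = 0.
  move=> h; have := fE 0 b; rewrite rmorph0 add0r /al' => -> //.
  exact: (cocycle1_0 gr c1).
have al'D a b : G' k a -> G' k b -> al' (a + b) = al' a + al' b.
  by move=> ga gb; have := lin' 1 a b ga gb; rewrite scale1r mul1r.
have Gbx n b : GD G' n e b -> G' n (b * x).
  rewrite /GD; case: leqP => [le hb|_ ->]; last by rewrite mul0r; apply: gr0.
  by rewrite -(subnK le); apply: (gr_mul gr') => //; apply: (os_x st).
have GDmul n m b c : GD G' n e b -> G' m c -> GD G' (n + m) e (b * c).
  rewrite /GD; case: leqP => [le hb hc|_ -> _].
    rewrite (leq_trans le) ?leq_addr // -addnBAC //; exact: (gr_mul gr').
  by rewrite mul0r; case: leqP => // _; apply: gr0.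
have key n : forall i j b r, (i < n)%N -> (0 < i)%N -> (0 < j)%N ->
    (i + j)%N = k -> G' i b -> G j r -> al' (b * iota r) = 0.
  elim: n => // n IH i j b r ltin i0 j0 ijk gb hr.
  have e0 := os_e st; have [s [c [hs hc ->]]] := os_decl st gb.
  have Gr := os_iota st hr.
  have dc : GD G' k e (c * iota (sigma r)).
    by rewrite -ijk; apply: GDmul => //; apply: (os_iota st); apply: (os_sig st).
  have hsr : G k (s * r) by rewrite -ijk; apply: (gr_mul gr).
  have Gcd : G' k (c * iota (delta r)).
    move: hc; rewrite /GD; case: leqP => [le hc|_ ->]; last by rewrite mul0r; apply: gr0.
    have -> : k = (i - e + (e + j))%N by lia.
    by apply: (gr_mul gr') => //; apply: (os_iota st); apply: (os_del st).
  rewrite mulrDl -rmorphM -mulrA (os_comm st) mulrDr mulrA al'D; first 1 last.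
  - exact: (os_iota st).
  - by apply: (grD gr') => //; apply: Gbx.
  rewrite al'i // (mul i j) // add0r al'D //; last exact: Gbx.
  rewrite al'x ?add0r; last exact: Gbx.
  have [lt|lt|ie] := ltngtP e i.
  - apply: (IH (i - e)%N (e + j)%N); try lia; last exact: (os_del st).
    by move: hc; rewrite /GD (ltnW lt).
  - by rewrite (GD_lt lt hc) mul0r -[0](rmorph0 iota) al'i ?(cocycle1_0 gr c1) //; apply: gr0.
  have [t ->] : exists t : K, c = t%:A by apply: (GDnnP gr' (m := i)); rewrite -{2}ie.
  rewrite -scalerAl mul1r -linearZ al'i; last first.
    by apply: grZ => //; rewrite -ijk -ie; apply: (os_del st).
  rewrite (cocycle1Z gr _ c1); last by rewrite -ijk -ie; apply: (os_del st).
  by rewrite aldel ?mulr0 // /GD -ijk -ie leq_addr addKn.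
exists al' => //; split=> // i j a b i0 j0 ijk ga gb.
have [r [c [hr hc ->]]] := os_decl st gb.
have h1 : G' k (a * iota r) by rewrite -ijk; apply: (gr_mul gr') => //; apply: (os_iota st).
have h2 : G' k (a * c * x).
  apply: Gbx; rewrite -ijk /GD; move: hc; rewrite /GD; case: leqP => [le hc|_ ->].
    by rewrite (leq_trans le) ?leq_addl // -addnBA //; apply: (gr_mul gr').
  by rewrite mulr0; case: leqP => // _; apply: gr0.
by rewrite mulrDr mulrA al'D // al'x // addr0 (key i.+1 i j).
Qed.

(** The cocycle is the coefficient of x, elements of degree below e being free
of x. *)
Lemma cocycle1_new : exists2 al, cocycle1 G' e al & al x = 1.
Proof.
have Ge := os_e st; have Gx := os_x st.
have dec a : exists t, G' e a -> exists r, a = iota r + t *: x.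
  case: (excluded_middle_informative (G' e a)) => h; last by exists 0.
  have [r [b [_ hb ->]]] := os_decl st h.
  have [t ->] := GDnnP gr' hb.
  by exists t => _; exists r; rewrite -scalerAl mul1r.
have [f hf] := fchoice dec.
have fE r t : G' e (iota r + t *: x) -> f (iota r + t *: x) = t.
  case/hf=> r' h; have : iota r + t%:A * x = iota r' + (f (iota r + t *: x))%:A * x.
    by rewrite -!scalerAl !mul1r.
  case/step_uniql=> _ /eqP; rewrite -subr_eq0 -scalerBl => /eqP/alg_inj0/eqP.
  by rewrite subr_eq0 => /eqP.
exists f.
  split=> [c a b ga gb|i j a b i0 j0 ij ga gb].
    have [r ea] := hf a ga; have [s eb] := hf b gb.
    rewrite {1}ea {1}eb.
    have e1 : c *: (iota r + f a *: x) + (iota s + f b *: x) =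
       iota (c *: r + s) + (c * f a + f b) *: x.
      by rewrite linearP scalerDr scalerA scalerDl addrACA.
    by rewrite e1 fE // -e1 -ea -eb; case: (gr_sub gr' e) => _; apply.
  have lt n c : (n < e)%N -> G' n c -> exists r, c = iota r.
    move=> ltn /(os_decl st)[r [d [_ /(GD_lt ltn) -> ->]]].
    by exists r; rewrite mul0r addr0.
  have [r ea] : exists r, a = iota r by apply: (lt i) => //; lia.
  have [s eb] : exists r, b = iota r by apply: (lt j) => //; lia.
  have gab : G' e (iota (r * s)).
    by rewrite rmorphM /= -ij; apply: (gr_mul gr'); rewrite -?ea -?eb.
  rewrite ea eb -rmorphM; have := fE (r * s) 0.
  by rewrite scale0r addr0 => ->.
by have := fE 0 1; rewrite rmorph0 add0r scale1r => ->.
Qed.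

End StepFacts.

Section Tower.
Variable K : fieldType.

Lemma base_dim d : @subspace_dim K K^o (@scalar_grading K d) (d == 0%N).
Proof.
case: d => [|d] /=.
  exists (fun=> 1); split=> [v|c].
    split=> [_|_]; last by right.
    by exists (fun=> v); rewrite big_ord1 /GRing.scale /= mulr1.
  by rewrite big_ord1 /GRing.scale /= mulr1 => h i; rewrite ord1.
exists (fun=> 0); split=> [v|c _ []//]; split=> [[->|//]|[c ->]].
  by exists (fun=> 0); rewrite big_ord0.
by rewrite big_ord0; left.
Qed.

Lemma tower_degs (A : algType K) (G : nat -> A -> Prop) ds :
  tower G ds -> all (fun k => 0 < k)%N ds.
Proof. by elim=> // R B i s d x e H H' es _ IH st; rewrite all_rcons IH andbT (os_e st). Qed.

Lemma tower_finite (A : algType K) (G : nat -> A -> Prop) ds :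
  tower G ds -> finite_components G.
Proof.
elim=> [d|R B i s d x e H H' es _ IH st]; first by exists (d == 0%N); apply: base_dim.
move=> k; have [n] := ubnP k; elim: n k => // n IHn k ltk.
have [m dm] := IH k; have e0 := os_e st.
case: (leqP e k) => [le|lt].
  have [m' dm'] := IHn (k - e)%N ltac:(lia).
  by exists (m + m')%N; apply: (step_dim st) => //; apply: GD_dim.
by exists (m + 0)%N; apply: (step_dim st) => //; apply: GD_dim0.
Qed.

(** Each step gives the direct decomposition A_d = R_d + A_(d-e) x. *)
Lemma tower_dim (A : algType K) (G : nat -> A -> Prop) ds :
  tower G ds ->
  let n k := count_mem k ds in
  [/\ subspace_dim (G 0) 1, subspace_dim (G 1%N) (n 1%N),
      subspace_dim (G 2) ('C((n 1%N).+1, 2) + n 2)%N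
    & subspace_dim (G 3) ('C((n 1%N).+2, 3) + n 1%N * n 2 + n 3)%N].
Proof.
elim=> [|R B i s d x e H H' es _ [h0 h1 h2 h3] st] n; first by split; apply: base_dim.
have e0 := os_e st.
have nE k : n k = (count_mem k es + (e == k))%N.
  by rewrite /n -cats1 count_cat /= addn0.
have lt k m : (k < e)%N -> subspace_dim (H k) m -> subspace_dim (H' k) m.
  by move=> ltk hm; rewrite -[m]addn0; apply: (step_dim st) => //; apply: GD_dim0.
have ge k m m' : (e <= k)%N -> subspace_dim (H k) m ->
    subspace_dim (H' (k - e)%N) m' -> subspace_dim (H' k) (m + m').
  by move=> le hm hm'; apply: (step_dim st) => //; apply: GD_dim.
have d0 := lt 0%N _ e0 h0.
have cg (V : lmodType K) (S : V -> Prop) p q :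
  subspace_dim S p -> p = q -> subspace_dim S q by move=> h <-.
have b2 p : 'C(p.+2, 2) = ('C(p.+1, 2) + p.+1)%N by rewrite binS bin1.
have b3 p : 'C(p.+3, 3) = ('C(p.+2, 3) + 'C(p.+2, 2))%N by rewrite binS.
rewrite !nE {nE}; move: lt ge h1 h2 h3; clear n st.
move: (count_mem 1%N es) (count_mem 2 es) (count_mem 3 es) => p q r.
 case: e e0 => [//|[|[|[|e]]]] _ lt ge h1 h2 h3 /=; split=> //;
  rewrite ?addn0 ?eqE /=.
- exact: (ge 1%N).
- apply: (cg _ _ _ _ (ge 2 _ _ isT h2 (ge 1%N _ _ isT h1 d0))).
  by rewrite addn1 b2 -addnA [(_ + _.+1)%N]addnC addnA.
- apply: (cg _ _ _ _ (ge 3 _ _ isT h3 (ge 2 _ _ isT h2 (ge 1%N _ _ isT h1 d0)))).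
  by rewrite addn1 b3 b2 mulSn; move: 'C(p.+2, 3) 'C(p.+1, 2) => t u; lia.
- exact: lt.
- by apply: (cg _ _ _ _ (ge 2 _ _ isT h2 d0)); lia.
- by apply: (cg _ _ _ _ (ge 3 _ _ isT h3 (lt 1%N _ isT h1))); lia.
- exact: lt.
- exact: lt.
- by apply: (cg _ _ _ _ (ge 3 _ _ isT h3 d0)); lia.
- exact: lt.
- exact: lt.
- exact: lt.
Qed.

(** The homogeneous elements in the form needed for inductions on products of
variables. *)
Inductive hgen (A : algType K) (vars : seq (A * nat)) : nat -> A -> Prop :=
| HGzero d : hgen vars d 0
| HGone : hgen vars 0 1
| HGvar v : v \in vars -> hgen vars v.2 v.1
| HGadd d c a b : hgen vars d a -> hgen vars d b -> hgen vars d (c *: a + b)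
| HGmul d d' a b : hgen vars d a -> hgen vars d' b -> hgen vars (d + d') (a * b).

Lemma hgen_map (R A : algType K) (iota : {lrmorphism R -> A})
    (vars : seq (R * nat)) w d r :
  hgen vars d r -> hgen (rcons [seq (iota v.1, v.2) | v <- vars] w) d (iota r).
Proof.
elim=> {d r} [d||v hv|d c a b _ ha _ hb|d d' a b _ ha _ hb].
- by rewrite rmorph0; apply: HGzero.
- by rewrite rmorph1; apply: HGone.
- apply: (HGvar (v := (iota v.1, v.2))); rewrite mem_rcons inE; apply/orP; right.
  by apply/mapP; exists v.
- by rewrite linearP; apply: HGadd.
- by rewrite rmorphM; apply: HGmul.
Qed.

Lemma hgen_skew (R : algType K) (sigma : {lrmorphism R -> R})
    (delta : {linear R -> R}) (G : nat -> R -> Prop) vars e d r :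
  graded G -> skew_derivation sigma delta ->
  (forall v, v \in vars -> [/\ G v.2 v.1, G v.2 (sigma v.1) & G (e + v.2)%N (delta v.1)]) ->
  hgen vars d r -> [/\ G d r, G d (sigma r) & G (e + d)%N (delta r)].
Proof.
move=> gr skew hv; have d1 : delta 1 = 0.
  have := skew 1 1; rewrite mul1r rmorph1 mul1r mulr1 => /esym/eqP.
  by rewrite -subr_eq0 addrK => /eqP.
elim=> {d r} [d||v /hv //|d c a b _ [h1 h2 h3] _ [h4 h5 h6]|
   d d' a b _ [h1 h2 h3] _ [h4 h5 h6]].
- by rewrite rmorph0 linear0; split; apply: gr0.
- by rewrite rmorph1 d1; split; [apply: gr1 | apply: gr1 | apply: gr0].
- by rewrite !linearP; split; [have [_ h] := gr_sub gr d|have [_ h] := gr_sub gr d|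
     have [_ h] := gr_sub gr (e + d)%N]; apply: h.
- split; first exact: (gr_mul gr); first by rewrite rmorphM; apply: (gr_mul gr).
  rewrite skew; apply: (grD gr); last by rewrite addnA; apply: (gr_mul gr).
  by rewrite addnCA; apply: (gr_mul gr).
Qed.

Lemma expansion_hgen (R A : algType K) (iota : {lrmorphism R -> A}) (x : A) e
    (G : nat -> R -> Prop) (vars : seq (A * nat)) :
  (forall d r, G d r -> hgen vars d (iota r)) -> (x, e) \in vars ->
  forall d a, expansion_grading G iota x e d a -> hgen vars d a.
Proof.
move=> hG hx d a [p <- hp].
have hD d' u v : hgen vars d' u -> hgen vars d' v -> hgen vars d' (u + v).
  by move=> hu hv; rewrite -[u]scale1r; apply: HGadd.
rewrite horner_coef; elim/big_ind: _ => [|u v|i _]; first exact: HGzero.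
  exact: hD.
rewrite coef_map /=; case: (hp i) => [->|[c <- /hG hc]].
  by rewrite rmorph0 mul0r; apply: HGzero.
apply: HGmul => //; elim: (nat_of_ord i) => [|j IH]; first exact: HGone.
by rewrite exprS mulSn; apply: HGmul => //; apply: (HGvar hx).
Qed.

(** A polynomial ring in one variable is an Ore step over K with sigma = id and
delta = 0. *)
Lemma tower_of_ore (A : algType K) (vars : seq (A * nat)) (G : nat -> A -> Prop)
    (T : graded_iterated_ore vars G) : sigmas_injective T ->
  [/\ tower G (unzip2 vars), forall v, v \in vars -> G v.2 v.1
    & forall d a, G d a -> hgen vars d a].
Proof.
elim: T => {A vars G} [A x e e0 ux|R vars G A iota sigma delta x e T IH e0 ore hv] /=.
  move=> _; have ore : ore_extension (scalar_map A) (idfun : K^o -> K^o)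
     (\0 : K^o -> K^o) x.
    split=> // [r1 r2|r]; first by rewrite /= mulr0 mul0r addr0.
    by rewrite /= rmorph0 addr0 /scalar_map -scalerAl mul1r -scalerAr mulr1.
  have st : ore_step (scalar_map A) (idfun : K^o -> K^o) (\0 : K^o -> K^o) x e
     (@scalar_grading K) (expansion_grading (@scalar_grading K) (in_alg A) x e).
    apply: (ore_step_expansion (base_graded K)) => //.
    - by move=> d; exists (d == 0%N); apply: base_dim.
    - by move=> d r _; left.
  split.
  - exact: (TowerStep (@TowerBase K) st).
  - by move=> v; rewrite inE => /eqP ->; apply: (os_x st).
  apply: (expansion_hgen (iota := scalar_map A)); last by rewrite inE.
  move=> d r [->|->]; first by rewrite rmorph0; apply: HGzero.
  suff : hgen [:: (x, e)] 0 (r *: (1 : A) + 0) by rewrite addr0.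
  by apply: HGadd; [apply: HGone | apply: HGzero].
case=> sigI /IH[tw varG gen]; have gr := tower_graded tw.
have hsd d r : G d r -> [/\ G d r, G d (sigma r) & G (e + d)%N (delta r)].
  move/gen; have [skew _ _] := ore.
  by apply: (hgen_skew gr skew) => v vv; have [] := hv v vv; split=> //; apply: varG.
have st : ore_step iota sigma delta x e G (expansion_grading G iota x e).
  apply: ore_step_expansion => //.
  - exact: (tower_finite tw).
  - by move=> d r /hsd[].
  - by move=> d r /hsd[].
split.
- rewrite /unzip2 map_rcons -map_comp; exact: (TowerStep tw st).
- move=> v; rewrite mem_rcons inE => /predU1P[->|/mapP[w ww ->]] /=.
    exact: (os_x st).
  by apply: (os_iota st); apply: varG.
apply: (expansion_hgen (iota := iota)); last by rewrite mem_rcons inE eqxx.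
by move=> d r /gen; apply: hgen_map.
Qed.

End Tower.

(** * Degrees of the variables *)

Section TowerCocycles.
Variable K : fieldType.
Implicit Types (A R : algType K) (ds : seq nat).

Lemma tower_inv A (G : nat -> A -> Prop) ds : tower G ds -> (0 < size ds)%N ->
  exists R (iota : {lrmorphism R -> A}) (sigma : {lrmorphism R -> R})
    (delta : {linear R -> R}) (x : A) (e : nat) (H : nat -> R -> Prop) es,
    [/\ tower H es, ore_step iota sigma delta x e H G & ds = rcons es e].
Proof.
by case=> // R B i s d x e H H' es tw st _; exists R, i, s, d, x, e, H, es.
Qed.

Lemma step_cocycle1E R A (iota : {lrmorphism R -> A}) (sigma : {lrmorphism R -> R})
    (delta : {linear R -> R}) (x : A) (e : nat) G G' k a :
  ore_step iota sigma delta x e G G' -> G' k a ->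
  exists r t, [/\ G k r, e != k -> t = 0 &
    forall al : A -> K, cocycle1 G' k al -> al a = al (iota r) + t * al x].
Proof.
move=> st /(os_decl st)[r [b [hr hb ->]]].
have gr' := os_gr' st; have e0 := os_e st; have gir := os_iota st hr.
have [lt|lt|ek] := ltngtP e k.
- exists r, 0; split=> // al c1; move: hb; rewrite /GD (ltnW lt) => hb.
  have gbx : G' k (b * x).
    by rewrite -(subnK (ltnW lt)); apply: (gr_mul gr') => //; apply: (os_x st).
  rewrite (cocycle1D c1) // mul0r; case: c1 => _ /(_ (k - e)%N e b x) -> //.
  - by rewrite subn_gt0.
  - by rewrite subnK // ltnW.
  - exact: (os_x st).
- exists r, 0; split=> // al c1; rewrite (GD_lt lt hb) mul0r addr0 mul0r addr0 //.
rewrite -ek in hb; have [t ->] := GDnnP gr' hb.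
have gx : G' k x by rewrite -ek; apply: (os_x st).
exists r, t; split=> // al c1.
rewrite -scalerAl mul1r (cocycle1D c1) ?(cocycle1Z gr' _ c1) //.
exact: grZ.
Qed.

(** In a degree without variables, every element is a combination of products of
elements of lower positive degree. *)
Lemma tower_cocycle1_zero A (G : nat -> A -> Prop) ds k al :
  tower G ds -> (0 < k)%N -> k \notin ds -> cocycle1 G k al ->
  forall a, G k a -> al a = 0.
Proof.
move=> tw k0; elim: tw al => {A G ds} [|R A i s d x e G G' es _ IH st] al.
  move=> _ c1 a [->|k00]; last by rewrite k00 in k0.
  exact: (cocycle1_0 (base_graded K) c1).
rewrite mem_rcons inE negb_or => /andP[ne nes] c1 a.
case/(step_cocycle1E st) => r [t [hr t0 -> //]].
rewrite t0 1?eq_sym // mul0r addr0.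
exact: (IH _ nes (cocycle1_restrict st c1)).
Qed.

(** Modulo products of elements of lower positive degree, the component is
spanned by the variable of that degree. *)
Lemma tower_cocycle1_line A (G : nat -> A -> Prop) ds k al be b :
  tower G ds -> (0 < k)%N -> (count_mem k ds <= 1)%N ->
  cocycle1 G k al -> cocycle1 G k be -> G k b -> be b != 0 ->
  exists c, forall a, G k a -> al a = c * be a.
Proof.
move=> tw k0; elim: tw al be b => {A G ds} [|R A i s d x e G G' es tw IH st] al be b.
  move=> _ _ c1 [->|k00]; last by rewrite k00 in k0.
  by rewrite (cocycle1_0 (base_graded K) c1) eqxx.
rewrite -cats1 count_cat /= addn0 => le c1 c2 gb nz.
have r1 := cocycle1_restrict st c1; have r2 := cocycle1_restrict st c2.
have [r [t [hr t0 bE]]] := step_cocycle1E st gb; rewrite bE // in nz.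
have [ek|ne] := eqVneq e k; last first.
  rewrite t0 // mul0r addr0 in nz.
  have [|c hc] := IH _ _ _ _ r1 r2 hr nz; first by rewrite (leq_trans _ le) ?leq_addr.
  exists c => a /(step_cocycle1E st)[q [u [hq u0 h]]].
  by rewrite !h // u0 // !mul0r !addr0 hc.
have nes : k \notin es by rewrite -has_pred1 has_count; move: le; rewrite ek eqxx addn1;
    case: (count _ _).
have z1 := tower_cocycle1_zero tw k0 nes r1.
have z2 := tower_cocycle1_zero tw k0 nes r2.
rewrite z2 // add0r mulf_eq0 negb_or in nz; case/andP: nz => _ nz.
exists (al x / be x) => a /(step_cocycle1E st)[q [u [hq u0 h]]].
by rewrite !h // z1 ?z2 // !add0r mulrCA divfK.
Qed.

(** The coefficient of the variable is a cocycle.  An obstruction to extending it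
over a later variable of degree e would be a nonzero cocycle in degree k - e,
and hence need a variable of degree k - e. *)
Lemma tower_indecomposable A (G : nat -> A -> Prop) ds k :
  tower G ds -> k \in ds -> (forall a b, subseq [:: a; b] ds -> (a + b)%N <> k) ->
  exists2 al, cocycle1 G k al & exists2 a, G k a & al a = 1.
Proof.
move=> tw; elim: tw => {A G ds} [//|R A i s d x e G G' es tw IH st].
rewrite mem_rcons inE => /orP[/eqP-> _|kes nopair].
  by have [al c1 hx] := cocycle1_new st; exists al => //; exists x => //; apply: (os_x st).
have k0 : (0 < k)%N by have /allP/(_ _ kes) := tower_degs tw.
have [|al c1 [a ga ha]] := IH kes.
  by move=> a b ab; apply: nopair; apply: subseq_trans ab (subseq_rcons _ _).
have [|al' c1' hal'] := cocycle1_extend st k0 c1; last first.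
  by exists al' => //; exists (i a); [apply: (os_iota st) | rewrite hal'].
have gr := os_gr st; have e0 := os_e st.
move=> r; have [lt|lt|ek] := ltngtP e k.
- rewrite /GD (ltnW lt); apply: (tower_cocycle1_zero tw _ _ (cocycle1_delta st lt c1)).
    by rewrite subn_gt0.
  apply/negP => h; apply: (nopair (k - e)%N e); last by rewrite subnK // ltnW.
  rewrite -cats1 -[[:: _; _]]/([:: (k - e)%N] ++ [:: e]).
  by apply: cat_subseq; rewrite ?sub1seq // mem_head.
- by move/(GD_lt lt) ->; rewrite linear0 (cocycle1_0 gr c1).
rewrite -ek => /(GDnnP gr)[t ->]; rewrite (step_deltac st).
by apply: (cocycle1_0 gr (k := k)).
Qed.

(** The smaller of the two remaining degrees can only be 1 + 1, and then the
larger one can only be 1 + 1 or 1 + 2, as 2 + 2 needs two variables of degree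
two. *)
Lemma degree_pairs (ds : seq nat) : size ds = 5%N -> all (fun k => 0 < k)%N ds ->
  count_mem 1%N ds = 3%N ->
  (forall k, k \in ds -> (1 < k)%N -> exists a b, subseq [:: a; b] ds /\ (a + b)%N = k) ->
  perm_eq ds [:: 1; 1; 1; 2; 2]%N \/ perm_eq ds [:: 1; 1; 1; 2; 3]%N.
Proof.
move=> sz pos c1 pairs.
have pds : perm_eq ds (nseq 3 1%N ++ filter (fun k => k != 1%N) ds).
  have <- : filter (pred1 1%N) ds = nseq 3 1%N.
    rewrite -c1 -size_filter; apply/all_pred1P; exact: filter_all.
  by rewrite perm_sym; apply/permPl; apply: (perm_filterC (pred1 1%N)).
set fs := filter _ _ in pds.
have szf : size fs = 2%N by have := perm_size pds; rewrite size_cat size_nseq sz; lia.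
have fsP k : k \in fs -> (1 < k)%N /\ k \in ds.
  rewrite mem_filter => /andP[n1 kd]; split=> //.
  by have /= := allP pos _ kd; case: k n1 {kd} => [|[]].
have [p [q [pq pE]]] : exists p q, (p <= q)%N /\ perm_eq ds [:: 1; 1; 1; p; q]%N.
  case E: fs szf => [|p [|q []]] // _; rewrite E in pds.
  case: (leqP p q) => le; first by exists p, q.
  exists q, p; split; first exact: ltnW.
  by apply: perm_trans pds _; rewrite -[[:: 1%N; _; _; _; _]]/([:: 1; 1; 1]%N ++ [:: q; p])
    perm_cat // (perm_catC [:: p] [:: q]).
have memE : ds =i [:: 1; 1; 1; p; q]%N by apply: perm_mem.
have cE k : count_mem k ds = ((k == 1) * 3 + (k == p) + (k == q))%N.
  by rewrite (permP pE) /= ![_ == k]eq_sym; case: (k == 1%N) => //=; lia.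
have p1 : (1 < p)%N.
  have : p != 1%N by apply/eqP => p1; move: (cE 1%N); rewrite c1 p1 /=; lia.
  have : (0 < p)%N by apply: (allP pos); rewrite memE !inE eqxx !orbT.
  lia.
have pair k : k \in ds -> (1 < k)%N -> exists a b,
    [/\ a \in [:: 1; p; q]%N, b \in [:: 1; p; q]%N, (a + b)%N = k,
        (0 < a)%N /\ (0 < b)%N & a = b -> (1 < count_mem a ds)%N].
  move=> kd k1; have [a [b [sub ab]]] := pairs k kd k1; exists a, b.
  have ma : a \in ds by apply: (mem_subseq sub); rewrite inE eqxx.
  have mb : b \in ds by apply: (mem_subseq sub); rewrite !inE eqxx orbT.
  split=> //.
  - by move: ma; rewrite memE !inE !orbA !orbb.
  - by move: mb; rewrite memE !inE !orbA !orbb.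
  - by split; apply: (allP pos).
  move=> eab; rewrite -eab in sub.
  by have := leq_count_subseq (pred1 a) sub; rewrite /= eqxx.
have [|a [b [ma mb ab [a0 b0] _]]] := pair p _ p1; first by rewrite memE !inE eqxx !orbT.
have p2 : p = 2%N.
  by move: ma mb; rewrite !inE => /or3P[]/eqP ea /or3P[]/eqP eb; lia.
have [||a' [b' [ma' mb' ab' [a0' b0'] dist]]] := pair q.
- by rewrite memE !inE eqxx !orbT.
- lia.
rewrite p2 in pE cE ma' mb' pq.
have [q2|q3] : q = 2%N \/ q = 3%N; last by right; rewrite -q3.
  move: ma' mb'; rewrite !inE => /or3P[]/eqP ea /or3P[]/eqP eb; try lia.
  by have := dist (etrans ea (esym eb)); rewrite ea cE /=; case: eqP; lia.
by left; rewrite -[X in [:: _; _; _; _; X]]q2.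
Qed.

(** Generation in degree one excludes nonzero cocycles in higher degrees: the
first claim follows through [tower_indecomposable], the second since the
coefficient of the last variable is a cocycle. *)
Lemma tower_degrees A (G : nat -> A -> Prop) ds :
  tower G ds -> size ds = 5%N -> count_mem 1%N ds = 3%N -> generated_in_degree_one G ->
  (perm_eq ds [:: 1; 1; 1; 2; 2]%N \/ perm_eq ds [:: 1; 1; 1; 2; 3]%N) /\
  last 0%N ds = 1%N.
Proof.
move=> tw sz c1 gen; have gr := tower_graded tw; split.
  apply: degree_pairs => //; first exact: (tower_degs tw).
  move=> k kd k1; apply: NNPP => npair.
  have [|al cal [a ga]] := tower_indecomposable tw kd.
    by move=> a b sub ab; apply: npair; exists a, b.
  by rewrite (generated_cocycle1 gr gen k1 cal) // => /esym/eqP; rewrite oner_eq0.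
have [|R [i [s [d [x [e [H [es [_ st ->]]]]]]]]] := tower_inv tw; first by rewrite sz.
rewrite last_rcons; have e0 := os_e st.
have [//|ne] := eqVneq e 1%N; have e1 : (1 < e)%N by lia.
have [al cal] := cocycle1_new st; rewrite (generated_cocycle1 gr gen e1 cal).
  by move/esym/eqP; rewrite oner_eq0.
exact: (os_x st).
Qed.

Lemma step_degree1 R A (iota : {lrmorphism R -> A}) (sigma : {lrmorphism R -> R})
    (delta : {linear R -> R}) (x : A) (e : nat) G G' a :
  ore_step iota sigma delta x e G G' -> G' 1%N a ->
  exists r t, [/\ G 1%N r, e != 1%N -> t = 0 & a = iota r + t *: x].
Proof.
move=> st /(os_decl st)[r [b [hr hb ->]]]; have e0 := os_e st.
have gr' := os_gr' st; have [e1|ne] := eqVneq e 1%N.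
  rewrite e1 in hb; have [t ->] := GDnnP gr' hb.
  by exists r, t; split; rewrite // -scalerAl mul1r.
exists r, 0; split=> //; have lt : (1 < e)%N by lia.
by rewrite (GD_lt lt hb) mul0r scale0r.
Qed.

(** Induction on the steps, comparing coefficients of the last variable. *)
Lemma tower_domain1 A (G : nat -> A -> Prop) ds a b :
  tower G ds -> G 1%N a -> G 1%N b -> a * b = 0 -> a = 0 \/ b = 0.
Proof.
move=> tw; elim: tw a b => {A G ds} [|R A i s d x e G G' es tw IH st] a b.
  by case=> // -> _ _; left.
move=> /(step_degree1 st)[r [t [hr t0 ->]]] /(step_degree1 st)[q [u [hq u0 ->]]].
have iI := step_iota_inj st.
have [e1|ne] := eqVneq e 1%N; last first.
  rewrite t0 // u0 // !scale0r !addr0 -rmorphM -(rmorph0 i) => /iI/IH[] // ->.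
    by left.
  by right.
have -> : (i r + t *: x) * (i q + u *: x) =
    i (r * q + t *: d q) + (i (u *: r + t *: s q) + (t * u) *: x) * x.
  rewrite mulrDl !mulrDr -!scalerAl -!scalerAr (os_comm st) !rmorphD !linearZ /= rmorphM.
  rewrite scalerDr scalerA [t * u]mulrC !linearZ /= !mulrDl -!scalerAl.
  rewrite -!addrA; congr (_ + _); rewrite [in LHS]addrA addrC [RHS]addrC -!addrA addrC.
  by rewrite -!addrA addrCA; congr (_ + _); rewrite addrCA.
case/(os_uniql st)=> h1 h2.
have [|h3 h4] := os_uniql st (r := u *: r + t *: s q) (b := (t * u)%:A).
  by rewrite -[RHS]h2 -scalerAl mul1r.
move/alg_inj0/eqP: h4; rewrite mulf_eq0 => /orP[]/eqP z; rewrite z in h1 h3 *.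
  rewrite !scale0r !addr0 in h1 h3 *; have [u1|nu] := eqVneq u 0.
    rewrite u1 scale0r addr0; case: (IH _ _ hr hq h1) => ->; rewrite rmorph0; auto.
  by left; move/eqP: h3; rewrite scaler_eq0 (negPf nu) => /eqP ->; rewrite rmorph0.
rewrite !scale0r add0r in h3 *; have [t1|nt] := eqVneq t 0.
  rewrite t1 !scale0r !addr0 in h1 *.
  by case: (IH _ _ hr hq h1) => ->; rewrite rmorph0; auto.
right; move/eqP: h3; rewrite scaler_eq0 (negPf nt) -(rmorph0 s) (inj_eq (os_inj st)).
by move/eqP ->; rewrite rmorph0 addr0.
Qed.

(** As in a quantum plane, the ordered quadratic monomials are independent: the
coefficients of the later of the two variables are compared. *)
Lemma tower_plane A (G : nat -> A -> Prop) ds :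
  tower G ds -> count_mem 1%N ds = 2%N ->
  exists u v, [/\ G 1%N u, G 1%N v,
    forall a, G 1%N a -> exists s t, a = s *: u + t *: v &
    forall p q r, p *: (u * u) + q *: (u * v) + r *: (v * v) = 0 ->
      [/\ p = 0, q = 0 & r = 0]].
Proof.
elim=> {A G ds} [//|R A i s d x e G G' es tw IH st].
have iI := step_iota_inj st.
rewrite -cats1 count_cat /= addn0; have [e1 c1|ne] := eqVneq e 1%N; last first.
  rewrite addn0 => /IH[u [v [hu hv span ind]]]; exists (i u), (i v).
  split; try exact: (os_iota st).
    move=> a /(step_degree1 st)[r [t [/span[p [q ->]] t0 ->]]].
    by exists p, q; rewrite t0 // scale0r addr0 linearD !linearZ.
  move=> p q r h; apply: ind; apply: iI; rewrite rmorph0 -[RHS]h.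
  by rewrite !linearD !linearZ /= !rmorphM.
have {}c1 : count_mem 1%N es = 1%N by move: c1; rewrite addn1 => -[].
have [_ d1 _ _] := tower_dim tw; rewrite c1 in d1.
have [b [ib Gb sb]] := dim_basis d1; pose u := b ord0.
have sbu r : G 1%N r -> exists t, r = t *: u.
  by case/sb=> c ->; exists (c ord0); rewrite big_ord1.
have nzu : u != 0.
  apply/eqP => u0; have := ib (fun=> 1); rewrite big_ord1 -/u u0 scaler0.
  by move=> /(_ erefl ord0)/eqP; rewrite oner_eq0.
exists (i u), x; split; first exact/(os_iota st)/Gb.
- by rewrite -[1%N]e1; apply: (os_x st).
- by move=> a /(step_degree1 st)[r [t [/sbu[p ->] _ ->]]]; exists p, t; rewrite linearZ.
move=> p q r h; have [] := os_uniql st (r := p *: (u * u)) (b := i (q *: u) + r *: x).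
  by rewrite -[RHS]h !linearZ /= rmorphM mulrDl -!scalerAl addrA.
move=> h1 h2; have [|h3 /alg_inj0 h4] := os_uniql st (r := q *: u) (b := r%:A).
  by rewrite -[RHS]h2 -scalerAl mul1r.
split=> //; last by move/eqP: h3; rewrite scaler_eq0 (negPf nzu) orbF => /eqP.
move/eqP: h1; rewrite scaler_eq0 => /orP[/eqP//|/eqP uu].
by case: (tower_domain1 tw (Gb _) (Gb _) uu) => u0; rewrite /u u0 eqxx in nzu.
Qed.

End TowerCocycles.

(** * Linear syzygies of the quadratic relations *)

Ltac addac := rewrite -?addrA; repeat match goal with
 | |- ?x = ?x => reflexivity
 | |- ?a + _ = _ => first [refine (congr1 (+%R a) _) |rewrite [in RHS](addrCA _ a) | rewrite [in RHS](addrC _ a)]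
 end; try reflexivity.

Section LinearSyzygies.
Variables (K : fieldType) (A : algType K).

(** The tensor with coefficients c lies in V I_2 and in I_2 V, where I_2 is the
space of quadratic relations. *)
Definition linear_syzygy (I J L : finType) (e1 : I -> A) (e2 : J -> A) (e3 : L -> A)
    (c : I -> J -> L -> K) : Prop :=
  (forall l, \sum_i \sum_j c i j l *: (e1 i * e2 j) = 0) /\
  (forall i, \sum_j \sum_l c i j l *: (e2 j * e3 l) = 0).

Definition no_linear_syzygy (I : finType) (e : I -> A) : Prop :=
  forall c, linear_syzygy e e e c -> forall i j l, c i j l = 0.

(** A syzygy transforms like a tensor of order three under change of basis. *)
Lemma no_linear_syzygy_basis (I F : finType) (S : A -> Prop) (e : I -> A) (f : F -> A) :
  basis e S -> basis f S -> no_linear_syzygy f -> no_linear_syzygy e.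
Proof.
move=> [ie Se _] [_ _ spf] nof c hc.
have [P hP] := fchoice (fun i => spf _ (Se i)).
have inv (w : I -> K) : (forall a, \sum_i P i a * w i = 0) -> forall i, w i = 0.
  move=> hw; apply: ie; under eq_bigr => i _ do rewrite hP scaler_sumr.
  rewrite exchange_big big1 //= => a _.
  under eq_bigr => i _ do rewrite scalerA mulrC.
  by rewrite -scaler_suml hw scale0r.
have sw1 (w : I -> A) (F1 : I -> K) : True by [].
pose c1 a j l := \sum_i P i a * c i j l.
have h1 : linear_syzygy f e e c1.
  case: hc => h1 h2; split=> [l|a].
    rewrite -[RHS](h1 l); under [RHS]eq_bigr => i _.
      under eq_bigr => j _ do rewrite hP mulr_suml scaler_sumr.
      rewrite exchange_big /=; over.
    rewrite [RHS]exchange_big /=; apply: eq_bigr => a _.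
    rewrite [RHS]exchange_big /=; apply: eq_bigr => j _.
    rewrite scaler_suml; apply: eq_bigr => i _.
    by rewrite -scalerAl scalerA mulrC.
  transitivity (\sum_i P i a *: (\sum_j \sum_l c i j l *: (e j * e l))); last first.
    by rewrite big1 // => i _; rewrite h2 scaler0.
  under [RHS]eq_bigr => i _.
    rewrite scaler_sumr; under eq_bigr => j _ do rewrite scaler_sumr.
    over.
  rewrite [RHS]exchange_big /=; apply: eq_bigr => j _.
  rewrite [RHS]exchange_big /=; apply: eq_bigr => l _.
  by rewrite scaler_suml; apply: eq_bigr => i _; rewrite scalerA.
pose c2 a b l := \sum_j P j b * c1 a j l.
have h2 : linear_syzygy f f e c2.
  case: h1 => h1 h2; split=> [l|a].
    rewrite -[RHS](h1 l); apply: eq_bigr => a _.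
    under [RHS]eq_bigr => j _ do rewrite hP mulr_sumr scaler_sumr.
    rewrite [RHS]exchange_big /=; apply: eq_bigr => b _.
    rewrite scaler_suml; apply: eq_bigr => j _.
    by rewrite -scalerAr scalerA mulrC.
  rewrite -[RHS](h2 a) [RHS]exchange_big [LHS]exchange_big /=; apply: eq_bigr => l _.
  under [RHS]eq_bigr => j _ do rewrite hP mulr_suml scaler_sumr.
  rewrite [RHS]exchange_big /=; apply: eq_bigr => b _.
  rewrite scaler_suml; apply: eq_bigr => j _.
  by rewrite -scalerAl scalerA mulrC.
pose c3 a b d := \sum_l P l d * c2 a b l.
have h3 : linear_syzygy f f f c3.
  case: h2 => h1' h2; split=> [d|a].
    transitivity (\sum_l P l d *: (\sum_a \sum_b c2 a b l *: (f a * f b))); last first.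
      by rewrite big1 // => l _; rewrite h1' scaler0.
    under [RHS]eq_bigr => l _.
      rewrite scaler_sumr; under eq_bigr => j _ do rewrite scaler_sumr.
      over.
    rewrite [RHS]exchange_big /=; apply: eq_bigr => a _.
    rewrite [RHS]exchange_big /=; apply: eq_bigr => b _.
    by rewrite scaler_suml; apply: eq_bigr => i _; rewrite scalerA.
  rewrite -[RHS](h2 a); apply: eq_bigr => b _.
  under [RHS]eq_bigr => l _ do rewrite hP mulr_sumr scaler_sumr.
  rewrite [RHS]exchange_big /=; apply: eq_bigr => d _.
  rewrite scaler_suml; apply: eq_bigr => l _.
  by rewrite -scalerAr scalerA mulrC.
have z3 := nof c3 h3.
have z2 a b l : c2 a b l = 0.
  by move: l; apply: inv => d; apply: z3.
have z1 a j l : c1 a j l = 0.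
  by move: j; apply: (inv (fun j => c1 a j l)) => b; apply: z2.
by move=> i j l; move: i; apply: (inv (fun i => c i j l)) => a; apply: z1.
Qed.

Variable G : nat -> A -> Prop.
Hypothesis gr : graded G.

Lemma generated_degree2 (I : finType) (e : I -> A) :
  generated_in_degree_one G -> finite_components G -> basis e (G 1%N) ->
  forall a, G 2 a -> spanned (fun p : I * I => e p.1 * e p.2) a.
Proof.
move=> gen fin [ie Ge spe] a ga; apply: NNPP => nsp.
have [n dn] := fin 2; have [b [ib Gb spb]] := dim_basis dn.
have [psi [lin psi0 psia]] := separation (gr_sub gr 2) spb
  (subspace_spanned (fun p : I * I => e p.1 * e p.2)) ga nsp.
suff c1 : cocycle1 G 2 psi.
  by move: psia; rewrite (generated_cocycle1 gr gen _ c1) // => /esym/eqP; rewrite oner_eq0.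
split=> // i j u v i0 j0 ij; have [-> ->] : i = 1%N /\ j = 1%N by lia.
move=> gu gv; apply: psi0; first by apply: (gr_mul gr gu gv).
have [c ->] := spe _ gu; have [d ->] := spe _ gv.
exists (fun p => c p.1 * d p.2); rewrite mulr_suml.
rewrite -(pair_big xpredT xpredT (fun i j => (c i * d j) *: (e i * e j))) /=.
apply: eq_bigr => k _; rewrite mulr_sumr; apply: eq_bigr => l _.
by rewrite -scalerAl -scalerAr scalerA.
Qed.

End LinearSyzygies.

(** In the last Ore step over two degree one variables u, v the tensor is
decomposed along x.  A nonzero tensor would put a quadratic relation g of R in
the slot of x, or lie over R_1.  In the first case the rank of g is two because
products of degree one elements do not vanish, so delta would map all of R_1
into R_1 R_1 and the generators of degree two would not be reached.  In the
second case the slices of the tensor are multiples of one relation, which would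
have rank one. *)
Lemma tower_no_linear_syzygy (K : fieldType) (A : algType K)
    (G : nat -> A -> Prop) ds (I : finType) (e : I -> A) :
  tower G (rcons ds 1%N) -> count_mem 1%N ds = 2%N -> (0 < count_mem 2 ds)%N ->
  generated_in_degree_one G -> basis e (G 1%N) -> no_linear_syzygy e.
Proof.
move=> tw c1 c2 gen be.
have [|R [i [s [d [x [k [H [es [twR st eqds]]]]]]]]] := tower_inv tw.
  by rewrite size_rcons.
have [eds ek] : ds = es /\ 1%N = k by move/rcons_inj: eqds => -[].
rewrite -{}eds -{}ek {es k eqds} in twR st.
have gr := os_gr st; have gr' := os_gr' st; have iI := step_iota_inj st.
have [u [v [Gu Gv span ind]]] := tower_plane twR c1.
have indR1 p q : p *: u + q *: v = 0 -> p = 0 /\ q = 0.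
  move=> h; have := ind p q 0; rewrite scale0r addr0.
  have -> : p *: (u * u) + q *: (u * v) = u * (p *: u + q *: v).
    by rewrite mulrDr -!scalerAr.
  by rewrite h mulr0 => /(_ erefl)[].
pose w (b : bool) := if b then v else u.
have Gw b : H 1%N (w b) by case: b.
pose f (z : bool + unit) := match z with inl b => i (w b) | inr _ => x end.
have sumf (V : nmodType) (F : bool + unit -> V) :
    \sum_z F z = F (inl true) + F (inl false) + F (inr tt).
  by rewrite big_sumType big_bool /= (big_pred1 tt) //; case.
have bf : basis f (G 1%N).
  split.
  - move=> c; rewrite sumf /= => h.
    have [|h1 /alg_inj0 h2] := os_uniql st
      (r := c (inl false) *: u + c (inl true) *: v) (b := (c (inr tt))%:A).
      by rewrite -[RHS]h linearD !linearZ /= -scalerAl mul1r [X in X + _]addrC.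
    by have [h3 h4] := indR1 _ _ h1; case=> [[]|[]].
  - by case=> [b|[]]; [apply: (os_iota st) | rewrite -[1%N]/1%N; apply: (os_x st)].
  move=> a /(step_degree1 st)[r [t [/span[p [q ->]] _ ->]]].
  exists (fun z => match z with inl b => if b then q else p | inr _ => t end).
  by rewrite sumf /= linearD !linearZ /= [X in X + _]addrC.
apply: (no_linear_syzygy_basis be bf) => c [h1 h2].
(* the components of a quadratic relation along 1, x and x x *)
have quad (q : bool + unit -> bool + unit -> K) :
    \sum_z \sum_y q z y *: (f z * f y) = 0 ->
    [/\ \sum_a \sum_b q (inl a) (inl b) *: (w a * w b)
          + \sum_b q (inr tt) (inl b) *: d (w b) = 0,
        \sum_a q (inl a) (inr tt) *: w a + \sum_b q (inr tt) (inl b) *: s (w b) = 0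
      & q (inr tt) (inr tt) = 0].
  move=> h.
  have [|g1 g2] := os_uniql st
    (r := \sum_a \sum_b q (inl a) (inl b) *: (w a * w b)
          + \sum_b q (inr tt) (inl b) *: d (w b))
    (b := i (\sum_a q (inl a) (inr tt) *: w a + \sum_b q (inr tt) (inl b) *: s (w b))
          + (q (inr tt) (inr tt))%:A * x).
    rewrite -[RHS]h !sumf /= !big_bool /= !linearD /= !linearZ /= !rmorphM.
    rewrite !(os_comm st) !mulrDl -!scalerAl mul1r !scalerDr.
    addac.
  have [|g3 /alg_inj0 g4] := os_uniql st
     (r := \sum_a q (inl a) (inr tt) *: w a + \sum_b q (inr tt) (inl b) *: s (w b))
     (b := (q (inr tt) (inr tt))%:A); first by rewrite -[RHS]g2.
  by split.
have Q1 z := quad (fun a b => c a b z) (h1 z).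
have Q2 z := quad (fun a b => c z a b) (h2 z).
have sw (p : bool -> K) : \sum_b p b *: w b = 0 -> forall b, p b = 0.
  rewrite big_bool /= addrC => /indR1[p0 p1] b; by case: b.
have xx z : c (inr tt) (inr tt) z = 0 by case: (Q1 z).
have xb b : c (inr tt) (inl b) (inr tt) = 0.
  have [_ + _] := Q2 (inr tt); rewrite [X in _ + X]big1 ?addr0.
    by move=> h; apply: (sw (fun b => c (inr tt) (inl b) (inr tt))).
  by move=> a _; rewrite xx scale0r.
(* the quadratic relations of R are determined by the coefficient of v u *)
have Z0 (g : bool -> bool -> K) : \sum_a \sum_b g a b *: (w a * w b) = 0 ->
    g true false = 0 -> forall a b, g a b = 0.
  move=> h g0; have [|p q r] := ind (g false false) (g false true) (g true true).
    by rewrite -[RHS]h !big_bool /= g0 scale0r addr0; addac.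
  by case=> [] [].
have rank (p q : bool -> K) : \sum_a \sum_b (p a * q b) *: (w a * w b) = 0 ->
    (forall a, p a = 0) \/ (forall b, q b = 0).
  have Gs (r : bool -> K) : H 1%N (\sum_a r a *: w a).
    by apply: subspace_sum => [|a _]; [apply: gr_sub | apply: grZ].
  move=> h; have [|/sw|/sw] := tower_domain1 twR (Gs p) (Gs q); [|by left|by right].
  rewrite -[RHS]h mulr_suml; apply: eq_bigr => a _; rewrite mulr_sumr.
  by apply: eq_bigr => b _; rewrite -scalerAl -scalerAr scalerA.
pose g a b := c (inr tt) (inl a) (inl b).
have gZ : \sum_a \sum_b g a b *: (w a * w b) = 0.
  have [+ _ _] := Q2 (inr tt); rewrite [X in _ + X]big1 ?addr0 //.
  by move=> b _; rewrite xx scale0r.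
pose D (r : R) := spanned (fun p : bool * bool => w p.1 * w p.2) r.
have sD : subspace D := subspace_spanned _.
have g0 a b : g a b = 0.
  apply: NNPP => nz.
  have nz10 : g true false != 0.
    by apply/eqP => z; apply: nz; apply: (Z0 g).
  have Dg k : D (\sum_b g b k *: d (w b)).
    have [+ _ _] := Q1 (inl k).
    move/eqP; rewrite addrC addr_eq0 => /eqP ->; apply: (subspaceN sD).
    apply: subspace_sum => // a' _; apply: subspace_sum => // b' _.
    apply: (subspaceZ _ sD); exact: (spanned_gen (fun p : bool * bool => w p.1 * w p.2) (a', b')).
  pose det := g true true * g false false - g true false * g false true.
  have ndet : det != 0.
    apply/eqP => /eqP; rewrite subr_eq0 => /eqP det0.
    have [|p0|q0] := rank (fun a => g a false / g true false) (fun b => g true b).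
    - rewrite -[RHS]gZ; apply: eq_bigr => a' _; apply: eq_bigr => b' _; congr (_ *: _).
      rewrite mulrAC; apply: (canLR (mulfK nz10)).
      case: a'; case: b' => //; first by rewrite mulrC.
      by rewrite [RHS]mulrC -det0 mulrC.
    - by have := p0 true; rewrite divff // => /eqP; rewrite oner_eq0.
    - by have /eqP := q0 false; rewrite (negPf nz10).
  have Dd b' : D (d (w b')).
    have D2 : D (det *: d v) /\ D (det *: d u).
      have := Dg true; have := Dg false; rewrite !big_bool /= => Df Dt; split.
        have -> : det *: d v = g false false *: (g true true *: d v + g false true *: d u)
           - g false true *: (g true false *: d v + g false false *: d u).
          rewrite !scalerDr !scalerA opprD addrACA -!scalerBl /det.
          rewrite [g false false * g false true]mulrC subrr scale0r addr0.
          by rewrite [g false false * _]mulrC [g false true * _]mulrC.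
        by apply: subspaceB => //; apply: subspaceZ.
      have -> : det *: d u = g true true *: (g true false *: d v + g false false *: d u)
           - g true false *: (g true true *: d v + g false true *: d u).
        rewrite !scalerDr !scalerA opprD addrACA -!scalerBl /det.
        by rewrite [g true true * g true false]mulrC subrr scale0r add0r.
      by apply: subspaceB => //; apply: subspaceZ.
    have inv r : D (det *: r) -> D r.
      by move/(subspaceZ det^-1 sD); rewrite scalerA mulVf // scale1r.
    by case: b'; apply: inv; case: D2.
  have D2 r : H 2 r -> D r.
    move=> hr; have [|q] := generated_degree2 gr' gen _ bf (os_iota st hr).
      exact: (tower_finite tw).
    have -> : \sum_p q p *: (f p.1 * f p.2) = \sum_a \sum_b q (a, b) *: (f a * f b).
      by rewrite pair_bigA; apply: eq_bigr => -[].
    move=> h.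
    have [|rE _] := os_uniql st
      (r := \sum_a \sum_b q (inl a, inl b) *: (w a * w b)
          + \sum_b q (inr tt, inl b) *: d (w b) - r)
      (b := i (\sum_a q (inl a, inr tt) *: w a + \sum_b q (inr tt, inl b) *: s (w b))
          + (q (inr tt, inr tt))%:A * x).
      rewrite rmorphB /= addrAC; apply/eqP; rewrite subr_eq0; apply/eqP.
      rewrite h !sumf /= !big_bool /= !linearD /= !linearZ /= !rmorphM.
      rewrite !(os_comm st) !mulrDl -!scalerAl mul1r !scalerDr.
      addac.
    move/eqP: rE; rewrite subr_eq0 => /eqP <-; apply: (subspaceD sD).
      apply: subspace_sum => // a' _; apply: subspace_sum => // b' _.
      apply: (subspaceZ _ sD); exact: (spanned_gen (fun p : bool * bool => w p.1 * w p.2) (a', b')).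
    by apply: subspace_sum => // b' _; apply: (subspaceZ _ sD).
  have [_ _ dim2 _] := tower_dim twR; rewrite c1 /= in dim2.
  have [B [iB GB spB]] := dim_basis dim2.
  pose m3 (k : 'I_3) := nth 0 [:: u * u; u * v; v * v] k.
  have span3 j : spanned m3 (B j).
    have s3 := subspace_spanned m3; apply: (spanned_sub s3 _ (D2 _ (GB j))).
    have S00 := spanned_gen m3 ord0; have S01 := spanned_gen m3 (Ordinal (isT : 1 < 3)%N).
    have S11 := spanned_gen m3 (Ordinal (isT : 2 < 3)%N).
    case=> [[] []] //=.
    move: gZ; rewrite !big_bool /= => gZ.
    suff : spanned m3 (g true false *: (v * u)).
      by move/(subspaceZ (g true false)^-1 s3); rewrite scalerA mulVf // scale1r.
    have -> : g true false *: (v * u) = - (g true true *: (v * v)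
       + (g false true *: (u * v) + g false false *: (u * u))).
      apply/eqP; rewrite -addr_eq0; apply/eqP; rewrite -[RHS]gZ; addac.
    by apply: (subspaceN s3); do !apply: (subspaceD s3); apply: (subspaceZ _ s3).
  have := steinitz iB span3; rewrite !card_ord; move: c2.
  by case: (count_mem 2 ds).
have xV b b' : c (inr tt) (inl b) (inl b') = 0 := g0 b b'.
have Vx b z : c (inl b) (inr tt) z = 0.
  case: z => [b'|[]]; last by case: (Q2 (inl b)).
  have [_ + _] := Q1 (inl b'); rewrite [X in _ + X]big1 ?addr0.
    by move=> h; apply: (sw (fun b => c (inl b) (inr tt) (inl b'))).
  by move=> a _; rewrite xV scale0r.
have VVx b b' : c (inl b) (inl b') (inr tt) = 0.
  have [_ + _] := Q2 (inl b); rewrite [X in _ + X]big1 ?addr0.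
    by move=> h; apply: (sw (fun b' => c (inl b) (inl b') (inr tt))).
  by move=> a _; rewrite Vx scale0r.
pose t a b k := c (inl a) (inl b) (inl k).
have t1 k : \sum_a \sum_b t a b k *: (w a * w b) = 0.
  have [+ _ _] := Q1 (inl k); rewrite [X in _ + X]big1 ?addr0 //.
  by move=> b _; rewrite xV scale0r.
have t2 a : \sum_b \sum_k t a b k *: (w b * w k) = 0.
  have [+ _ _] := Q2 (inl a); rewrite [X in _ + X]big1 ?addr0 //.
  by move=> b _; rewrite Vx scale0r.
have t0 a b k : t a b k = 0.
  suff al0 a' : t a' true false = 0 by apply: (Z0 (t a)).
  apply: NNPP => /eqP nz.
  (* the slices of t in both directions are multiples of one relation *)
  have prop k' a1 b1 : t a1 b1 k' = t true false k' / t a' true false * t a' a1 b1.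
    apply/eqP; rewrite -subr_eq0; apply/eqP.
    apply: (Z0 (fun a b => t a b k' - t true false k' / t a' true false * t a' a b)).
      under eq_bigr => a2 _ do under eq_bigr => b2 _ do
        rewrite scalerBl -scalerA.
      under eq_bigr => a2 _ do rewrite sumrB -scaler_sumr.
      by rewrite sumrB -scaler_sumr t1 t2 scaler0 subr0.
    by rewrite divfK ?subrr.
  have [|p0|q0] := rank (fun b1 => t a' a' b1) (fun k1 => t true false k1 / t a' true false).
  - rewrite -[RHS](t2 a'); apply: eq_bigr => b1 _; apply: eq_bigr => k1 _.
    by congr (_ *: _); rewrite [RHS]prop mulrC.
  - by have := prop false a' true; rewrite p0 mulr0 => /eqP; rewrite (negPf nz).
  - by have := prop false a' true; rewrite q0 mul0r => /eqP; rewrite (negPf nz).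
case=> [a|[]] [b|[]] [k|[]]; [exact: t0|exact: VVx|exact: Vx|exact: Vx|exact: xV|
  exact: xb|exact: xx|exact: xx].
Qed.

(** * Graded free resolutions given by one matrix *)

Section Homogeneous.
Variables (K : fieldType) (A : algType K) (G : nat -> A -> Prop).
Hypothesis gr : graded G.
Variables (N : nat) (h g : 'I_N -> nat).

(** Rows, columns and matrices over the free module on 'I_N, whose s-th basis
vector has homological degree h s and internal degree g s.  Columns are graded
dually, relative to the internal degree l of the top basis vector; hmx a b
stands for the homological degree b - a. *)
Definition hrow (D k : nat) (v : 'rV[A]_N) : Prop :=
  forall t, GD G D (g t) (v 0 t) /\ (h t <> k -> v 0 t = 0).

Definition hcol (l m k : nat) (u : 'cV[A]_N) : Prop :=
  forall t, GD G (g t + m) l (u t 0) /\ (h t <> k -> u t 0 = 0).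

Definition hmx (a b m : nat) (M : 'M[A]_N) : Prop :=
  forall s t, GD G (g s + m) (g t) (M s t) /\
    ((h t + a)%N <> (h s + b)%N -> M s t = 0).

Lemma hrow0 D k : hrow D k 0.
Proof. by move=> t; rewrite mxE; split=> // ; apply: GD0. Qed.

Lemma hrowD D k u v : hrow D k u -> hrow D k v -> hrow D k (u + v).
Proof.
move=> hu hv t; rewrite !mxE; have [h1 h2] := hu t; have [h3 h4] := hv t.
split; first by apply: subspaceD => //; apply: subspaceGD.
by move=> ne; rewrite h2 // h4 // addr0.
Qed.

Lemma hrowN D k u : hrow D k u -> hrow D k (- u).
Proof.
move=> hu t; rewrite !mxE; have [h1 h2] := hu t.
split; first by apply: subspaceN => //; apply: subspaceGD.
by move=> ne; rewrite h2 // oppr0.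
Qed.

Lemma hmx_shift a b m M : hmx a.+1 b.+1 m M <-> hmx a b m M.
Proof. by split=> hM s t; have [h1 h2] := hM s t; split=> // ne; apply: h2; lia. Qed.

Lemma hmxD a b m M M' : hmx a b m M -> hmx a b m M' -> hmx a b m (M + M').
Proof.
move=> hu hv s t; rewrite !mxE; have [h1 h2] := hu s t; have [h3 h4] := hv s t.
split; first by apply: subspaceD => //; apply: subspaceGD.
by move=> ne; rewrite h2 // h4 // addr0.
Qed.

Lemma hmxN a b m M : hmx a b m M -> hmx a b m (- M).
Proof.
move=> hu s t; rewrite !mxE; have [h1 h2] := hu s t.
split; first by apply: subspaceN => //; apply: subspaceGD.
by move=> ne; rewrite h2 // oppr0.
Qed.

Lemma hmx1 : hmx 0 0 0 1%:M.
Proof.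
move=> s t; rewrite mxE; case: eqP => [->|_]; last by split=> //; apply: GD0.
split; last by [].
by rewrite addn0 mulr1n -[1]scale1r; apply: GDnn.
Qed.

Lemma hmxM a b m a' b' m' M M' : hmx a b m M -> hmx a' b' m' M' ->
  hmx (a + a') (b + b') (m + m') (M *m M').
Proof.
move=> hM hM' s u; rewrite mxE; split.
  apply: subspace_sum => [|t _]; first exact: subspaceGD.
  have [h1 _] := hM s t; have [h2 _] := hM' t u.
  apply: (GDM gr (n := (g t + m')%N)) => //.
  by rewrite addnA; apply/GD_shift.
move=> ne; rewrite big1 // => t _; have [_ h1] := hM s t; have [_ h2] := hM' t u.
case: (eqVneq (h t + a)%N (h s + b)%N) => [e1|/eqP/h1->]; last by rewrite mul0r.
case: (eqVneq (h u + a')%N (h t + b')%N) => [e2|/eqP/h2->]; last by rewrite mulr0.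
lia.
Qed.

Lemma hrow_row a b m M s k : hmx a b m M -> (k + a = h s + b)%N ->
  hrow (g s + m) k (row s M).
Proof.
move=> hM ks t; rewrite mxE; have [h1 h2] := hM s t; split=> // ne.
by apply: h2; lia.
Qed.

Lemma hrowM D k a b m k' v M : hrow D k v -> hmx a b m M -> (k' + a = k + b)%N ->
  hrow (D + m) k' (v *m M).
Proof.
move=> hv hM kk u; rewrite mxE; split.
  apply: subspace_sum => [|t _]; first exact: subspaceGD.
  have [h1 _] := hv t; have [h2 _] := hM t u.
  by apply: (GDM gr (n := (g t + m)%N)) => //; apply/GD_shift.
move=> ne; rewrite big1 // => t _; have [_ h1] := hv t; have [_ h2] := hM t u.
case: (eqVneq (h t) k) => [e1|/eqP/h1->]; last by rewrite mul0r.
by rewrite h2 ?mulr0 //; lia.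
Qed.

Lemma hcolM l m k a b m' k' u M : hcol l m k u -> hmx a b m' M -> (k + a = k' + b)%N ->
  hcol l (m' + m) k' (M *m u).
Proof.
move=> hu hM kk s; rewrite mxE; split.
  apply: subspace_sum => [|t _]; first exact: subspaceGD.
  have [h1 _] := hu t; have [h2 _] := hM s t.
  apply: (GDM gr (n := (g t + m)%N)) => //.
  by rewrite addnA; apply/GD_shift.
move=> ne; rewrite big1 // => t _; have [_ h1] := hu t; have [_ h2] := hM s t.
case: (eqVneq (h t) k) => [e1|/eqP/h1->]; last by rewrite mulr0.
by rewrite h2 ?mul0r //; lia.
Qed.

Variables (n l : nat) (dd : 'M[A]_N) (bot top : 'I_N).

(** The free resolution of K of length n by left modules A^('I_N), acting on
rows, whose transpose, acting on columns, resolves K as a right module: the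
Gorenstein property. *)
Record resolution : Prop := Resolution {
  re_dd : hmx 1 0 0 dd;
  re_sq : dd *m dd = 0;
  re_bot : forall s, (h s == 0%N) = (s == bot);
  re_top : forall s, (h s == n) = (s == top);
  re_hn : forall s, (h s <= n)%N;
  re_hg : forall s, (h s <= g s)%N;
  re_gbot : g bot = 0%N;
  re_gtop : g top = l;
  re_glt : forall s, s != top -> (g s < l)%N;
  re_left : forall D k v, hrow D k v -> (0 < D)%N || (0 < k)%N -> v *m dd = 0 ->
    exists2 w : 'rV[A]_N, hrow D k.+1 w & v = w *m dd;
  re_right : forall m k u, hcol l m k u -> (k < n)%N || (0 < m)%N -> dd *m u = 0 ->
    exists2 w : 'cV[A]_N, (forall t, GD G (g t + m) l (w t 0) /\
                          ((h t).+1 <> k -> w t 0 = 0)) & u = dd *m w }.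

Hypothesis re : resolution.

Lemma re_gpos s : s != bot -> (0 < g s)%N.
Proof. by rewrite -(re_bot re) => hs; apply: leq_trans (re_hg re s); rewrite lt0n. Qed.

Lemma re_gle s : (g s <= l)%N.
Proof.
have [->|/(re_glt re)/ltnW//] := eqVneq s top; by rewrite (re_gtop re).
Qed.

Lemma row_mulmx_eq (E M M' : 'M[A]_N) s :
  (forall t, E s t <> 0 -> row t M = row t M') -> row s (E *m M) = row s (E *m M').
Proof.
move=> eqM; apply/rowP => u; rewrite !mxE; apply: eq_bigr => t _.
case: (eqVneq (E s t) 0) => [->|/eqP/eqM/rowP/(_ u)]; first by rewrite !mul0r.
by rewrite !mxE => ->.
Qed.

(** Rows over the basis vectors of growing homological degree are lifted along
the resolution; this produces chain maps and homotopies alike. *)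
Lemma resolution_lift (E C : 'M[A]_N) (m j : nat) (y0 : 'rV[A]_N) :
  hmx 1 0 0 E -> E *m E = 0 -> hmx 1 j m C -> C *m dd + E *m C = 0 ->
  hrow m j y0 -> y0 *m dd = row bot C ->
  exists Y, [/\ hmx 0 j m Y, Y *m dd = C + E *m Y & row bot Y = y0].
Proof.
move=> hE EE hC CE hy0 y0C.
have Ebot Y : row bot (E *m Y) = 0.
  apply/rowP => u; rewrite !mxE big1 // => t _; have [_ ->] := hE bot t.
    by rewrite mul0r.
  have /eqP -> : h bot == 0%N by rewrite (re_bot re).
  by rewrite addn1.
suff /(_ n)[Y [hY eqY rY]] : forall k, exists Y, [/\ hmx 0 j m Y,
    forall s, (h s <= k)%N -> row s (Y *m dd) = row s (C + E *m Y) & row bot Y = y0].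
  exists Y; split=> //; apply/row_matrixP => s; apply: eqY; exact: (re_hn re).
elim=> [|k [Y [hY eqY rY]]].
  exists (\matrix_(s, t) if s == bot then y0 0 t else 0); split.
  - move=> s t; rewrite mxE; have [->|_] := eqVneq s bot; last by split=> //; apply: GD0.
    have [h1 h2] := hy0 t; rewrite (re_gbot re); split=> // ne; apply: h2.
    have /eqP h0 : h bot == 0%N by rewrite (re_bot re).
    lia.
  - move=> s; rewrite leqn0 (re_bot re) => /eqP ->.
    rewrite linearD /= Ebot addr0 -y0C row_mul; congr (_ *m _).
    by apply/rowP => t; rewrite !mxE eqxx.
  by apply/rowP => t; rewrite !mxE eqxx.
have ex s : exists w, h s = k.+1 -> hrow (g s + m) (h s + j) w /\
    w *m dd = row s (C + E *m Y).
  case: (eqVneq (h s) k.+1) => [hs|/eqP ne]; last by exists 0.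
  have hr : hrow (g s + m) (k + j) (row s (C + E *m Y)).
    apply: (@hrow_row 1 j m); last by rewrite hs; lia.
    apply: hmxD => //; have := hmxM hE hY.
    by rewrite addn0 add0n add0n.
  have gs : (0 < g s + m)%N || (0 < k + j)%N.
    by rewrite addn_gt0 re_gpos // -(re_bot re) hs.
  have [|w hw wE] := re_left re hr gs; last by exists w => _; rewrite hs addSn.
  rewrite -row_mul mulmxDl -mulmxA linearD /=.
  have -> : row s (E *m (Y *m dd)) = row s (E *m (C + E *m Y)).
    apply: row_mulmx_eq => t nz; apply: eqY.
    have [_ z] := hE s t; case: (eqVneq (h t + 1)%N (h s + 0)%N) => [|/eqP/z//]; lia.
  by rewrite mulmxDr mulmxA EE mul0mx addr0 -linearD CE linear0.
have [W hW] := fchoice ex.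
pose Y' := \matrix_(s, t) if h s == k.+1 then W s 0 t else Y s t.
have rY' s : row s Y' = if h s == k.+1 then W s else row s Y.
  by apply/rowP => t; rewrite !mxE; case: eqP => //; rewrite mxE.
exists Y'; split.
- move=> s t; rewrite mxE; case: eqP => // hs; have [/(_ t)[h1 h2] _] := hW s hs.
  by split=> // ne; apply: h2; lia.
- move=> s; rewrite leq_eqVlt => /orP[/eqP hs|ltk]; last first.
    have ns : (h s == k.+1) = false by lia.
    rewrite row_mul rY' ns -row_mul eqY // !linearD /=; congr (_ + _).
    apply: row_mulmx_eq => t nz; rewrite rY'; case: eqP => // ht.
    by have [_ z] := hE s t; case: nz; apply: z; lia.
  rewrite row_mul rY' hs eqxx; have [_ ->] := hW s hs; rewrite !linearD /=; congr (_ + _).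
  apply: row_mulmx_eq => t nz; rewrite rY'; case: eqP => // ht.
  by have [_ z] := hE s t; case: nz; apply: z; lia.
rewrite rY' -rY; case: eqP => // h0.
have /eqP : h bot == 0%N by rewrite (re_bot re).
by rewrite h0.
Qed.

End Homogeneous.

(** * The resolution of an Ore extension *)

Lemma mulmx_scal (R : nzRingType) (N : nat) (u : 'cV[R]_N) q :
  map_mx (fun a => a * q) u = u *m q%:M.
Proof. by apply/colP => t; rewrite !mxE big_ord1 !mxE eqxx mulr1n. Qed.

Lemma scalar_mx0 (R : nzRingType) (n : nat) : 0%:M = 0 :> 'M[R]_n.
Proof. exact: raddf0. Qed.

Section Cone.
Variables (K : fieldType) (R A : algType K) (iota : {lrmorphism R -> A}).
Variables (sigma : {lrmorphism R -> R}) (delta : {linear R -> R}) (x : A) (e : nat).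
Variables (G : nat -> R -> Prop) (G' : nat -> A -> Prop).
Hypothesis st : ore_step iota sigma delta x e G G'.
Variables (N : nat) (h g : 'I_N -> nat) (n l : nat) (dd : 'M[R]_N) (bot top : 'I_N).
Hypothesis re : resolution G h g n l dd bot top.

Let gr := os_gr st.
Let gr' := os_gr' st.

Lemma sigma_hmx a b m M : hmx G h g a b m M -> hmx G h g a b m (map_mx sigma M).
Proof.
move=> hM s t; rewrite mxE; have [h1 h2] := hM s t; split.
  by move: h1; rewrite /GD; case: leqP => _ => [/(os_sig st)//|->]; rewrite rmorph0.
by move/h2->; rewrite rmorph0.
Qed.

Lemma sigma_lift a b m M : hmx G h g a b m M ->
  exists2 M', hmx G h g a b m M' & map_mx sigma M' = M.
Proof.
move=> hM; have ex s t : exists r, GD G (g s + m) (g t) r /\ sigma r = M s t.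
  have [h1 _] := hM s t; move: h1; rewrite /GD; case: leqP => _.
    by case/(os_sig_onto st) => r; exists r.
  by move=> ->; exists 0; rewrite rmorph0.
have [F hF] := fchoice (fun s => fchoice (ex s)).
exists (\matrix_(s, t) F s t); last by apply/matrixP => s t; rewrite !mxE; case: (hF s t).
move=> s t; rewrite mxE; have [h1 h2] := hF s t; split=> // ne.
by have [_ h3] := hM s t; apply: (os_inj st); rewrite h2 h3 // rmorph0.
Qed.

Lemma map_inj_mx p q (M M' : 'M[R]_(p, q)) : map_mx sigma M = map_mx sigma M' -> M = M'.
Proof.
move/matrixP=> eM; apply/matrixP => i j; apply: (os_inj st).
by have := eM i j; rewrite !mxE.
Qed.

(** The chain map covering the action of sigma is homotopic to an isomorphism,
so that it does not vanish on the top basis vector. *)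
Lemma cone_chain_maps : exists (dd' S T : 'M[R]_N) (c : K),
  [/\ map_mx sigma dd' = dd,
      hmx G h g 0 0 0 S /\ hmx G h g 0 0 e T,
      S *m dd = dd' *m S,
      dd *m T - T *m dd = map_mx delta dd' *m S
    & [/\ row bot S = delta_mx 0 bot, row bot T = 0, S top top = c%:A & c != 0]].
Proof.
have [dd' hdd' sdd'] := sigma_lift (re_dd re).
have dd2' : dd' *m dd' = 0.
  by apply: map_inj_mx; rewrite map_mxM sdd' (re_sq re) map_mx0.
have dbot (M : 'M[R]_N) : hmx G h g 1 0 0 M -> row bot M = 0.
  move=> hM; apply/rowP => t; rewrite !mxE; have [_ -> //] := hM bot t.
  have /eqP -> : h bot == 0%N by rewrite (re_bot re).
  by rewrite addn1.
pose eb : 'rV[R]_N := delta_mx 0 bot.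
have ebM (M : 'M[R]_N) : eb *m M = row bot M by rewrite rowE.
have heb : hrow G h g 0 0 eb.
  move=> t; rewrite mxE eqxx /=; case: eqP => [->|_]; last by split=> //; apply: GD0.
  rewrite (re_gbot re); split; first by rewrite -[_%:R]scale1r; apply: (GDnn gr 0).
  by have /eqP -> : h bot == 0%N by rewrite (re_bot re).
have hmx0 a b m : hmx G h g a b m 0 by move=> s t; rewrite mxE; split=> //; apply: GD0.
have lift0 (E : 'M[R]_N) : hmx G h g 1 0 0 E -> E *m E = 0 ->
    exists Y, [/\ hmx G h g 0 0 0 Y, Y *m dd = E *m Y & row bot Y = eb].
  move=> hE EE; have [||Y [hY YE rY]] := resolution_lift gr re (E := E) (C := 0)
     (m := 0%N) (j := 0%N) (y0 := eb) hE EE (hmx0 _ _ _) _ heb.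
  - by rewrite mul0mx mulmx0 addr0.
  - by rewrite ebM linear0 (dbot _ (re_dd re)).
  by exists Y; split; rewrite // YE add0r.
have [S [hS Sdd rS]] := lift0 dd' hdd' dd2'.
have [S2 [hS2 S2dd rS2]] : exists Y, [/\ hmx G h g 0 0 0 Y,
    Y *m dd = map_mx sigma dd *m Y & row bot Y = eb].
  apply: lift0; first exact: (sigma_hmx (re_dd re)).
  by rewrite -map_mxM (re_sq re) map_mx0.
have [S' hS' sS'] := sigma_lift hS2.
have S'dd : dd *m S' = S' *m dd'.
  by apply: map_inj_mx; rewrite !map_mxM sS' sdd' S2dd.
have rS' : row bot S' = eb.
  apply/rowP => t; apply: (os_inj st); have /rowP/(_ t) := rS2; rewrite -sS' !mxE => ->.
  by rewrite rmorph_nat.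
(* S' covers the inverse of sigma, so that S' S is homotopic to the
   identity; on the top basis vector the homotopy vanishes for degree
   reasons *)
pose Z := S' *m S - 1%:M.
have hZ : hmx G h g 0 0 0 Z.
  apply: hmxD => //; first by have := hmxM gr hS' hS.
  by apply: hmxN => //; apply: hmx1.
have Zdd : Z *m dd = dd *m Z.
  by rewrite mulmxBl mulmxBr mul1mx mulmx1 -mulmxA Sdd !mulmxA S'dd.
have [|||||H [hH HE _]] := resolution_lift gr re (E := - dd) (C := Z)
    (m := 0%N) (j := 1%N) (y0 := 0) _ _ _ _ (hrow0 gr _ _ _ _).
- by apply: hmxN => //; apply: (re_dd re).
- by rewrite mulNmx mulmxN opprK (re_sq re).
- by apply/hmx_shift.
- by rewrite mulNmx Zdd subrr.
- by rewrite mul0mx linearB /= row_mul rS' -rowE rS row1 subrr.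
have glt t : t != top -> (g t < g top)%N by rewrite (re_gtop re); apply: (re_glt re).
have htop : h top = n by apply/eqP; rewrite (re_top re).
have SS : S' top top * S top top = 1.
  have /matrixP/(_ top top) := HE; rewrite !mxE.
  rewrite big1 => [|s _]; last first.
    have [_ h1] := hH top s; rewrite h1 ?mul0r //; have := re_hn re s; lia.
  rewrite [X in _ + X]big1 ?addr0; last first.
    move=> s _; rewrite mxE; have [h1 _] := hH s top; have [_ h2] := re_dd re top s.
    have [stop|ns] := eqVneq s top; first by rewrite h2 ?oppr0 ?mul0r // stop; lia.
    by rewrite (GD_lt _ h1) ?mulr0 // addn0 glt.
  rewrite eqxx (bigD1 top) //= big1 ?addr0 => [|s ns]; last first.
    have [_ h1] := hS' top s; rewrite h1 ?mul0r //.
    by rewrite !addn0 htop => /eqP; rewrite (re_top re) (negPf ns).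
  by move/esym/eqP; rewrite subr_eq0 => /eqP.
have [c Sc] : exists c : K, S top top = c%:A.
  by apply: (GDnnP gr (m := g top)); have [] := hS top top; rewrite addn0.
have nzc : c != 0.
  by apply/eqP => c0; move: SS; rewrite Sc c0 scale0r mulr0 => /esym/eqP; rewrite oner_eq0.
have hdel : hmx G h g 1 0 e (map_mx delta dd').
  move=> s t; rewrite mxE; have [h1 h2] := hdd' s t; split; last by move/h2->; rewrite linear0.
  move: h1; rewrite addn0 /GD; case: leqP => [le /(os_del st)|_ ->].
    by rewrite (leq_trans le) ?leq_addr // addnC addnBAC.
  by rewrite linear0; case: leqP => // _; apply: gr0.
have hdelS : hmx G h g 1 0 e (map_mx delta dd' *m S).
  by have := hmxM gr hdel hS; rewrite !addn0.
(* apply delta to dd' *m dd' = 0 *)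
have delsq : dd *m map_mx delta dd' + map_mx delta dd' *m dd' = 0.
  apply/matrixP => s t; rewrite -sdd' !mxE -big_split /=.
  have /matrixP/(_ s t) := dd2'; rewrite !mxE => /(congr1 delta).
  rewrite linear0 linear_sum /= => hz; rewrite -[RHS]hz; apply: eq_bigr => j _.
  by rewrite !mxE (os_skew st).
have [|||T [hT TE rT]] := resolution_lift gr re (E := dd)
    (C := - (map_mx delta dd' *m S)) (m := e) (j := 0%N) (y0 := 0)
    (re_dd re) (re_sq re) _ _ (hrow0 gr _ _ _ _).
- exact: hmxN.
- by rewrite mulNmx mulmxN -opprD -mulmxA Sdd !mulmxA -mulmxDl addrC delsq mul0mx oppr0.
- rewrite mul0mx linearN /= row_mul; suff -> : row bot (map_mx delta dd') = 0.
    by rewrite mul0mx oppr0.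
  apply/rowP => t; have /rowP/(_ t) := dbot _ hdd'; rewrite !mxE => ->.
  by rewrite linear0.
exists dd', S, T, c; split=> //.
by rewrite TE opprD opprK addrCA subrr addr0.
Qed.

Lemma GD_split m k b : (k <= m)%N -> GD G' (m - k) e b -> GD G' m (k + e) b.
Proof.
move=> le; rewrite -{2}(subnK le) [(k + e)%N]addnC; case: (GD_shift G' k (m - k) e b).
by [].
Qed.

Lemma splitl m k a : GD G' m k a ->
  exists r b, [/\ GD G m k r, GD G' m (k + e) b & a = iota r + b * x].
Proof.
rewrite {1}/GD; case: leqP => [le /(os_decl st)[r [b [hr hb ->]]]|lt ->].
  by exists r, b; split=> //; [rewrite /GD le | apply: GD_split].
by exists 0, 0; rewrite mul0r rmorph0 addr0; split=> //; apply: GD0.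
Qed.

Lemma splitr m k a : GD G' m k a ->
  exists r b, [/\ GD G m k r, GD G' m (k + e) b & a = iota r + x * b].
Proof.
rewrite {1}/GD; case: leqP => [le /(os_decr st)[r [b [hr hb ->]]]|lt ->].
  by exists r, b; split=> //; [rewrite /GD le | apply: GD_split].
by exists 0, 0; rewrite mulr0 rmorph0 addr0; split=> //; apply: GD0.
Qed.

Local Notation D := (map_mx iota dd).

Lemma mx_uniqr p q (M0 M0' : 'M[R]_(p, q)) (M1 M1' : 'M[A]_(p, q)) :
  map_mx iota M0 + x *: M1 = map_mx iota M0' + x *: M1' -> M0 = M0' /\ M1 = M1'.
Proof.
move/matrixP=> eM; split; apply/matrixP => i j; have := eM i j; rewrite !mxE;
by case/(step_uniqr st).
Qed.

Lemma mx_uniql p q (M0 M0' : 'M[R]_(p, q)) (M1 M1' : 'M[A]_(p, q)) :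
  map_mx iota M0 + map_mx (fun a => a * x) M1 =
  map_mx iota M0' + map_mx (fun a => a * x) M1' -> M0 = M0' /\ M1 = M1'.
Proof.
move/matrixP=> eM; split; apply/matrixP => i j; have := eM i j; rewrite !mxE;
by case/(step_uniql st).
Qed.

Lemma hrow_split d k (v : 'rV[A]_N) : hrow G' h g d k v ->
  exists (v0 : 'rV[R]_N) (v1 : 'rV[A]_N), [/\ hrow G h g d k v0,
    if (e <= d)%N then hrow G' h g (d - e) k v1 else v1 = 0
    & v = map_mx iota v0 + x *: v1].
Proof.
move=> hv; have ex t : exists rb : R * A, [/\ GD G d (g t) rb.1,
    GD G' d (g t + e) rb.2 & v 0 t = iota rb.1 + x * rb.2].
  have [h1 _] := hv t; have [r [b [hr hb vE]]] := splitr h1.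
  by exists (r, b).
have [F hF] := fchoice ex.
have z t : h t <> k -> F t = (0, 0).
  have [_ h2] := hv t; have [_ _ vE] := hF t; move/h2; rewrite vE.
  by case/(os_uniqr st); case: (F t) => r b /= -> ->.
exists (\row_t (F t).1), (\row_t (F t).2); split.
- by move=> t; rewrite mxE; have [h1 _ _] := hF t; split=> // /z ->.
- case: leqP => [le t|lt]; last first.
    apply/rowP => t; rewrite !mxE; have [_ h2 _] := hF t.
    by apply: (GD_lt _ h2); lia.
  rewrite mxE; have [_ h2 _] := hF t; split; last by move/z ->.
  by apply/(GD_shift G' e); rewrite subnK.
by apply/rowP => t; rewrite !mxE; case: (hF t).
Qed.

Lemma hcol_split m k (u : 'cV[A]_N) : hcol G' h g l m k u ->
  exists (u0 : 'cV[R]_N) (u1 : 'cV[A]_N), [/\ hcol G h g l m k u0,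
    if (e <= m)%N then hcol G' h g l (m - e) k u1 else u1 = 0
    & u = map_mx iota u0 + map_mx (fun a => a * x) u1].
Proof.
move=> hu; have ex t : exists rb : R * A, [/\ GD G (g t + m) l rb.1,
    GD G' (g t + m) (l + e) rb.2 & u t 0 = iota rb.1 + rb.2 * x].
  have [h1 _] := hu t; have [r [b [hr hb vE]]] := splitl h1.
  by exists (r, b).
have [F hF] := fchoice ex.
have z t : h t <> k -> F t = (0, 0).
  have [_ h2] := hu t; have [_ _ vE] := hF t; move/h2; rewrite vE.
  by case/(os_uniql st); case: (F t) => r b /= -> ->.
exists (\col_t (F t).1), (\col_t (F t).2); split.
- by move=> t; rewrite mxE; have [h1 _ _] := hF t; split=> // /z ->.
- case: leqP => [le t|lt]; last first.
    apply/colP => t; rewrite !mxE; have [_ h2 _] := hF t.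
    by apply: (GD_lt _ h2); have := re_gle re t; lia.
  rewrite mxE; have [_ h2 _] := hF t; split; last by move/z ->.
  by apply/(GD_shift G' e); rewrite -addnA subnK.
by apply/colP => t; rewrite !mxE; case: (hF t).
Qed.

Lemma GDiota m k r : GD G m k r -> GD G' m k (iota r).
Proof.
rewrite /GD; case: leqP => _; first exact: (os_iota st).
by move=> ->; rewrite rmorph0.
Qed.

Lemma GDxl m k b : GD G' m k b -> GD G' (m + e) k (x * b).
Proof.
move=> hb; apply: (GDM gr' (n := m)) => //.
by rewrite addnC /GD leq_addl addnK; apply: (os_x st).
Qed.

Lemma GDxr m k b : GD G' m k b -> GD G' (m + e) k (b * x).
Proof.
move=> hb; apply: (GDM gr' (n := (k + e)%N)); first exact/GD_shift.
by rewrite addnC /GD leq_addl addnK; apply: (os_x st).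
Qed.

Lemma GDexpx j : G' (j * e)%N (x ^+ j).
Proof.
elim: j => [|j IH]; first exact: gr1.
by rewrite exprS mulSn; apply: (gr_mul gr') => //; apply: (os_x st).
Qed.

Lemma hrow_iota d k v : hrow G h g d k v -> hrow G' h g d k (map_mx iota v).
Proof.
move=> hv t; rewrite mxE; have [h1 h2] := hv t.
by split; [apply: GDiota | move/h2 ->; rewrite rmorph0].
Qed.

Lemma hrow_x d k v : hrow G' h g d k v -> hrow G' h g (d + e) k (x *: v).
Proof.
move=> hv t; rewrite mxE; have [h1 h2] := hv t.
by split; [apply: GDxl | move/h2 ->; rewrite mulr0].
Qed.

Let eb : 'rV[A]_N := delta_mx 0 bot.
Let et : 'cV[A]_N := delta_mx top 0.

Lemma left_mulD (v0 : 'rV[R]_N) (v1 : 'rV[A]_N) :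
  (map_mx iota v0 + x *: v1) *m D = map_mx iota (v0 *m dd) + x *: (v1 *m D).
Proof. by rewrite mulmxDl -map_mxM -scalemxAl. Qed.

Lemma right_mulD (u0 : 'cV[R]_N) (u1 : 'cV[A]_N) :
  D *m (map_mx iota u0 + map_mx (fun a => a * x) u1) =
  map_mx iota (dd *m u0) + map_mx (fun a => a * x) (D *m u1).
Proof.
rewrite mulmxDr -map_mxM; congr (_ + _); apply/colP => i; rewrite !mxE mulr_suml.
by apply: eq_bigr => j _; rewrite !mxE mulrA.
Qed.

(** Over A = \bigoplus x^i R the left homology becomes K[x]. *)
Lemma base_left d k (v : 'rV[A]_N) : hrow G' h g d k v -> v *m D = 0 ->
  exists (w : 'rV[A]_N) (c : K) j, [/\ hrow G' h g d k.+1 w,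
    v = w *m D + (c *: x ^+ j) *: eb & c != 0 -> k = 0%N /\ (j * e)%N = d].
Proof.
have [m] := ubnP d; elim: m d v => // m IH d v ltd hv vD; have e0 := os_e st.
have [v0 [v1 [hv0 hv1 vE]]] := hrow_split hv.
have [v0D v1D] : v0 *m dd = 0 /\ v1 *m D = 0.
  by apply: mx_uniqr; rewrite -left_mulD -vE vD map_mx0 scaler0 addr0.
have [w1 [c [j [hw1 v1E hc]]]] : exists (w : 'rV[A]_N) (c : K) j,
    [/\ if (e <= d)%N then hrow G' h g (d - e) k.+1 w else w = 0,
    v1 = w *m D + (c *: x ^+ j) *: eb & c != 0 -> k = 0%N /\ (j.+1 * e)%N = d].
  case: leqP hv1 => [le hv1|lt ->].
    have [|w [c [j [hw v1E hc]]]] := IH (d - e)%N v1 _ hv1 v1D; first by lia.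
    by exists w, c, j; split=> // /hc[-> jd]; split=> //; rewrite mulSn jd subnKC.
  by exists 0, 0, 0%N; rewrite mul0mx !scale0r addr0 eqxx.
have [pos|] := boolP ((0 < d)%N || (0 < k)%N).
  have [w0 hw0 v0E] := re_left re hv0 pos v0D.
  exists (map_mx iota w0 + x *: w1), c, j.+1; split=> //.
    apply: hrowD => //; first exact: hrow_iota.
    case: leqP hw1 => [le /hrow_x|_ ->]; first by rewrite subnK.
    by rewrite scaler0; apply: hrow0.
  by rewrite vE left_mulD -v0E v1E scalerDr addrA scalerA -scalerAr -exprS.
rewrite negb_or -!eqn0Ngt => /andP[/eqP d0 /eqP k0]; subst d k.
have v10 : v1 = 0 by move: hv1; rewrite leqn0 gtn_eqF.
have [a va] : exists a : K, v0 0 bot = a%:A.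
  by apply: (GDnnP gr (m := 0%N)); have [] := hv0 bot; rewrite (re_gbot re).
exists 0, a, 0%N; split=> //; first exact: hrow0.
rewrite mul0mx add0r vE v10 scaler0 addr0; apply/rowP => t; rewrite !mxE eqxx /= expr0.
have [->|nt] := eqVneq t bot; first by rewrite va linearZ /= rmorph1 mulr1.
have [_ ->] := hv0 t; first by rewrite rmorph0 mulr0.
by move/eqP; rewrite (re_bot re) (negPf nt).
Qed.

(** Dually, over A = \bigoplus R x^i the right homology is K[x], carried by the
top basis vector. *)
Lemma base_right m k (u : 'cV[A]_N) : hcol G' h g l m k u -> D *m u = 0 ->
  exists (w : 'cV[A]_N) (c : K) j, [/\
    forall t, GD G' (g t + m) l (w t 0) /\ ((h t).+1 <> k -> w t 0 = 0),
    u = D *m w + map_mx (fun a => a * (c *: x ^+ j)) et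
    & c != 0 -> k = n /\ (j * e)%N = m].
Proof.
have [p] := ubnP m; elim: p m u => // p IH m u ltm hu uD; have e0 := os_e st.
have [u0 [u1 [hu0 hu1 uE]]] := hcol_split hu.
have [u0D u1D] : dd *m u0 = 0 /\ D *m u1 = 0.
  apply: mx_uniql; rewrite -right_mulD -uE uD map_mx0 add0r.
  by apply/colP => t; rewrite !mxE mul0r.
have [w1 [c [j [hw1 u1E hc]]]] : exists (w : 'cV[A]_N) (c : K) j,
    [/\ if (e <= m)%N then forall t, GD G' (g t + (m - e)) l (w t 0) /\
         ((h t).+1 <> k -> w t 0 = 0) else w = 0,
    u1 = D *m w + map_mx (fun a => a * (c *: x ^+ j)) et
    & c != 0 -> k = n /\ (j.+1 * e)%N = m].
  case: leqP hu1 => [le hu1|lt ->].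
    have [|w [c [j [hw u1E hc]]]] := IH (m - e)%N u1 _ hu1 u1D; first by lia.
    by exists w, c, j; split=> // /hc[-> jd]; split=> //; rewrite mulSn jd subnKC.
  exists 0, 0, 0%N; rewrite mulmx0 scale0r eqxx add0r; split=> //.
  by apply/colP => t; rewrite !mxE mulr0.
have [pos|] := boolP ((k < n)%N || (0 < m)%N).
  have [w0 hw0 u0E] := re_right re hu0 pos u0D.
  exists (map_mx iota w0 + map_mx (fun a => a * x) w1), c, j.+1; split=> //.
    move=> t; rewrite !mxE; have [h1 h2] := hw0 t; split.
      apply: (subspaceD (subspaceGD gr' _ _)); first exact: GDiota.
      case: leqP hw1 => [le /(_ t)[/GDxr]|_ ->]; first by rewrite -addnA subnK.
      by rewrite mxE mul0r; move=> *; apply: GD0.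
    move=> ne; rewrite h2 // rmorph0 add0r.
    by case: leqP hw1 => [_ /(_ t)[_ ->]|_ ->] //; rewrite ?mxE mul0r.
  rewrite uE right_mulD -u0E -addrA; congr (_ + _); rewrite u1E.
  apply/colP => t; rewrite !mxE mulrDl; congr (_ + _).
  by rewrite -!mulrA -scalerAl -exprSr.
rewrite negb_or -leqNgt -eqn0Ngt => /andP[kn /eqP m0]; subst m.
have u10 : u1 = 0 by move: hu1; rewrite leqn0 gtn_eqF.
have [a va] : exists a : K, u0 top 0 = a%:A.
  by apply: (GDnnP gr (m := l)); have [] := hu0 top; rewrite (re_gtop re) addn0.
have htop : h top = n by apply/eqP; rewrite (re_top re).
have z t : t != top -> u0 t 0 = 0.
  move=> nt; have [h1 _] := hu0 t; rewrite addn0 in h1.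
  by apply: (GD_lt _ h1); apply: (re_glt re).
have [kn'|kn'] := eqVneq k n; last first.
  have u00 : u0 = 0.
    apply/colP => t; rewrite mxE; have [->|/z//] := eqVneq t top.
    by have [_ ->] := hu0 top; rewrite // htop; apply/eqP; rewrite eq_sym.
  exists 0, 0, 0%N; split; last by rewrite eqxx.
    by move=> t; rewrite mxE; split=> //; apply: GD0.
  rewrite uE u10 u00; apply/colP => t; rewrite !mxE mul0r rmorph0 addr0.
  by rewrite scale0r mulr0 addr0 big1 // => s _; rewrite !mxE mulr0.
exists 0, a, 0%N; split=> //.
  by move=> t; rewrite mxE; split=> //; apply: GD0.
rewrite uE u10; apply/colP => t; rewrite !mxE mul0r addr0 expr0 eqxx andbT.
rewrite big1 => [|s _]; last by rewrite !mxE mulr0.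
rewrite add0r; have [->|/z->] := eqVneq t top; last by rewrite rmorph0 mul0r.
by rewrite va linearZ /= rmorph1 mul1r.
Qed.

(** The classes left over by [base_left] are not boundaries. *)
Lemma left_no_constant d j (c : K) (w : 'rV[A]_N) : hrow G' h g d 1 w ->
  (j * e)%N = d -> w *m D = (c *: x ^+ j) *: eb -> c = 0.
Proof.
elim: j d w => [|j IH] d w hw jd wD.
  have w0 : w = 0.
    apply/rowP => t; have [h1 h2] := hw t; rewrite mxE.
    have [ht|/eqP/h2//] := eqVneq (h t) 1%N.
    by apply: (GD_lt _ h1); rewrite -jd mul0n; have := re_hg re t; rewrite ht.
  move: wD; rewrite w0 mul0mx => /rowP/(_ bot); rewrite !mxE !eqxx mulr1 expr0.
  by move/esym/alg_inj0.
have [w0 [w1 [hw0 hw1 wE]]] := hrow_split hw; rewrite wE left_mulD in wD.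
have [_ w1D] : w0 *m dd = 0 /\ w1 *m D = (c *: x ^+ j) *: eb.
  by apply: mx_uniqr; rewrite wD map_mx0 add0r scalerA -scalerAr -exprS.
apply: (IH (d - e)%N w1) => //; last by rewrite -jd mulSn addKn.
by move: hw1; rewrite -jd mulSn leq_addr.
Qed.

(** The classes left over by [base_right] are not boundaries. *)
Lemma right_no_constant m j (c : K) (w : 'cV[A]_N) :
  (forall t, GD G' (g t + m) l (w t 0) /\ ((h t).+1 <> n -> w t 0 = 0)) ->
  (j * e)%N = m -> D *m w = map_mx (fun a => a * (c *: x ^+ j)) et -> c = 0.
Proof.
have htop : h top = n by apply/eqP; rewrite (re_top re).
elim: j m w => [|j IH] m w hw jm wD.
  have w0 : w = 0.
    apply/colP => t; have [h1 h2] := hw t; rewrite mxE.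
    have [tt|nt] := eqVneq t top; first by apply: h2; rewrite tt htop; lia.
    by apply: (GD_lt _ h1); rewrite -jm mul0n addn0; apply: (re_glt re).
  move: wD; rewrite w0 mulmx0 => /colP/(_ top); rewrite !mxE !eqxx mul1r expr0.
  by move/esym/alg_inj0.
pose k := n.-1.
have hw' : hcol G' h g l m k w.
  move=> t; have [h1 h2] := hw t; split=> // ne; have [n0|npos] := posnP n.
    by apply: h2; lia.
  by apply: h2; rewrite /k in ne; lia.
have [w0 [w1 [hw0 hw1 wE]]] := hcol_split hw'; rewrite wE right_mulD in wD.
have [_ w1D] : dd *m w0 = 0 /\ D *m w1 = map_mx (fun a => a * (c *: x ^+ j)) et.
  apply: mx_uniql; rewrite wD map_mx0 add0r; apply/colP => t; rewrite !mxE.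
  by rewrite -mulrA -scalerAl -exprSr.
apply: (IH (m - e)%N w1) => //; last by rewrite -jm mulSn addKn.
move=> t; move: hw1; rewrite -jm mulSn leq_addr => /(_ t)[h1 h2]; split=> // ne.
have [n0|npos] := posnP n; last by apply: h2; rewrite /k; lia.
have [_ z] := hw t; have := z ltac:(lia); rewrite wE !mxE => /(os_uniql st)[_ ->] //.
Qed.

Definition cone_deg (f : 'I_N -> nat) (k : nat) (i : 'I_(N + N)) : nat :=
  match split i with inl s => f s | inr s => (f s + k)%N end.

Lemma cone_degl f k s : cone_deg f k (lshift N s) = f s.
Proof. by rewrite /cone_deg; have /= -> := unsplitK (inl s : 'I_N + 'I_N). Qed.

Lemma cone_degr f k s : cone_deg f k (rshift N s) = (f s + k)%N.
Proof. by rewrite /cone_deg; have /= -> := unsplitK (inr s : 'I_N + 'I_N). Qed.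

Local Notation h' := (cone_deg h 1).
Local Notation g' := (cone_deg g e).

Let degE := (cone_degl, cone_degr).

(** The resolution of K over A is the cone of the lift X = x S + T of right
multiplication by x on A / A R_+. *)
Lemma cone_resolution : exists X : 'M[A]_N,
  resolution G' h' g' n.+1 (l + e) (block_mx D 0 X (- D)) (lshift N bot) (rshift N top).
Proof.
have e0 := os_e st.
have [dd' [S [T [s [sdd' [hS hT] Sdd Tdd [rS rT Stt nzs]]]]]] := cone_chain_maps.
pose X := x *: map_mx iota S + map_mx iota T; exists X.
(* X commutes with D, which is the square of the cone differential being 0 *)
have XD : X *m D = D *m X.
  have xdd : D *m (x *: map_mx iota S) =
      x *: map_mx iota (dd' *m S) - map_mx iota (map_mx delta dd' *m S).
    apply/matrixP => i j; rewrite !mxE !rmorph_sum mulr_sumr -sumrB.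
    apply: eq_bigr => k _; rewrite !mxE -sdd' mxE !rmorphM !mulrA (os_comm st).
    by rewrite mulrDl addrK.
  rewrite /X mulmxDl mulmxDr xdd -scalemxAl -!map_mxM Sdd -Tdd.
  by rewrite map_mxB opprB addrA subrK addrC -?addrA.
have hX : hmx G' h g 0 0 e X.
  move=> i j; rewrite !mxE; have [h1 h2] := hS i j; have [h3 h4] := hT i j; split.
    apply: (subspaceD (subspaceGD gr' _ _)); last exact: GDiota.
    by rewrite addn0 in h1; apply: GDxl; apply: GDiota.
  by move=> ne; rewrite h2 // h4 // rmorph0 mulr0 addr0.
have hD : hmx G' h g 1 0 0 D.
  move=> i j; rewrite mxE; have [h1 h2] := re_dd re i j.
  by split; [apply: GDiota | move/h2 ->; rewrite rmorph0].
have DD : D *m D = 0 by rewrite -map_mxM (re_sq re) map_mx0.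
have hbot : h bot = 0%N by apply/eqP; rewrite (re_bot re).
have htop : h top = n by apply/eqP; rewrite (re_top re).
have ebX a : (a *: eb) *m X = (a * x) *: eb.
  rewrite -scalemxAl /eb -rowE /X !linearD /=.
  have -> : row bot (x *: map_mx iota S) = x *: eb.
    apply/rowP => t; rewrite !mxE; have /rowP/(_ t) := rS; rewrite !mxE => ->.
    by rewrite rmorph_nat.
  have -> : row bot (map_mx iota T) = 0.
    by apply/rowP => t; rewrite !mxE; have /rowP/(_ t) := rT; rewrite !mxE => ->; rewrite rmorph0.
  by rewrite addr0 scalerA.
have ebD a : (a *: eb) *m D = 0.
  rewrite -scalemxAl /eb -rowE; apply/rowP => t; rewrite !mxE.
  by have [_ ->] := re_dd re bot t; rewrite ?hbot ?addn1 // rmorph0 mulr0.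
have Det : D *m et = 0.
  rewrite /et -colE; apply/colP => t; rewrite !mxE.
  have [_ ->] := re_dd re t top; rewrite ?rmorph0 // htop.
  by have := re_hn re t; lia.
(* the corner of X is s x + t0 with s a nonzero scalar *)
pose t0 := T top top.
have [wt hwt wtE] : exists2 w : 'cV[R]_N, (forall t, GD G (g t + e) l (w t 0) /\
    ((h t).+1 <> n -> w t 0 = 0)) & delta_mx top 0 *m t0%:M = dd *m w.
  apply: (re_right re); first 1 last.
  - by rewrite e0 orbT.
  - rewrite mulmxA -colE; have -> : col top dd = 0; last by rewrite mul0mx.
    apply/colP => t; rewrite !mxE; have [_ -> //] := re_dd re t top.
    by rewrite htop; have := re_hn re t; lia.
  move=> t; rewrite -mulmx_scal !mxE eqxx andbT; have [->|nt] := eqVneq t top.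
    rewrite mul1r; split; last by rewrite htop.
    by have [h1 _] := hT top top; rewrite -[X in GD _ _ X](re_gtop re).
  by rewrite mul0r; split=> //; apply: GD0.
have etX : X *m et = et *m (s *: x)%:M + map_mx iota (delta_mx top 0 *m t0%:M).
  rewrite /et -colE; apply/colP => t; rewrite -!mulmx_scal !mxE eqxx andbT.
  have [->|nt] := eqVneq t top.
    by rewrite !mul1r Stt linearZ /= rmorph1 -scalerAr mulr1.
  have ht : (h top + 0)%N <> (h t + 0)%N.
    by rewrite !addn0 htop => /esym/eqP; rewrite (re_top re) (negPf nt).
  have [_ ->] := hS t top; rewrite //; have [_ ->] := hT t top; rewrite //.
  by rewrite !mul0r rmorph0 mulr0.
rewrite wtE map_mxM in etX.
have iwt k q m : G' k q -> (e + k)%N = m -> forall t,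
    GD G' (g t + m) l ((map_mx iota wt *m q%:M) t 0) /\
    ((h t).+1 <> n -> (map_mx iota wt *m q%:M) t 0 = 0).
  move=> hq <- t; rewrite -mulmx_scal !mxE; have [h1 h2] := hwt t; split.
    apply: (GDM gr' (n := (l + k)%N)); first by rewrite addnA; apply/GD_shift; apply: GDiota.
    by rewrite /GD leq_addr addKn.
  by move/h2->; rewrite rmorph0 mul0r.
split.
- move=> i j; case: (split_ordP i) => p ->; case: (split_ordP j) => q ->; rewrite !degE.
  + rewrite block_mxEul; exact: hD.
  + by rewrite block_mxEur mxE; split=> //; apply: GD0.
  + rewrite block_mxEdl; have [h1 h2] := hX p q; rewrite addn0; split=> // ne.
    by apply: h2; lia.
  rewrite block_mxEdr mxE; have [h1 h2] := hD p q; split; last by move=> ne; rewrite h2 ?oppr0 //; lia.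
  rewrite addnAC; apply/GD_shift; apply: subspaceN => //; exact: subspaceGD.
- rewrite mulmx_block !mulmx0 !mul0mx !mulmxN !mulNmx !opprK DD XD subrr.
  by rewrite !(oppr0, addr0, add0r) block_mx0.
- move=> i; case: (split_ordP i) => p ->; rewrite !degE; first by rewrite eq_lshift (re_bot re).
  by rewrite eq_rlshift addn1.
- move=> i; case: (split_ordP i) => p ->; rewrite !degE.
    by rewrite eq_lrshift; apply/negbTE; have := re_hn re p; lia.
  by rewrite addn1 eqSS eq_rshift (re_top re).
- by move=> i; case: (split_ordP i) => p ->; rewrite !degE; have := re_hn re p; lia.
- by move=> i; case: (split_ordP i) => p ->; rewrite !degE; have := re_hg re p; lia.
- by rewrite degE (re_gbot re).
- by rewrite degE (re_gtop re).
- move=> i; case: (split_ordP i) => p ->; rewrite !degE; first by have := re_gle re p; lia.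
  by rewrite eq_rshift => /(re_glt re); lia.
- move=> d k v hv pos; rewrite -[v]hsubmxK mul_row_block mulmx0 add0r.
  set v0 := lsubmx v; set v1 := rsubmx v.
  rewrite -[0]hsubmxK => /eq_row_mx[]; rewrite !linear0 => v01 /eqP.
  rewrite mulmxN oppr_eq0 => /eqP v1D.
  have hv0 : hrow G' h g d k v0.
    by move=> t; rewrite mxE; have := hv (lshift N t); rewrite !degE.
  have hv1 t : GD G' d (g t + e) (v1 0 t) /\ ((h t).+1 <> k -> v1 0 t = 0).
    by rewrite mxE; have := hv (rshift N t); rewrite !degE addn1.
  case: k pos hv0 hv1 {hv} => [|k] pos hv0 hv1.
    have v10 : v1 = 0 by apply/rowP => t; rewrite [RHS]mxE; have [_ ->] := hv1 t.
    rewrite v10 mul0mx addr0 in v01 *.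
    have [w [c [j [hw v0E hc]]]] := base_left hv0 v01.
    pose q := c *: x ^+ j.-1.
    have qx : (q * x) *: eb = (c *: x ^+ j) *: eb.
      have [c0|/hc[_ jd]] := eqVneq c 0; first by rewrite /q c0 !(scale0r, mul0r).
      rewrite /q -scalerAl -exprSr prednK //; case: j jd {hc v0E q} => // d0.
      by rewrite -d0 in pos.
    exists (row_mx w (q *: eb)); last first.
      by rewrite mul_row_block mulmx0 add0r ebX qx mulmxN ebD oppr0 -v0E.
    move=> i; case: (split_ordP i) => t ->; rewrite ?row_mxEl ?row_mxEr !degE //.
    rewrite !mxE eqxx /=; have [->|_] := eqVneq t bot; last first.
      by rewrite mulr0; split=> //; apply: GD0.
    rewrite mulr1 hbot (re_gbot re); split=> //; rewrite /q.
    have [->|/hc[_ jd]] := eqVneq c 0; first by rewrite scale0r; apply: GD0.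
    case: j jd {hc v0E q qx} => [|j] jd; first by rewrite -jd in pos.
    apply: subspaceZ; first exact: subspaceGD.
    by rewrite /GD add0n -jd mulSn leq_addr addKn; apply: GDexpx.
  (* the class of v1 in K[x] is c x^j; multiplied by x it is a boundary, so
     that c = 0 *)
  have [w1 [hw1 v1E]] : exists w1, (if (e <= d)%N then hrow G' h g (d - e) k.+1 w1 else w1 = 0)
      /\ v1 = w1 *m D.
    case: leqP => [le|lt]; last first.
      exists 0; split=> //; rewrite mul0mx; apply/rowP => t; rewrite [RHS]mxE.
      by have [h1 _] := hv1 t; apply: (GD_lt _ h1); lia.
    have hv1' : hrow G' h g (d - e) k v1.
      move=> t; have [h1 h2] := hv1 t; split; last by move=> ne; apply: h2; lia.
      by apply/(GD_shift G' e); rewrite subnK.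
    have [w1 [c [j [hw1 v1E hc]]]] := base_left hv1' v1D.
    exists w1; split=> //; rewrite v1E; have [->|nc] := eqVneq c 0.
      by rewrite !scale0r addr0.
    have [k0 jd] := hc nc; subst k; case/eqP: nc.
    have hw : hrow G' h g d 1 (- (v0 + w1 *m X)).
      apply: (hrowN gr'); apply: (hrowD gr') => //.
      by rewrite -(subnK le); apply: (hrowM gr' hw1 hX).
    apply: (left_no_constant hw (j := j.+1)); first by rewrite mulSn jd subnKC.
    rewrite mulNmx mulmxDl -mulmxA XD mulmxA; apply/eqP; rewrite eq_sym -addr_eq0; apply/eqP.
    have := v01; rewrite v1E mulmxDl ebX -scalerAl -exprSr => vz; rewrite -[RHS]vz.
    by addac.
  have hwX : hrow G' h g d k.+1 (w1 *m X).
    case: leqP hw1 => [le hw1|_ ->]; last by rewrite mul0mx; apply: hrow0.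
    by rewrite -(subnK le); apply: (hrowM gr' hw1 hX).
  have [||w0 [c [j [hw0 wE hc]]]] := base_left (v := v0 + w1 *m X) (d := d) (k := k.+1).
  + exact: (hrowD gr').
  + by rewrite mulmxDl -mulmxA XD mulmxA -v1E.
  have c0 : c = 0 by apply/eqP/negPn/negP => /hc[].
  rewrite c0 !scale0r addr0 in wE.
  exists (row_mx w0 (- w1)); last first.
    by rewrite mul_row_block mulmx0 add0r !mulNmx mulmxN opprK -wE -v1E addrK.
  move=> i; case: (split_ordP i) => t ->; rewrite ?row_mxEl ?row_mxEr !degE //.
  rewrite mxE; case: leqP hw1 => [le /(_ t)[h1 h2]|_ ->]; last first.
    by rewrite mxE oppr0; split=> //; apply: GD0.
  split; last by move=> ne; rewrite h2 ?oppr0 //; lia.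
  apply: subspaceN; first exact: subspaceGD.
  by rewrite -[X in GD G' X](subnK le); apply/GD_shift.
have mB (a b : 'cV[A]_N) t : (a - b) t 0 = a t 0 - b t 0 by rewrite !mxE.
have mD (a b : 'cV[A]_N) t : (a + b) t 0 = a t 0 + b t 0 by rewrite !mxE.
have mN (a : 'cV[A]_N) t : (- a) t 0 = - a t 0 by rewrite !mxE.
have GB d k a b : GD G' d k a -> GD G' d k b -> GD G' d k (a - b).
  by move=> ha hb; apply: subspaceB => //; apply: subspaceGD.
move=> m k u hu pos; rewrite -[u]vsubmxK mul_block_col mul0mx addr0.
set u0 := usubmx u; set u1 := dsubmx u.
rewrite -[0]vsubmxK => /eq_col_mx[]; rewrite !linear0 => u0D /eqP.
rewrite mulNmx subr_eq0 => /eqP Xu0.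
have hu0 : if (e <= m)%N then hcol G' h g l (m - e) k u0 else u0 = 0.
  case: leqP => [le t|lt].
    rewrite mxE; have := hu (lshift N t); rewrite !degE => -[h1 h2]; split=> //.
    by apply/(GD_shift G' e); rewrite -addnA subnK.
  apply/colP => t; rewrite !mxE; have := hu (lshift N t); rewrite !degE => -[h1 _].
  by apply: (GD_lt _ h1); have := re_gle re t; lia.
have hu1 t : GD G' (g t + m) l (u1 t 0) /\ ((h t).+1 <> k -> u1 t 0 = 0).
  rewrite mxE; have := hu (rshift N t); rewrite !degE addn1 => -[h1 h2]; split=> //.
  by apply/(GD_shift G' e); rewrite addnAC.
have hXw (w0 : 'cV[A]_N) : (forall t, GD G' (g t + (m - e)) l (w0 t 0) /\ ((h t).+1 <> k -> w0 t 0 = 0)) ->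
    (e <= m)%N -> forall t, GD G' (g t + m) l ((X *m w0) t 0) /\ ((h t).+1 <> k -> (X *m w0) t 0 = 0).
  move=> hw le; case: k hw {hu hu0 hu1 pos} => [|k] hw t.
    have -> : w0 = 0 by apply/colP => r; have [_ ->] := hw r; rewrite ?mxE.
    by rewrite mulmx0 mxE; split=> //; apply: GD0.
  have hw' : hcol G' h g l (m - e) k w0.
    by move=> r; have [h1 h2] := hw r; split=> // ne; apply: h2; lia.
  have [h1 h2] := hcolM gr' hw' hX (erefl _) t; rewrite subnKC // in h1.
  by split=> // ne; apply: h2; lia.
(* likewise for the component of u0 at the top basis vector, where x acts
   by s x up to boundaries *)
have [w0 [hw0 u0E]] : exists w0 : 'cV[A]_N, (if (e <= m)%N then forall t,
    GD G' (g t + (m - e)) l (w0 t 0) /\ ((h t).+1 <> k -> w0 t 0 = 0) else w0 = 0)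
    /\ u0 = D *m w0.
  case: leqP hu0 => [le hu0|_ ->]; last by exists 0; rewrite mulmx0.
  have [w0 [c [j [hw0 u0E hc]]]] := base_right hu0 u0D.
  exists w0; split=> //; rewrite u0E mulmx_scal; have [->|nc] := eqVneq c 0.
    by rewrite scale0r scalar_mx0 mulmx0 addr0.
  have [kn jd] := hc nc; subst k; case/eqP: (nc).
  pose q := c *: x ^+ j.
  have hq : G' (m - e)%N q by rewrite -jd; apply: (grZ gr'); apply: GDexpx.
  have sc : s * c = 0; last by move/eqP: sc; rewrite mulf_eq0 (negPf nzs) => /eqP.
  apply: (right_no_constant (m := m) (j := j.+1)
    (w := u1 - X *m w0 - map_mx iota wt *m q%:M)).
  - move=> t; have [h1 h2] := hu1 t; have [h3 h4] := hXw w0 hw0 le t.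
    have [h5 h6] := iwt _ q m hq (subnKC le) t.
    rewrite !mB; split; first by do 2 apply: (GB _ _ _ _) => //.
    by move=> ne; rewrite h2 // h4 // h6 // !subr0.
  - by rewrite mulSn jd subnKC.
  rewrite !mulmxBr -Xu0 u0E mulmx_scal mulmxDr !mulmxA XD etX mulmxDl mulmx_scal -!mulmxA.
  rewrite -scalar_mxM [X in X - _ - _]addrC addrK addrK.
  by congr (_ *m _%:M); rewrite -scalerAl -scalerAr scalerA exprS.
have hu1' t : GD G' (g t + m) l ((u1 - X *m w0) t 0) /\
    ((h t).+1 <> k -> (u1 - X *m w0) t 0 = 0).
  have [h1 h2] := hu1 t; case: leqP hw0 => [le hw0|_ ->]; last by rewrite mulmx0 subr0.
  have [h3 h4] := hXw w0 hw0 le t; rewrite mB; split; first exact: GB.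
  by move=> ne; rewrite h2 // h4 // subrr.
have u1D : D *m (u1 - X *m w0) = 0.
  by rewrite mulmxBr -Xu0 u0E !mulmxA XD subrr.
case: k pos hu hu0 hu1 hw0 hXw hu1' => [|k] pos hu hu0 hu1 hw0 hXw hu1'.
  have u10 : u1 = 0 by apply/colP => t; rewrite [RHS]mxE; have [_ ->] := hu1 t.
  have w00 : w0 = 0.
    case: leqP hw0 => // le hw0; apply/colP => t; rewrite [RHS]mxE.
    by have [_ ->] := hw0 t.
  exists 0; first by move=> t; rewrite mxE; split=> //; apply: GD0.
  by rewrite mulmx0 u10 u0E w00 mulmx0 col_mx0.
have hc' : hcol G' h g l m k (u1 - X *m w0).
  by move=> t; have [h1 h2] := hu1' t; split=> // ne; apply: h2; lia.
have [w1 [c [j [hw1 wE hc]]]] := base_right hc' u1D.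
(* the class c x^j left in the second component is s x times q *)
pose q := (s^-1 * c) *: x ^+ j.-1.
have qE : c != 0 -> [/\ k = n, (e + j.-1 * e)%N = m & c *: x ^+ j = s *: x * q].
  move=> /hc[kn jd]; have j0 : (0 < j)%N.
    by case: j jd {hc wE q} => // d0; move: pos; rewrite kn -d0 ltnn.
  split=> //; first by rewrite -mulSn prednK.
  by rewrite /q -scalerAl -scalerAr scalerA mulrA divff // mul1r -exprS prednK.
have hq : G' (j.-1 * e)%N q by apply: (grZ gr'); apply: GDexpx.
have q0 : c = 0 -> q = 0 by move=> c0; rewrite /q c0 mulr0 scale0r.
have key : u1 = X *m (w0 + et *m q%:M) + D *m (w1 - map_mx iota wt *m q%:M).
  have : u1 = X *m w0 + (u1 - X *m w0) by rewrite addrC subrK.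
  rewrite wE mulmx_scal mulmxDr mulmxBr !mulmxA etX mulmxDl => ->.
  have [c0|/qE[_ _ ->]] := eqVneq c 0.
    by rewrite c0 q0 // !scale0r !scalar_mx0 !mulmx0 !addr0 subr0.
  rewrite scalar_mxM mulmxA; move: (et *m _ *m _) (X *m w0) (D *m w1) (D *m _ *m _) => a1 a2 a3 a4.
  by rewrite -!addrA; congr (_ + _); rewrite addrC; congr (_ + _); rewrite addrCA subrr addr0.
exists (col_mx (w0 + et *m q%:M) (- (w1 - map_mx iota wt *m q%:M))); last first.
  rewrite mul_block_col mul0mx addr0 mulNmx mulmxN opprK -key mulmxDr -u0E.
  by rewrite mulmxA Det mul0mx addr0.
move=> i; case: (split_ordP i) => t ->; rewrite ?col_mxEu ?col_mxEd !degE.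
  rewrite mD -mulmx_scal !mxE eqxx andbT.
  have hw0t : GD G' (g t + m) (l + e) (w0 t 0) /\ ((h t).+1 <> k.+1 -> w0 t 0 = 0).
    case: leqP hw0 => [le /(_ t)[h1 h2]|_ ->]; last by rewrite mxE; split=> //; apply: GD0.
    by split=> //; rewrite -(subnK le) addnA; apply/GD_shift.
  have [h1 h2] := hw0t.
  have [c0|/qE[kn jm _]] := eqVneq c 0; first by rewrite q0 // mulr0 addr0.
  have [tt|nt] := eqVneq t top; last by rewrite mul0r addr0.
  rewrite mul1r tt; split; last by rewrite htop kn.
  rewrite -tt; apply: (subspaceD (subspaceGD gr' _ _)) => //.
  by rewrite tt (re_gtop re) -jm addnA /GD leq_addr addKn.
have [h1 h2] := hw1 t.
have hwq : GD G' (g t + m) l ((map_mx iota wt *m q%:M) t 0) /\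
    ((h t).+1 <> k -> (map_mx iota wt *m q%:M) t 0 = 0).
  have [c0|/qE[kn jm _]] := eqVneq c 0; last by rewrite kn; apply: (iwt _ q m hq jm).
  by rewrite q0 // scalar_mx0 mulmx0 mxE; split=> //; apply: GD0.
have [h3 h4] := hwq; rewrite mN mB; split.
  by rewrite addnAC; apply/GD_shift; apply: subspaceN; [apply: subspaceGD|apply: GB].
by move=> ne; rewrite h2 ?h4 ?subrr ?oppr0 //; lia.
Qed.

End Cone.

(** * The resolution of a tower *)

(** The number of k-element subsets of the variables with degree sum j. *)
Definition cell_count (ds : seq nat) : nat -> nat -> nat :=
  foldl (fun f e k j =>
    (f k j + (if (0 < k) && (e <= j) then f k.-1 (j - e) else 0))%N)
    (fun k j => (k == 0%N) && (j == 0%N) : nat) ds.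

Lemma card_cone (N : nat) (h g : 'I_N -> nat) e k j :
  #|[pred s | (cone_deg h 1 s == k) && (cone_deg g e s == j)]| =
  (#|[pred s | (h s == k) && (g s == j)]| +
   (if (0 < k) && (e <= j) then #|[pred s | (h s == k.-1) && (g s == (j - e)%N)]| else 0))%N.
Proof.
rewrite -!sum1_card big_split_ord /=; congr (_ + _)%N.
  by apply: eq_bigl => s; rewrite !inE !cone_degl.
case: ifP => [/andP[k0 ej]|kj].
  by apply: eq_bigl => s; rewrite !inE !cone_degr; lia.
by rewrite big_pred0 // => s; rewrite !inE !cone_degr; lia.
Qed.

Lemma base_resolution (K : fieldType) :
  @resolution K K^o (@scalar_grading K) 1 (fun=> 0%N) (fun=> 0%N) 0 0 0 ord0 ord0.
Proof.
have gr := base_graded K.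
split=> //.
- by move=> s t; rewrite mxE; split=> //; apply: GD0.
- by rewrite mulmx0.
- by move=> s; rewrite (ord1 s).
- by move=> s; rewrite (ord1 s).
- by move=> s; rewrite (ord1 s).
- move=> D k v hv pos _; have -> : v = 0.
    apply/rowP => t; rewrite mxE; have [h1 h2] := hv t; have [D0|D0] := posnP D.
      by apply: h2; move: pos; rewrite D0; lia.
    by move: h1; rewrite /GD leq0n subn0 => -[//|d0]; rewrite d0 in D0.
  by exists 0; [apply: hrow0 | rewrite mul0mx].
move=> m k u hu pos _; have -> : u = 0.
  apply/colP => t; rewrite mxE; have [h1 h2] := hu t.
  by move: h1; rewrite /GD leq0n subn0 add0n => -[//|d0]; rewrite d0 in pos.
by exists 0; [move=> t; rewrite mxE; split=> //; apply: GD0 | rewrite mulmx0].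
Qed.

(** The basis vectors correspond to the sets of variables, as in a Koszul complex:
each step adds a second copy, for the sets containing the new variable. *)
Lemma tower_resolution (K : fieldType) (A : algType K) (G : nat -> A -> Prop) ds :
  tower G ds -> exists (N : nat) (h g : 'I_N -> nat) (dd : 'M[A]_N) (bot top : 'I_N),
    resolution G h g (size ds) (sumn ds) dd bot top /\
    forall k j, #|[pred s | (h s == k) && (g s == j)]| = cell_count ds k j.
Proof.
elim=> {A G ds} [|R A i s d x e G G' es tw [N [h [g [dd [bot [top [re cnt]]]]]]] st].
  exists 1%N, (fun=> 0%N), (fun=> 0%N), 0, ord0, ord0; split; first exact: base_resolution.
  move=> k j; rewrite /cell_count /= -sum1_card big_mkcond big_ord1 !inE.
  by rewrite (eq_sym 0%N k) (eq_sym 0%N j); case: ifP.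
have [X reX] := cone_resolution st re.
exists (N + N)%N, (cone_deg h 1), (cone_deg g e), (block_mx (map_mx i dd) 0 X (- map_mx i dd)).
exists (lshift N bot), (rshift N top); split; first by rewrite size_rcons sumn_rcons.
by move=> k j; rewrite card_cone /cell_count -cats1 foldl_cat /= !cnt.
Qed.

(** * Cocycles of degree two and the top of the resolution *)

Section LinearOn.
Variables (K : fieldType) (V : lmodType K) (S : V -> Prop).
Hypothesis hS : subspace S.

Definition linear_on (F : V -> K) : Prop :=
  forall c a b, S a -> S b -> F (c *: a + b) = c * F a + F b.

Variable F : V -> K.
Hypothesis lin : linear_on F.

Lemma linear_on0 : F 0 = 0.
Proof.
have [S0 _] := hS; have := lin (-1) S0 S0.
by rewrite scaler0 addr0 mulN1r addNr.
Qed.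

Lemma linear_onZ c a : S a -> F (c *: a) = c * F a.
Proof.
move=> Sa; have [S0 _] := hS; rewrite -[c *: a]addr0 lin //.
by rewrite linear_on0 addr0.
Qed.

Lemma linear_onD a b : S a -> S b -> F (a + b) = F a + F b.
Proof. by move=> Sa Sb; rewrite -[a]scale1r lin // mul1r scale1r. Qed.

Lemma linear_on_sum (I : finType) (f : I -> V) : (forall i, S (f i)) ->
  F (\sum_i f i) = \sum_i F (f i).
Proof.
move=> hf; suff [] : F (\sum_i f i) = \sum_i F (f i) /\ S (\sum_i f i) by [].
elim/big_rec2: _ => [|i y x _ [<- Sy]]; first by rewrite linear_on0; case: hS.
by rewrite linear_onD //; split=> //; apply: subspaceD.
Qed.

End LinearOn.

Section Cocycles.
Variables (K : fieldType) (A : algType K) (G : nat -> A -> Prop).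

(** Hochschild 2-cocycles of internal degree d with trivial coefficients; up to
exact ones, they are dual to the minimal relations of degree d. *)
Record cocycle2 (d : nat) (th : A -> A -> K) : Prop := Cocycle2 {
  c2_l : forall i j b, (0 < i)%N -> (0 < j)%N -> (i + j)%N = d -> G j b ->
    linear_on (G i) (th^~ b);
  c2_r : forall i j a, (0 < i)%N -> (0 < j)%N -> (i + j)%N = d -> G i a ->
    linear_on (G j) (th a);
  c2_assoc : forall i j k a b c, (0 < i)%N -> (0 < k)%N -> (i + j + k)%N = d ->
    G i a -> G j b -> G k c -> th (a * b) c = th a (b * c) }.

Definition exact2 (d : nat) (th : A -> A -> K) : Prop :=
  exists2 phi, linear_on (G d) phi & forall i j a b,
    (0 < i)%N -> (0 < j)%N -> (i + j)%N = d -> G i a -> G j b -> th a b = phi (a * b).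

Lemma cocycle2_sum (J : finType) (c : J -> K) (F : J -> A -> A -> K) d :
  (forall j, cocycle2 d (F j)) -> cocycle2 d (fun a b => \sum_j c j * F j a b).
Proof.
move=> hF; split.
- move=> i j b i0 j0 ij gb k a a' ga ga'; rewrite mulr_sumr -big_split.
  by apply: eq_bigr => t _; rewrite /= (c2_l (hF t) i0 j0 ij gb) // mulrDr mulrCA.
- move=> i j a i0 j0 ij ga k b b' gb gb'; rewrite mulr_sumr -big_split.
  by apply: eq_bigr => t _; rewrite /= (c2_r (hF t) i0 j0 ij ga) // mulrDr mulrCA.
move=> i j k a b e i0 k0 ijk ga gb ge; apply: eq_bigr => t _.
by rewrite (c2_assoc (hF t) i0 k0 ijk).
Qed.

Hypothesis gr : graded G.
Variables (N : nat) (h g : 'I_N -> nat) (n l : nat) (dd : 'M[A]_N) (bot top : 'I_N).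
Hypothesis re : resolution G h g n l dd bot top.

Lemma row_top_GD s : GD G l (g s) (dd top s).
Proof. by have [h1 _] := re_dd re top s; rewrite addn0 (re_gtop re) in h1. Qed.

Lemma dd_GD s t : GD G (g s) (g t) (dd s t).
Proof. by have [h1 _] := re_dd re s t; rewrite addn0 in h1. Qed.

Lemma htop : h top = n. Proof. by apply/eqP; rewrite (re_top re). Qed.

Lemma dd_top t : dd t top = 0.
Proof. by have [_ ->] := re_dd re t top; rewrite // htop; have := re_hn re t; lia. Qed.

(** By self-duality, the entries of the row top generate A_+ as a right ideal. *)
Lemma top_expansion m f : (0 < m)%N -> G m f -> exists2 w : 'cV[A]_N,
  (forall t, GD G (g t + m) l (w t 0) /\ ((h t).+1 <> n -> w t 0 = 0)) &
  delta_mx top 0 *m f%:M = dd *m w.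
Proof.
move=> m0 gf; apply: (re_right re); first 1 last.
- by rewrite m0 orbT.
- rewrite mulmxA -colE; have -> : col top dd = 0; last by rewrite mul0mx.
  by apply/colP => t; rewrite !mxE dd_top.
move=> t; rewrite -mulmx_scal !mxE eqxx andbT; have [->|nt] := eqVneq t top.
  rewrite mul1r; split; last by rewrite htop.
  by rewrite (re_gtop re) /GD leq_addr addKn.
by rewrite mul0r; split=> //; apply: GD0.
Qed.

Section Contraction.
Variables (d : nat) (th : A -> A -> K).
Hypothesis c2 : cocycle2 d th.

(** Contraction of th by the last differential dd top s; outside the range of
positive degrees it is set to 0. *)
Definition top_pairing (s : 'I_N) (b : A) : K :=
  if (g s < l)%N && (l < g s + d)%N then th (dd top s) b else 0.

Lemma top_pairing_lin s : linear_on (GD G (g s + d) l) (top_pairing s).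
Proof.
move=> c b b' hb hb'; rewrite /top_pairing; case: ifP; last by rewrite mulr0 addr0.
case/andP=> lt le; move: (row_top_GD s) hb hb'.
rewrite /GD (ltnW lt) (ltnW le) => ga; apply: (c2_r c2 _ _ _ ga); lia.
Qed.

Let sG m k : subspace (GD G m k) := subspaceGD gr m k.

Lemma top_pairing0 s : top_pairing s 0 = 0.
Proof. exact: (linear_on0 (sG _ _) (@top_pairing_lin s)). Qed.

Lemma th0l j b : (0 < j)%N -> (j < d)%N -> G j b -> th 0 b = 0.
Proof.
move=> j0 lt gb; apply: (linear_on0 (gr_sub gr (d - j)) (F := th^~ b)).
by apply: (c2_l c2 _ j0 _ gb); lia.
Qed.

Lemma GD_mulr m k s t b : GD G (g s) (g t) k -> GD G (g t + m) l b ->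
  GD G (g s + m) l (k * b).
Proof. by move=> hk hb; apply: (GDM gr (n := (g t + m)%N)) => //; apply/GD_shift. Qed.

(** The pairing of th with the last two differentials.  By the self-duality of the
resolution, it represents the class of th in H^2, one coordinate for each basis
vector T two steps below the top. *)
Definition contraction (T : 'I_N) : K := \sum_s top_pairing s (dd s T).

Lemma top_pairing_assoc s i j b c : (0 < i)%N -> (0 < j)%N -> (i + j)%N = d ->
  GD G (g s + i) l b -> G j c ->
  top_pairing s (b * c) = th (dd top s * b) c.
Proof.
move=> i0 j0 ij; have [->|ns] := eqVneq s top => hb hc.
  rewrite dd_top mul0r (th0l (j := j)) //; last by lia.
  by rewrite /top_pairing (re_gtop re) ltnn.
have lt : (g s < l)%N by apply: (re_glt re).
move: hb; rewrite {1}/GD; case: leqP => [le hb|lt' ->]; last first.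
  by rewrite mul0r mulr0 top_pairing0 (th0l (j := j)) //; lia.
rewrite /top_pairing lt /=; have -> : (l < g s + d)%N by lia.
have := row_top_GD s; rewrite /GD (ltnW lt) => ga.
rewrite (c2_assoc c2 (i := (l - g s)%N) (j := (g s + i - l)%N) (k := j)) //; lia.
Qed.

(** Away from internal degree l - d, associativity of th moves w out of the
pairing and leaves the product of two successive differentials, which is 0. *)
Lemma pairing_column (T : 'I_N) (w : A) :
  GD G (g T + d) l w -> ((h T).+2 <> n -> w = 0) ->
  exists c : K, [/\ \sum_s top_pairing s (dd s T * w) = c * contraction T,
    (g T + d)%N = l -> w = c%:A & (h T).+2 <> n \/ (g T + d)%N <> l -> c = 0].
Proof.
move=> hw z; have [->|nz] := eqVneq w 0.
  exists 0; split=> //; last by rewrite scale0r.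
  by rewrite mul0r big1 // => s _; rewrite mulr0 top_pairing0.
have hT : (h T).+2 = n by apply/eqP; apply: contraNT nz => /eqP/z ->.
have nT : T != top by apply: contra_eq_neq hT => ->; rewrite htop; lia.
have gT := re_glt re nT.
have [lt|gt|eq] := ltngtP (g T + d)%N l.
- by case/negP: nz; rewrite (GD_lt lt hw).
- exists 0; split=> //; last by lia.
  move: hw; rewrite /GD (ltnW gt) mul0r => hw.
  under eq_bigr => s _.
    rewrite (@top_pairing_assoc s (l - g T) (g T + d - l)) //; try lia.
      over.
    rewrite -[X in GD G _ X](subnKC (ltnW gT)); apply/GD_shift; exact: dd_GD.
  rewrite -(linear_on_sum (gr_sub gr (l - g T)) (F := th^~ w)); first 1 last.
  + by apply: (c2_l c2 _ _ _ hw); lia.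
  + move=> s; have := GDM gr (row_top_GD s) (dd_GD s T).
    by rewrite /GD (ltnW gT).
  have /matrixP/(_ top T) := re_sq re; rewrite !mxE => ->.
  by rewrite (th0l (j := (g T + d - l)%N)) //; lia.
rewrite eq in hw; have [c wE] := GDnnP gr hw; exists c; split=> //; last by lia.
rewrite /contraction mulr_sumr; apply: eq_bigr => s _.
rewrite wE -scalerAr mulr1 (linear_onZ (sG _ _) (@top_pairing_lin s)) //.
by rewrite -eq GD_shift; apply: dd_GD.
Qed.

Lemma top_pairing_sum (w : 'cV[A]_N) : (forall T, GD G (g T + d) l (w T 0)) ->
  \sum_s top_pairing s ((dd *m w) s 0) = \sum_T \sum_s top_pairing s (dd s T * w T 0).
Proof.
move=> hw; rewrite exchange_big; apply: eq_bigr => s _; rewrite mxE.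
apply: (linear_on_sum (sG _ _) (@top_pairing_lin s)) => T.
exact: GD_mulr (dd_GD s T) (hw T).
Qed.

(** Writing f = \sum_s dd top s * w s, the primitive is
phi(f) = \sum_s th(dd top s, w s); the vanishing of the contractions makes
this independent of the choice of w. *)
Lemma contraction_exact : (0 < d)%N ->
  (forall T, (h T).+2 = n -> (g T + d)%N = l -> contraction T = 0) -> exact2 d th.
Proof.
move=> d0 ct0.
(* W w is the value of the primitive on the element with expansion w *)
pose W (w : 'cV[A]_N) := \sum_s top_pairing s (w s 0).
have Wlin c (u v : 'cV[A]_N) : (forall s, GD G (g s + d) l (u s 0)) ->
    (forall s, GD G (g s + d) l (v s 0)) -> W (c%:A *: u + v) = c * W u + W v.
  move=> hu hv; rewrite /W mulr_sumr -big_split; apply: eq_bigr => s _.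
  by rewrite !mxE mulr_algl; apply: top_pairing_lin.
have cA (c : K) p q (M : 'M[A]_(p, q)) (u : 'cV[A]_q) : M *m (c%:A *: u) = c%:A *: (M *m u).
  apply/colP => s; rewrite !mxE mulr_sumr; apply: eq_bigr => t _.
  by rewrite mxE !mulr_algl scalerAr.
have uniq (u v : 'cV[A]_N) : (forall t, GD G (g t + d) l (u t 0) /\ ((h t).+1 <> n -> u t 0 = 0)) ->
    (forall t, GD G (g t + d) l (v t 0) /\ ((h t).+1 <> n -> v t 0 = 0)) ->
    dd *m u = dd *m v -> W u = W v.
  move=> hu hv uv; have n0 : u <> v -> (0 < n)%N.
    case: (posnP n) => // n0; case; apply/colP => t.
    by have [_ ->] := hu t; rewrite ?n0 //; have [_ ->] := hv t; rewrite ?n0.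
  have [-> //|/eqP/n0 {}n0] := eqVneq u v.
  have [|||w hw wE] := re_right re (m := d) (k := n.-1) (u := u - v).
  - move=> t; rewrite !mxE; have [h1 h2] := hu t; have [h3 h4] := hv t; split.
      exact: (subspaceB (sG _ _)).
    by move=> ne; rewrite h2 ?h4 ?subrr //; lia.
  - by rewrite d0 orbT.
  - by rewrite mulmxBr uv subrr.
  have : W (u - v) = 0.
    rewrite /W wE top_pairing_sum => [|T]; last by case: (hw T).
    rewrite big1 // => T _; have [h1 h2] := hw T.
    have [|c [-> _ c0]] := pairing_column h1; first by move=> ne; apply: h2; lia.
    have [hT|/eqP ne] := eqVneq (h T).+2 n; last by rewrite c0 ?mul0r; [|left].
    have [gT|/eqP ne] := eqVneq (g T + d)%N l; last by rewrite c0 ?mul0r; [|right].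
    by rewrite ct0 ?mulr0.
  have -> : W u = W ((1 : K)%:A *: (u - v) + v) by rewrite !scale1r subrK.
  move=> W0; rewrite Wlin ?W0 ?mulr0 ?add0r // => s; last by case: (hv s).
  have [h1 _] := hu s; have [h2 _] := hv s.
  by rewrite !mxE; apply: (subspaceB (sG _ _)).
have [F hF] : exists F : A -> 'cV[A]_N, forall f, G d f ->
    (forall t, GD G (g t + d) l (F f t 0) /\ ((h t).+1 <> n -> F f t 0 = 0)) /\
    delta_mx top 0 *m f%:M = dd *m F f.
  apply: (fchoice (P := fun f (w : 'cV[A]_N) => G d f ->
    (forall t, GD G (g t + d) l (w t 0) /\ ((h t).+1 <> n -> w t 0 = 0)) /\
    delta_mx top 0 *m f%:M = dd *m w)) => f.
  case: (excluded_middle_informative (G d f)) => [gf|ngf]; last by exists 0.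
  by have [w hw wE] := top_expansion d0 gf; exists w.
exists (fun f => W (F f)).
  move=> c a b ga gb; have gab : G d (c *: a + b).
    by have [_ hh] := gr_sub gr d; apply: hh.
  have [h1 h2] := hF _ ga; have [h3 h4] := hF _ gb; have [h5 h6] := hF _ gab.
  rewrite -Wlin; try by [move=> s; case: (h1 s) | move=> s; case: (h3 s)].
  apply: uniq => //.
    move=> t; have [k1 k2] := h1 t; have [k3 k4] := h3 t; rewrite !mxE; split.
      by rewrite mulr_algl; have [_ hh] := sG (g t + d)%N l; apply: hh.
    by move=> ne; rewrite k2 // k4 // mulr0 addr0.
  by rewrite -h6 mulmxDr cA -h2 -h4 raddfD mulmxDr -cA scale_scalar_mx mulr_algl.
move=> i j a b i0 j0 ij ga gb; have [w hw wE] := top_expansion i0 ga.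
have gab : G d (a * b) by rewrite -ij; apply: (gr_mul gr).
have [h1 h2] := hF _ gab.
have hwb t : GD G (g t + d) l ((w *m b%:M) t 0) /\ ((h t).+1 <> n -> (w *m b%:M) t 0 = 0).
  have [k1 k2] := hw t; rewrite -mulmx_scal !mxE; split; last by move/k2->; rewrite mul0r.
  apply: (GDM gr (n := (l + j)%N)); first by rewrite -ij addnA; apply/GD_shift.
  by rewrite /GD leq_addr addKn.
rewrite (uniq _ _ h1 hwb); last by rewrite -h2 mulmxA -wE scalar_mxM mulmxA.
rewrite /W; under eq_bigr => s _.
  rewrite -mulmx_scal mxE (@top_pairing_assoc s i j) //; last by case: (hw s).
  over.
rewrite -(linear_on_sum (gr_sub gr i) (F := th^~ b)); first 1 last.
- exact: (c2_l c2 i0 j0 ij gb).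
- move=> s; have [k1 _] := hw s; apply/(GDn0 G).
  apply/(GD_shift G l); rewrite add0n addnC.
  apply: (GDM gr (n := (g s + i)%N)) => //.
  by apply/GD_shift; apply: row_top_GD.
have /colP/(_ top) := wE; rewrite !mxE big_ord1 !mxE !eqxx mul1r mulr1n => ->.
by [].
Qed.

(** Pair th with the column p of dd *m dd = 0; only the scalar entries of that
column contribute. *)
Lemma contraction_relation p : (h p).+3 = n -> (g p + d)%N = l ->
  exists2 c : 'I_N -> K, forall T, g T = g p -> dd T p = (c T)%:A &
  \sum_(T | ((h T).+2 == n) && (g T == g p)) c T * contraction T = 0.
Proof.
move=> hp gp.
have hd T : GD G (g T + d) l (dd T p).
  by rewrite -gp; apply/GD_shift; apply: dd_GD.
have hz T : (h T).+2 <> n -> dd T p = 0.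
  by move=> ne; have [_ h1] := re_dd re T p; apply: h1; lia.
have [c hc] := fchoice (fun T => pairing_column (hd T) (hz T)).
exists c => [T gT|]; first by have [_ h1 _] := hc T; apply: h1; rewrite gT.
have := top_pairing_sum (w := col p dd).
have -> : dd *m col p dd = 0 by rewrite colE mulmxA (re_sq re) mul0mx.
move=> /(_ ltac:(by move=> T; rewrite mxE)).
rewrite [LHS]big1 => [|s _]; last by rewrite !mxE top_pairing0.
move=> e0; rewrite [RHS]e0 big_mkcond; apply: eq_bigr => T _; rewrite mxE.
have [-> _ c0] := hc T; case: andP => // nn; rewrite c0 ?mul0r //.
have [hT|/eqP ne] := eqVneq (h T).+2 n; last by left.
right=> e1; case: nn; split; first exact/eqP.
by apply/eqP; move: e1; rewrite -gp; lia.
Qed.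

End Contraction.

Lemma contraction_sum (J : finType) (c : J -> K) (F : J -> A -> A -> K) d T :
  contraction d (fun a b => \sum_j c j * F j a b) T = \sum_j c j * contraction d (F j) T.
Proof.
rewrite /contraction; under [RHS]eq_bigr => j _ do rewrite mulr_sumr.
rewrite exchange_big; apply: eq_bigr => s _; rewrite /top_pairing; case: ifP => //= _.
by rewrite big1 // => j _; rewrite mulr0.
Qed.

End Cocycles.

(** * The resolution in low degrees *)

Lemma sum_subtype (V : nmodType) (I : finType) (P : pred I) (F : I -> V) :
  \sum_(i | P i) F i = \sum_(q : {i : I | P i}) F (val q).
Proof.
rewrite (reindex_omap (fun q : {i : I | P i} => val q) insub) /=.
  by apply: eq_bigl => q; rewrite (valP q) valK eqxx.
by move=> i Pi; rewrite insubT.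
Qed.

Section LowDegrees.
Variables (K : fieldType) (A : algType K) (G : nat -> A -> Prop).
Hypothesis gr : graded G.
Variables (N : nat) (h g : 'I_N -> nat) (n l : nat) (dd : 'M[A]_N) (bot top : 'I_N).
Hypothesis re : resolution G h g n l dd bot top.

Let ddG := dd_GD re.

Lemma hbot : h bot = 0%N. Proof. by apply/eqP; rewrite (re_bot re). Qed.

Lemma delta_mulmx s (a : A) : (a *: delta_mx 0 s : 'rV[A]_N) *m dd = a *: row s dd.
Proof. by rewrite -scalemxAl -rowE. Qed.

Lemma dd_bot t : dd bot t = 0.
Proof. by have [_ h1] := re_dd re bot t; apply: h1; rewrite hbot; lia. Qed.

Lemma hrow_delta D k s a : h s = k -> GD G D (g s) a -> hrow G h g D k (a *: delta_mx 0 s).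
Proof.
move=> <- ha t; rewrite !mxE eqxx /=; case: eqP => [->|_]; first by rewrite mulr1.
by rewrite mulr0; split=> //; apply: GD0.
Qed.

Lemma hrow_low D k v : hrow G h g D k v -> (D < k)%N -> v = 0.
Proof.
move=> hv lt; apply/rowP => t; rewrite mxE; have [h1 h2] := hv t.
have [ht|/eqP/h2//] := eqVneq (h t) k; apply: (GD_lt _ h1).
by have := re_hg re t; lia.
Qed.

Lemma exact_low D k v : hrow G h g D k v -> (0 < k)%N -> (D <= k)%N -> v *m dd = 0 -> v = 0.
Proof.
move=> hv k0 le vD; have [|w hw ->] := re_left re hv _ vD; first by rewrite k0 orbT.
by rewrite (hrow_low hw) ?mul0mx.
Qed.

Lemma bot_expansion D a : (0 < D)%N -> G D a ->
  exists2 w : 'rV[A]_N, hrow G h g D 1 w & a *: delta_mx 0 bot = w *m dd.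
Proof.
move=> D0 ga; apply: (re_left re); first 1 last.
- by rewrite D0.
- by rewrite delta_mulmx; apply/rowP => t; rewrite !mxE dd_bot mulr0.
apply: hrow_delta hbot _; rewrite (re_gbot re); exact/GDn0.
Qed.

Let Q := {q : 'I_N | (h q == 1%N) && (g q == 1%N)}.
Let e (q : Q) : A := dd (val q) bot.

(** Internal degree one admits no scalar entries from homological degree two, since
the internal degree is at least the homological one. *)
Lemma degree1_basis : basis e (G 1%N).
Proof.
have eG q : G 1%N (e q).
  by have := ddG (val q) bot; case/andP: (valP q) => _ /eqP ->; rewrite (re_gbot re) GDn0.
split=> //.
  move=> c c0; pose w : 'rV[A]_N := \row_t \sum_(q : Q | val q == t) (c q)%:A.
  have wE q : w 0 (val q) = (c q)%:A.
    by rewrite mxE (big_pred1 q).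
  have w0 t : ~~ ((h t == 1%N) && (g t == 1%N)) -> w 0 t = 0.
    by move=> nt; rewrite mxE big_pred0 // => q; apply: contraNF nt => /eqP <-; exact: (valP q).
  have hw : hrow G h g 1 1 w.
    move=> t; case: (boolP ((h t == 1%N) && (g t == 1%N))) => [qt|/w0 ->]; last first.
      by split=> //; apply: GD0.
    have /= -> := wE (exist _ t qt); case/andP: (qt) => /eqP ht /eqP ->; split=> //.
    exact: GDnn.
  have w00 : w = 0.
    apply: (exact_low hw) => //; apply/rowP => t; rewrite mxE [RHS]mxE.
    have [->|nt] := eqVneq t bot.
      rewrite (bigID (fun q => (h q == 1%N) && (g q == 1%N))) /= [X in _ + X]big1 ?addr0.
        rewrite sum_subtype -[RHS]c0; apply: eq_bigr => q _.
        by rewrite wE -scalerAl mul1r.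
      by move=> q /w0 ->; rewrite mul0r.
    rewrite big1 // => q _; case: (boolP ((h q == 1%N) && (g q == 1%N))) => [|/w0 ->].
      case/andP=> /eqP hq _; have [_ ->] := re_dd re q t; first by rewrite mulr0.
      rewrite hq; have : h t != 0%N by rewrite (re_bot re).
      lia.
    by rewrite mul0r.
  by move=> q; apply: (@alg_inj0 K A); rewrite -wE w00 mxE.
move=> a /(bot_expansion (ltn0Sn 0))[w hw wE].
have [c hc] : exists c : 'I_N -> K, forall t, (h t == 1%N) && (g t == 1%N) -> w 0 t = (c t)%:A.
  apply: (fchoice (P := fun t c => (h t == 1%N) && (g t == 1%N) -> w 0 t = c%:A)) => t.
  case: (boolP ((h t == 1%N) && (g t == 1%N))) => [/andP[_ /eqP gt]|_]; last by exists 0.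
  by have [h1 _] := hw t; rewrite gt in h1; have [c ->] := GDnnP gr h1; exists c.
exists (fun q => c (val q)).
have /rowP/(_ bot) := wE; rewrite !mxE !eqxx mulr1 => ->.
rewrite (bigID (fun q => (h q == 1%N) && (g q == 1%N))) /= [X in _ + X]big1 ?addr0.
  rewrite sum_subtype; apply: eq_bigr => q _.
  by rewrite hc ?(valP q) // -scalerAl mul1r.
move=> t; rewrite negb_and => nt; have [h1 h2] := hw t.
have [ht|/eqP/h2->] := eqVneq (h t) 1%N; last by rewrite mul0r.
rewrite (GD_lt _ h1) ?mul0r //; have := re_hg re t; move: nt; rewrite ht /=; lia.
Qed.

(** If the row T had no scalar entry, then \sum_p dd T p (x) \sum_q dd p q (x)
dd q bot would be a linear syzygy. *)
Lemma cubic_row_scalar T : no_linear_syzygy e -> h T = 3 -> g T = 3 ->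
  exists p, [/\ h p = 2%N, g p = 3 & dd T p != 0].
Proof.
move=> nls hT gT; apply: NNPP => nex.
have ex0 p : h p = 2%N -> g p = 3 -> dd T p = 0.
  by move=> hp gp; apply/eqP; apply: contra_notT nex => nz; exists p.
have [ie Ge spe] := degree1_basis.
pose P p := (h p == 2%N) && (g p == 2%N).
have ddT0 p : ~~ P p -> dd T p = 0.
  move=> np; have [h1 h2] := re_dd re T p; rewrite hT gT !addn0 in h1 h2.
  have [hp|ne] := eqVneq (h p) 2%N; last by apply: h2; lia.
  have := re_hg re p; rewrite hp => le; have [gp|ne] := eqVneq (g p) 3; first exact: ex0.
  by apply: (GD_lt _ h1); move: np; rewrite /P hp eqxx /=; lia.
have [C hC] : exists C : 'I_N -> Q -> K, forall p, P p -> dd T p = \sum_i C p i *: e i.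
  apply: (fchoice (P := fun p c => P p -> dd T p = \sum_i c i *: e i)) => p.
  case: (boolP (P p)) => [/andP[_ /eqP gp]|_]; last by exists (fun=> 0).
  have := ddG T p; rewrite gT gp => /(GDE G (d := 1) (erefl _))/spe[c ->].
  by exists c.
have [E hE] : exists E : 'I_N -> Q -> Q -> K, forall p, P p -> forall q,
    dd p (val q) = \sum_j E p q j *: e j.
  apply: (fchoice (P := fun p c => P p -> forall q, dd p (val q) = \sum_j c q j *: e j)) => p.
  case: (boolP (P p)) => [/andP[_ /eqP gp]|_]; last by exists (fun _ _ => 0).
  have [c hc] : exists c : Q -> Q -> K, forall q, dd p (val q) = \sum_j c q j *: e j.
    apply: (fchoice (P := fun q c => dd p (val q) = \sum_j c j *: e j)) => q.
    have := ddG p (val q); case/andP: (valP q) => _ /eqP ->.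
    by rewrite gp => /(GDE G (d := 1) (erefl _))/spe.
  by exists c.
pose r i : 'rV[A]_N := \row_p (if P p then (C p i)%:A else 0).
have rdd i z : (r i *m dd) 0 z = \sum_(p | P p) C p i *: dd p z.
  rewrite mxE [RHS]big_mkcond; apply: eq_bigr => p _; rewrite mxE.
  by case: ifP => _; rewrite ?mul0r // mulr_algl.
have rQ i (q : Q) : (r i *m dd) 0 (val q) = \sum_j (\sum_(p | P p) C p i * E p q j) *: e j.
  rewrite rdd; transitivity (\sum_(p | P p) \sum_j (C p i * E p q j) *: e j).
    by apply: eq_bigr => p Pp; rewrite hE // scaler_sumr; apply: eq_bigr => j _; rewrite scalerA.
  by rewrite exchange_big; apply: eq_bigr => j _; rewrite scaler_suml.
have sqT z : \sum_(p | P p) dd T p * dd p z = 0.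
  have /matrixP/(_ T z) := re_sq re; rewrite !mxE => e0; rewrite -[RHS]e0.
  by rewrite big_mkcond; apply: eq_bigr => p _; case: ifP => // /negbT/ddT0 ->; rewrite mul0r.
have rnQ i z : ~~ ((h z == 1%N) && (g z == 1%N)) -> (r i *m dd) 0 z = 0.
  move=> nz; rewrite rdd.
  have [hz|nhz] := eqVneq (h z) 1%N; last first.
    rewrite big1 // => p /andP[/eqP hp _]; have [_ h1] := re_dd re p z.
    by rewrite h1 ?scaler0 // hp; lia.
  have gz1 : g z <> 1%N by move: nz; rewrite hz /=; lia.
  have [gz|ngz] := eqVneq (g z) 2%N; last first.
    rewrite big1 // => p /andP[_ /eqP gp]; have := ddG p z; rewrite gp => h1.
    by rewrite (GD_lt _ h1) ?scaler0 //; have := re_hg re z; lia.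
  have [s hs] : exists s : 'I_N -> K, forall p, P p -> dd p z = (s p)%:A.
    apply: (fchoice (P := fun p c => P p -> dd p z = c%:A)) => p.
    case: (boolP (P p)) => [/andP[_ /eqP gp]|_]; last by exists 0.
    by have := ddG p z; rewrite gp gz => /(GDnnP gr)[c ->]; exists c.
  have z0 : forall j, \sum_(p | P p) C p j * s p = 0.
    apply: ie; rewrite -[RHS](sqT z).
    transitivity (\sum_(p | P p) \sum_j (C p j * s p) *: e j).
      by rewrite exchange_big; apply: eq_bigr => j _; rewrite scaler_suml.
    apply: eq_bigr => p Pp; rewrite hC // hs // mulr_algr scaler_sumr.
    by apply: eq_bigr => j _; rewrite scalerA mulrC.
  rewrite -[RHS](scale0r (1 : A)) -(z0 i) scaler_suml; apply: eq_bigr => p Pp.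
  by rewrite hs // scalerA.
have t0 : forall i j q, \sum_(p | P p) C p i * E p q j = 0.
  apply: (nls (fun i j q => \sum_(p | P p) C p i * E p q j)); split=> [q|i].
    rewrite -[RHS](sqT (val q)).
    transitivity (\sum_i \sum_j \sum_(p | P p) (C p i * E p q j) *: (e i * e j)).
      by do 2 (apply: eq_bigr => ? _); rewrite scaler_suml.
    under eq_bigr => i _ do rewrite exchange_big /=.
    rewrite exchange_big /=; apply: eq_bigr => p Pp; rewrite hC // hE // mulr_suml.
    apply: eq_bigr => i _; rewrite mulr_sumr; apply: eq_bigr => j _.
    by rewrite -scalerAl -scalerAr scalerA.
  have : (r i *m dd *m dd) 0 bot = 0 by rewrite -mulmxA (re_sq re) mulmx0 mxE.
  rewrite mxE (bigID (fun q => (h q == 1%N) && (g q == 1%N))) /= [X in _ + X]big1 ?addr0; last first.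
    by move=> z /(rnQ i) ->; rewrite mul0r.
  rewrite sum_subtype => rz; rewrite -[RHS]rz exchange_big; apply: eq_bigr => q _.
  rewrite rQ mulr_suml; apply: eq_bigr => j _.
  by rewrite -scalerAl.
have r0 i : r i = 0.
  apply: (exact_low (D := 2) (k := 2)) => //.
    move=> p; rewrite mxE; case: ifP => [/andP[/eqP -> /eqP ->]|_]; split=> //.
      exact: GDnn.
    exact: GD0.
  apply/rowP => z; rewrite [RHS]mxE.
  case: (boolP ((h z == 1%N) && (g z == 1%N))) => [qz|/rnQ -> //].
  have := rQ i (exist _ z qz); rewrite /= => ->.
  by rewrite big1 // => j _; rewrite t0 scale0r.
have rowT0 : row T dd = 0.
  apply/rowP => p; rewrite !mxE; case: (boolP (P p)) => [Pp|/ddT0 //].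
  rewrite hC // big1 // => i _; have /rowP/(_ p) := r0 i; rewrite !mxE Pp.
  by move/alg_inj0 ->; rewrite scale0r.
have /rowP/(_ T) : (1 : A) *: delta_mx 0 T = 0 :> 'rV[A]_N.
  apply: (exact_low (D := 3) (k := 3)) => //; last by rewrite delta_mulmx rowT0 scaler0.
  apply: (hrow_delta hT); rewrite gT -[X in GD _ _ _ X]scale1r; exact: GDnn.
by rewrite !mxE !eqxx mulr1 => /eqP; rewrite oner_eq0.
Qed.

(** The cocycle is the coordinate at z of an expansion over the row entries
dd s bot: it is well defined if no scalar entry cancels z, and it vanishes on
products, whose expansions have no scalar coordinates. *)
Lemma column_cocycle1 z : h z = 1%N ->
  (forall T, h T = 2%N -> g T = g z -> dd T z = 0) ->
  exists2 zeta, cocycle1 G (g z) zeta & exists2 a, G (g z) a & zeta a = 1.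
Proof.
move=> hz col0; set k := g z; have k0 : (0 < k)%N by apply: (re_gpos re); rewrite -(re_bot re) hz.
pose rep a (w : 'rV[A]_N) := hrow G h g k 1 w /\ a *: delta_mx 0 bot = w *m dd.
have uniq a w w' : rep a w -> rep a w' -> w 0 z = w' 0 z.
  move=> [hw wE] [hw' wE']; have [|||u hu uE] := re_left re (v := w - w') (D := k) (k := 1%N).
  - by move=> //; apply: (hrowD gr) => //; apply: hrowN.
  - by rewrite orbT.
  - by rewrite mulmxBl -wE -wE' subrr.
  apply/eqP; rewrite -subr_eq0; have /rowP/(_ z) := uE; rewrite !mxE => ->.
  rewrite big1 // => T _; have [h1 h2] := hu T.
  have [hT|/eqP/h2->] := eqVneq (h T) 2%N; last by rewrite mul0r.
  have [lt|gt|eq] := ltngtP (g T) k.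
  - by have := ddG T z => h3; rewrite (GD_lt lt h3) mulr0.
  - by rewrite (GD_lt gt h1) mul0r.
  by rewrite col0 ?mulr0.
have ex a : exists wc : 'rV[A]_N * K, G k a -> rep a wc.1 /\ wc.1 0 z = (wc.2)%:A.
  case: (excluded_middle_informative (G k a)) => [ga|nga]; last by exists (0, 0).
  have [w hw wE] := bot_expansion k0 ga; have [h1 _] := hw z.
  by have [c wz] := GDnnP gr h1; exists (w, c).
have [F hF] := fchoice ex; pose zeta a := (F a).2.
have zE a w c : G k a -> rep a w -> w 0 z = c%:A -> zeta a = c.
  move=> ga ha wz; have [h1 h2] := hF a ga.
  apply/eqP; rewrite -subr_eq0; apply/eqP; apply: (@alg_inj0 K A).
  by rewrite scalerBl -h2 -wz (uniq _ _ _ ha h1) subrr.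
exists zeta.
  split=> [c a b ga gb|i j a b i0 j0 ij ga gb].
    have [[h1 h2] h3] := hF a ga; have [[h4 h5] h6] := hF b gb.
    apply: (zE _ (c%:A *: (F a).1 + (F b).1)).
    - by have [_ hh] := gr_sub gr k; apply: hh.
    - split; last by rewrite mulmxDl -scalemxAl -h2 -h5 scalerA mulr_algl -scalerDl.
      apply: (hrowD gr) => // t; rewrite !mxE mulr_algl; have [k1 k2] := h1 t; split.
        by apply: subspaceZ => //; apply: subspaceGD.
      by move/k2 ->; rewrite scaler0.
    by rewrite !mxE h3 h6 mulr_algl scalerA -scalerDl.
  have gab : G k (a * b) by rewrite -ij; apply: (gr_mul gr).
  have [w hw wE] := bot_expansion j0 gb; apply: (zE _ (a *: w)) => //.
    split; last by rewrite -scalemxAl -wE scalerA.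
    move=> t; rewrite mxE; have [h1 h2] := hw t; split; last by move/h2->; rewrite mulr0.
    by apply: (GDM gr (n := j)); rewrite // -ij /GD leq_addl addnK.
  rewrite mxE; have [h1 _] := hw z; rewrite (GD_lt _ h1) ?mulr0 ?scale0r //.
  by rewrite -/k; lia.
have gz : G k (dd z bot) by have := ddG z bot; rewrite (re_gbot re) GDn0.
exists (dd z bot) => //; apply: (zE _ (1 *: delta_mx 0 z)) => //; last first.
  by rewrite !mxE !eqxx mulr1 scale1r.
split.
  apply: (hrow_delta hz); rewrite -[1]scale1r; exact: GDnn.
rewrite delta_mulmx scale1r; apply/rowP => t; rewrite !mxE eqxx /=.
have [->|nt] := eqVneq t bot; first by rewrite mulr1.
rewrite mulr0; have [_ ->] := re_dd re z t => //.
by rewrite hz => /eqP; rewrite addn1 eqSS (re_bot re) (negPf nt).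
Qed.

End LowDegrees.

(** * Cup products *)

Lemma dependent (K : fieldType) (I J : finType) (F : J -> I -> K) : (#|I| < #|J|)%N ->
  exists c : J -> K, (exists j, c j != 0) /\ forall i, \sum_j c j * F j i = 0.
Proof.
move=> lt; apply: NNPP => nex.
pose V := {ffun I -> K^o}; pose f j : V := [ffun i => F j i].
pose e i : V := [ffun k => (k == i)%:R].
have ind : independent f.
  move=> c c0 j; apply/eqP; apply: contra_notT nex => nz.
  exists c; split; first by exists j.
  move=> i; have /ffunP/(_ i) := c0; rewrite sum_ffunE ffunE => h; rewrite -[RHS]h.
  by apply: eq_bigr => k _; rewrite !ffunE.
have : (#|J| <= #|I|)%N.
  apply: (steinitz (e := e) ind) => j; exists (F j); apply/ffunP => i.
  rewrite sum_ffunE ffunE (bigD1 i) //= !ffunE eqxx /GRing.scale /= mulr1 big1 ?addr0 //.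
  by move=> k ne; rewrite !ffunE eq_sym (negPf ne) /= /GRing.scale /= mulr0.
by rewrite leqNgt lt.
Qed.

Lemma basis_coordinates (K : fieldType) (V : lmodType K) (I : finType) (e : I -> V) S :
  subspace S -> basis e S -> exists mu : I -> V -> K,
    [/\ forall i, linear_on S (mu i), forall v, S v -> v = \sum_i mu i v *: e i
      & forall i j, mu i (e j) = (i == j)%:R].
Proof.
move=> hS [ie Se spe].
have ex v : exists c : I -> K, S v -> v = \sum_i c i *: e i.
  case: (excluded_middle_informative (S v)) => [/spe[c cE]|n]; last by exists (fun=> 0).
  by exists c.
have [F hF] := fchoice ex; exists (fun i v => F v i).
have uniq c d : \sum_i c i *: e i = \sum_i d i *: e i -> forall i, c i = d i.
  move=> h i; apply/eqP; rewrite -subr_eq0; apply/eqP; move: i.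
  apply: (ie (fun i => c i - d i)); under eq_bigr => i _ do rewrite scalerBl.
  by rewrite sumrB h subrr.
split=> //.
  move=> i c a b Sa Sb; apply: (uniq (F (c *: a + b)) (fun i => c * F a i + F b i)).
  rewrite -hF; last by have [_ h] := hS; apply: h.
  under eq_bigr => k _ do rewrite scalerDl -scalerA.
  by rewrite big_split -scaler_sumr /= -!hF.
move=> i j; apply: (uniq (F (e j)) (fun i => (i == j)%:R)); rewrite -hF //.
rewrite (bigD1 j) //= eqxx scale1r big1 ?addr0 // => k /negPf ->.
by rewrite scale0r.
Qed.

Section CupProducts.
Variable K : fieldType.

Lemma step_cocycle1_delta (R A : algType K) (iota : {lrmorphism R -> A})
    (sigma : {lrmorphism R -> R}) (delta : {linear R -> R}) (x : A) (e : nat) G G' k al r :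
  ore_step iota sigma delta x e G G' -> cocycle1 G' (e + k)%N al -> (0 < k)%N -> G k r ->
  al (iota (delta r)) = 0.
Proof.
move=> st c1 k0 gr_; have gr' := os_gr' st; have e0 := os_e st; case: (c1) => _ mul.
have gx := os_x st.
have : al (x * iota r) = 0 by apply: (mul e k) => //; apply: (os_iota st).
rewrite (os_comm st) (cocycle1D c1); first 1 last.
- rewrite addnC; apply: (gr_mul gr') => //; apply: (os_iota st); exact: (os_sig st).
- by apply: (os_iota st); apply: (os_del st).
rewrite (mul k e) ?add0r //; first exact: addnC.
by apply: (os_iota st); apply: (os_sig st).
Qed.

(** A degree k+1 primitive f of the cup product eta u mu.  At the step where
eta is new, the relation x r = sigma(r) x + delta(r) forces mu = 0 on the
variables before it, at a later step of degree one it forces mu x = 0, provided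
that f vanishes on delta(r); zeta serves to ensure this. *)
Lemma cup_not_exact (R : algType K) (H : nat -> R -> Prop) es k eta mu f :
  tower H es -> (1 < k)%N -> (count_mem k.+1 es <= 1)%N ->
  (k.+1 \in es -> exists2 zeta, cocycle1 H k.+1 zeta & exists2 a, H k.+1 a & zeta a != 0) ->
  cocycle1 H k eta -> (exists2 a, H k a & eta a != 0) ->
  linear_on (H 1%N) mu -> linear_on (H k.+1) f ->
  (forall a b, H k a -> H 1%N b -> f (a * b) = eta a * mu b) ->
  (forall i j a b, (0 < i)%N -> (1 < j)%N -> (i + j)%N = k.+1 -> H i a -> H j b ->
    f (a * b) = 0) ->
  forall a, H 1%N a -> mu a = 0.
Proof.
move=> tw k1; elim: tw eta mu f => {R H es} [|R A i s d x e H G es tw IH st] eta mu f.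
  move=> _ _ _ _ lmu _ _ _ a [->|//].
  exact: (linear_on0 (gr_sub (base_graded K) 1%N) lmu).
rewrite -cats1 count_cat /= addn0 cats1 => le hz c1 [a0 ga0 nz] lmu lf f1 f2 a ga.
have gr := os_gr st; have gr' := os_gr' st; have e0 := os_e st; have iG := os_iota st.
have gx := os_x st.
pose f' r := f (i r); pose mu' r := mu (i r); pose eta' r := eta (i r).
have c1' : cocycle1 H k eta' := cocycle1_restrict st c1.
have lmu' : linear_on (H 1%N) mu'.
  by move=> c u v hu hv; rewrite /mu' linearD linearZ lmu //; apply: iG.
have lf' : linear_on (H k.+1) f'.
  by move=> c u v hu hv; rewrite /f' linearD linearZ lf //; apply: iG.
have hz' : k.+1 \in es -> e != k.+1 /\
    exists2 zeta, cocycle1 G k.+1 zeta & exists2 r, H k.+1 r & zeta (i r) != 0.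
  move=> kes; have ne : e != k.+1.
    apply: contraL kes => /eqP ek; rewrite -has_pred1 has_count -leqNgt.
    by move: le; rewrite ek eqxx /= addn1 ltnS.
  split=> //; have [|zeta cz [b gb nzb]] := hz _.
    by rewrite mem_rcons inE kes orbT.
  exists zeta => //; have [r [t [hr t0 h]]] := step_cocycle1E st gb.
  by exists r => //; move: nzb; rewrite h // t0 // mul0r addr0.
(* a cocycle on R of degree k+1 is a multiple of zeta, which vanishes on
   delta(r) because it extends to A *)
have claim : cocycle1 H k.+1 f' -> forall m r, (0 < m)%N -> (e + m)%N = k.+1 -> H m r ->
    f' (d r) = 0.
  move=> cf m r m0 em hr; have hdr : H k.+1 (d r) by rewrite -em; apply: (os_del st).
  case: (boolP (k.+1 \in es)) => [kes|nes]; last by apply: (tower_cocycle1_zero tw _ nes cf).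
  have [ne [zeta cz [b hb nzb]]] := hz' kes.
  have [||c hc] := tower_cocycle1_line tw _ _ cf (cocycle1_restrict st cz) hb nzb => //.
    exact: leq_trans (leq_addr _ _) le.
  rewrite hc // (step_cocycle1_delta st (k := m)) ?mulr0 //; first by rewrite em.
have f1' r q : H k r -> H 1%N q -> f' (r * q) = eta' r * mu' q.
  by move=> hr hq; rewrite /f' rmorphM f1 //; apply: iG.
have f2' i' j r q : (0 < i')%N -> (1 < j)%N -> (i' + j)%N = k.+1 -> H i' r -> H j q ->
    f' (r * q) = 0.
  by move=> i0 j1 ij hr hq; rewrite /f' rmorphM (f2 i' j) //; apply: iG.
have cf' : (forall r q, H k r -> H 1%N q -> eta' r * mu' q = 0) -> cocycle1 H k.+1 f'.
  move=> z; split=> // i' j r q i0 j0 ij hr hq.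
  have [j1|j1] := eqVneq j 1%N; last by apply: (f2' i' j) => //; lia.
  rewrite j1 in ij hq; have ik : i' = k by move: ij; rewrite addn1 => -[].
  by rewrite ik in hr; rewrite f1' // z.
have [r [t [hr t0 aE]]] := step_degree1 st ga.
have muE : mu a = mu' r + t * mu x.
  have [e1|ne] := eqVneq e 1%N; last by rewrite aE t0 // scale0r addr0 mul0r addr0.
  rewrite aE addrC lmu //; first by rewrite addrC.
    by rewrite -e1.
  exact: iG.
(* if eta does not vanish on R, then mu does by induction and only x
   remains; otherwise x is the variable detected by eta *)
have [[r0 hr0 nz0]|none] := classic (exists2 r, H k r & eta' r != 0).
  have mu0 q : H 1%N q -> mu' q = 0.
    apply: (IH eta' mu' f') => //; first exact: leq_trans (leq_addr _ _) le.
      move=> kes; have [ne [zeta cz [b hb nzb]]] := hz' kes.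
      by exists (fun r => zeta (i r)); [exact: (cocycle1_restrict st cz) | exists b].
    by exists r0.
  rewrite muE mu0 // add0r; have [e1|/t0 ->] := eqVneq e 1%N; last by rewrite mul0r.
  have cf : cocycle1 H k.+1 f' by apply: cf' => u v _ hv; rewrite mu0 // mulr0.
  have [r1 hr1 sr1] := os_sig_onto st hr0; rewrite -sr1 in nz0.
  rewrite e1 in gx.
  have : f (x * i r1) = 0 by apply: (f2 1%N k) => //; apply: iG.
  have hs : G k (i (s r1)) by apply: iG; rewrite sr1.
  rewrite (os_comm st) (linear_onD lf); first 1 last.
  - by rewrite -addn1; apply: (gr_mul gr').
  - by apply: iG; rewrite -add1n -e1; apply: (os_del st).
  rewrite f1 // -/(f' _) (claim cf k) ?addr0 //; [|lia|by rewrite e1].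
  by move/eqP; rewrite mulf_eq0 (negPf nz0) => /eqP ->; rewrite mulr0.
have z r1 : H k r1 -> eta' r1 = 0.
  by move=> h1; apply/eqP; apply: contra_notT none => nz1; exists r1.
have cf : cocycle1 H k.+1 f' by apply: cf' => u v hu _; rewrite z // mul0r.
have [u [t' [hu t'0 a0E]]] := step_cocycle1E st ga0.
rewrite a0E // -/(eta' u) z // add0r in nz.
have ek : e = k by apply/eqP; apply: contraNT nz => /t'0 ->; rewrite mul0r.
rewrite mulf_eq0 negb_or in nz; case/andP: nz => _ nzx.
have hk : G k x by rewrite -ek.
have m1 : mu' r = 0.
  have hi := iG _ _ hr.
  have : f (x * i r) = eta x * mu' r by apply: f1.
  have hs : G 1%N (i (s r)) by apply: iG; apply: (os_sig st).
  rewrite (os_comm st) (linear_onD lf); first 1 last.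
  - by rewrite -add1n; apply: (gr_mul gr').
  - by apply: iG; rewrite -addn1 -ek; apply: (os_del st).
  rewrite (f2 1%N k) // -/(f' _) (claim cf 1%N) ?addr0 //; last by rewrite ek addn1.
  by move/esym/eqP; rewrite mulf_eq0 (negPf nzx) => /eqP.
by rewrite muE m1 t0 ?mul0r ?addr0 // ek; lia.
Qed.

Variables (R : algType K) (H : nat -> R -> Prop).
Hypothesis gr : graded H.

(** The product zeta u mu.  It is given as a function on pairs of homogeneous
elements by extending zeta and mu by 0 to the other degrees. *)
Lemma cup_product k zeta mu : (0 < k)%N -> cocycle1 H k zeta -> linear_on (H 1%N) mu ->
  exists2 cup, cocycle2 H k.+1 cup & forall i j a b, (0 < i)%N -> (0 < j)%N ->
    (i + j)%N = k.+1 -> H i a -> H j b -> cup a b = if i == k then zeta a * mu b else 0.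
Proof.
move=> k0 cz lmu; have [comp [lin hom GC _ _]] := graded_components gr.
have compl d : comp d 0 = 0 by have := hom d d 0 (gr0 gr d); rewrite eqxx.
have z0 := cocycle1_0 gr cz; have m0 := linear_on0 (gr_sub gr 1%N) lmu.
pose cup a b := zeta (comp k a) * mu (comp 1%N b).
have cupE i j a b : H i a -> H j b -> cup a b =
    if (i == k) && (j == 1%N) then zeta a * mu b else 0.
  move=> ha hb; rewrite /cup (hom _ _ _ ha) (hom _ _ _ hb) [k == i]eq_sym [1%N == j]eq_sym.
  by case: (i == k) => /=; [case: (j == 1%N); rewrite ?m0 ?mulr0 | rewrite z0 mul0r].
exists cup; last first.
  move=> i j a b i0 j0 ij ha hb; rewrite (cupE i j) //.
  by case: (eqVneq i k) => //= ik; have -> : j = 1%N by lia.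
split.
- move=> i j b i0 j0 ij hb c a a' ha ha'; rewrite /cup lin.
  case: cz => lz _; rewrite lz; [by rewrite mulrDl mulrA | exact: GC | exact: GC].
- move=> i j a i0 j0 ij ha c b b' hb hb'; rewrite /cup lin lmu; try exact: GC.
  by rewrite mulrDr mulrCA.
move=> i j l a b c i0 l0 ijl ha hb hc.
have hab : H (i + j)%N (a * b) by apply: (gr_mul gr).
have hbc : H (j + l)%N (b * c) by apply: (gr_mul gr).
rewrite (cupE _ _ _ _ hab hc) (cupE _ _ _ _ ha hbc).
have [j0|jpos] := posnP j.
  rewrite j0 addn0 add0n; case: ifP => // /andP[/eqP ik /eqP l1].
  rewrite j0 in hb; have [t ->] := (gr_scal gr b).1 hb.
  rewrite -scalerAr -scalerAl mulr1 mul1r (cocycle1Z gr _ cz) -?ik //.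
  by rewrite (linear_onZ (gr_sub gr 1%N) lmu) -?l1 // mulrCA mulrA.
have -> : (i == k) && (j + l == 1)%N = false by lia.
case: ifP => // /andP[/eqP ijk _]; case: cz => _ mul.
by rewrite (mul i j) // mul0r.
Qed.

End CupProducts.

(** * The second cohomology of towers of length five *)

Section Step.
Variables (K : fieldType) (R A : algType K) (iota : {lrmorphism R -> A}).
Variables (sigma : {lrmorphism R -> R}) (delta : {linear R -> R}) (x : A).
Variables (H : nat -> R -> Prop) (G : nat -> A -> Prop).
Hypothesis st : ore_step iota sigma delta x 1 H G.

Let gr := os_gr st.
Let gr' := os_gr' st.

Lemma cocycle2_restrict d th : cocycle2 G d th -> cocycle2 H d (fun r q => th (iota r) (iota q)).
Proof.
move=> c2; split.
- move=> i j b i0 j0 ij hb c a a' ha ha'; rewrite linearD linearZ /=.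
  by apply: (c2_l c2 i0 j0 ij); apply: (os_iota st).
- move=> i j a i0 j0 ij ha c b b' hb hb'; rewrite linearD linearZ /=.
  by apply: (c2_r c2 i0 j0 ij); apply: (os_iota st).
move=> i j k a b c i0 k0 ijk ha hb hc; rewrite !rmorphM.
by apply: (c2_assoc c2 i0 k0 ijk); apply: (os_iota st).
Qed.

Lemma step_linear_extend d phi psi : linear_on (H d) phi -> linear_on (GD G d 1) psi ->
  exists2 f, linear_on (G d) f & forall r b, H d r -> GD G d 1 b -> f (iota r + b * x) = phi r + psi b.
Proof.
move=> lphi lpsi; have ex a : exists rb : R * A, G d a ->
    [/\ H d rb.1, GD G d 1 rb.2 & a = iota rb.1 + rb.2 * x].
  case: (excluded_middle_informative (G d a)) => [/(os_decl st)[r [b hrb]]|n].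
    by exists (r, b).
  by exists (0, 0).
have [F hF] := fchoice ex; pose f a := phi (F a).1 + psi (F a).2.
have sGD := subspaceGD gr' d 1.
have gx : G 1%N x := os_x st.
have mem r b : H d r -> GD G d 1 b -> G d (iota r + b * x).
  move=> hr hb; apply: (grD gr'); first exact: (os_iota st).
  by apply/GDn0; apply: (GDM gr' hb); rewrite GDn0.
have fE r b : H d r -> GD G d 1 b -> f (iota r + b * x) = phi r + psi b.
  move=> hr hb; have [h1 h2 /esym/(step_uniql st)[h3 h4]] := hF _ (mem _ _ hr hb).
  by rewrite /f h3 h4.
exists f => // c a a' ga ga'; have [h1 h2 aE] := hF _ ga; have [h3 h4 aE'] := hF _ ga'.
have h5 : H d (c *: (F a).1 + (F a').1) by have [_ hh] := gr_sub gr d; apply: hh.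
have h6 : GD G d 1 (c *: (F a).2 + (F a').2) by have [_ hh] := sGD; apply: hh.
have -> : c *: a + a' = iota (c *: (F a).1 + (F a').1) + (c *: (F a).2 + (F a').2) * x.
  by rewrite {1}aE {1}aE' scalerDr linearD linearZ mulrDl -scalerAl; addac.
by rewrite fE // lphi // lpsi // /f mulrDr; addac.
Qed.

(** Cocycles on A extending tau, normalised so as to be determined by tau and by
r |-> th x r. *)
Record normal2 (d : nat) (tau : R -> R -> K) (th : A -> A -> K) : Prop := Normal2 {
  n2_cocycle : cocycle2 G d th;
  n2_base : forall i j r q, (0 < i)%N -> (0 < j)%N -> (i + j)%N = d -> H i r -> H j q ->
    th (iota r) (iota q) = tau r q;
  n2_x : forall b, G d.-1 b -> th b x = 0 }.

Lemma normal2_sum (J : finType) (c : J -> K) (F : J -> A -> A -> K) d :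
  (forall j, normal2 d (fun _ _ => 0) (F j)) ->
  normal2 d (fun _ _ => 0) (fun a b => \sum_j c j * F j a b).
Proof.
move=> hF; split.
- by apply: cocycle2_sum => j; case: (hF j).
- move=> i j r q i0 j0 ij hr hq; rewrite big1 // => k _.
  by rewrite (n2_base (hF k) i0 j0 ij) // mulr0.
by move=> b hb; rewrite big1 // => k _; rewrite (n2_x (hF k)) // mulr0.
Qed.

(** Subtract the coboundary of a function equal to phi on R and to
b |-> th(b,x) on the multiples b x. *)
Lemma step_normal d th tau phi : (1 < d)%N -> cocycle2 G d th -> linear_on (H d) phi ->
  (forall i j r q, (0 < i)%N -> (0 < j)%N -> (i + j)%N = d -> H i r -> H j q ->
    th (iota r) (iota q) = tau r q + phi (r * q)) ->
  exists th' f, [/\ normal2 d tau th', linear_on (G d) f &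
    forall i j a b, (0 < i)%N -> (0 < j)%N -> (i + j)%N = d -> G i a -> G j b ->
      th a b = th' a b + f (a * b)].
Proof.
move=> d1 c2 lphi hth; have gx : G 1%N x := os_x st.
have dd : d = (d.-1 + 1)%N by lia.
have GDd b : GD G d 1 b <-> G d.-1 b by apply: GDE.
have lx : linear_on (G d.-1) (th^~ x) by apply: (c2_l c2 _ _ _ gx); lia.
have [|f lf fE] := step_linear_extend lphi (psi := th^~ x).
  by move=> c a a' /GDd ha /GDd ha'; apply: lx.
exists (fun a b => th a b - f (a * b)), f; split=> //; last first.
  by move=> *; rewrite subrK.
have Gdp i j a b : (i + j)%N = d -> G i a -> G j b -> G d (a * b).
  by move=> <-; apply: (gr_mul gr').
split.
- split.
  + move=> i j b i0 j0 ij hb c a a' ha ha'; rewrite (c2_l c2 i0 j0 ij hb) //.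
    rewrite mulrDl -scalerAl lf; try exact: Gdp ij _ hb.
    by rewrite mulrBr opprD; addac.
  + move=> i j a i0 j0 ij ha c b b' hb hb'; rewrite (c2_r c2 i0 j0 ij ha) //.
    rewrite mulrDr -scalerAr lf; try exact: Gdp ij ha _.
    by rewrite mulrBr opprD; addac.
  move=> i j k a b c i0 k0 ijk ha hb hc.
  by rewrite (c2_assoc c2 i0 k0 ijk) // mulrA.
- move=> i j r q i0 j0 ij hr hq; rewrite (hth i j) //.
  have -> : iota r * iota q = iota (r * q) + 0 * x by rewrite rmorphM mul0r addr0.
  rewrite fE; last exact: GD0.
    by rewrite (linear_on0 (gr_sub gr' d.-1) lx) addr0 addrK.
  by rewrite -ij; apply: (gr_mul gr).
move=> b hb; have -> : b * x = iota 0 + b * x by rewrite rmorph0 add0r.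
rewrite fE; [|exact: gr0|exact/GDd].
by rewrite (linear_on0 (gr_sub gr d) lphi) add0r subrr.
Qed.

Section Normal.
Variables (d : nat) (tau : R -> R -> K) (th : A -> A -> K).
Hypothesis n2 : normal2 d tau th.

Let D r := th x (iota r).

Lemma normal2_defect_linear : (1 < d)%N -> linear_on (H d.-1) D.
Proof.
move=> d1 c r q hr hq; rewrite /D linearD linearZ /=.
have lx : linear_on (G d.-1) (th x).
  by apply: (c2_r (n2_cocycle n2) (i := 1%N)) (os_x st); lia.
by apply: lx; apply: (os_iota st).
Qed.

(** Associativity of th on the triple x, r, q, after rewriting x r as
sigma(r) x + delta(r). *)
Lemma normal2_defect i j r q : (0 < i)%N -> (0 < j)%N -> (1 + i + j)%N = d -> H i r -> H j q ->
  D (r * q) = tau (delta r) q + tau (sigma r) (delta q).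
Proof.
move=> i0 j0 ij hr hq; have c2 := n2_cocycle n2; have gx : G 1%N x := os_x st.
have [hir hiq] := (os_iota st hr, os_iota st hq).
have hsr := os_iota st (os_sig st hr); have hsq := os_iota st (os_sig st hq).
have [hdr hdq] := (os_del st hr, os_del st hq).
rewrite /D rmorphM -(c2_assoc c2 (i := 1%N) (j := i) (k := j)) // (os_comm st).
rewrite (linear_onD (c2_l c2 (i := (1 + i)%N) (j := j) _ j0 ij hiq)); first 1 last.
- by rewrite //.
- by rewrite addnC; apply: (gr_mul gr').
- exact: (os_iota st hdr).
rewrite (n2_base n2 _ j0 ij hdr hq) // addrC; congr (_ + _).
rewrite (c2_assoc c2 (i := i) (j := 1%N) (k := j)) //; last by lia.
rewrite (os_comm st).
rewrite (linear_onD (c2_r c2 (i := i) (j := (1 + j)%N) i0 _ _ hsr)) //; first 1 last.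
- by rewrite addnCA addnA.
- by rewrite addnC; apply: (gr_mul gr').
- exact: (os_iota st hdq).
rewrite -(c2_assoc c2 (i := i) (j := j) (k := 1%N)) //; last by lia.
rewrite (n2_x n2) ?add0r; first by apply: (n2_base n2 i0 _ _ (os_sig st hr) hdq); lia.
have -> : d.-1 = (i + j)%N by lia.
exact: (gr_mul gr').
Qed.

(** Powers of x are moved to the right end of the second argument, where th
vanishes, and to the left end of the first one, where the defect
r |-> th(x,r) does. *)
Lemma normal2_zero : (1 < d)%N -> (forall r q, tau r q = 0) -> (forall r, H d.-1 r -> D r = 0) ->
  forall i j a b, (0 < i)%N -> (0 < j)%N -> (i + j)%N = d -> G i a -> G j b -> th a b = 0.
Proof.
move=> d1 tau0 D0 i j a b i0 j0 ij ga gb; have c2 := n2_cocycle n2; have gx : G 1%N x := os_x st.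
have dec k c : (0 < k)%N -> G k c -> exists r b, [/\ H k r, G k.-1 b & c = iota r + b * x].
  move=> k0 /(os_decl st)[r [e [hr he ->]]]; exists r, e; split=> //.
  by apply/(GDE G (m := k) (n := 1%N)); first lia.
have decr k c : (0 < k)%N -> G k c -> exists r b, [/\ H k r, G k.-1 b & c = iota r + x * b].
  move=> k0 /(os_decr st)[r [e [hr he ->]]]; exists r, e; split=> //.
  by apply/(GDE G (m := k) (n := 1%N)); first lia.
have right k l c e : (0 < k)%N -> (0 < l)%N -> (k + l)%N = d -> G k c -> G l e ->
    exists2 r, H l r & th c e = th c (iota r).
  move=> k0 l0 kl gc /(dec _ _ l0)[r [e' [hr he' ->]]]; exists r => //.
  rewrite (linear_onD (c2_r c2 k0 l0 kl gc)); last first.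
  - by rewrite -(prednK l0) -addn1; apply: (gr_mul gr').
  - exact: (os_iota st).
  rewrite -(c2_assoc c2 (i := k) (j := l.-1) (k := 1%N)) //; last by lia.
  rewrite (n2_x n2) ?addr0 //; have -> : d.-1 = (k + l.-1)%N by lia.
  exact: (gr_mul gr').
have thx c : G d.-1 c -> th x c = 0.
  move=> gc; have [r hr ->] := right 1%N d.-1 x c isT ltac:(lia) ltac:(lia) gx gc.
  exact: D0.
have [r hr ->] := right _ _ _ _ i0 j0 ij ga gb.
have gir := os_iota st hr; have [q [a' [hq ha' ->]]] := decr _ _ i0 ga.
rewrite (linear_onD (c2_l c2 i0 j0 ij gir)); last first.
- by rewrite -(prednK i0) -add1n; apply: (gr_mul gr').
- exact: (os_iota st).
rewrite (n2_base n2 i0 j0 ij) // tau0 add0r (c2_assoc c2 (i := 1%N) (j := i.-1) (k := j)) //.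
  apply: thx; rewrite (_ : d.-1 = (i.-1 + j)%N); last by clear -ij i0 j0; lia.
  exact: (gr_mul gr' ha' gir).
by lia.
Qed.
End Normal.

(** The restriction to R is the first obstruction to exactness.  When it is
exact, the second one is the class of r |-> th(x,r). *)
Lemma step_exact d th : (1 < d)%N -> cocycle2 G d th ->
  exact2 H d (fun r q => th (iota r) (iota q)) ->
  exists th' f, [/\ normal2 d (fun _ _ => 0) th', cocycle1 H d.-1 (fun r => th' x (iota r)),
    linear_on (G d) f & forall i j a b, (0 < i)%N -> (0 < j)%N -> (i + j)%N = d ->
      G i a -> G j b -> th a b = th' a b + f (a * b)].
Proof.
move=> d1 c2 [phi lphi hphi].
have [|th' [f [n2 lf thE]]] := step_normal (tau := fun _ _ => 0) d1 c2 lphi.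
  by move=> i j r q i0 j0 ij hr hq; rewrite add0r; apply: hphi i0 j0 ij hr hq.
exists th', f; split=> //; split; first exact: (normal2_defect_linear n2).
move=> i j r q i0 j0 ij hr hq; rewrite (normal2_defect n2 i0 j0 _ hr hq) ?addr0 //; lia.
Qed.

End Step.

Section CaseTwo.
Variables (K : fieldType) (R A : algType K) (iota : {lrmorphism R -> A}).
Variables (sigma : {lrmorphism R -> R}) (delta : {linear R -> R}) (x : A).
Variables (H : nat -> R -> Prop) (G : nat -> A -> Prop) (es : seq nat).
Hypothesis st : ore_step iota sigma delta x 1 H G.
Hypotheses (tw : tower H es) (pe : perm_eq es [:: 1; 1; 2; 3]%N).
Hypothesis gen : generated_in_degree_one G.

Let gr := os_gr st.
Let gr' := os_gr' st.

Lemma cells4 : [/\ size es = 4%N, sumn es = 7%N, cell_count es 2 3 = 2%N &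
  cell_count es 1 3 = 1%N].
Proof.
have /allP/(_ es) : all (fun s => [&& size s == 4%N, sumn s == 7%N, cell_count s 2 3 == 2%N &
    cell_count s 1 3 == 1%N]) (permutations [:: 1; 1; 2; 3]%N) by vm_compute.
by rewrite mem_permutations => /(_ pe)/and4P[/eqP ? /eqP ? /eqP ? /eqP ?].
Qed.

(** Without generators of degree three in R, the basis vector z of homological
degree one and internal degree three is cancelled by a scalar entry of the
resolution; this entry is a relation between the two contractions, so that H^2
in degree four is at most a line. *)
Lemma exact_pencil (F : 'I_2 -> R -> R -> K) :
  (forall zeta, cocycle1 H 3 zeta -> forall a, H 3 a -> zeta a = 0) ->
  (forall j, cocycle2 H 4 (F j)) ->
  exists c : 'I_2 -> K, (exists j, c j != 0) /\ exact2 H 4 (fun a b => \sum_j c j * F j a b).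
Proof.
move=> noz hF; have [N [h [g [dd [bot [top [re cnt]]]]]]] := tower_resolution tw.
have [sz sm c23 c13] := cells4; rewrite sz sm in re.
have [z /andP[/eqP hz /eqP gz]] : exists z, (h z == 1%N) && (g z == 3).
  by have /card_gt0P[z hz] : (0 < #|[pred s | (h s == 1%N) && (g s == 3)]|)%N;
    [rewrite cnt c13 | exists z].
have [T0 [hT0 gT0 nz]] : exists T, [/\ h T = 2%N, g T = 3 & dd T z != 0].
  apply: NNPP => nex; have [T hT|zeta cz [a ga]] := column_cocycle1 gr re hz.
    rewrite gz => gT; apply/eqP; apply: contra_notT nex => nz; by exists T.
  rewrite gz in cz ga; rewrite (noz _ cz _ ga) => /esym/eqP.
  by rewrite oner_eq0.
pose I := {t : 'I_N | [&& h t == 2%N, g t == 3 & t != T0]}.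
have cI : #|{: I}| = 1%N.
  rewrite card_sig; apply/eqP; rewrite -(eqn_add2l 1); apply/eqP.
  rewrite -[RHS]c23 -cnt [RHS](cardD1 T0) !inE hT0 gT0 eqxx; congr (_ + _)%N.
  by apply: eq_card => t; rewrite !inE [LHS]andbA [LHS]andbC.
have [|c [cnz c0]] := @dependent K I 'I_2 (fun j i => contraction g 7 dd top 4 (F j) (val i)).
  by rewrite cI card_ord.
exists c; split=> //; have c2 := cocycle2_sum c hF.
apply: (contraction_exact gr re c2) => // T hT gT.
have k0 T' : h T' = 2%N -> g T' = 3 -> T' != T0 ->
    contraction g 7 dd top 4 (fun a b => \sum_j c j * F j a b) T' = 0.
  move=> h2 g3 nT; rewrite contraction_sum.
  have hT' : [&& h T' == 2%N, g T' == 3 & T' != T0] by rewrite h2 g3 nT.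
  exact: c0 (exist _ T' hT').
have h2 : h T = 2%N by lia.
have g3 : g T = 3 by lia.
have [TT|/k0-> //] := eqVneq T T0.
have [||c' hc' rel] := contraction_relation gr re c2 (p := z); rewrite ?hz ?gz //.
move: rel; rewrite (bigD1 T0) /=; last by rewrite hT0 gT0 gz.
rewrite big1 ?addr0; last first.
  move=> T' /andP[/andP[/eqP h4 /eqP g4] nT]; rewrite k0 ?mulr0 //; first by lia.
  by rewrite g4.
rewrite -TT => /eqP; rewrite mulf_eq0 => /orP[|/eqP //].
by move: nz; rewrite hc' ?gT0 ?gz // -TT => nz0 /eqP z0; rewrite z0 scale0r eqxx in nz0.
Qed.

(** With a generator of degree three in R, all of H^2(R)_4 consists of cup
products zeta u mu, and these do not extend to A: as A is generated in degree
one, eta = zeta \o delta is a nonzero cocycle of degree two, and an extension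
would make eta u mu exact. *)
Lemma restriction_exact zeta th : cocycle1 H 3 zeta -> (exists2 a, H 3 a & zeta a != 0) ->
  cocycle2 G 4 th -> exact2 H 4 (fun r q => th (iota r) (iota q)).
Proof.
move=> cz [a0 ga0 nz0] c2; have [N [h [g [dd [bot [top [re cnt]]]]]]] := tower_resolution tw.
have [sz sm c23 c13] := cells4; rewrite sz sm in re.
have cm k : count_mem k es = count_mem k [:: 1; 1; 2; 3]%N by apply/permP.
(* A has no generators of degree two, so that zeta does not extend and zeta
   \o delta is nonzero *)
have ceta : cocycle1 H 2 (fun r => zeta (delta r)) by exact: (cocycle1_delta st _ cz).
have nzeta : exists2 a, H 2 a & zeta (delta a) != 0.
  apply: NNPP => nex; have [//|r|z' cz' zE] := cocycle1_extend st (k := 3) _ cz.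
    by move=> hr; apply/eqP; apply: contra_notT nex => nzr; exists r.
  move: nz0; rewrite -zE // (generated_cocycle1 gr' gen _ cz') ?eqxx //.
  exact: (os_iota st).
have [_ d1 _ _] := tower_dim tw; rewrite cm in d1.
have {d1} /dim_basis[f bf] : subspace_dim (H 1%N) 2 := d1.
have [mu [lmu vmu muf]] := basis_coordinates (gr_sub gr 1%N) bf.
have [cup hcup] : exists cup : 'I_2 -> R -> R -> K, forall s, cocycle2 H 4 (cup s) /\
    forall i j a b, (0 < i)%N -> (0 < j)%N -> (i + j)%N = 4%N -> H i a -> H j b ->
      cup s a b = if i == 3 then zeta a * mu s b else 0.
  apply: (fchoice (P := fun s cup => cocycle2 H 4 cup /\
    forall i j a b, (0 < i)%N -> (0 < j)%N -> (i + j)%N = 4%N -> H i a -> H j b ->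
      cup a b = if i == 3 then zeta a * mu s b else 0)) => s.
  by have [c h1 h2] := cup_product gr (k := 3) isT cz (lmu s); exists c.
have cupE s := (hcup s).2.
(* three cocycles, the two cup products and the restriction of th, with
   contractions in a plane *)
pose F (o : option 'I_2) := if o is Some s then cup s else fun r q => th (iota r) (iota q).
have hF o : cocycle2 H 4 (F o).
  by case: o => [s|] /=; [case: (hcup s) | apply: (cocycle2_restrict st)].
pose I := {t : 'I_N | (h t == 2%N) && (g t == 3)}.
have [|c [cnz c0]] := @dependent K I (option 'I_2) (fun o i => contraction g 7 dd top 4 (F o) (val i)).
  by rewrite card_option card_ord card_sig cnt c23.
have [phi lphi hphi] : exact2 H 4 (fun a b => \sum_o c o * F o a b).
  apply: (contraction_exact gr re (cocycle2_sum c hF)) => // T hT gT.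
  have hT' : (h T == 2%N) && (g T == 3) by apply/andP; split; apply/eqP; lia.
  by rewrite contraction_sum; apply: c0 (exist _ T hT').
pose m v := \sum_s c (Some s) * mu s v.
have lm : linear_on (H 1%N) m.
  move=> k a b ha hb; rewrite /m mulr_sumr -big_split; apply: eq_bigr => s _.
  by rewrite lmu // mulrDr mulrCA.
have mf s : m (f s) = c (Some s).
  rewrite /m (bigD1 s) //= muf eqxx mulr1 big1 ?addr0 // => t /negPf nt.
  by rewrite muf nt mulr0.
have sumo (E : option 'I_2 -> K) : \sum_o E o = E None + \sum_s E (Some s).
  rewrite (bigD1 None) //=; congr (_ + _).
  rewrite (reindex_omap Some id) /=; last by case.
  by apply: eq_bigl => s; rewrite eqxx.
have sumE i j a b : (0 < i)%N -> (0 < j)%N -> (i + j)%N = 4%N -> H i a -> H j b ->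
    phi (a * b) = c None * th (iota a) (iota b) + (if i == 3 then zeta a * m b else 0).
  move=> i0 j0 ij ha hb; rewrite -(hphi _ _ _ _ i0 j0 ij ha hb) sumo; congr (_ + _).
  under eq_bigr => s _ do rewrite /= (cupE s i j a b i0 j0 ij ha hb).
  case: ifP => _; last by rewrite big1 // => s _; rewrite mulr0.
  by rewrite /m mulr_sumr; apply: eq_bigr => s _; rewrite mulrCA.
(* a combination of the cup products alone is exact only if it is 0 *)
have [cN|nN] := eqVneq (c None) 0.
  have m0 : forall a, H 1%N a -> m a = 0.
    apply: (cup_not_exact (k := 3) tw (eta := zeta) (f := phi)) => //.
    - by rewrite cm.
    - by rewrite (perm_mem pe).
    - by exists a0.
    - by move=> a b ha hb; rewrite (sumE 3 1%N) // cN mul0r add0r.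
    move=> i j a b i0 j1 ij ha hb; rewrite (sumE i j) //; last by lia.
    by rewrite cN mul0r add0r; case: eqP => // i3; lia.
  case: cnz => [[s|]]; last by rewrite cN eqxx.
  by rewrite -mf m0 ?eqxx //; case: bf.
pose k := - (c None)^-1; pose tau r q := k * (\sum_s c (Some s) * cup s r q).
pose phi' r := (c None)^-1 * phi r; pose m' v := k * m v.
have lphi' : linear_on (H 4%N) phi'.
  by move=> t a b ha hb; rewrite /phi' lphi // mulrDr mulrCA.
have lm' : linear_on (H 1%N) m'.
  by move=> t a b ha hb; rewrite /m' lm // mulrDr mulrCA.
have tauE i j a b : (0 < i)%N -> (0 < j)%N -> (i + j)%N = 4%N -> H i a -> H j b ->
    tau a b = if i == 3 then zeta a * m' b else 0.
  move=> i0 j0 ij ha hb; rewrite /tau.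
  under eq_bigr => s _ do rewrite /= (cupE s i j a b i0 j0 ij ha hb).
  case: ifP => _; last by rewrite big1 ?mulr0 // => s _; rewrite mulr0.
  rewrite /m' mulrCA; congr (_ * _).
  by rewrite /m mulr_sumr; apply: eq_bigr => s _; rewrite mulrCA.
have thE i j r q : (0 < i)%N -> (0 < j)%N -> (i + j)%N = 4%N -> H i r -> H j q ->
    th (iota r) (iota q) = tau r q + phi' (r * q).
  move=> i0 j0 ij hr hq; rewrite (tauE i j) // /phi' (sumE i j) // mulrDr mulKf //.
  case: ifP => _; rewrite ?mulr0 ?addr0 ?add0r //.
  by rewrite /m' /k mulNr mulrN -mulrCA addrC -addrA subrr addr0 ?addrK.
have [th' [f' [n2 _ _]]] := step_normal (tau := tau) st (d := 4) isT c2 lphi' thE.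
(* the defect r |-> th'(x,r) is a primitive of the cup product of zeta \o
   delta and m' *)
have m'0 : forall a, H 1%N a -> m' a = 0.
  apply: (cup_not_exact (k := 2) tw (eta := fun r => zeta (delta r))
    (f := fun r => th' x (iota r))) => //.
  - by rewrite cm.
  - by move=> _; exists zeta => //; exists a0.
  - exact: (normal2_defect_linear st n2).
  - move=> a b ha hb; rewrite (normal2_defect st n2 (i := 2) (j := 1%N)) //.
    rewrite (tauE 3 1%N) //=; last exact: (os_del st ha).
    rewrite (tauE 2 2) //= ?addr0 //; first exact: (os_sig st).
    exact: (os_del st hb).
  move=> i j a b i0 j1 ij ha hb; have [i1 j2] : i = 1%N /\ j = 2%N by lia.
  rewrite i1 in ha; rewrite j2 in hb.
  rewrite (normal2_defect st n2 (i := 1%N) (j := 2)) // (tauE 2 2) //=; last exact: (os_del st ha).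
  rewrite (tauE 1%N 3) //= ?addr0 //; first exact: (os_sig st).
  exact: (os_del st hb).
exists phi' => // i j a b i0 j0 ij ha hb; rewrite (thE i j) // (tauE i j) //.
case: eqP => [i3|]; last by rewrite add0r.
by rewrite m'0 ?mulr0 ?add0r //; have <- : j = 1%N by lia.
Qed.

(** If R has a generator of degree three, the restrictions to R are exact and
the defects r |-> th(x,r) lie on a line.  Otherwise the restrictions lie on a
line, and the defects vanish. *)
Lemma cocycle2_pencil (F : 'I_2 -> A -> A -> K) : (forall j, cocycle2 G 4 (F j)) ->
  exists c : 'I_2 -> K, (exists j, c j != 0) /\ exact2 G 4 (fun a b => \sum_j c j * F j a b).
Proof.
move=> hF; have cm k : count_mem k es = count_mem k [:: 1; 1; 2; 3]%N by apply/permP.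
have [[zeta cz nz]|none] := classic (exists2 zeta, cocycle1 H 3 zeta & exists2 a, H 3 a & zeta a != 0).
  have ex j : exists tf : (A -> A -> K) * (A -> K),
      [/\ normal2 iota x H G 4 (fun _ _ => 0) tf.1, cocycle1 H 3 (fun r => tf.1 x (iota r)),
      linear_on (G 4%N) tf.2 & forall u v a b, (0 < u)%N -> (0 < v)%N -> (u + v)%N = 4%N ->
        G u a -> G v b -> F j a b = tf.1 a b + tf.2 (a * b)].
    have [th' [f hf]] := step_exact st (d := 4) isT (hF j) (restriction_exact cz nz (hF j)).
    by exists (th', f).
  have {ex}[tf htf] := fchoice ex; have [a0 ga0 nza] := nz.
  have [d hd] : exists d : 'I_2 -> K, forall j r, H 3 r -> (tf j).1 x (iota r) = d j * zeta r.
    apply: (fchoice (P := fun j d => forall r, H 3 r -> (tf j).1 x (iota r) = d * zeta r)) => j.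
    by have [_ h1 _ _] := htf j; apply: (tower_cocycle1_line tw _ _ h1 cz ga0 nza); rewrite ?cm.
  have [|c [cnz c0]] := @dependent K unit 'I_2 (fun j _ => d j); first by rewrite card_unit card_ord.
  exists c; split=> //; exists (fun a => \sum_j c j * (tf j).2 a).
    move=> k a b ga gb; rewrite mulr_sumr -big_split; apply: eq_bigr => j _.
    by have [_ _ lf _] := htf j; rewrite lf // mulrDr mulrCA.
  move=> i j a b i0 j0 ij ga gb.
  have n2 : normal2 iota x H G 4 (fun _ _ => 0) (fun a b => \sum_j c j * (tf j).1 a b).
    by apply: normal2_sum => t; case: (htf t).
  have z : \sum_t c t * (tf t).1 a b = 0.
    rewrite (normal2_zero st n2 isT _ _ i0 j0 ij ga gb) // => r hr.
    transitivity ((\sum_t c t * d t) * zeta r); last by rewrite (c0 tt) mul0r.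
    by rewrite mulr_suml; apply: eq_bigr => t _; rewrite hd // mulrA.
  transitivity (\sum_t c t * (tf t).1 a b + \sum_t c t * (tf t).2 (a * b));
    last by rewrite z add0r.
  rewrite -big_split; apply: eq_bigr => t _; have [_ _ _ E] := htf t.
  by rewrite (E i j) // mulrDr.
have noz zeta : cocycle1 H 3 zeta -> forall a, H 3 a -> zeta a = 0.
  move=> cz a ga; apply/eqP; apply: contra_notT none => nz.
  by exists zeta => //; exists a.
have [c [cnz ex]] := exact_pencil noz (fun j => cocycle2_restrict st (hF j)).
exists c; split=> //.
have [th' [f [n2 cD lf E]]] := step_exact st (d := 4) isT (cocycle2_sum c hF) ex.
exists f => // i j a b i0 j0 ij ga gb; rewrite (E i j) //.
by rewrite (normal2_zero st n2 isT _ _ i0 j0 ij) ?add0r // => r hr; apply: noz cD r hr.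
Qed.

End CaseTwo.

(** Contractions live on the basis vectors of homological degree three and
internal degree l - d, where l is 7 or 8.  This degree is at least three, with
a single basis vector for d = l - 3, where [cubic_row_scalar] makes the
contraction vanish.  The remaining degree 4 for l = 8 is [cocycle2_pencil]. *)
Theorem tower_cohomology2 (K : fieldType) (A : algType K) (G : nat -> A -> Prop) ds :
  tower G ds -> size ds = 5%N -> count_mem 1%N ds = 3%N -> generated_in_degree_one G ->
  let exact_from d0 := forall d th, (d0 <= d)%N -> cocycle2 G d th -> exact2 G d th in
  perm_eq ds [:: 1; 1; 1; 2; 2]%N /\ exact_from 4%N \/
  [/\ perm_eq ds [:: 1; 1; 1; 2; 3]%N, exact_from 5%N &
   forall F : 'I_2 -> A -> A -> K, (forall j, cocycle2 G 4 (F j)) ->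
   exists c : 'I_2 -> K, (exists j, c j != 0) /\
     exact2 G 4 (fun a b => \sum_j c j * F j a b)].
Proof.
move=> tw sz c1 gen exact_from; have gr := tower_graded tw.
have [pe last1] := tower_degrees tw sz c1 gen.
have [es eds] : exists es, ds = rcons es 1%N.
  by case/lastP: ds last1 sz {tw c1 pe} => // es e; rewrite last_rcons => -> _; exists es.
have cm k : count_mem k ds = (count_mem k es + (1 == k))%N.
  by rewrite eds -cats1 count_cat /= addn0.
have c1' : count_mem 1%N es = 2%N by move: c1; rewrite cm addn1 => -[].
have cells : forall ds', perm_eq ds ds' -> ds' \in [:: [:: 1; 1; 1; 2; 2]; [:: 1; 1; 1; 2; 3]]%N ->
    cell_count ds 3 3 = 1%N /\ sumn ds = sumn ds'.
  move=> ds' p; rewrite !inE => /orP[] /eqP e.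
    have /allP/(_ ds) : all (fun s => (cell_count s 3 3 == 1%N) && (sumn s == 7%N))
      (permutations ds') by rewrite e; vm_compute.
    by rewrite mem_permutations => /(_ p)/andP[/eqP ? /eqP ->]; rewrite e.
  have /allP/(_ ds) : all (fun s => (cell_count s 3 3 == 1%N) && (sumn s == 8%N))
    (permutations ds') by rewrite e; vm_compute.
  by rewrite mem_permutations => /(_ p)/andP[/eqP ? /eqP ->]; rewrite e.
have c2 : (0 < count_mem 2 es)%N.
  have : (0 < count_mem 2 ds)%N by case: pe => /permP ->.
  by rewrite cm addn0.
have ex : cell_count ds 3 3 = 1%N -> exact_from (sumn ds - 3)%N.
  move=> cc d th le c; have [N [h [g [dd [bot [top [re cnt]]]]]]] := tower_resolution tw.
  rewrite sz in re.
  have l3 : (3 < sumn ds)%N.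
    by case: pe => /perm_sumn ->.
  apply: (contraction_exact gr re c); first by lia.
  move=> T hT gT; have h3 : h T = 3 by lia.
  have g3 : g T = 3 by have := re_hg re T; lia.
  have tw' := tw; rewrite eds in tw'.
  have nls := tower_no_linear_syzygy tw' c1' c2 gen (degree1_basis gr re).
  have [p [hp gp nz]] := cubic_row_scalar gr re nls h3 g3.
  have [||c' hc rel] := contraction_relation gr re c (p := p); rewrite ?hp ?gp //.
    by rewrite -g3.
  move: rel; rewrite (big_pred1 T).
    move=> /eqP; rewrite mulf_eq0 => /orP[/eqP z0|/eqP //].
    by move: nz; rewrite hc ?g3 ?gp // z0 scale0r eqxx.
  move=> t /=; apply/andP/eqP => [[/eqP h5 /eqP g5]|->]; last first.
    by rewrite h3 g3 gp.
  have /card_le1_eqP : (#|[pred s | (h s == 3) && (g s == 3)]| <= 1)%N by rewrite cnt cc.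
  move=> /(_ T t); apply; rewrite inE ?h3 ?g3 //.
  by rewrite g5 gp; apply/andP; split=> //; apply/eqP; lia.
case: pe => pe; [left | right].
  have [cc sm] := cells _ pe isT; split=> //.
  by have := ex cc; rewrite sm.
have [cc sm] := cells _ pe isT; split=> //; first by have := ex cc; rewrite sm.
have [|R [i [s [d [x [e [H [es' [twR st eds']]]]]]]]] := tower_inv tw; first by rewrite sz.
have [ees ee] : es = es' /\ 1%N = e by move: eds'; rewrite eds => /rcons_inj[].
rewrite -{}ees -{}ee {es' e eds'} in twR st.
apply: (cocycle2_pencil st twR) => //.
by rewrite -(perm_cons 1%N) -(perm_rcons 1%N es) -eds.
Qed.

(** * Free algebras *)

(** The interface through which free algebras are used; it hides the
representation of their elements as finitely supported functions. *)
Record word_basis (K : fieldType) (n : nat) (F : algType K) : Type := WordBasis {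
  word : seq 'I_n -> F;
  coef : F -> seq 'I_n -> K;
  words : F -> seq (seq 'I_n);
  word_nil : word [::] = 1;
  word_cat : forall s t, word (s ++ t) = word s * word t;
  coef_linear : forall c f g s, coef (c *: f + g) s = c * coef f s + coef g s;
  coef_word : forall s t, coef (word s) t = (s == t)%:R;
  words_uniq : forall f, uniq (words f);
  coef_words : forall f s, coef f s != 0 -> s \in words f;
  word_expansion : forall f, f = \sum_(s <- words f) coef f s *: word s }.

Section FreeAlgebra.
Variables (K : fieldType) (n : nat) (F : algType K) (W : word_basis n F).
Implicit Types (f g : F) (s t : seq 'I_n).

Local Notation word := (word W).
Local Notation coef := (coef W).
Local Notation words := (words W).
Local Notation gen i := (word [:: i]).

Lemma word_cons i s : word (i :: s) = gen i * word s.
Proof. by rewrite -cat1s word_cat. Qed.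

Lemma wcoef0 s : coef 0 s = 0.
Proof.
have := coef_linear W (-1) 0 0 s; rewrite scaler0 addr0 => h.
by rewrite h mulN1r addNr.
Qed.

Lemma wcoefD f g s : coef (f + g) s = coef f s + coef g s.
Proof. by rewrite -[f]scale1r coef_linear mul1r scale1r. Qed.

Lemma wcoefZ c f s : coef (c *: f) s = c * coef f s.
Proof. by rewrite -[c *: f]addr0 coef_linear wcoef0 addr0. Qed.

Lemma coef_inj f g : (forall s, coef f s = coef g s) -> f = g.
Proof.
move=> h; have z k : (forall s, coef k s = 0) -> k = 0.
  by move=> k0; rewrite [k](word_expansion W) big1 // => s _; rewrite k0 scale0r.
apply/eqP; rewrite -subr_eq0; apply/eqP; apply: z => s.
by rewrite wcoefD -scaleN1r wcoefZ h mulN1r subrr.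
Qed.

Lemma free_ind (P : F -> Prop) : P 0 -> (forall c s f, P f -> P (c *: word s + f)) ->
  forall f, P f.
Proof.
move=> P0 PD f; rewrite [f](word_expansion W).
by elim/big_rec: _ => // m g _; apply: PD.
Qed.

Section Extension.
Variables (V : lmodType K) (h : seq 'I_n -> V).

Definition word_map f : V := \sum_(s <- words f) coef f s *: h s.

Lemma word_mapEw d f : uniq d -> {subset words f <= d} ->
  word_map f = \sum_(s <- d) coef f s *: h s.
Proof.
move=> ud sub; rewrite /word_map [RHS](bigID (fun s => s \in words f)) /=.
rewrite [X in _ = _ + X]big1 ?addr0; last first.
  move=> s ns; suff -> : coef f s = 0 by rewrite scale0r.
  by apply/eqP; apply: contraNT ns; apply: coef_words.
rewrite -[RHS]big_filter; apply: perm_big; apply: uniq_perm; rewrite ?words_uniq ?filter_uniq //.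
by move=> s; rewrite mem_filter; case: (boolP (s \in words f)) => // /sub ->.
Qed.

Fact word_map_linear : linear word_map.
Proof.
move=> c f g; pose d := undup (words f ++ words g ++ words (c *: f + g)).
have ud : uniq d by apply: undup_uniq.
rewrite !(word_mapEw ud); try by move=> s hs; rewrite mem_undup !mem_cat hs ?orbT.
rewrite scaler_sumr -big_split; apply: eq_bigr => m _ /=.
by rewrite coef_linear scalerDl scalerA.
Qed.
HB.instance Definition _ := GRing.isLinear.Build K F V *:%R word_map word_map_linear.

Lemma word_map_word s : word_map (word s) = h s.
Proof.
rewrite (word_mapEw (d := undup (s :: words (word s)))) ?undup_uniq //; last first.
  by move=> t ht; rewrite mem_undup inE ht orbT.
rewrite (bigD1_seq s) ?undup_uniq ?mem_undup ?mem_head //=.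
rewrite (coef_word W) eqxx scale1r big1 ?addr0 //.
by move=> t nt; rewrite (coef_word W) eq_sym (negPf nt) scale0r.
Qed.

End Extension.

Section Evaluation.
Variables (A : algType K) (a : 'I_n -> A).

Definition free_eval : F -> A := word_map (fun s => \prod_(i <- s) a i).
HB.instance Definition _ := GRing.Linear.on free_eval.

Lemma free_eval_word s : free_eval (word s) = \prod_(i <- s) a i.
Proof. exact: word_map_word. Qed.

Fact free_eval_monoid : monoid_morphism free_eval.
Proof.
split; first by rewrite -(word_nil W) free_eval_word big_nil.
elim/free_ind => [|c s f IH] g; first by rewrite linear0 !mul0r linear0.
rewrite mulrDl linearD linearP /= IH mulrDl; congr (_ + _).
rewrite -scalerAl linearZ /= -scalerAl; congr (_ *: _); move: g {IH} => g.
elim/free_ind: g => [|b t g IHg]; first by rewrite linear0 !mulr0 linear0.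
rewrite mulrDr linearD linearP /= IHg mulrDr; congr (_ + _).
rewrite -scalerAr linearZ /= -scalerAr -(word_cat W); congr (_ *: _).
by rewrite !free_eval_word big_cat.
Qed.
HB.instance Definition _ := GRing.isMonoidMorphism.Build F A free_eval free_eval_monoid.

Lemma free_eval_gen i : free_eval (gen i) = a i.
Proof. by rewrite free_eval_word big_seq1. Qed.

End Evaluation.

Lemma hom_word (A : algType K) (p : {lrmorphism F -> A}) s :
  p (word s) = \prod_(i <- s) p (gen i).
Proof.
elim: s => [|i s IH]; first by rewrite (word_nil W) rmorph1 big_nil.
by rewrite word_cons rmorphM /= IH big_cons.
Qed.

Lemma free_hom_ext (A : algType K) (p q : {lrmorphism F -> A}) :
  (forall i, p (gen i) = q (gen i)) -> p =1 q.
Proof.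
move=> h; elim/free_ind => [|c s f e]; first by rewrite !linear0.
by rewrite !linearP /= e !hom_word; congr (_ *: _ + _); apply: eq_bigr.
Qed.

Section Weights.
Variable w : 'I_n -> nat.

Definition weight s : nat := (\sum_(i <- s) w i)%N.

Definition component (d : nat) : F -> F :=
  word_map (fun s => if weight s == d then word s else 0).
HB.instance Definition _ d := GRing.Linear.on (component d).

Definition homogeneous d f : Prop := component d f = f.
Local Notation H := homogeneous.

Lemma component_word d s : component d (word s) = if weight s == d then word s else 0.
Proof. exact: word_map_word. Qed.

Lemma component_comp d e f : component d (component e f) = if d == e then component e f else 0.
Proof.
elim/free_ind: f => [|c s f IH]; first by rewrite !linear0 if_same.
rewrite !linearP /= IH !component_word.
case: (eqVneq d e) => [->|ne]; first by case: ifP => h; rewrite ?linear0 ?component_word ?h.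
case: ifP => h; last by rewrite linear0 scaler0 addr0.
by rewrite component_word (eqP h) eq_sym (negPf ne) scaler0 addr0.
Qed.

Lemma component_hom d f : H d (component d f).
Proof. by rewrite /homogeneous component_comp eqxx. Qed.

Lemma component_id d d' f : H d' f -> component d f = if d == d' then f else 0.
Proof. by move=> <-; rewrite component_comp. Qed.

Lemma component_coef d f s : coef (component d f) s = if weight s == d then coef f s else 0.
Proof.
elim/free_ind: f => [|c t f IH]; first by rewrite linear0 wcoef0 if_same.
rewrite linearP /= !wcoefD !wcoefZ IH component_word (coef_word W).
case: (eqVneq t s) => [->|ne]; first by case: ifP => _; rewrite ?(coef_word W) ?eqxx ?wcoef0 ?mulr0 ?addr0.
by case: ifP => _; rewrite ?wcoef0 ?(coef_word W) ?(negPf ne) mulr0 !add0r.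
Qed.

Lemma homogeneousP d f : H d f <-> forall s, coef f s != 0 -> weight s = d.
Proof.
split=> [<- s|h]; first by rewrite component_coef; case: (eqVneq (weight s) d) => // _; rewrite eqxx.
apply: coef_inj => s; rewrite component_coef; case: eqP => // ne.
by apply/eqP; rewrite eq_sym; apply: contra_notT ne => /h.
Qed.

Lemma hom0 d : H d 0. Proof. exact: linear0. Qed.

Lemma hom_subspace d : subspace (H d).
Proof.
by split=> [|c f g hf hg]; [apply: hom0 | rewrite /homogeneous linearP /= hf hg].
Qed.

Lemma hom_word_weight s : H (weight s) (word s).
Proof. by rewrite /homogeneous component_word eqxx. Qed.

Lemma hom_gen i : H (w i) (gen i).
Proof. by have := hom_word_weight [:: i]; rewrite /weight big_seq1. Qed.

Lemma homogeneous_ind d (P : F -> Prop) : P 0 ->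
  (forall c s f, weight s = d -> P f -> P (c *: word s + f)) -> forall f, H d f -> P f.
Proof.
move=> P0 PD f <-; elim/free_ind: f => [|c s f IH]; first by rewrite linear0.
rewrite linearP /= component_word; case: eqP => [e|_]; first exact: PD.
by rewrite scaler0 add0r.
Qed.

Lemma homM d e f g : H d f -> H e g -> H (d + e)%N (f * g).
Proof.
move=> hf hg; elim/homogeneous_ind: hf => [|c s f' hs IH]; first by rewrite mul0r; apply: hom0.
rewrite mulrDl; apply: (subspaceD (hom_subspace _)) => //; rewrite -scalerAl.
apply: (subspaceZ _ (hom_subspace _)); elim/homogeneous_ind: hg => [|b t g' ht IHg].
  by rewrite mulr0; apply: hom0.
rewrite mulrDr; apply: (subspaceD (hom_subspace _)) => //; rewrite -scalerAr.
apply: (subspaceZ _ (hom_subspace _)); rewrite -(word_cat W) -hs -ht.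
by rewrite -[X in H X]big_cat; apply: hom_word_weight.
Qed.

Lemma hom1 : H 0 1.
Proof. by rewrite -(word_nil W); have := hom_word_weight [::]; rewrite /weight big_nil. Qed.

Lemma component_mul d f g :
  component d (f * g) = \sum_(i < d.+1) component i f * component (d - i) g.
Proof.
elim/free_ind: f => [|c s f IH].
  by rewrite mul0r linear0 big1 // => i _; rewrite linear0 mul0r.
rewrite mulrDl linearD /= IH; under [RHS]eq_bigr => i _ do rewrite linearP /= mulrDl -scalerAl.
rewrite big_split -scaler_sumr; congr (_ + _); rewrite /= -scalerAl linearZ; congr (_ *: _).
move: g {IH} => g; elim/free_ind: g => [|b t g IH].
  by rewrite mulr0 linear0 big1 // => i _; rewrite linear0 mulr0.
rewrite mulrDr linearD /= IH; under [RHS]eq_bigr => i _ do rewrite linearP /= mulrDr -scalerAr.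
rewrite big_split -scaler_sumr; congr (_ + _); rewrite /= -scalerAr linearZ /=; congr (_ *: _).
rewrite -(word_cat W) component_word /weight big_cat /= -!/(weight _).
have [le|lt] := leqP (weight s) d.
  rewrite (bigD1 (Ordinal (le : weight s < d.+1)%N)) //= !component_word eqxx big1 ?addr0.
    have -> : (weight s + weight t == d) = (weight t == d - weight s)%N by lia.
    by case: ifP => _; rewrite ?mulr0 // (word_cat W).
  move=> i ne; rewrite component_word; case: eqP => [e|_]; last by rewrite mul0r.
  by case/eqP: ne; apply: val_inj.
rewrite big1 => [|i _]; last first.
  by rewrite component_word; case: eqP => [e|_]; rewrite ?mul0r //; have := ltn_ord i; lia.
by case: eqP => // e; lia.
Qed.

End Weights.
End FreeAlgebra.

Section Malg.
Variables (K : fieldType) (I : choiceType).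

Fact malg_scalerAr (c : K) (f g : {malg K[{fmonom I}]}) : c *: (f * g) = f * (c *: g).
Proof.
apply/malgP => k; rewrite mcoeffZ (mcoeffMlw k (fsubset_refl _) (fsubset_refl _)).
rewrite (mcoeffMlw k (fsubset_refl _) (msuppZ_le c g)).
rewrite mulr_sumr; apply: eq_bigr => k1 _; rewrite mulr_sumr; apply: eq_bigr => k2 _.
by rewrite mcoeffZ mulrnAr; congr (_ *+ _); apply: mulrCA.
Qed.
End Malg.

(** The type of the free algebra again, now as an algebra in which scalars also
move through the right factor of a product. *)
Definition free_alg (K : fieldType) (n : nat) : Type := free_algebra K n.
HB.instance Definition _ (K : fieldType) (n : nat) :=
  GRing.Lalgebra.copy (free_alg K n) (free_algebra K n).
HB.instance Definition _ (K : fieldType) (n : nat) :=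
  GRing.Lalgebra_isAlgebra.Build K (free_alg K n) (@malg_scalerAr K 'I_n).

Section MalgWords.
Variables (K : fieldType) (n : nat).

Definition mword (s : seq 'I_n) : free_algebra K n := << FMonom s >>.
Definition mcoef (f : free_algebra K n) (s : seq 'I_n) : K := f@_(FMonom s).
Definition mwords (f : free_algebra K n) : seq (seq 'I_n) := 
  [seq fmonom_val m | m <- enum_fset (msupp f)].

Fact mword_nil : mword [::] = 1.
Proof. by rewrite /mword -fmoneE. Qed.

Fact mword_cat s t : mword (s ++ t) = mword s * mword t.
Proof. by rewrite malgM_def fgmulUU mulr1 /mmul /= fmmulE. Qed.

Fact mcoef_linear c f g s : mcoef (c *: f + g) s = c * mcoef f s + mcoef g s.
Proof. by rewrite /mcoef mcoeffD mcoeffZ. Qed.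

Fact mcoef_word s t : mcoef (mword s) t = (s == t)%:R.
Proof. by rewrite /mcoef mcoeffU1; congr (_%:R); rewrite fmP. Qed.

Fact mwords_uniq f : uniq (mwords f).
Proof.
by rewrite map_inj_uniq ?fset_uniq // => -[s] [t] /= ->.
Qed.

Fact mcoef_words f s : mcoef f s != 0 -> s \in mwords f.
Proof. by rewrite /mcoef mcoeff_neq0 => h; apply/mapP; exists (FMonom s). Qed.

Fact mword_expansion f : f = \sum_(s <- mwords f) mcoef f s *: mword s.
Proof.
rewrite /mwords big_map {1}[f]monalgE; apply: eq_bigr => m _; apply/malgP => k.
by rewrite mcoeffZ mcoeffU1 /mcoef fmK mcoeffU mulr_natr.
Qed.

Definition malg_words : word_basis n (free_alg K n) :=
  @WordBasis K n (free_alg K n) _ _ _ mword_nil mword_cat mcoef_linear mcoef_word mwords_uniq mcoef_words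
    mword_expansion.

Lemma mword_gen i : mword [:: i] = free_gen K i.
Proof. by rewrite /mword /free_gen fmuE. Qed.

Lemma free_homogeneousE w d f : free_homogeneous w d f <-> homogeneous malg_words w d f.
Proof.
split=> [h|/homogeneousP h m nz].
  by apply/homogeneousP => s; apply: (h (FMonom s)).
by apply: h; rewrite /= /mcoef fmK.
Qed.

End MalgWords.

(** * Minimal relations and cocycles *)

Section UnitWeights.
Variables (K : fieldType) (b : nat) (F : algType K) (W : word_basis b F).
Local Notation word := (word W).
Local Notation gen i := (word [:: i]).
Local Notation H := (homogeneous W (fun=> 1%N)).

Lemma weight1 (s : seq 'I_b) : weight (fun=> 1%N) s = size s.
Proof. exact: sum1_size. Qed.

Definition left_quotient (i : 'I_b) : F -> F :=
  word_map W (fun s => if s is j :: t then (if j == i then word t else 0) else 0).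
HB.instance Definition _ i := GRing.Linear.on (left_quotient i).

Definition right_quotient (i : 'I_b) : F -> F :=
  word_map W (fun s => if rev s is j :: t then (if j == i then word (rev t) else 0) else 0).
HB.instance Definition _ i := GRing.Linear.on (right_quotient i).

Lemma right_quotient_gen i j f : right_quotient i (f * gen j) = if j == i then f else 0.
Proof.
elim/(free_ind (W := W)): f => [|c s f IH]; first by rewrite mul0r linear0 if_same.
rewrite mulrDl -scalerAl linearP /= IH -(word_cat W) [right_quotient i _]word_map_word.
by rewrite cats1 rev_rcons revK; case: ifP; rewrite ?scaler0 ?addr0.
Qed.

Lemma left_quotient_hom d i f : H d f -> H d.-1 (left_quotient i f).
Proof.
move=> hf; elim/homogeneous_ind: hf => [|c s {}f hs IH]; first by rewrite linear0; apply: hom0.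
rewrite linearP /=; apply: (subspaceD (hom_subspace _ _ _)) => //.
apply: (subspaceZ _ (hom_subspace _ _ _)); rewrite [left_quotient i _]word_map_word.
rewrite weight1 in hs; case: s hs => [|j t]; first by move=> _; apply: hom0.
case: ifP => _ <-; last exact: hom0.
by have := hom_word_weight W (fun=> 1%N) t; rewrite weight1.
Qed.

Lemma right_quotient_hom d i f : H d f -> H d.-1 (right_quotient i f).
Proof.
move=> hf; elim/homogeneous_ind: hf => [|c s {}f hs IH]; first by rewrite linear0; apply: hom0.
rewrite linearP /=; apply: (subspaceD (hom_subspace _ _ _)) => //.
apply: (subspaceZ _ (hom_subspace _ _ _)); rewrite [right_quotient i _]word_map_word.
rewrite weight1 -size_rev in hs; case: (rev s) hs => [|j t]; first by move=> _; apply: hom0.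
case: ifP => _ <-; last exact: hom0.
by have := hom_word_weight W (fun=> 1%N) (rev t); rewrite weight1 size_rev.
Qed.

Lemma left_expansion d f : (0 < d)%N -> H d f -> f = \sum_i gen i * left_quotient i f.
Proof.
move=> d0; move=> hf; elim/homogeneous_ind: hf => [|c s {}f hs IH].
  by rewrite big1 // => i _; rewrite linear0 mulr0.
rewrite {1}IH; under [RHS]eq_bigr => i _ do rewrite linearP /= mulrDr -scalerAr.
rewrite big_split -scaler_sumr; congr (_ *: _ + _); rewrite weight1 in hs.
case: s hs => [|j t] ht; first by rewrite -ht in d0.
rewrite (bigD1 j) //= [left_quotient j _]word_map_word eqxx -(word_cons W) big1 ?addr0 //.
by move=> i nj; rewrite [left_quotient i _]word_map_word eq_sym (negPf nj) mulr0.
Qed.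

Lemma right_expansion d f : (0 < d)%N -> H d f -> f = \sum_i right_quotient i f * gen i.
Proof.
move=> d0; move=> hf; elim/homogeneous_ind: hf => [|c s {}f hs IH].
  by rewrite big1 // => i _; rewrite linear0 mul0r.
rewrite {1}IH; under [RHS]eq_bigr => i _ do rewrite linearP /= mulrDl -scalerAl.
rewrite big_split -scaler_sumr; congr (_ *: _ + _); rewrite weight1 in hs.
case/lastP: s hs => [|t j] ht; first by rewrite -ht in d0.
rewrite (bigD1 j) //= [right_quotient j _]word_map_word rev_rcons eqxx revK -(word_cat W) cats1.
rewrite big1 ?addr0 // => i nj.
by rewrite [right_quotient i _]word_map_word rev_rcons eq_sym (negPf nj) mul0r.
Qed.

Lemma right_quotient_sum i (u : 'I_b -> F) : right_quotient i (\sum_j u j * gen j) = u i.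
Proof.
rewrite linear_sum (bigD1 i) //= right_quotient_gen eqxx big1 ?addr0 // => j ne.
by rewrite right_quotient_gen (negPf ne).
Qed.

Lemma hom_scalar f : H 0 f -> exists c : K, f = c%:A.
Proof.
move=> hf; elim/homogeneous_ind: hf => [|c s {}f hs [a ->]]; first by exists 0; rewrite scale0r.
rewrite weight1 in hs; exists (c + a); case: s hs => // _.
by rewrite (word_nil W) scalerDl.
Qed.

Lemma word_hom s : H (size s) (word s).
Proof. by have := hom_word_weight W (fun=> 1%N) s; rewrite weight1. Qed.

Lemma words_basis d : basis (fun t : d.-tuple 'I_b => word t) (H d).
Proof.
split.
- move=> c c0 t; have := congr1 (fun f => coef W f t) c0; rewrite wcoef0.
  have coef_sum (I : finType) (f : I -> F) s : coef W (\sum_i f i) s = \sum_i coef W (f i) s.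
    by elim/big_rec2: _ => [|i y x _ <-]; rewrite ?wcoef0 ?wcoefD.
  rewrite coef_sum (bigD1 t) //= wcoefZ (coef_word W) eqxx mulr1 big1 ?addr0 //.
  by move=> s ns; rewrite wcoefZ (coef_word W) val_eqE (negPf ns) mulr0.
- by move=> t; have := word_hom t; rewrite size_tuple.
move=> f; move=> hf; elim/homogeneous_ind: hf => [|c s {}f hs IH].
  by case: (subspace_spanned (fun t : d.-tuple 'I_b => word t)).
have [_ h] := subspace_spanned (fun t : d.-tuple 'I_b => word t); apply: h => //.
rewrite weight1 in hs; have -> : s = tcast hs (in_tuple s) by rewrite val_tcast.
exact: (spanned_gen (fun t : d.-tuple 'I_b => word t)).
Qed.

Variables (A : algType K) (G : nat -> A -> Prop) (pi : {lrmorphism F -> A}).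
Hypotheses (gr : graded G) (pi1 : forall i, G 1%N (pi (gen i))).
Hypothesis pi_onto : forall a, exists f, pi f = a.

Lemma pi_word s : G (size s) (pi (word s)).
Proof.
elim: s => [|i s IH]; first by rewrite (word_nil W) rmorph1; apply: gr1.
by rewrite (word_cons W) rmorphM /= -add1n; apply: (gr_mul gr).
Qed.

Lemma pi_hom d f : H d f -> G d (pi f).
Proof.
move=> hf; elim/homogeneous_ind: hf => [|c s {}f hs IH]; first by rewrite rmorph0; apply: gr0.
rewrite linearP; have [_ h] := gr_sub gr d; apply: h => //.
by rewrite -hs weight1; apply: pi_word.
Qed.

Lemma pi_component d f : pi f = 0 -> pi (component W (fun=> 1%N) d f) = 0.
Proof.
move=> f0; have [comp [lin hom _ _ _]] := graded_components gr.
have c0 : comp d 0 = 0 by rewrite (hom d d 0 (gr0 gr d)) eqxx.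
suff -> : pi (component W (fun=> 1%N) d f) = comp d (pi f) by rewrite f0.
elim/(free_ind (W := W)): f {f0} => [|c s f IH]; first by rewrite !linear0.
rewrite !linearP /= lin IH (hom _ _ _ (pi_word s)) (component_word W) weight1 eq_sym.
by case: ifP; rewrite ?rmorph0.
Qed.

Lemma pi_lift d a : G d a -> exists2 f, H d f & pi f = a.
Proof.
move=> ga; have [f fE] := pi_onto a; have [comp [lin hom _ _ _]] := graded_components gr.
have c0 : comp d 0 = 0 by rewrite (hom d d 0 (gr0 gr d)) eqxx.
exists (component W (fun=> 1%N) d f); first exact: component_hom.
rewrite -[RHS](_ : comp d a = a); last by rewrite (hom _ _ _ ga) eqxx.
rewrite -fE; elim/(free_ind (W := W)): f {fE} => [|c s f IH]; first by rewrite !linear0.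
rewrite !linearP /= lin IH (hom _ _ _ (pi_word s)) (component_word W) weight1 eq_sym.
by case: ifP; rewrite ?rmorph0.
Qed.

Lemma ker0 f : H 0 f -> pi f = 0 -> f = 0.
Proof.
by move/hom_scalar => [c ->]; rewrite linearZ rmorph1 => /alg_inj0 ->; rewrite scale0r.
Qed.

Definition kernel d f : Prop := H d f /\ pi f = 0.

Lemma kernel_subspace d : subspace (kernel d).
Proof.
split; first by split; [apply: hom0 | rewrite rmorph0].
move=> c f g [hf f0] [hg g0]; split; first by have [_ h] := hom_subspace W (fun=> 1%N) d; apply: h.
by rewrite linearP /= f0 g0 scaler0 addr0.
Qed.

Lemma kernelMl i j p g : H i p -> kernel j g -> kernel (i + j) (p * g).
Proof. by move=> hp [hg g0]; split; [apply: homM | rewrite rmorphM /= g0 mulr0]. Qed.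

Lemma kernelMr i j p g : kernel i p -> H j g -> kernel (i + j) (p * g).
Proof. by move=> [hp p0] hg; split; [apply: homM | rewrite rmorphM /= p0 mul0r]. Qed.

(** The part of degree d of F_+ I + I F_+, with I the kernel; it suffices to
multiply by generators. *)
Definition decomposable d f : Prop := exists u v : 'I_b -> F,
  [/\ forall i, kernel d.-1 (u i), forall i, kernel d.-1 (v i)
    & f = \sum_i gen i * u i + \sum_i v i * gen i].

Lemma decomposable_subspace d : subspace (decomposable d).
Proof.
have [k0 kl] := kernel_subspace d.-1; split.
  exists (fun=> 0), (fun=> 0); split=> //.
  by rewrite !big1 ?addr0 // => i _; rewrite ?mulr0 ?mul0r.
move=> c _ _ [u [v [hu hv ->]]] [u' [v' [hu' hv' ->]]].
exists (fun i => c *: u i + u' i), (fun i => c *: v i + v' i); split=> [i|i|]; try exact: kl.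
under [X in _ = X + _]eq_bigr => i _ do rewrite mulrDr -scalerAr.
under [X in _ = _ + X]eq_bigr => i _ do rewrite mulrDl -scalerAl.
by rewrite !big_split -!scaler_sumr scalerDr; addac.
Qed.

Lemma decomposable_kernel d f : (0 < d)%N -> decomposable d f -> kernel d f.
Proof.
move=> d0 [u [v [hu hv ->]]]; have hg i : H 1%N (gen i) := word_hom [:: i].
apply: subspaceD; first exact: kernel_subspace.
  apply: subspace_sum => [|i _]; first exact: kernel_subspace.
  by rewrite -(prednK d0) -add1n; apply: kernelMl.
apply: subspace_sum => [|i _]; first exact: kernel_subspace.
by rewrite -(prednK d0) -addn1; apply: kernelMr.
Qed.

Lemma decomposableMl d i j p g : (0 < i)%N -> (i + j)%N = d -> H i p -> kernel j g ->
  decomposable d (p * g).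
Proof.
move=> i0 ij hp kg; have [k0 _] := kernel_subspace d.-1.
exists (fun l => left_quotient l p * g), (fun=> 0); split=> // [l|].
  have -> : d.-1 = (i.-1 + j)%N by lia.
  by apply: kernelMl => //; apply: left_quotient_hom.
rewrite [X in _ + X]big1 ?addr0 => [|l _]; last by rewrite mul0r.
rewrite {1}(left_expansion i0 hp) mulr_suml; apply: eq_bigr => l _.
by rewrite mulrA.
Qed.

Lemma decomposableMr d i j p g : (0 < j)%N -> (i + j)%N = d -> kernel i p -> H j g ->
  decomposable d (p * g).
Proof.
move=> j0 ij kp hg; have [k0 _] := kernel_subspace d.-1.
exists (fun=> 0), (fun l => p * right_quotient l g); split=> // [l|].
  have -> : d.-1 = (i + j.-1)%N by lia.
  by apply: kernelMr => //; apply: right_quotient_hom.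
rewrite [X in X + _]big1 ?add0r => [|l _]; last by rewrite mulr0.
rewrite {1}(right_expansion j0 hg) mulr_sumr; apply: eq_bigr => l _.
by rewrite mulrA.
Qed.

(** A functional psi on F_d vanishing on the decomposable elements of the
kernel gives a 2-cocycle on A, through any choice of lifts. *)
Lemma relation_cocycle d psi : linear_on (H d) psi ->
  (forall f, decomposable d f -> psi f = 0) ->
  exists2 theta, cocycle2 G d theta &
    forall i j f g, (0 < i)%N -> (0 < j)%N -> (i + j)%N = d -> H i f -> H j g ->
      theta (pi f) (pi g) = psi (f * g).
Proof.
move=> lin psi0.
have ex a : exists f, forall i, G i a -> H i f /\ pi f = a.
  have [->|nz] := eqVneq a 0.
    by exists 0 => i _; rewrite rmorph0; split=> //; apply: hom0.
  case: (classic (exists i, G i a)) => [[i ga]|none]; last first.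
    by exists 0 => i ga; case: none; exists i.
  have [f hf fE] := pi_lift ga; exists f => j gj.
  have [<- //|ne] := eqVneq i j; case/eqP: nz; exact: (gr_uniq gr ga gj ne).
have [L hL] := fchoice ex.
have key i j f f' g g' : (0 < i)%N -> (0 < j)%N -> (i + j)%N = d ->
    H i f -> H i f' -> H j g -> H j g' -> pi f = pi f' -> pi g = pi g' ->
    psi (f * g) = psi (f' * g').
  move=> i0 j0 ij hf hf' hg hg' ef eg.
  have k1 : kernel i (f - f').
    by split; [apply: (subspaceB (hom_subspace _ _ _)) | rewrite rmorphB /= ef subrr].
  have k2 : kernel j (g - g').
    by split; [apply: (subspaceB (hom_subspace _ _ _)) | rewrite rmorphB /= eg subrr].
  have -> : f * g = 1 *: ((f - f') * g + f' * (g - g')) + f' * g'.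
    by rewrite scale1r mulrBl mulrBr addrA subrK subrK.
  have n1 := decomposableMr j0 ij k1 hg; have n2 := decomposableMl i0 ij hf' k2.
  have n12 := subspaceD (decomposable_subspace d) n1 n2.
  rewrite lin; first by rewrite psi0 // mulr0 add0r.
    rewrite -ij; apply: (subspaceD (hom_subspace _ _ _)); apply: homM => //.
      by case: k1.
    by case: k2.
  by rewrite -ij; apply: homM.
have thE i j f g : (0 < i)%N -> (0 < j)%N -> (i + j)%N = d -> H i f -> H j g ->
    psi (L (pi f) * L (pi g)) = psi (f * g).
  move=> i0 j0 ij hf hg; have [h1 h2] := hL _ _ (pi_hom hf); have [h3 h4] := hL _ _ (pi_hom hg).
  exact: key i0 j0 ij _ _ _ _ _ _.
exists (fun x y => psi (L x * L y)); last exact: thE.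
have thL i j x y f g : (0 < i)%N -> (0 < j)%N -> (i + j)%N = d -> H i f -> H j g ->
    pi f = x -> pi g = y -> psi (L x * L y) = psi (f * g).
  by move=> i0 j0 ij hf hg <- <-; apply: (thE i j).
split.
- move=> i j y i0 j0 ij gy c x x' gx gx'.
  have [h1 h2] := hL _ _ gx; have [h3 h4] := hL _ _ gx'; have [h5 h6] := hL _ _ gy.
  have hx : H i (c *: L x + L x') by have [_ h] := hom_subspace W (fun=> 1%N) i; apply: h.
  rewrite (thL i j _ _ _ _ i0 j0 ij hx h5) //; last by rewrite linearP /= h2 h4.
  by rewrite mulrDl -scalerAl lin //; rewrite -ij; apply: homM.
- move=> i j x i0 j0 ij gx c y y' gy gy'.
  have [h1 h2] := hL _ _ gy; have [h3 h4] := hL _ _ gy'; have [h5 h6] := hL _ _ gx.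
  have hy : H j (c *: L y + L y') by have [_ h] := hom_subspace W (fun=> 1%N) j; apply: h.
  rewrite (thL i j _ _ _ _ i0 j0 ij h5 hy) //; last by rewrite linearP /= h2 h4.
  by rewrite mulrDr -scalerAr lin //; rewrite -ij; apply: homM.
move=> i j k x y z i0 k0 ijk gx gy gz.
have [h1 h2] := hL _ _ gx; have [h3 h4] := hL _ _ gy; have [h5 h6] := hL _ _ gz.
rewrite (thL (i + j)%N k _ _ (L x * L y) (L z)) //; [|by lia|exact: homM|by rewrite rmorphM /= h2 h4].
rewrite -mulrA; apply/esym; apply: (thL i (j + k)%N) => //; [by lia|by lia|exact: homM|].
by rewrite rmorphM /= h4 h6.
Qed.

(** A primitive phi of the cocycle makes psi and phi \o pi agree on products,
hence on F_d, and phi \o pi vanishes on the kernel. *)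
Lemma exact_relation d theta psi : (1 < d)%N -> linear_on (H d) psi ->
  (forall i j f g, (0 < i)%N -> (0 < j)%N -> (i + j)%N = d -> H i f -> H j g ->
      theta (pi f) (pi g) = psi (f * g)) ->
  exact2 G d theta -> forall f, kernel d f -> psi f = 0.
Proof.
move=> d1 lin th [phi lphi ex] f [hf f0].
suff -> : psi f = phi (pi f) by rewrite f0 (linear_on0 (gr_sub gr d) lphi).
have hH := hom_subspace W (fun=> 1%N) d.
rewrite (left_expansion (ltnW d1) hf) rmorph_sum.
have hq i : H d.-1 (left_quotient i f) by apply: left_quotient_hom.
have hg i : H 1%N (gen i) := word_hom [:: i].
have hp i : H d (gen i * left_quotient i f).
  rewrite -[X in H X](prednK (ltnW d1)) -add1n; exact: (homM (hg i) (hq i)).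
rewrite (linear_on_sum hH lin) // (linear_on_sum (gr_sub gr d) lphi) => [|i]; last exact: pi_hom.
apply: eq_bigr => i _; rewrite -(th 1%N d.-1) //; try lia.
rewrite (ex 1%N d.-1) ?rmorphM //; try exact: pi_hom; lia.
Qed.

Variables (N : nat) (r : 'I_N -> F) (deg : 'I_N -> nat).
Hypothesis hr : forall k, H (deg k) (r k).
Hypothesis min : minimal_ideal_generators r (fun f => pi f = 0).

Let all_gen f := exists2 k, k \in [set: 'I_N] & f = r k.

Lemma kernelP f : pi f = 0 <-> ideal_generated_by all_gen f.
Proof. by have [h _] := min; apply: h. Qed.

Let low d f := exists2 k, (deg k <= d)%N & f = r k.

Lemma low_mono d e f : (e <= d)%N -> ideal_generated_by (low e) f -> ideal_generated_by (low d) f.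
Proof.
move=> le; elim=> {f} [g [k kd ->]||g g' _ h _ h'|h g _ hg|h g _ hg].
- by apply: IdealIn; exists k => //; apply: leq_trans le.
- exact: IdealZero.
- exact: IdealAdd.
- exact: IdealMulL.
- exact: IdealMulR.
Qed.

Lemma ideal_sum (S : F -> Prop) (I : finType) (g : I -> F) :
  (forall i, ideal_generated_by S (g i)) -> ideal_generated_by S (\sum_i g i).
Proof. by move=> h; elim/big_rec: _ => [|i x _]; [apply: IdealZero | apply: IdealAdd]. Qed.

Local Notation comp := (component W (fun=> 1%N)).

Lemma component_ideal f d : ideal_generated_by all_gen f ->
  ideal_generated_by (low d) (comp d f).
Proof.
move=> hf; elim: hf d => {f} [f [k _ ->]||f g _ hf _ hg|h f _ hf|h f _ hf] d.
- rewrite (component_id d (hr k)); case: eqP => [dk|_]; last exact: IdealZero.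
  by apply: IdealIn; exists k; rewrite ?dk.
- by rewrite linear0; apply: IdealZero.
- by rewrite linearD; apply: IdealAdd; [apply: hf | apply: hg].
- rewrite component_mul; apply: ideal_sum => i; apply: IdealMulL.
  by apply: low_mono (hf _); apply: leq_subr.
- rewrite component_mul; apply: ideal_sum => i; apply: IdealMulR.
  by apply: low_mono (hf _); rewrite -ltnS.
Qed.

(** In h * f the positive part of h contributes decomposable elements, and its
constant term a scalar multiple; likewise in f * h. *)
Lemma kernel_generators d f : kernel d f ->
  exists c : 'I_N -> K, decomposable d (f - \sum_(k | deg k == d) c k *: r k).
Proof.
move=> [hf /kernelP f0]; have [D0 Dl] := decomposable_subspace d.
have DD g g' : decomposable d g -> decomposable d g' -> decomposable d (g + g').
  by apply: subspaceD; apply: decomposable_subspace.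
have sD (c c' : 'I_N -> K) : \sum_(k | deg k == d) (c k + c' k) *: r k =
    \sum_(k | deg k == d) c k *: r k + \sum_(k | deg k == d) c' k *: r k.
  by rewrite -big_split; apply: eq_bigr => k _; rewrite scalerDl.
have sZ a (c : 'I_N -> K) : \sum_(k | deg k == d) (a * c k) *: r k =
    a *: \sum_(k | deg k == d) c k *: r k.
  by rewrite scaler_sumr; apply: eq_bigr => k _; rewrite scalerA.
have <- : comp d f = f by [].
elim: f0 {hf} => {f} [f [k _ ->]||f g _ [c hc] _ [c' hc']|h f f0 [c hc]|h f f0 [c hc]].
- exists (fun j => (j == k)%:R); rewrite (component_id d (hr k)).
  case: (eqVneq d (deg k)) => [dk|ne].
    rewrite (bigD1 k) /= ?dk // eqxx scale1r big1 ?addr0 ?subrr -?dk // => j /andP[_ /negPf ->].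
    by rewrite scale0r.
  rewrite big1 ?subr0 // => j /eqP dj; case: eqP => [jk|_]; last by rewrite scale0r.
  by rewrite -dj jk eqxx in ne.
- by exists (fun=> 0); rewrite linear0 big1 ?subr0 // => k _; rewrite scale0r.
- by exists (fun k => c k + c' k); rewrite sD linearD opprD addrACA; apply: DD.
- have [a ha] := hom_scalar (component_hom W (fun=> 1%N) 0 h).
  exists (fun k => a * c k); rewrite sZ component_mul big_ord_recl /= subn0 ha.
  rewrite -scalerAl mul1r addrAC -scalerBr; apply: DD.
    by apply: subspaceZ => //; apply: decomposable_subspace.
  apply: subspace_sum => [|i _]; first exact: decomposable_subspace.
  apply: (decomposableMl (i := bump 0 i) (j := (d - bump 0 i)%N)) => //.
  - by rewrite subnKC // /bump; have := ltn_ord i; lia.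
  - exact: component_hom.
  - by split; [apply: component_hom | apply: pi_component; apply/kernelP].
have [a ha] := hom_scalar (component_hom W (fun=> 1%N) 0 h).
exists (fun k => a * c k); rewrite sZ component_mul big_ord_recr /= subnn ha.
rewrite -scalerAr mulr1 -addrA -scalerBr; apply: DD; last first.
  by apply: subspaceZ => //; apply: decomposable_subspace.
apply: subspace_sum => [|i _]; first exact: decomposable_subspace.
apply: (decomposableMr (i := i) (j := (d - i)%N)) => //.
- by rewrite subn_gt0; apply: ltn_ord.
- by rewrite subnKC // ltnW.
- by split; [apply: component_hom | apply: pi_component; apply/kernelP].
- exact: component_hom.
Qed.

(** Otherwise one generator of degree d is a combination of the other ones and of
decomposable elements, which come from generators of lower degree. *)
Lemma generators_independent d (c : 'I_N -> K) :
  decomposable d (\sum_(k | deg k == d) c k *: r k) -> forall k, deg k = d -> c k = 0.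
Proof.
move=> dec k0 dk0; apply/eqP; apply: contraT => nz; exfalso.
pose J := [set~ k0]; pose S f := exists2 k, k \in J & f = r k.
have ScZ a f : ideal_generated_by S f -> ideal_generated_by S (a *: f).
  by move=> hf; rewrite -mulr_algl; apply: IdealMulL.
have lowS f e : (e < d)%N -> ideal_generated_by (low e) f -> ideal_generated_by S f.
  move=> lt; elim=> {f} [f [k kd ->]||f g _ hf _ hg|h f _ hf|h f _ hf].
  - apply: IdealIn; exists k => //; rewrite !inE; apply: contraTneq kd => ->.
    by rewrite dk0 -ltnNge.
  - exact: IdealZero.
  - exact: IdealAdd.
  - exact: IdealMulL.
  - exact: IdealMulR.
have kerS f : kernel d.-1 f -> ideal_generated_by S f.
  move=> [hf f0]; have [d0|d0] := posnP d.
    by rewrite (ker0 (f := f)) //; [apply: IdealZero | rewrite d0 in hf].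
  apply: (lowS f d.-1); first by rewrite prednK.
  by rewrite -[f]hf; apply: component_ideal; apply/kernelP.
have rk0 : ideal_generated_by S (r k0).
  have [u [v [hu hv]]] := dec; rewrite (bigD1 k0) ?dk0 //= => e.
  have -> : r k0 = (c k0)^-1 *: (\sum_i gen i * u i + \sum_i v i * gen i
      + (- 1) *: \sum_(k | (deg k == d) && (k != k0)) c k *: r k).
    by rewrite -e scaleN1r addrK scalerA mulVf // scale1r.
  apply: (ScZ _ _); apply: IdealAdd; [apply: IdealAdd|apply: (ScZ _ _)].
  - by apply: ideal_sum => i; apply: IdealMulL; apply: kerS.
  - by apply: ideal_sum => i; apply: IdealMulR; apply: kerS.
  elim/big_rec: _ => [|k x /andP[_ nk] hx]; first exact: IdealZero.
  by apply: IdealAdd => //; apply: (ScZ _ _); apply: IdealIn; exists k; rewrite // !inE.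
have [gen nproper] := min; apply: (nproper J).
  by rewrite properEneq subsetT andbT; apply/eqP => /setP/(_ k0); rewrite !inE eqxx.
move=> f; split=> [/kernelP|].
  elim=> {f} [f [k _ ->]||f g _ hf _ hg|h f _ hf|h f _ hf].
  - by case: (eqVneq k k0) => [-> //|nk]; apply: IdealIn; exists k; rewrite // !inE.
  - exact: IdealZero.
  - exact: IdealAdd.
  - exact: IdealMulL.
  - exact: IdealMulR.
move=> hf; apply/kernelP; elim: hf => {f} [f [k _ ->]||f g _ hf _ hg|h f _ hf|h f _ hf].
- by apply: IdealIn; exists k; rewrite // inE.
- exact: IdealZero.
- exact: IdealAdd.
- exact: IdealMulL.
- exact: IdealMulR.
Qed.

End UnitWeights.

(** * Relation types of towers *)

Lemma spanning_basis (K : fieldType) (V : lmodType K) (S : V -> Prop) b (f : 'I_b -> V) :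
  subspace_dim S b -> (forall i, S (f i)) -> (forall v, S v -> spanned f v) -> basis f S.
Proof.
move=> /dim_basis[e [ie Se _]] Sf spf; split=> // c c0 i0; apply/eqP; apply: contraT => nz.
pose g (q : {i | i != i0}) := f (val q).
have sg := subspace_spanned g.
have spg v : spanned f v -> spanned g v.
  apply: spanned_sub => // i; have [->|ne] := eqVneq i i0; last first.
    exact: (spanned_gen g (exist _ i ne)).
  have -> : f i0 = \sum_(q : {i | i != i0}) (- (c i0)^-1 * c (val q)) *: g q.
    rewrite -(sum_subtype (fun i => i != i0) (fun i => (- (c i0)^-1 * c i) *: f i)).
    apply: (scalerI nz); rewrite scaler_sumr; move: c0; rewrite (bigD1 i0) //=.
    move/eqP; rewrite addr_eq0 => /eqP ->; rewrite -sumrN; apply: eq_bigr => i' _.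
    by rewrite scalerA mulNr mulrN mulrA divff // mul1r scaleNr.
  by exists (fun q => - (c i0)^-1 * c (val q)).
have := steinitz (e := g) ie (fun j => spg _ (spf _ (Se j))).
rewrite card_ord card_sig (eq_card (B := predC1 i0)) // cardC1 card_ord.
by have := ltn_ord i0; lia.
Qed.

Lemma ord2_neq (i j : 'I_2) : i != j -> (i != 0) = (j == 0).
Proof. by case: i => [[|[|i]] hi]; case: j => [[|[|j]] hj]. Qed.

Section Counting.
Variables (K : fieldType) (b : nat) (F : algType K) (W : word_basis b F).
Local Notation word := (word W).
Local Notation gen i := (word [:: i]).
Local Notation H := (homogeneous W (fun=> 1%N)).
Variables (A : algType K) (G : nat -> A -> Prop) (pi : {lrmorphism F -> A}).
Hypotheses (gr : graded G) (pi1 : forall i, G 1%N (pi (gen i))).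
Hypothesis pi_onto : forall a, exists f, pi f = a.
Hypothesis dim1 : subspace_dim (G 1%N) b.

Local Notation kernel := (kernel W pi).
Local Notation decomposable := (decomposable W pi).

Lemma gens_basis : basis (fun i => pi (gen i)) (G 1%N).
Proof.
apply: (spanning_basis dim1) => // a /(pi_lift gr pi1 pi_onto)[f hf <-].
rewrite (left_expansion (isT : (0 < 1)%N) hf) rmorph_sum /=.
apply: subspace_sum => [|i _]; first exact: subspace_spanned.
have [c ->] := hom_scalar (left_quotient_hom i hf).
rewrite mulr_algr linearZ; apply: subspaceZ; first exact: subspace_spanned.
exact: (spanned_gen (fun i => pi (gen i))).
Qed.

Lemma kernel1 f : kernel 1 f -> f = 0.
Proof.
move=> [hf f0]; have [ind _ _] := gens_basis.
have [c hc] := fchoice (fun i => hom_scalar (left_quotient_hom i hf)).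
have fE : f = \sum_i c i *: gen i.
  rewrite {1}(left_expansion (isT : (0 < 1)%N) hf); apply: eq_bigr => i _.
  by rewrite hc -scalerAr mulr1.
have c0 : forall i, c i = 0.
  by apply: ind; rewrite -[RHS]f0 fE linear_sum; apply: eq_bigr => i _; rewrite linearZ.
by rewrite fE big1 // => i _; rewrite c0 scale0r.
Qed.

Lemma decomposable_low d f : (d < 3)%N -> decomposable d f -> f = 0.
Proof.
move=> lt [u [v [hu hv ->]]].
have z g : kernel d.-1 g -> g = 0.
  case: d lt {hu hv} => [|[|[|]]] // _; try by move=> [hg g0]; apply: ker0 hg g0.
  exact: kernel1.
rewrite !big1 ?addr0 // => i _; first by rewrite (z _ (hv i)) mul0r.
by rewrite (z _ (hu i)) mulr0.
Qed.

(** The coefficients of the tensor \sum_i gen i * u i = - \sum_i v i * gen i form a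
linear syzygy. *)
Lemma cubic_relations_free u v : no_linear_syzygy (fun i => pi (gen i)) ->
  (forall i, kernel 2 (u i)) -> (forall i, kernel 2 (v i)) ->
  \sum_i gen i * u i + \sum_i v i * gen i = 0 -> (forall i, u i = 0) /\ (forall i, v i = 0).
Proof.
move=> nls hu hv uv.
have hq i j : H 1%N (left_quotient W j (u i)) by case: (hu i) => h _; apply: left_quotient_hom h.
have [c hc] : exists c : 'I_b -> 'I_b -> 'I_b -> K, forall i j l,
    left_quotient W l (left_quotient W j (u i)) = (c i j l)%:A.
  apply: (fchoice (P := fun i c => forall j l, left_quotient W l (left_quotient W j (u i)) = (c j l)%:A)) => i.
  apply: (fchoice (P := fun j c => forall l, left_quotient W l (left_quotient W j (u i)) = (c l)%:A)) => j.
  exact: (fchoice (fun l => hom_scalar (left_quotient_hom l (hq i j)))).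
have uE i : u i = \sum_j \sum_l c i j l *: (gen j * gen l).
  case: (hu i) => h _; rewrite (left_expansion (isT : (0 < 2)%N) h); apply: eq_bigr => j _.
  rewrite {1}(left_expansion (isT : (0 < 1)%N) (hq i j)) mulr_sumr; apply: eq_bigr => l _.
  by rewrite hc mulr_algr -scalerAr.
have vE l : v l = - \sum_i \sum_j c i j l *: (gen i * gen j).
  rewrite -[LHS](right_quotient_sum W l v); have /eqP := uv; rewrite addrC addr_eq0 => /eqP ->.
  rewrite linearN; congr (- _); rewrite linear_sum; apply: eq_bigr => i _ /=.
  rewrite uE mulr_sumr linear_sum; apply: eq_bigr => j _ /=; rewrite mulr_sumr linear_sum.
  rewrite (bigD1 l) //= -scalerAr mulrA linearZ /= right_quotient_gen eqxx big1 ?addr0 //.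
  by move=> k nk; rewrite -scalerAr mulrA linearZ /= right_quotient_gen (negPf nk) scaler0.
have c0 : forall i j l, c i j l = 0.
  apply: nls; split=> [l|i].
    have [_] := hv l; rewrite vE rmorphN => /eqP; rewrite oppr_eq0 => /eqP e0.
    rewrite -[RHS]e0 rmorph_sum /=; apply: eq_bigr => i _; rewrite rmorph_sum /=.
    by apply: eq_bigr => j _; rewrite linearZ rmorphM.
  have [_ e0] := hu i; rewrite -[RHS]e0 uE rmorph_sum /=; apply: eq_bigr => j _; rewrite rmorph_sum /=.
  by apply: eq_bigr => l _; rewrite linearZ rmorphM.
split=> i; first by rewrite uE big1 // => j _; rewrite big1 // => l _; rewrite c0 scale0r.
by rewrite vE big1 ?oppr0 // => j _; rewrite big1 // => l _; rewrite c0 scale0r.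
Qed.

Variables (N : nat) (r : 'I_N -> F) (deg : 'I_N -> nat).
Hypothesis hr : forall k, H (deg k) (r k).
Hypothesis min : minimal_ideal_generators r (fun f => pi f = 0).

Let indep := generators_independent hr min.
Let cnt d := #|[pred k | deg k == d]|.

Lemma kernel_r k : kernel (deg k) (r k).
Proof.
split=> //; apply/(kernelP min); apply: IdealIn; exists k => //; exact: in_setT.
Qed.

Lemma delta_sum k : \sum_(j | deg j == deg k) (j == k)%:R *: r j = r k.
Proof.
rewrite (bigD1 k) //= eqxx scale1r big1 ?addr0 // => j /andP[_ /negPf ->].
by rewrite scale0r.
Qed.

Lemma not_decomposable k : ~ decomposable (deg k) (r k).
Proof.
rewrite -(delta_sum k) => /indep/(_ k erefl); rewrite eqxx => /eqP.
by rewrite oner_eq0.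
Qed.

Lemma deg_gt1 k : (1 < deg k)%N.
Proof.
rewrite ltnNge; apply/negP => le; apply: (@not_decomposable k).
have -> : r k = 0; last by case: (decomposable_subspace W pi (deg k)).
have := kernel_r k; case: (deg k) le => [|[|]] // _; last exact: kernel1.
by case; apply: ker0.
Qed.

Let R d := {k | deg k == d}.

Lemma R_independent d (c : R d -> K) :
  decomposable d (\sum_k c k *: r (val k)) -> forall k, c k = 0.
Proof.
pose c' k := if insub k is Some q then c q else 0.
have e : \sum_k c k *: r (val k) = \sum_(k | deg k == d) c' k *: r k.
  by rewrite [RHS]sum_subtype; apply: eq_bigr => k _; rewrite /c' valK.
rewrite e => /indep h k; have := h (val k) (eqP (valP k)); by rewrite /c' valK.
Qed.

Lemma quadratic_basis : basis (fun k : R 2 => r (val k)) (kernel 2).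
Proof.
split.
- move=> c c0; apply: R_independent; rewrite c0.
  by case: (decomposable_subspace W pi 2).
- by move=> k; have := kernel_r (val k); rewrite (eqP (valP k)).
move=> f kf; have [c] := kernel_generators gr pi1 hr min kf.
move/(decomposable_low (isT : (2 < 3)%N))/eqP; rewrite subr_eq0 => /eqP ->.
by exists (fun k => c (val k)); rewrite sum_subtype.
Qed.

Lemma quadratic_count h2 : subspace_dim (G 2) h2 -> (b ^ 2 = h2 + cnt 2)%N.
Proof.
move=> /dim_basis[e be].
have := rank_nullity (p := pi) (hom_subspace W (fun=> 1%N) 2) (words_basis W 2) be
  (fun w h => pi_hom gr pi1 h) (pi_lift gr pi1 pi_onto (d := 2)) quadratic_basis.
by rewrite card_tuple !card_ord card_sig.
Qed.

Definition cubic_element (s : (('I_b * R 2) + ('I_b * R 2)) + R 3) : F :=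
  match s with
  | inl (inl (i, k)) => gen i * r (val k)
  | inl (inr (i, k)) => r (val k) * gen i
  | inr k => r (val k)
  end.

(** Freeness of the products of generators with quadratic relations is the
absence of linear syzygies; the relations of degree three complement them by
minimality. *)
Lemma cubic_basis : no_linear_syzygy (fun i => pi (gen i)) -> basis cubic_element (kernel 3).
Proof.
move=> nls; have [i2 k2 sp2] := quadratic_basis; have hg i : H 1%N (gen i) := word_hom W [:: i].
split.
- move=> c; rewrite !big_sumType /= => c0.
  pose u i := \sum_(k : R 2) c (inl (inl (i, k))) *: r (val k).
  pose v i := \sum_(k : R 2) c (inl (inr (i, k))) *: r (val k).
  have hu i : kernel 2 (u i).
    apply: subspace_sum => [|k _]; first exact: kernel_subspace.
    by apply: subspaceZ; [apply: kernel_subspace | apply: k2].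
  have hv i : kernel 2 (v i).
    apply: subspace_sum => [|k _]; first exact: kernel_subspace.
    by apply: subspaceZ; [apply: kernel_subspace | apply: k2].
  have eu : \sum_(p : 'I_b * R 2) c (inl (inl p)) *: (gen p.1 * r (val p.2)) = \sum_i gen i * u i.
    transitivity (\sum_(p : 'I_b * R 2) c (inl (inl (p.1, p.2))) *: (gen p.1 * r (val p.2))).
      by apply: eq_bigr => -[].
    rewrite -(pair_bigA _ (fun i k => c (inl (inl (i, k))) *: (gen i * r (val k)))) /=.
    by apply: eq_bigr => i _; rewrite mulr_sumr; apply: eq_bigr => k _; rewrite scalerAr.
  have ev : \sum_(p : 'I_b * R 2) c (inl (inr p)) *: (r (val p.2) * gen p.1) = \sum_i v i * gen i.
    transitivity (\sum_(p : 'I_b * R 2) c (inl (inr (p.1, p.2))) *: (r (val p.2) * gen p.1)).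
      by apply: eq_bigr => -[].
    rewrite -(pair_bigA _ (fun i k => c (inl (inr (i, k))) *: (r (val k) * gen i))) /=.
    by apply: eq_bigr => i _; rewrite mulr_suml; apply: eq_bigr => k _; rewrite scalerAl.
  have c0' : \sum_i gen i * u i + \sum_i v i * gen i + \sum_(k : R 3) c (inr k) *: r (val k) = 0.
    rewrite -eu -ev -[RHS]c0; congr (_ + _ + _); by apply: eq_bigr => -[].
  have c3 : forall k, c (inr k) = 0.
    apply: R_independent; have /eqP := c0'; rewrite addrC addr_eq0 => /eqP ->.
    apply: subspaceN; first exact: decomposable_subspace.
    by exists u, v.
  have [|u0 v0] := cubic_relations_free nls hu hv.
    by move: c0'; rewrite [X in _ + X = 0]big1 ?addr0 // => k _; rewrite c3 scale0r.
  have z1 i := i2 (fun k => c (inl (inl (i, k)))) (u0 i).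
  have z2 i := i2 (fun k => c (inl (inr (i, k)))) (v0 i).
  by case=> [[[i k]|[i k]]|k].
- case=> [[[i k]|[i k]]|k].
  + exact: (kernelMl (hg i) (k2 k)).
  + exact: (kernelMr (k2 k) (hg i)).
  by have := kernel_r (val k); rewrite (eqP (valP k)).
move=> f kf; have [c [u [v [hu hv]]]] := kernel_generators gr pi1 hr min kf.
pose e := cubic_element; have se := subspace_spanned e; rewrite -/e.
move/eqP; rewrite subr_eq => /eqP ->; apply: (subspaceD se); first apply: (subspaceD se).
- apply: subspace_sum => // i _; have [c' ->] := sp2 _ (hu i); rewrite mulr_sumr.
  apply: subspace_sum => // k _; rewrite -scalerAr; apply: subspaceZ => //.
  exact: (spanned_gen e (inl (inl (i, k)))).
- apply: subspace_sum => // i _; have [c' ->] := sp2 _ (hv i); rewrite mulr_suml.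
  apply: subspace_sum => // k _; rewrite -scalerAl; apply: subspaceZ => //.
  exact: (spanned_gen e (inl (inr (i, k)))).
rewrite sum_subtype; apply: subspace_sum => // k _; apply: subspaceZ => //.
exact: (spanned_gen e (inr k)).
Qed.

Lemma cubic_count h3 : no_linear_syzygy (fun i => pi (gen i)) -> subspace_dim (G 3) h3 ->
  (b ^ 3 = h3 + (2 * b * cnt 2 + cnt 3))%N.
Proof.
move=> nls /dim_basis[e be].
have := rank_nullity (p := pi) (hom_subspace W (fun=> 1%N) 3) (words_basis W 3) be
  (fun w h => pi_hom gr pi1 h) (pi_lift gr pi1 pi_onto (d := 3)) (cubic_basis nls).
rewrite card_tuple !card_sum !card_prod !card_ord !card_sig => ->.
by rewrite addnn -mul2n mulnA.
Qed.

Lemma separating_functional d k (N' : F -> Prop) : subspace N' -> deg k = d ->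
  (forall f, decomposable d f -> N' f) -> ~ N' (r k) ->
  exists psi, [/\ linear_on (H d) psi, forall f, decomposable d f -> psi f = 0,
    forall f, H d f -> N' f -> psi f = 0 & psi (r k) = 1].
Proof.
move=> sN dk dN nN; have d0 : (0 < d)%N by rewrite -dk ltnW ?deg_gt1.
have [n dn] : exists n, subspace_dim (H d) n.
  by exists #|{: d.-tuple 'I_b}|; apply: basis_dim (words_basis W d); apply: hom_subspace.
have [e [_ _ spe]] := dim_basis dn.
have hk : H d (r k) by rewrite -dk.
have [psi [lin psi0 psi1]] := separation (hom_subspace W (fun=> 1%N) d) spe sN hk nN.
exists psi; split=> // f df; apply: psi0; last exact: dN.
by case: (decomposable_kernel d0 df).
Qed.

(** A relation of degree d that is minimal is detected by a functional vanishing
on decomposable elements; its cocycle is not exact. *)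
Lemma no_relation d : (1 < d)%N -> (forall th, cocycle2 G d th -> exact2 G d th) ->
  cnt d = 0%N.
Proof.
move=> d1 ex; apply: eq_card0 => k; apply/negP => /eqP dk.
have [|||psi [lin psi0 _ psi1]] := @separating_functional d k (decomposable d) _ dk.
- exact: decomposable_subspace.
- by [].
- by rewrite -dk; apply: not_decomposable.
have [th c2 thE] := relation_cocycle gr pi1 pi_onto lin psi0.
have := exact_relation gr pi1 d1 lin thE (ex _ c2) (f := r k).
rewrite psi1 -dk => /(_ (kernel_r k))/eqP; by rewrite oner_eq0.
Qed.

(** Functionals dual to two minimal relations modulo decomposable elements give
two cocycles that are independent in H^2. *)
Lemma one_relation d : (1 < d)%N ->
  (forall F : 'I_2 -> A -> A -> K, (forall j, cocycle2 G d (F j)) ->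
    exists c : 'I_2 -> K, (exists j, c j != 0) /\
      exact2 G d (fun a b => \sum_j c j * F j a b)) -> (cnt d <= 1)%N.
Proof.
move=> d1 pencil; rewrite leqNgt; apply/negP => /card_gt1P[k1 [k2 []]].
rewrite !inE => /eqP dk1 /eqP dk2 nk.
pose k (j : 'I_2) := if j == 0 then k1 else k2.
pose k' (j : 'I_2) := if j == 0 then k2 else k1.
have dk j : deg (k j) = d by rewrite /k; case: ifP.
have dk' j : deg (k' j) = d by rewrite /k'; case: ifP.
have nkk j : k j != k' j by rewrite /k /k'; case: ifP => _; rewrite // eq_sym.
have sD := decomposable_subspace W pi d.
have ex j : exists psi, [/\ linear_on (H d) psi, forall f, decomposable d f -> psi f = 0,
    psi (r (k j)) = 1 & psi (r (k' j)) = 0].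
  (* psi j vanishes on the decomposable elements and on the other relation *)
  pose N' f := exists a, decomposable d (f - a *: r (k' j)).
  have [|||psi [h1 h2 h3 h4]] := @separating_functional d (k j) N' _ (dk j).
  - split; first by exists 0; rewrite scale0r subr0; case: sD.
    move=> c u v [a ha] [a' ha']; exists (c * a + a').
    have -> : c *: u + v - (c * a + a') *: r (k' j) =
        c *: (u - a *: r (k' j)) + (v - a' *: r (k' j)).
      by rewrite scalerBr scalerA scalerDl opprD; addac.
    by case: sD => _; apply.
  - by move=> f df; exists 0; rewrite scale0r subr0.
  - move=> [a]; have {1}<- := delta_sum (k j); have {1}<- := delta_sum (k' j).
    rewrite dk dk' scaler_sumr -sumrB => h.
    have h' : decomposable d (\sum_(i | deg i == d) ((i == k j)%:R - a * (i == k' j)%:R) *: r i).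
      by under eq_bigr => i _ do rewrite scalerBl -scalerA.
    have /eqP := indep h' (dk j); rewrite eqxx (negPf (nkk j)) mulr0 subr0.
    by rewrite oner_eq0.
  exists psi; split=> //; apply: h3; first by rewrite -(dk' j).
  by exists 1; rewrite scale1r subrr; case: sD.
have [psi hpsi] := fchoice ex.
have exth j : exists th, cocycle2 G d th /\ forall u v f g, (0 < u)%N -> (0 < v)%N ->
    (u + v)%N = d -> H u f -> H v g -> th (pi f) (pi g) = psi j (f * g).
  have [lin psi0 _ _] := hpsi j.
  by have [th c2 thE] := relation_cocycle gr pi1 pi_onto lin psi0; exists th.
have [th hth] := fchoice exth; have [c [[j nz] exc]] := pencil th (fun j => (hth j).1).
pose Psi f := \sum_i c i * psi i f.
have lPsi : linear_on (H d) Psi.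
  move=> a u v hu hv; rewrite /Psi mulr_sumr -big_split; apply: eq_bigr => i _.
  by have [lin _ _ _] := hpsi i; rewrite lin // mulrDr mulrCA.
have PsiE u v f g : (0 < u)%N -> (0 < v)%N -> (u + v)%N = d -> H u f -> H v g ->
    \sum_i c i * th i (pi f) (pi g) = Psi (f * g).
  by move=> u0 v0 uv hf hg; apply: eq_bigr => i _; rewrite ((hth i).2 u v f g u0 v0 uv hf hg).
have := exact_relation gr pi1 d1 lPsi PsiE exc (f := r (k j)).
rewrite -{1}(dk j) => /(_ (kernel_r _)); rewrite /Psi (bigD1 j) //= big1 => [|i ni].
  by have [_ _ -> _] := hpsi j; rewrite mulr1 addr0 => /eqP; rewrite (negPf nz).
have -> : k j = k' i.
  by rewrite /k /k' -(ord2_neq ni); case: (i == 0).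
by have [_ _ _ ->] := hpsi i; rewrite mulr0.
Qed.

End Counting.

Lemma card_nth (a : seq nat) d : #|[pred k : 'I_(size a) | nth 0%N a k == d]| = count_mem d a.
Proof.
by rewrite -sum1_card -sum1_count (big_nth 0%N) big_mkord.
Qed.

Lemma sorted_count_eq (a a' : seq nat) : sorted leq a -> sorted leq a' ->
  (forall d, count_mem d a = count_mem d a') -> a = a'.
Proof.
move=> sa sa' h; apply: (sorted_eq leq_trans anti_leq sa sa').
by apply/allP => x _; apply/eqP.
Qed.

(** The relation type is determined by the numbers of minimal relations of each
degree: those of degree two and three by dimensions, as there are no linear
syzygies, the others by the second cohomology. *)
Theorem tower_relation_type (K : fieldType) (A : algType K) (G : nat -> A -> Prop) ds a :
  tower G ds -> size ds = 5%N -> generated_in_degree_one G -> subspace_dim (G 1%N) 3%N ->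
  relation_type G a ->
  perm_eq ds [:: 1; 1; 1; 2; 2]%N /\ a = [:: 2; 3; 3; 3; 3; 3]%N \/
  perm_eq ds [:: 1; 1; 1; 2; 3]%N /\ (a = [:: 2; 2; 3]%N \/ a = [:: 2; 2; 3; 4]%N).
Proof.
move=> tw sz gen d3 [sa [b [pi0 [r0 [db pi1 onto hr min]]]]]; have gr := tower_graded tw.
have b3 : b = 3%N := dim_uniq db d3; subst b.
pose F := free_alg K 3%N; pose W := malg_words K 3%N; pose pi : {lrmorphism F -> A} := pi0.
pose r : 'I_(size a) -> F := r0; pose deg (k : 'I_(size a)) := nth 0%N a k.
have pi1' i : G 1%N (pi (word W [:: i])).
  by have := pi1 i; rewrite -mword_gen.
have onto' : forall x, exists f, pi f = x := onto.
have hr' k : homogeneous W (fun=> 1%N) (deg k) (r k) by apply/free_homogeneousE; apply: hr.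
have min' : minimal_ideal_generators r (fun f => pi f = 0) := min.
have [_ d1 d2 d3'] := tower_dim tw; have c1 : count_mem 1%N ds = 3%N := dim_uniq d1 d3.
have [pe last1] := tower_degrees tw sz c1 gen.
have nls : no_linear_syzygy (fun i => pi (word W [:: i])).
  have [es eds] : exists es, ds = rcons es 1%N.
    by case/lastP: ds last1 sz {tw c1 pe d1 d2 d3'} => // es e; rewrite last_rcons => -> _; exists es.
  have cm k : count_mem k ds = (count_mem k es + (1 == k))%N.
    by rewrite eds -cats1 count_cat /= addn0.
  have tw' := tw; rewrite eds in tw'; apply: (tower_no_linear_syzygy tw') => //.
  - by move: c1; rewrite cm addn1 => -[].
  - have : (0 < count_mem 2 ds)%N by case: pe => /permP ->.
    by rewrite cm addn0.
  exact: gens_basis.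
have cE d : #|[pred k | deg k == d]| = count_mem d a by apply: card_nth.
have q := quadratic_count gr pi1' onto' d3 hr' min' d2.
have c := cubic_count gr pi1' onto' d3 hr' min' nls d3'.
have low d : (d < 2)%N -> count_mem d a = 0%N.
  move=> lt; rewrite -cE; apply: eq_card0 => k; apply/negP => /eqP dk.
  by have := deg_gt1 gr pi1' onto' d3 hr' min' k; rewrite dk ltnNge -ltnS lt.
have no d : (1 < d)%N -> (forall th, cocycle2 G d th -> exact2 G d th) -> count_mem d a = 0%N.
  by move=> d1' ex; rewrite -cE; apply: (no_relation gr pi1' onto' d3 hr' min').
have := tower_cohomology2 tw sz c1 gen; rewrite /=.
rewrite !cE c1 in q c.
case=> [[pe' ex]|[pe' ex pencil]]; [left | right]; split=> //.
  have cm k : count_mem k ds = count_mem k [:: 1; 1; 1; 2; 2]%N by apply/permP.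
  rewrite !cm (_ : 'C(4, 2) = 6)%N // in q; rewrite !cm (_ : 'C(5, 3) = 10)%N // in c.
  apply: sorted_count_eq => // -[|[|[|[|d]]]]; try (by apply: low); last by apply: no => // th c2; apply: ex c2.
    by move: q; rewrite /=; move: (count_mem 2 a) => x; lia.
  by move: q c; rewrite /=; move: (count_mem 2 a) (count_mem 3 a) => x y; lia.
have cm k : count_mem k ds = count_mem k [:: 1; 1; 1; 2; 3]%N by apply/permP.
rewrite !cm (_ : 'C(4, 2) = 6)%N // in q; rewrite !cm (_ : 'C(5, 3) = 10)%N // in c.
have n2 : count_mem 2 a = 2%N by move: q; rewrite /=; move: (count_mem 2 a) => x; lia.
have n3 : count_mem 3 a = 1%N.
  by move: q c; rewrite /=; move: (count_mem 2 a) (count_mem 3 a) => x y; lia.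
have n4 : (count_mem 4 a <= 1)%N by rewrite -cE; apply: (one_relation gr pi1' onto' d3 hr' min').
have n5 d : count_mem d.+4.+1 a = 0%N by apply: no => // th c2; apply: ex c2.
case: (posnP (count_mem 4 a)) => h4; [left | right].
  by apply: sorted_count_eq => // -[|[|[|[|[|d]]]]];
    [exact: low|exact: low|exact: n2|exact: n3|exact: h4|exact: n5].
have {}h4 : count_mem 4 a = 1%N by move: n4 h4; case: (count_mem 4 a) => [|[]].
by apply: sorted_count_eq => // -[|[|[|[|[|d]]]]];
    [exact: low|exact: low|exact: n2|exact: n3|exact: h4|exact: n5].
Qed.

(** * Construction of Ore extensions *)

Section SkewShift.
Variables (K : fieldType) (R : algType K).
Variables (s : {lrmorphism R -> R}) (d : {linear R -> R}).
Implicit Types p q r : {poly R}.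

(** Left multiplication by the new variable, on polynomials with left coefficients. *)
Definition skew_shift p : {poly R} := map_poly s p * 'X + map_poly d p.

Lemma skew_shift_additive : zmod_morphism skew_shift.
Proof.
move=> p q; rewrite /skew_shift !raddfB mulrBl; apply/polyP => i.
by rewrite !coefD !coefN !coefD !opprD; rewrite -!addrA; congr (_ + _); rewrite addrCA.
Qed.
HB.instance Definition _ := GRing.isZmodMorphism.Build {poly R} {poly R} skew_shift skew_shift_additive.

Hypothesis skew : skew_derivation s d.

Lemma skew_d1 : d 1 = 0.
Proof.
have := skew 1 1; rewrite !mulr1 rmorph1 mul1r => /eqP.
by rewrite -subr_eq0 opprD addNKr oppr_eq0 => /eqP.
Qed.

Lemma skew_shiftZ a p : skew_shift (a *: p) = s a *: skew_shift p + d a *: p.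
Proof.
apply/polyP => i; rewrite /skew_shift !(coefD, coefZ, coefMX, coef_map) /= skew.
case: i => [|i] /=; first by rewrite !add0r.
by rewrite rmorphM mulrDr addrA.
Qed.

Lemma skew_shiftXn i : skew_shift 'X^i = 'X^(i.+1).
Proof.
apply/polyP => j; rewrite /skew_shift coefD coefMX !coef_map !coefXn /=.
have -> : d (j == i)%:R = 0 by case: (j == i); rewrite ?skew_d1 ?linear0.
by rewrite addr0; case: j => [|j] //=; rewrite rmorph_nat eqSS.
Qed.

Definition skew_mul p q : {poly R} := \sum_(i < size p) p`_i *: iter i skew_shift q.

Lemma skew_mulEw n p q : (size p <= n)%N ->
  skew_mul p q = \sum_(i < n) p`_i *: iter i skew_shift q.
Proof.
move=> le; rewrite /skew_mul (big_ord_widen _ (fun i => p`_i *: iter i skew_shift q) le).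
rewrite [RHS](bigID (fun i : 'I_n => (i < size p)%N)) /= [X in _ = _ + X]big1 ?addr0 // => i.
by rewrite -leqNgt => h; rewrite nth_default // scale0r.
Qed.

Lemma skew_mulDl p q r : skew_mul (p + q) r = skew_mul p r + skew_mul q r.
Proof.
pose n := maxn (size (p + q)) (maxn (size p) (size q)).
rewrite !(@skew_mulEw n) ?leq_max ?leqnn ?orbT // -big_split.
by apply: eq_bigr => i _; rewrite coefD scalerDl.
Qed.

Lemma iter_skew_shiftD i p q :
  iter i skew_shift (p + q) = iter i skew_shift p + iter i skew_shift q.
Proof. by elim: i => //= i ->; rewrite raddfD. Qed.

Lemma skew_mulDr p q r : skew_mul p (q + r) = skew_mul p q + skew_mul p r.
Proof.
by rewrite /skew_mul -big_split; apply: eq_bigr => i _; rewrite iter_skew_shiftD scalerDr.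
Qed.

Lemma skew_mul0l q : skew_mul 0 q = 0.
Proof. by rewrite /skew_mul size_poly0 big_ord0. Qed.

Lemma skew_mulZ a p q : skew_mul (a *: p) q = a *: skew_mul p q.
Proof.
rewrite (@skew_mulEw (size p)) ?size_scale_leq // /skew_mul scaler_sumr.
by apply: eq_bigr => i _; rewrite coefZ scalerA.
Qed.

Lemma skew_mul_suml (I : finType) (f : I -> {poly R}) q :
  skew_mul (\sum_i f i) q = \sum_i skew_mul (f i) q.
Proof.
by elim/big_rec2: _ => [|i y x _ <-]; rewrite ?skew_mul0l ?skew_mulDl.
Qed.

Lemma skew_mulXn i q : skew_mul 'X^i q = iter i skew_shift q.
Proof.
rewrite /skew_mul size_polyXn (bigD1 ord_max) //= coefXn eqxx scale1r big1 ?addr0 // => j nj.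
by rewrite coefXn (_ : (j == i :> nat) = false) ?scale0r //; apply/negbTE.
Qed.

Lemma poly_sum p : p = \sum_(i < size p) p`_i *: 'X^i.
Proof. by rewrite -[LHS]coefK poly_def. Qed.

Lemma skew_shift_sum (I : finType) (f : I -> {poly R}) :
  skew_shift (\sum_i f i) = \sum_i skew_shift (f i).
Proof. exact: raddf_sum. Qed.

Lemma skew_shift_mul q r : skew_mul (skew_shift q) r = skew_shift (skew_mul q r).
Proof.
rewrite {1}[q]poly_sum skew_shift_sum skew_mul_suml /skew_mul skew_shift_sum.
apply: eq_bigr => i _; rewrite !skew_shiftZ skew_shiftXn.
by rewrite -!/(skew_mul _ _) skew_mulDl !skew_mulZ !skew_mulXn.
Qed.

Lemma skew_mulA : associative skew_mul.
Proof.
move=> p q r; rewrite [RHS](_ : _ = \sum_(i < size p) p`_i *: skew_mul (iter i skew_shift q) r).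
  apply: eq_bigr => i _; congr (_ *: _); elim: (nat_of_ord i) => //= n ->.
  by rewrite skew_shift_mul.
by rewrite [X in skew_mul X _](_ : _ = \sum_(i < size p) p`_i *: iter i skew_shift q) // skew_mul_suml; apply: eq_bigr => i _; rewrite skew_mulZ.
Qed.

Lemma skew_mul1l : left_id 1 skew_mul.
Proof. by move=> q; rewrite -(expr0 'X) skew_mulXn. Qed.

Lemma iter_skew_shift1 i : iter i skew_shift 1 = 'X^i.
Proof. by elim: i => //= i ->; rewrite skew_shiftXn. Qed.

Lemma skew_mul1r : right_id 1 skew_mul.
Proof. by move=> p; rewrite [RHS]poly_sum; apply: eq_bigr => i _; rewrite iter_skew_shift1. Qed.

End SkewShift.

(** A phantom parameter keeps the multiplication twisted by s and d apart from
the usual one on polynomials. *)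
Definition ore_poly (K : fieldType) (R : algType K) (s : {lrmorphism R -> R})
  (d : {linear R -> R}) (skew : skew_derivation s d) : Type := {poly R}.

Section OrePoly.
Variables (K : fieldType) (R : algType K).
Variables (s : {lrmorphism R -> R}) (d : {linear R -> R}) (skew : skew_derivation s d).
Local Notation A := (ore_poly skew).

HB.instance Definition _ := GRing.Zmodule.on A.
HB.instance Definition _ := GRing.Zmodule_isNzRing.Build A
  (skew_mulA skew) (@skew_mul1l K R s d) (skew_mul1r skew) (@skew_mulDl K R s d)
  (fun p q r => skew_mulDr s d p q r) (oner_neq0 {poly R}).

Definition ore_scale (c : K) (p : A) : A := (c%:A : R) *: (p : {poly R}).

Fact ore_scaleA a b p : ore_scale a (ore_scale b p) = ore_scale (a * b) p.
Proof. by rewrite /ore_scale scalerA -scalerAl mul1r scalerA. Qed.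
Fact ore_scale1 : left_id 1 ore_scale.
Proof. by move=> p; rewrite /ore_scale !scale1r. Qed.
Fact ore_scaleDr : right_distributive ore_scale +%R.
Proof. by move=> a p q; rewrite /ore_scale scalerDr. Qed.
Fact ore_scaleDl p : {morph ore_scale^~ p : a b / a + b}.
Proof. by move=> a b; rewrite /ore_scale !scalerDl. Qed.
HB.instance Definition _ := GRing.Zmodule_isLmodule.Build K A
  ore_scaleA ore_scale1 ore_scaleDr ore_scaleDl.

Fact ore_scaleAl (c : K) (p q : A) : c *: (p * q) = (c *: p) * q.
Proof. by rewrite [RHS](skew_mulZ s d c%:A). Qed.
HB.instance Definition _ := GRing.Lmodule_isLalgebra.Build K A ore_scaleAl.

Fact ore_scaleAr (c : K) (p q : A) : c *: (p * q) = p * (c *: q).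
Proof.
rewrite -[LHS]/(c%:A *: \sum_(i < size p) p`_i *: iter i (skew_shift s d) q).
rewrite scaler_sumr; apply: eq_bigr => i _.
have this : iter i (skew_shift s d) (c%:A *: (q : {poly R})) = c%:A *: iter i (skew_shift s d) q.
  elim: (i : nat) => //= n ->; rewrite (skew_shiftZ skew) linearZ rmorph1.
  by rewrite linearZ /= (skew_d1 skew) scaler0 scale0r addr0.
by rewrite -[c *: q]/(c%:A *: (q : {poly R})) this !scalerA mulr_algl mulr_algr.
Qed.
HB.instance Definition _ := GRing.Lalgebra_isAlgebra.Build K A ore_scaleAr.

Definition ore_inj (r : R) : A := r%:P.
Fact ore_inj_add : zmod_morphism ore_inj.
Proof. by move=> a b; rewrite /ore_inj polyCB. Qed.
HB.instance Definition _ := GRing.isZmodMorphism.Build R A ore_inj ore_inj_add.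

Lemma ore_injM r (q : A) : ore_inj r * q = r *: (q : {poly R}) :> {poly R}.
Proof.
rewrite /ore_inj -[r%:P]alg_polyC -[_ * _]/(skew_mul s d _ _) skew_mulZ.
by rewrite skew_mul1l.
Qed.

Fact ore_inj_mul : monoid_morphism ore_inj.
Proof.
by split=> // a b; rewrite [RHS]ore_injM /ore_inj -mul_polyC polyCM.
Qed.
HB.instance Definition _ := GRing.isMonoidMorphism.Build R A ore_inj ore_inj_mul.
Fact ore_inj_scale : scalable ore_inj.
Proof. by move=> c a; rewrite /ore_inj -[c *: a]mulr_algl polyCM mul_polyC. Qed.
HB.instance Definition _ := GRing.isScalable.Build K R A *:%R ore_inj ore_inj_scale.

Definition ore_var : A := 'X.

Lemma ore_varM (q : A) : ore_var * q = skew_shift s d q.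
Proof. by rewrite -[_ * _]/(skew_mul s d 'X q) -['X]expr1 skew_mulXn. Qed.

Lemma ore_varXn i : ore_var ^+ i = 'X^i :> {poly R}.
Proof.
elim: i => // i IH; rewrite exprS [LHS]ore_varM [X in skew_shift _ _ X]IH.
exact: skew_shiftXn.
Qed.

Lemma ore_poly_extension : ore_extension ore_inj s d ore_var.
Proof.
have ev (p : {poly R}) : (map_poly ore_inj p).[ore_var] = p.
  rewrite (@horner_coef_wide A (size p)) ?size_poly // [RHS]poly_sum.
  apply: eq_bigr => i _; rewrite coef_map /=.
  by rewrite [LHS]ore_injM [X in _ *: X]ore_varXn.
split=> //.
  by move=> a; exists a; split; [apply: ev | move=> p <-; rewrite ev].
move=> r; rewrite [LHS]ore_varM; apply/polyP => i.
have -> : ore_inj (s r) * ore_var + ore_inj (d r) = s r *: 'X + (d r)%:P :> {poly R}.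
  by apply: (congr1 (fun q : {poly R} => q + (d r)%:P)); apply: ore_injM.
rewrite /skew_shift /ore_inj !map_polyC /= !coefD coefZ !coefC !coefMX coefX coefC.
by case: i => [|[|i]] /=; rewrite ?mulr0 ?mulr1 ?coefC.
Qed.

End OrePoly.

Section Universal.
Variables (K : fieldType) (R A : algType K) (iota : {lrmorphism R -> A}).
Variables (s : {lrmorphism R -> R}) (d : {linear R -> R}) (x : A).
Hypothesis ore : ore_extension iota s d x.

Lemma shift_eval (B : algType K) (f : {lrmorphism R -> B}) (X : B) (p : {poly R}) :
  (forall r, X * f r = f (s r) * X + f (d r)) ->
  X * (map_poly f p).[X] = (map_poly f (skew_shift s d p)).[X].
Proof.
move=> h; rewrite /skew_shift rmorphD rmorphM /= map_polyX hornerD hornerMX.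
have sz (g : {additive R -> R}) : (size (map_poly f (map_poly g p)) <= size p)%N.
  by rewrite (leq_trans (size_poly _ _)) // size_poly.
rewrite (horner_coef_wide X (sz s)) (horner_coef_wide X (sz d)).
rewrite (@horner_coef_wide _ (size p)) ?size_poly // mulr_sumr mulr_suml -big_split.
apply: eq_bigr => i _ /=; rewrite !coef_map /= mulrA h mulrDl -!mulrA.
by rewrite -exprS exprSr.
Qed.

(** The extension substitutes X in expansions with left coefficients; it is
multiplicative because left multiplication by x acts on expansions through
[skew_shift] on both sides. *)
Lemma ore_hom_extension (B : algType K) (f : {lrmorphism R -> B}) (X : B) :
  (forall r, X * f r = f (s r) * X + f (d r)) ->
  exists F : {lrmorphism A -> B}, (forall r, F (iota r) = f r) /\ F x = X.
Proof.
case: ore => skew unexp comm hX.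
pose ev (p : {poly R}) := (map_poly iota p).[x].
have [inv hinv] : exists inv : A -> {poly R}, forall a, ev (inv a) = a /\
    forall p, ev p = a -> inv a = p.
  apply: (fchoice (P := fun a q => ev q = a /\ forall p, ev p = a -> q = p)) => a.
  by have [p [e u]] := unexp a; exists p.
pose F a := (map_poly f (inv a)).[X].
have FE p : F (ev p) = (map_poly f p).[X] by have [_ /(_ p erefl)] := hinv (ev p); rewrite /F => ->.
have evK a : exists p, a = ev p by exists (inv a); case: (hinv a).
have FD : zmod_morphism F.
  move=> a b; have [p ->] := evK a; have [q ->] := evK b.
  have -> : ev p - ev q = ev (p - q) by rewrite /ev rmorphB /= hornerD hornerN.
  by rewrite !FE rmorphB /= hornerD hornerN.
have Fr r a : F (iota r * a) = f r * F a.
  have [p ->] := evK a; have -> : iota r * ev p = ev (r *: p).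
    by rewrite /ev -mul_polyC rmorphM /= map_polyC /= mul_polyC hornerZ.
  by rewrite !FE -mul_polyC rmorphM /= map_polyC /= mul_polyC hornerZ.
have Fx a : F (x * a) = X * F a.
  have [p ->] := evK a; have -> : x * ev p = ev (skew_shift s d p) by apply: shift_eval.
  by rewrite !FE shift_eval.
have Fi r : F (iota r) = f r.
  have -> : iota r = ev r%:P by rewrite /ev map_polyC hornerC.
  by rewrite FE map_polyC hornerC.
have F0 : F 0 = 0 by have := FD 0 0; rewrite !subrr.
have FDD a b : F (a + b) = F a + F b.
  by have := FD a (- b); rewrite opprK => ->; have := FD 0 b; rewrite sub0r F0 sub0r => ->; rewrite opprK.
have FM : monoid_morphism F.
  split; first by rewrite -(rmorph1 iota) Fi rmorph1.
  move=> a b; have [p aE] := evK a; rewrite aE FE /ev.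
  rewrite (@horner_coef_wide _ (size p)) ?size_poly //.
  rewrite [in RHS](@horner_coef_wide _ (size p)) ?size_poly // !mulr_suml.
  have Fsum (g : nat -> A) n : F (\sum_(i < n) g i) = \sum_(i < n) F (g i).
    by elim: n => [|n IH]; rewrite ?big_ord0 // !big_ord_recr FDD IH.
  rewrite (Fsum (fun i => (map_poly iota p)`_i * x ^+ i * b)); apply: eq_bigr => i _; rewrite !coef_map /= -!mulrA Fr; congr (_ * _).
  elim: (nat_of_ord i) => [|n IH]; first by rewrite !expr0 !mul1r.
  by rewrite !exprS -!mulrA Fx IH.
have FS : scalable F.
  move=> c a; rewrite -[c *: a]mulr_algl; have -> : c%:A = iota c%:A :> A.
    by rewrite linearZ rmorph1.
  by rewrite Fr linearZ /= rmorph1 mulr_algl.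
pose F1 := GRing.isZmodMorphism.Build A B F FD.
pose F2 := GRing.isMonoidMorphism.Build A B F FM.
pose F3 := GRing.isScalable.Build K A B *:%R F FS.
exists (HB.pack F F1 F2 F3 : {lrmorphism A -> B}); split=> //=.
by rewrite -[x]mulr1 Fx -(rmorph1 iota) Fi rmorph1 mulr1.
Qed.

(** The set of r satisfying the relation is a subalgebra, s being multiplicative
and d a skew derivation. *)
Lemma ore_hom_generators (B : algType K) (f : {lrmorphism R -> B}) (X : B) (S : R -> Prop) :
  (forall r, subalgebra_generated_by S r) ->
  (forall r, S r -> X * f r = f (s r) * X + f (d r)) ->
  forall r, X * f r = f (s r) * X + f (d r).
Proof.
case: ore => skew _ _ gen h r; elim: (gen r) => {r} [r /h //||r q _ hr _ hq|r q _ hr _ hq|c r _ hr].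
- by rewrite !rmorph1 mulr1 mul1r (skew_d1 skew) rmorph0 addr0.
- by rewrite !rmorphD linearD rmorphD /= mulrDr mulrDl hr hq addrACA.
- rewrite !rmorphM /= mulrA hr mulrDl -mulrA hq mulrDr !mulrA -addrA; congr (_ + _).
  by rewrite skew rmorphD !rmorphM.
by rewrite !linearZ /= -scalerAr hr scalerDr -scalerAl.
Qed.

End Universal.

(** Upper triangular matrices with entries s, d, r: a homomorphism to these is a
pair of homomorphisms together with a skew derivation. *)
Definition triangular (K : fieldType) (B : algType K) : Type := ((B : lmodType K) * (B : lmodType K) * (B : lmodType K))%type.

Section Triangular.
Variables (K : fieldType) (B : algType K).
Local Notation T := (triangular B).

HB.instance Definition _ := GRing.Lmodule.on T.

Definition tri_mul (u v : T) : T :=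
  (u.1.1 * v.1.1, u.1.1 * v.1.2 + u.1.2 * v.2, u.2 * v.2).
Definition tri_one : T := (1, 0, 1).

Fact tri_mulA : associative tri_mul.
Proof.
move=> [[a b] c] [[a' b'] c'] [[a2 b2] c2]; rewrite /tri_mul /=.
by rewrite !mulrDr !mulrDl !mulrA addrA.
Qed.
Fact tri_mul1l : left_id tri_one tri_mul.
Proof. by move=> [[a b] c]; rewrite /tri_mul /= !mul1r mul0r addr0. Qed.
Fact tri_mul1r : right_id tri_one tri_mul.
Proof. by move=> [[a b] c]; rewrite /tri_mul /= !mulr1 mulr0 add0r. Qed.
Fact tri_mulDl : left_distributive tri_mul +%R.
Proof.
move=> [[a b] c] [[a' b'] c'] [[a2 b2] c2]; rewrite /tri_mul /= !mulrDl.
by congr (_, _, _); rewrite addrACA.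
Qed.
Fact tri_mulDr : right_distributive tri_mul +%R.
Proof.
move=> [[a b] c] [[a' b'] c'] [[a2 b2] c2]; rewrite /tri_mul /= !mulrDr.
by congr (_, _, _); rewrite addrACA.
Qed.
Fact tri_one_neq0 : tri_one != 0.
Proof. by apply/eqP => -[/eqP]; rewrite oner_eq0. Qed.
HB.instance Definition _ := GRing.Zmodule_isNzRing.Build T
  tri_mulA tri_mul1l tri_mul1r tri_mulDl tri_mulDr tri_one_neq0.

Fact tri_scaleAl (c : K) (u v : T) : c *: tri_mul u v = tri_mul (c *: u) v.
Proof.
case: u v => [[a b] e] [[a' b'] e']; congr (_, _, _); rewrite /= ?scalerAl //.
by rewrite scalerDr !scalerAl.
Qed.
HB.instance Definition _ := GRing.Lmodule_isLalgebra.Build K T tri_scaleAl.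
Fact tri_scaleAr (c : K) (u v : T) : c *: tri_mul u v = tri_mul u (c *: v).
Proof.
case: u v => [[a b] e] [[a' b'] e']; congr (_, _, _); rewrite /= ?scalerAr //.
by rewrite scalerDr !scalerAr.
Qed.
HB.instance Definition _ := GRing.Lalgebra_isAlgebra.Build K T tri_scaleAr.

Variables (A : algType K) (M : {lrmorphism A -> T}).

Definition tri_sigma (a : A) : B := (M a).1.1.
Definition tri_delta (a : A) : B := (M a).1.2.
Definition tri_base (a : A) : B := (M a).2.

Fact tri_sigmaB : zmod_morphism tri_sigma. Proof. by move=> a b; rewrite /tri_sigma rmorphB. Qed.
HB.instance Definition _ := GRing.isZmodMorphism.Build A B tri_sigma tri_sigmaB.
Fact tri_sigmaM : monoid_morphism tri_sigma.
Proof. by split=> [|a b]; rewrite /tri_sigma ?rmorph1 ?rmorphM. Qed.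
HB.instance Definition _ := GRing.isMonoidMorphism.Build A B tri_sigma tri_sigmaM.
Fact tri_sigmaZ : scalable tri_sigma. Proof. by move=> c a; rewrite /tri_sigma linearZ. Qed.
HB.instance Definition _ := GRing.isScalable.Build K A B *:%R tri_sigma tri_sigmaZ.

Fact tri_baseB : zmod_morphism tri_base. Proof. by move=> a b; rewrite /tri_base rmorphB. Qed.
HB.instance Definition _ := GRing.isZmodMorphism.Build A B tri_base tri_baseB.
Fact tri_baseM : monoid_morphism tri_base.
Proof. by split=> [|a b]; rewrite /tri_base ?rmorph1 ?rmorphM. Qed.
HB.instance Definition _ := GRing.isMonoidMorphism.Build A B tri_base tri_baseM.
Fact tri_baseZ : scalable tri_base. Proof. by move=> c a; rewrite /tri_base linearZ. Qed.
HB.instance Definition _ := GRing.isScalable.Build K A B *:%R tri_base tri_baseZ.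

Fact tri_delta_linear : linear tri_delta. Proof. by move=> c a b; rewrite /tri_delta linearP. Qed.
HB.instance Definition _ := GRing.isLinear.Build K A B *:%R tri_delta tri_delta_linear.

Lemma tri_deltaM a b : tri_delta (a * b) = tri_sigma a * tri_delta b + tri_delta a * tri_base b.
Proof. by rewrite /tri_delta rmorphM. Qed.

End Triangular.

Lemma hom_generators (K : fieldType) (A B : algType K) (f g : {lrmorphism A -> B}) (S : A -> Prop) :
  (forall a, subalgebra_generated_by S a) -> (forall a, S a -> f a = g a) -> f =1 g.
Proof.
move=> gen h a; elim: (gen a) => {a} [a /h //||a b _ ha _ hb|a b _ ha _ hb|c a _ ha].
- by rewrite !rmorph1.
- by rewrite !rmorphD /= ha hb.
- by rewrite !rmorphM /= ha hb.
by rewrite !linearZ /= ha.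
Qed.

(** * A family of iterated Ore extensions *)

Lemma ore_generated (K : fieldType) (R A : algType K) (iota : {lrmorphism R -> A}) x (S : R -> Prop) (S' : A -> Prop) :
  unique_expansions iota x -> (forall r, subalgebra_generated_by S r) ->
  (forall r, S r -> S' (iota r)) -> S' x -> forall a, subalgebra_generated_by S' a.
Proof.
move=> un gen hS hx a; have [p [<- _]] := un a.
rewrite horner_coef; apply: big_rec => [|i u _ hu]; first by rewrite -(scale0r 1); apply: SubalgScale; apply: SubalgOne.
apply: SubalgAdd => //; apply: SubalgMul; last first.
  elim: (nat_of_ord i) => [|n IH]; first exact: SubalgOne.
  by rewrite exprS; apply: SubalgMul => //; apply: SubalgIn.
rewrite coef_map; elim: (gen p`_i) => {u hu} [r /hS|| r q _ hr _ hq | r q _ hr _ hq | c r _ hr] /=.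
- exact: SubalgIn.
- by rewrite rmorph1; apply: SubalgOne.
- by rewrite rmorphD; apply: SubalgAdd.
- by rewrite rmorphM; apply: SubalgMul.
by rewrite linearZ; apply: SubalgScale.
Qed.

(** A homomorphism M to triangular matrices is how sigma and delta are defined:
their values on generators have to satisfy the relations of R, and the
identities for sigma and delta on products then come for free. *)
Lemma triangular_extension (K : fieldType) (R : algType K) (S : R -> Prop) (M : {lrmorphism R -> triangular R}) :
  (forall r, subalgebra_generated_by S r) -> (forall r, S r -> (M r).2 = r) ->
  exists (A : algType K) (iota : {lrmorphism R -> A}) (s : {lrmorphism R -> R}) (d : {linear R -> R}) (x : A),
  [/\ ore_extension iota s d x, forall r, s r = (M r).1.1, forall r, d r = (M r).1.2
    & forall (B : algType K) (f : {lrmorphism R -> B}) (X : B),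
      (forall r, S r -> X * f r = f (M r).1.1 * X + f (M r).1.2) ->
      exists F : {lrmorphism A -> B}, (forall r, F (iota r) = f r) /\ F x = X].
Proof.
move=> gen base.
have baseE : tri_base M =1 idfun by apply: (hom_generators (f := tri_base M) (g := idfun) gen).
have skew : skew_derivation (tri_sigma M) (tri_delta M).
  by move=> a b; rewrite [LHS](tri_deltaM M) baseE.
have ore := ore_poly_extension skew.
exists (ore_poly skew), (@ore_inj _ _ _ _ skew), (tri_sigma M), (tri_delta M), (ore_var skew); split=> // B f X h.
by apply: (ore_hom_extension ore); apply: (ore_hom_generators ore gen).
Qed.
Definition tri (K : fieldType) (B : algType K) (a b c : B) : triangular B := (a, b, c).

Lemma triM (K : fieldType) (B : algType K) (a b c a' b' c' : B) :
  tri a b c * tri a' b' c' = tri (a * a') (a * b' + b * c') (c * c').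
Proof. by []. Qed.

Lemma triD (K : fieldType) (B : algType K) (a b c a' b' c' : B) :
  tri a b c + tri a' b' c' = tri (a + a') (b + b') (c + c').
Proof. by []. Qed.

Lemma triZ (K : fieldType) (B : algType K) k (a b c : B) : k *: tri a b c = tri (k *: a) (k *: b) (k *: c).
Proof. by []. Qed.

Lemma polynomial_expansions (K : fieldType) : unique_expansions (in_alg {poly K}) ('X : {poly K}).
Proof.
have e (p : {poly K}) : (map_poly (in_alg {poly K}) p).['X] = p.
  by rewrite -[RHS]comp_polyXr /comp_poly; congr horner; apply: eq_map_poly => c; rewrite /= alg_polyC.
by move=> a; exists a; split=> [|p <-]; rewrite e.
Qed.

Lemma polynomial_hom (K : fieldType) (B : algType K) (X : B) :
  exists F : {lrmorphism {poly K} -> B}, F 'X = X.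
Proof.
pose f (p : {poly K}) : B := horner_alg X p.
have fB : zmod_morphism f by move=> p q; rewrite /f rmorphB.
have fM : monoid_morphism f by split=> [|p q]; rewrite /f ?rmorph1 ?rmorphM.
have fZ : scalable f by move=> c p; rewrite /f -mul_polyC rmorphM /= horner_algC mulr_algl.
pose F1 := GRing.isZmodMorphism.Build {poly K} B f fB.
pose F2 := GRing.isMonoidMorphism.Build {poly K} B f fM.
pose F3 := GRing.isScalable.Build K {poly K} B *:%R f fZ.
by exists (HB.pack f F1 F2 F3 : {lrmorphism {poly K} -> B}); apply: horner_algX.
Qed.

Lemma subalgebra_mono (K : fieldType) (A : algType K) (S S' : A -> Prop) a :
  (forall v, S v -> S' v) -> subalgebra_generated_by S a -> subalgebra_generated_by S' a.
Proof.
move=> h; elim=> {a} [a /h||a b _ ha _ hb|a b _ ha _ hb|c a _ ha].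
- exact: SubalgIn.
- exact: SubalgOne.
- exact: SubalgAdd.
- exact: SubalgMul.
exact: SubalgScale.
Qed.

Lemma polynomial_generated (K : fieldType) (p : {poly K}) : subalgebra_generated_by (fun q => q = 'X) p.
Proof.
elim/poly_ind: p => [|p c hp]; first by rewrite -(scale0r 1); apply: SubalgScale; apply: SubalgOne.
apply: SubalgAdd; first by apply: SubalgMul => //; apply: SubalgIn.
by rewrite -alg_polyC; apply: SubalgScale; apply: SubalgOne.
Qed.

Section Step.
Variables (K : fieldType) (R : algType K) (vars : seq (R * nat)) (G : nat -> R -> Prop).
Variables (T : graded_iterated_ore vars G) (M : {lrmorphism R -> triangular R}) (e : nat).
Local Notation s r := (M r).1.1.
Local Notation d r := (M r).1.2.

(** Here sigma is injective since it is an involution on the variables. *)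
Lemma presentation_step : sigmas_injective T ->
  (forall u, subalgebra_generated_by (fun v => v \in unzip1 vars) u) -> (0 < e)%N ->
  (forall v, v \in vars -> [/\ (M v.1).2 = v.1, s (s v.1) = v.1,
    G v.2 (s v.1) & G (e + v.2)%N (d v.1)]) ->
  exists (A : algType K) (iota : {lrmorphism R -> A}) (x : A) (G' : nat -> A -> Prop)
    (T' : graded_iterated_ore (rcons [seq (iota v.1, v.2) | v <- vars] (x, e)) G'),
  [/\ sigmas_injective T',
    forall u, subalgebra_generated_by (fun v => v \in unzip1 (rcons [seq (iota v.1, v.2) | v <- vars] (x, e))) u,
    forall r, x * iota r = iota (s r) * x + iota (d r)
  & forall (B : algType K) (f : {lrmorphism R -> B}) (X : B),
      (forall v, v \in vars -> X * f v.1 = f (s v.1) * X + f (d v.1)) ->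
      exists F : {lrmorphism A -> B}, (forall r, F (iota r) = f r) /\ F x = X].
Proof.
move=> inj gen e0 h.
have [r /mapP[v /h[hv _ _ _] ->] //|A [iota [s [d [x [ore sE dE ext]]]]]] := triangular_extension (M := M) gen.
have hom v : v \in vars -> G v.2 (s v.1) /\ G (e + v.2)%N (d v.1).
  by move/h => [_ _ h1 h2]; rewrite sE dE.
have [_ un com] := ore; exists A, iota, x, _, (OreStep T e0 ore hom); split.
- split=> //; apply: (can_inj (g := s)); apply: (hom_generators (f := s \o s) (g := idfun) gen) => r.
  by move=> /mapP[v /h[_ hv _ _] ->]; rewrite /= !sE.
- apply: (ore_generated un gen) => [r /mapP[v hv ->]|].
    by rewrite /unzip1 map_rcons mem_rcons inE -map_comp (map_f (fun v => iota v.1)) ?orbT.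
  by rewrite /unzip1 map_rcons mem_rcons mem_head.
- by move=> r; rewrite com sE dE.
move=> B f X hX; apply: ext => r /mapP[v hv ->]; exact: hX.
Qed.
End Step.

Section Family.
Variables (K : fieldType) (g e k l : K).

(** Each variable, in the order a, y, z, b, x, is an Ore extension of the
subalgebra of the preceding ones, under constraints on the parameters that make
the right-hand sides compatible. *)
Record relations (B : algType K) (a y z b x : B) : Prop := Relations {
  rel_ya : y * a = a * y;
  rel_za : z * a = a * z;
  rel_zy : z * y = g *: (y * z);
  rel_ba : b * a = a * b + e *: y;
  rel_by : b * y = y * b + e *: z;
  rel_bz : b * z = g *: (z * b);
  rel_xa : x * a = a * x + k *: (b * b) + l *: y;
  rel_xy : x * y = y * x;
  rel_xz : x * z = z * x;
  rel_xb : x * b = b * x + l *: z }.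

Hypotheses (g2 : g * g = 1) (le : l * e = 0) (ke : k * e * (1 + g) = 0) (lg : l * (g - 1) = 0).
Variables (dy dz : nat).
Hypotheses (dy0 : (0 < dy)%N) (dz0 : (0 < dz)%N).
Hypotheses (deg_e : e != 0 -> dy = 2%N /\ dz = 3%N) (deg_l : l != 0 -> dy = 2%N /\ dz = 2%N).

Let gg (V : lmodType K) (v : V) : g *: (g *: v) = v.
Proof. by rewrite scalerA g2 scale1r. Qed.

Lemma scale_graded (A : algType K) (G : nat -> A -> Prop) d c a : graded G -> (c != 0 -> G d a) -> G d (c *: a).
Proof.
move=> gr h; case: (eqVneq c 0) => [->|/h]; first by rewrite scale0r; apply: gr0.
exact: grZ.
Qed.

Lemma stage1 : exists (A : algType K) (a : A) (G : nat -> A -> Prop)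
    (T : graded_iterated_ore [:: (a, 1%N)] G),
  [/\ sigmas_injective T, forall u, subalgebra_generated_by (fun v => v \in [:: a]) u
    & forall (B : algType K) (a' : B), exists F : {lrmorphism A -> B}, F a = a'].
Proof.
exists {poly K}, 'X, _, (PolynomialRing (isT : (0 < 1)%N) (@polynomial_expansions K)); split=> //.
  by move=> u; apply: subalgebra_mono (polynomial_generated u) => v ->; rewrite inE.
exact: polynomial_hom.
Qed.

Lemma stage2 : exists (A : algType K) (a y : A) (G : nat -> A -> Prop)
    (T : graded_iterated_ore [:: (a, 1); (y, dy)]%N G),
  [/\ sigmas_injective T, forall u, subalgebra_generated_by (fun v => v \in [:: a; y]) u,
    y * a = a * y
    & forall (B : algType K) (a' y' : B), y' * a' = a' * y' ->
      exists F : {lrmorphism A -> B}, F a = a' /\ F y = y'].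
Proof.
have [R [a [G [T [inj gen HP]]]]] := stage1.
have [/tower_graded gr var _] := tower_of_ore inj.
have [M Ma] := HP _ (tri a 0 a).
have [|A [i [x [G' [T' [inj' gen' com ext]]]]]] := presentation_step (M := M) inj gen dy0.
  move=> v; rewrite inE => /eqP ->; rewrite /= Ma /= Ma; split=> //; last exact: gr0.
  by apply: (var (a, 1%N)); rewrite inE.
exists A, (i a), x, G', T'; split=> //; first by rewrite com Ma /= rmorph0 addr0.
move=> B a' y' h; have [f fa] := HP B a'.
have [v|F [Fi Fx]] := ext B f y'; last by exists F; rewrite Fi.
by rewrite inE => /eqP -> /=; rewrite Ma /= rmorph0 addr0 fa.
Qed.

Lemma stage3 : exists (A : algType K) (a y z : A) (G : nat -> A -> Prop)
    (T : graded_iterated_ore [:: (a, 1); (y, dy); (z, dz)]%N G),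
  [/\ sigmas_injective T, forall u, subalgebra_generated_by (fun v => v \in [:: a; y; z]) u,
    [/\ y * a = a * y, z * a = a * z & z * y = g *: (y * z)]
    & forall (B : algType K) (a' y' z' : B), y' * a' = a' * y' -> z' * a' = a' * z' ->
      z' * y' = g *: (y' * z') ->
      exists F : {lrmorphism A -> B}, [/\ F a = a', F y = y' & F z = z']].
Proof.
have [R [a [y [G [T [inj gen ya HP]]]]]] := stage2.
have [/tower_graded gr var _] := tower_of_ore inj.
have [|M [Ma My]] := HP _ (tri a 0 a) (tri (g *: y) 0 y).
  by rewrite !triM !mulr0 !mul0r -scalerAl -scalerAr ya.
have [|A [i [x [G' [T' [inj' gen' com ext]]]]]] := presentation_step (M := M) inj gen dz0.
  move=> v hv; have := var v hv; move: hv; rewrite !inE => /orP[] /eqP -> /= hv.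
    by rewrite Ma /= Ma; split=> //; apply: gr0.
  have My' : M (g *: y) = tri y 0 (g *: y) by rewrite linearZ /= My triZ gg scaler0.
  by rewrite My /= My'; split=> //; [apply: grZ | apply: gr0].
exists A, (i a), (i y), x, G', T'; split=> //.
  by rewrite !com Ma My /= !rmorph0 !addr0 linearZ -scalerAl -!rmorphM ya.
move=> B a' y' z' h1 h2 h3; have [f [fa fy]] := HP B a' y' h1.
have [v|F [Fi Fx]] := ext B f z'; last by exists F; rewrite !Fi.
by rewrite !inE => /orP[] /eqP -> /=; rewrite ?Ma ?My /= rmorph0 addr0 ?linearZ /= ?fa ?fy // -scalerAl.
Qed.

Lemma stage4 : exists (A : algType K) (a y z b : A) (G : nat -> A -> Prop)
    (T : graded_iterated_ore [:: (a, 1); (y, dy); (z, dz); (b, 1)]%N G),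
  [/\ sigmas_injective T, forall u, subalgebra_generated_by (fun v => v \in [:: a; y; z; b]) u,
    [/\ y * a = a * y, z * a = a * z & z * y = g *: (y * z)]
      /\ [/\ b * a = a * b + e *: y, b * y = y * b + e *: z & b * z = g *: (z * b)]
    & forall (B : algType K) (a' y' z' b' : B), y' * a' = a' * y' -> z' * a' = a' * z' ->
      z' * y' = g *: (y' * z') -> b' * a' = a' * b' + e *: y' -> b' * y' = y' * b' + e *: z' ->
      b' * z' = g *: (z' * b') ->
      exists F : {lrmorphism A -> B}, [/\ F a = a', F y = y', F z = z' & F b = b']].
Proof.
have [R [a [y [z [G [T [inj gen [ya za zy] HP]]]]]]] := stage3.
have [/tower_graded gr var _] := tower_of_ore inj.
have [|||M [Ma My Mz]] := HP _ (tri a (e *: y) a) (tri y (e *: z) y) (tri (g *: z) 0 z).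
- by rewrite !triM ya -!scalerAl -!scalerAr za [X in tri _ X _]addrC.
- by rewrite !triM -!scalerAl -!scalerAr za zy !mulr0 !mul0r add0r addr0 !scalerA mulrAC g2 mul1r.
- by rewrite !triM triZ -!scalerAl -!scalerAr !mulr0 !mul0r add0r addr0 zy !scalerA.
have [|A [i [x [G' [T' [inj' gen' com ext]]]]]] := presentation_step (M := M) inj gen (isT : (0 < 1)%N).
  move=> v hv; have := var v hv; move: hv; rewrite !inE => /orP[|/orP[]] /eqP -> /= hv.
  - rewrite Ma /= Ma; split=> //=; apply: (scale_graded gr) => /deg_e[dy2 _].
    by have := var (y, dy); rewrite dy2 !inE eqxx orbT => /(_ isT).
  - rewrite My /= My; split=> //=; apply: (scale_graded gr) => /deg_e[-> dz3].
    by have := var (z, dz); rewrite dz3 !inE eqxx !orbT => /(_ isT).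
  have Mz' : M (g *: z) = tri z 0 (g *: z) by rewrite linearZ /= Mz triZ gg scaler0.
  by rewrite Mz /= Mz'; split=> //; [apply: grZ | apply: gr0].
exists A, (i a), (i y), (i z), x, G', T'; split=> //.
  rewrite !com Ma My Mz /= !rmorph0 !addr0 !linearZ /= -!rmorphM -!scalerAl ya za zy.
  by split; split=> //; exact: linearZ.
move=> B a' y' z' b' h1 h2 h3 h4 h5 h6; have [f [fa fy fz]] := HP B a' y' z' h1 h2 h3.
have [v|F [Fi Fx]] := ext B f b'; last by exists F; rewrite !Fi.
rewrite !inE => /orP[|/orP[]] /eqP -> /=; rewrite ?Ma ?My ?Mz /= ?rmorph0 ?addr0 ?linearZ /= ?fa ?fy ?fz //.
by rewrite -scalerAl.
Qed.

Lemma family_exists : exists (A : algType K) (a y z b x : A) (G : nat -> A -> Prop)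
    (T : graded_iterated_ore [:: (a, 1); (y, dy); (z, dz); (b, 1); (x, 1)]%N G),
  [/\ sigmas_injective T, relations a y z b x,
      forall u, subalgebra_generated_by (fun v => v \in [:: a; y; z; b; x]) u
    & forall (B : algType K) (a' y' z' b' x' : B), relations a' y' z' b' x' ->
      exists F : {lrmorphism A -> B}, [/\ F a = a', F y = y', F z = z', F b = b' & F x = x']].
Proof.
have [R [a [y [z [b [G [T [inj gen [[ya za zy] [ba by_ bz]] HP]]]]]]]] := stage4.
have [/tower_graded gr var _] := tower_of_ore inj.
have lgE (V : lmodType K) (v : V) : l *: (g *: v) = l *: v.
  by rewrite scalerA; congr (_ *: _); apply/eqP; rewrite -subr_eq0 -{2}[l]mulr1 -mulrBr lg.
have leE (V : lmodType K) (v : V) : l *: (e *: v) = 0 by rewrite scalerA le scale0r.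
have bzb : b * (z * b) = g *: (z * (b * b)) by rewrite mulrA bz -scalerAl mulrA.
have bbz : b * b * z = z * (b * b) by rewrite -mulrA bz -scalerAr bzb gg.
have bby : k *: (b * b * y) = k *: (y * (b * b)).
  have -> : b * b * y = y * b * b + e *: (z * b) + g *: (e *: (z * b)).
    by rewrite -mulrA by_ mulrDr mulrA by_ mulrDl -scalerAr bz -scalerAl [e *: (g *: _)]scalerA mulrC -scalerA.
  rewrite -addrA -{1}[e *: _]scale1r.
  rewrite -scalerDl scalerDr !scalerA [k * _ * e]mulrAC ke scale0r addr0.
  by rewrite mulrA.
have [||||||M [Ma My Mz Mb]] := HP _ (tri a (k *: (b * b) + l *: y) a) (tri y 0 y) (tri z 0 z) (tri b (l *: z) b).
- by rewrite !triM !mulr0 !mul0r add0r addr0 mulrDl mulrDr -!scalerAl -!scalerAr bby ya.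
- by rewrite !triM !mulr0 !mul0r add0r addr0 mulrDl mulrDr -!scalerAl -!scalerAr bbz zy lgE za.
- by rewrite !triM triZ !mulr0 !mul0r !addr0 scaler0 zy.
- rewrite !triM triZ triD mulrDl mulrDr -!scalerAl -!scalerAr ba by_ scaler0 addr0 za.
  by rewrite scalerDr leE addr0 mulrA [X in tri _ X _]addrC.
- by rewrite !triM triZ triD scaler0 !mulr0 !mul0r !add0r !addr0 -!scalerAl -!scalerAr zy lgE by_.
- by rewrite !triM triZ !mulr0 !mul0r !add0r !addr0 -!scalerAl -!scalerAr bz [in RHS]scalerA [g * l]mulrC -scalerA lgE.
have [|A [i [x [G' [T' [inj' gen' com ext]]]]]] := presentation_step (M := M) inj gen (isT : (0 < 1)%N).
  have Gb : G 1%N b by have := var (b, 1%N); rewrite !inE eqxx !orbT => /(_ isT).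
  move=> v hv; have := var v hv; move: hv; rewrite !inE => /orP[|/orP[|/orP[]]] /eqP -> /= hv.
  - rewrite Ma /= Ma; split=> //=; apply: (grD gr); first by apply: grZ => //; apply: (gr_mul gr).
    apply: (scale_graded gr) => /deg_l[dy2 _].
    by have := var (y, dy); rewrite dy2 !inE eqxx !orbT => /(_ isT).
  - by rewrite My /= My; split=> //; apply: gr0.
  - by rewrite Mz /= Mz; split=> //; apply: gr0.
  rewrite Mb /= Mb; split=> //=; apply: (scale_graded gr) => /deg_l[_ dz2].
  by have := var (z, dz); rewrite dz2 !inE eqxx !orbT => /(_ isT).
exists A, (i a), (i y), (i z), (i b), x, G', T'; split=> //.
  split; rewrite ?com ?Ma ?My ?Mz ?Mb /= ?rmorph0 ?addr0 -?rmorphM ?ya ?za ?zy ?ba ?by_ ?bz;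
  by rewrite ?rmorphD /= ?rmorphD /= ?linearZ /= ?linearZ /= ?rmorphM /= ?addrA.
move=> B a' y' z' b' x' [h1 h2 h3 h4 h5 h6 h7 h8 h9 h10].
have [f [fa fy fz fb]] := HP B a' y' z' b' h1 h2 h3 h4 h5 h6.
have [v|F [Fi Fx]] := ext B f x'; last by exists F; rewrite !Fi.
rewrite !inE => /orP[|/orP[|/orP[]]] /eqP -> /=; rewrite ?Ma ?My ?Mz ?Mb /= ?rmorph0 ?addr0 ?rmorphD /= ?linearZ /= ?linearZ /= ?rmorphM /= ?fa ?fy ?fz ?fb ?addrA //.
Qed.
End Family.

(** * Quotient algebras *)

Section Ideal.
Local Open Scope quotient_scope.
Variables (K : fieldType) (F : algType K) (S : F -> Prop).
Local Notation J := (ideal_generated_by S).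

Lemma idealN f : J f -> J (- f).
Proof. by move=> h; rewrite -mulN1r; apply: IdealMulL. Qed.

Lemma idealZ c f : J f -> J (c *: f).
Proof. by move=> h; rewrite -mulr_algl; apply: IdealMulL. Qed.

Definition congr_mod (f g : F) : bool := if excluded_middle_informative (J (f - g)) then true else false.

Lemma congr_modP f g : reflect (J (f - g)) (congr_mod f g).
Proof. by rewrite /congr_mod; case: excluded_middle_informative => h; constructor. Qed.

Fact congr_mod_equiv : equiv_class_of congr_mod.
Proof.
split=> [f|f g|g f h].
- by apply/congr_modP; rewrite subrr; apply: IdealZero.
- by apply/congr_modP/congr_modP => h; rewrite -opprB; apply: idealN.
move=> /congr_modP h1 /congr_modP h2; apply/congr_modP.
by rewrite -[f](subrK g) -addrA; apply: IdealAdd.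
Qed.
Canonical congr_mod_rel := EquivRelPack congr_mod_equiv.

Hypothesis proper : ~ J 1.

Definition ideal_quotient of (~ J 1) : Type := {eq_quot congr_mod_rel}.
Local Notation Q := (ideal_quotient proper).
HB.instance Definition _ := Choice.on Q.
Definition cl (f : F) : Q := \pi_({eq_quot congr_mod_rel}) f.
Definition rp (q : Q) : F := repr (q : {eq_quot congr_mod_rel}).

Lemma clP f g : cl f = cl g <-> J (f - g).
Proof.
split=> [/eqquotP/congr_modP //|h]; apply/eqquotP; exact/congr_modP.
Qed.

Lemma rpK q : cl (rp q) = q.
Proof. exact: reprK. Qed.

Lemma rp_cl f : J (rp (cl f) - f).
Proof. by apply/clP; rewrite rpK. Qed.

Lemma cl_ind (P : Q -> Prop) : (forall f, P (cl f)) -> forall q, P q.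
Proof. by move=> h q; rewrite -[q]rpK. Qed.

Definition q_add (p q : Q) := cl (rp p + rp q).
Definition q_opp (p : Q) := cl (- rp p).
Definition q_mul (p q : Q) := cl (rp p * rp q).
Definition q_scale (c : K) (p : Q) := cl (c *: rp p).

Lemma cl_add f g : q_add (cl f) (cl g) = cl (f + g).
Proof. by apply/clP; rewrite opprD addrACA; apply: IdealAdd; apply: rp_cl. Qed.
Lemma cl_opp f : q_opp (cl f) = cl (- f).
Proof. by apply/clP; rewrite opprK addrC -opprB; apply: idealN; apply: rp_cl. Qed.
Lemma cl_mul f g : q_mul (cl f) (cl g) = cl (f * g).
Proof.
apply/clP; rewrite (_ : _ - _ = rp (cl f) * (rp (cl g) - g) + (rp (cl f) - f) * g).
  by apply: IdealAdd; [apply: IdealMulL | apply: IdealMulR]; apply: rp_cl.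
by rewrite mulrBr mulrBl addrA subrK.
Qed.
Lemma cl_scale c f : q_scale c (cl f) = cl (c *: f).
Proof. by apply/clP; rewrite -scalerBr; apply: idealZ; apply: rp_cl. Qed.

Fact q_addA : associative q_add.
Proof. by elim/cl_ind=> f; elim/cl_ind=> g; elim/cl_ind=> h; rewrite !cl_add addrA. Qed.
Fact q_addC : commutative q_add.
Proof. by elim/cl_ind=> f; elim/cl_ind=> g; rewrite !cl_add addrC. Qed.
Fact q_add0 : left_id (cl 0) q_add.
Proof. by elim/cl_ind=> f; rewrite cl_add add0r. Qed.
Fact q_addN : left_inverse (cl 0) q_opp q_add.
Proof. by elim/cl_ind=> f; rewrite cl_opp cl_add addNr. Qed.
HB.instance Definition _ := GRing.isZmodule.Build Q q_addA q_addC q_add0 q_addN.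

Lemma clD f g : cl f + cl g = cl (f + g).
Proof. exact: cl_add. Qed.

Fact q_mulA : associative q_mul.
Proof. by elim/cl_ind=> f; elim/cl_ind=> g; elim/cl_ind=> h; rewrite !cl_mul mulrA. Qed.
Fact q_mul1l : left_id (cl 1) q_mul.
Proof. by elim/cl_ind=> f; rewrite cl_mul mul1r. Qed.
Fact q_mul1r : right_id (cl 1) q_mul.
Proof. by elim/cl_ind=> f; rewrite cl_mul mulr1. Qed.
Fact q_mulDl : left_distributive q_mul +%R.
Proof. by elim/cl_ind=> f; elim/cl_ind=> g; elim/cl_ind=> h; rewrite clD !cl_mul clD mulrDl. Qed.
Fact q_mulDr : right_distributive q_mul +%R.
Proof. by elim/cl_ind=> f; elim/cl_ind=> g; elim/cl_ind=> h; rewrite clD !cl_mul clD mulrDr. Qed.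
Fact q_one_neq0 : cl 1 != 0.
Proof. by apply/eqP => /clP; rewrite subr0. Qed.
HB.instance Definition _ := GRing.Zmodule_isNzRing.Build Q q_mulA q_mul1l q_mul1r q_mulDl q_mulDr q_one_neq0.

Lemma cl_mulE f g : cl f * cl g = cl (f * g).
Proof. exact: cl_mul. Qed.

Fact q_scaleA a b p : q_scale a (q_scale b p) = q_scale (a * b) p.
Proof. by elim/cl_ind: p => f; rewrite !cl_scale scalerA. Qed.
Fact q_scale1 : left_id 1 q_scale.
Proof. by elim/cl_ind=> f; rewrite cl_scale scale1r. Qed.
Fact q_scaleDr : right_distributive q_scale +%R.
Proof. by move=> c; elim/cl_ind=> f; elim/cl_ind=> g; rewrite clD !cl_scale clD scalerDr. Qed.
Fact q_scaleDl p : {morph q_scale^~ p : a b / a + b}.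
Proof. by elim/cl_ind: p => f a b; rewrite !cl_scale clD scalerDl. Qed.
HB.instance Definition _ := GRing.Zmodule_isLmodule.Build K Q q_scaleA q_scale1 q_scaleDr q_scaleDl.

Lemma cl_scaleE c f : c *: cl f = cl (c *: f).
Proof. exact: cl_scale. Qed.

Fact q_scaleAl (c : K) (p q : Q) : c *: (p * q) = (c *: p) * q.
Proof. by elim/cl_ind: p => f; elim/cl_ind: q => g; rewrite cl_mulE !cl_scaleE cl_mulE scalerAl. Qed.
HB.instance Definition _ := GRing.Lmodule_isLalgebra.Build K Q q_scaleAl.
Fact q_scaleAr (c : K) (p q : Q) : c *: (p * q) = p * (c *: q).
Proof. by elim/cl_ind: p => f; elim/cl_ind: q => g; rewrite cl_mulE !cl_scaleE cl_mulE scalerAr. Qed.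
HB.instance Definition _ := GRing.Lalgebra_isAlgebra.Build K Q q_scaleAr.

Fact clB : zmod_morphism cl.
Proof. by move=> f g; rewrite -[RHS]/(q_add _ (q_opp _)) cl_opp cl_add. Qed.
HB.instance Definition _ := GRing.isZmodMorphism.Build F Q cl clB.
Fact clM : monoid_morphism cl.
Proof. by split=> // f g; rewrite -[RHS]/(q_mul _ _) cl_mul. Qed.
HB.instance Definition _ := GRing.isMonoidMorphism.Build F Q cl clM.
Fact clZ : scalable cl.
Proof. by move=> c f; rewrite -[RHS]/(q_scale _ _) cl_scale. Qed.
HB.instance Definition _ := GRing.isScalable.Build K F Q *:%R cl clZ.

End Ideal.

(** In an algebra 1 is not 0, so the ideal has to be proper. *)
Lemma quotient_exists (K : fieldType) (F : algType K) (S : F -> Prop) : ~ ideal_generated_by S 1 ->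
  exists (Q : algType K) (p : {lrmorphism F -> Q}), forall f, p f = 0 <-> ideal_generated_by S f.
Proof.
move=> proper; exists (ideal_quotient proper), (cl proper) => f.
by have := clP proper f 0; rewrite subr0 raddf0.
Qed.

(** * Minimal families of relations *)

Lemma ideal_mono (R : nzRingType) (S S' : R -> Prop) f :
  (forall g, S g -> ideal_generated_by S' g) -> ideal_generated_by S f -> ideal_generated_by S' f.
Proof.
move=> h; elim=> {f} [f /h//||f g _ hf _ hg|p f _ hf|p f _ hf].
- exact: IdealZero.
- exact: IdealAdd.
- exact: IdealMulL.
exact: IdealMulR.
Qed.

Section MinimalRelations.
Variables (K : fieldType) (A : algType K) (b : nat).
Variables (F : algType K) (W : word_basis b F) (pi : {lrmorphism F -> A}) (N : nat) (r : 'I_N -> F) (deg : 'I_N -> nat).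
Hypothesis hr : forall k, homogeneous W (fun=> 1%N) (deg k) (r k).
Hypothesis ker : forall f, pi f = 0 <-> ideal_generated_by (fun g => exists k, g = r k) f.

(** A subfamily that generates the ideal and is minimal for inclusion, sorted by
degree. *)
Lemma minimal_relations : exists (a : seq nat) (r' : 'I_(size a) -> F),
  [/\ sorted leq a, (size a <= N)%N, forall k : 'I_(size a), homogeneous W (fun=> 1%N) (nth 0%N a k) (r' k)
    & minimal_ideal_generators r' (fun f => pi f = 0)].
Proof.
pose sub (J : {set 'I_N}) g := exists2 i, i \in J & g = r i.
pose P (J : {set 'I_N}) : bool :=
  if excluded_middle_informative (generates_ideal (sub J) (fun f => pi f = 0)) then true else false.
have PP J : reflect (generates_ideal (sub J) (fun f => pi f = 0)) (P J).
  by rewrite /P; case: excluded_middle_informative => h; constructor.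
have [|J /minsetP[/PP genJ minJ]] := @ex_minset _ P.
  exists [set: 'I_N]; apply/PP => f; rewrite ker; split; apply: ideal_mono => g.
    by move=> [k ->]; apply: IdealIn; exists k.
  by move=> [k _ ->]; apply: IdealIn; exists k.
pose s := sort (fun i j => deg i <= deg j)%N (enum J); pose a := map deg s.
pose f (k : 'I_(size a)) : 'I_N := tnth (in_tuple s) (cast_ord (size_map deg s) k).
have fJ k : f k \in J by rewrite -mem_enum -(mem_sort (fun i j => deg i <= deg j)%N); apply: mem_tnth.
have fS i : i \in J -> exists k, i = f k.
  rewrite -mem_enum -(mem_sort (fun i j => deg i <= deg j)%N) -/s => /(tnthP (in_tuple s))[k ->].
  by exists (cast_ord (esym (size_map deg s)) k); rewrite /f cast_ordKV.
have finj : injective f.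
  move=> k k'; rewrite /f !(tnth_nth (f k)) /= => /eqP.
  by rewrite nth_uniq ?sort_uniq ?enum_uniq ?size_map // => [/eqP/val_inj //| |]; rewrite -(size_map deg s).
exists a, (fun k => r (f k)); split.
- rewrite sorted_map; apply: (sort_sorted (leT := fun i j => deg i <= deg j)%N) => i j.
  exact: leq_total.
- rewrite size_map size_sort -cardE; have := max_card (mem J); rewrite card_ord; exact.
- move=> k; rewrite (nth_map (f k)) ?(leq_trans (ltn_ord k)) ?size_map //.
  by rewrite /f {2}(tnth_nth (f k)); apply: hr.
split.
  move=> g; rewrite genJ; split; apply: ideal_mono => {}g.
    by move=> [i /fS[k ->] ->]; apply: IdealIn; exists k.
  by move=> [k _ ->]; apply: IdealIn; exists (f k).
move=> J' pJ' gen; have := proper_card pJ'; rewrite ltnNge => /negP; apply.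
have e : f @: J' = J.
  apply: minJ; last by apply/subsetP => i /imsetP[k _ ->].
  apply/PP => g; rewrite gen; split; apply: ideal_mono => {}g.
    by move=> [k kJ ->]; apply: IdealIn; exists (f k) => //; apply: imset_f.
  by move=> [i /imsetP[k kJ ->] ->]; apply: IdealIn; exists k.
rewrite subset_leq_card //; apply/subsetP => k _.
by have := fJ k; rewrite -e => /imsetP[k' hk' /finj ->].
Qed.
End MinimalRelations.

Lemma relation_type_minimal (K : fieldType) (A : algType K) (G : nat -> A -> Prop) b (v : 'I_b -> A) t
    (r : 'I_(size t) -> free_alg K b) :
  let pi : {lrmorphism free_alg K b -> A} := free_eval (malg_words K b) v in
  subspace_dim (G 1%N) b -> (forall i, G 1%N (v i)) -> (forall u, exists f, pi f = u) ->
  sorted leq t -> (forall k : 'I_(size t), homogeneous (malg_words K b) (fun=> 1%N) (nth 0%N t k) (r k)) ->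
  minimal_ideal_generators r (fun f => pi f = 0) -> relation_type G t.
Proof.
move=> pi dim G1 onto st hr min; split=> //; exists b, pi, r; split=> //.
  by move=> i; rewrite -mword_gen; have -> : pi (mword K [:: i]) = v i by apply: free_eval_gen.
by move=> k; apply/free_homogeneousE.
Qed.

(** * Relations of the family *)

Section Relators.
Variables (K : fieldType) (g e k l : K).

Definition relators (B : algType K) (a y z b x : B) : seq B :=
  [:: y * a - a * y; z * a - a * z; z * y - g *: (y * z);
      b * a - (a * b + e *: y); b * y - (y * b + e *: z); b * z - g *: (z * b);
      x * a - (a * x + k *: (b * b) + l *: y); x * y - y * x; x * z - z * x;
      x * b - (b * x + l *: z)].

Lemma relatorsP (B : algType K) (a y z b x : B) :
  relations g e k l a y z b x <-> forall u, u \in relators a y z b x -> u = 0.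
Proof.
split=> [[h1 h2 h3 h4 h5 h6 h7 h8 h9 h10] u|h].
  rewrite !inE h1 h2 h3 h4 h5 h6 h7 h8 h9 h10 !subrr !orbb; by move=> /eqP.
by split; apply/eqP; rewrite -subr_eq0; apply/eqP; apply: h; rewrite !inE eqxx ?orbT.
Qed.

Lemma relators_hom (A B : algType K) (p : {lrmorphism A -> B}) (a y z b x : A) :
  relators (p a) (p y) (p z) (p b) (p x) = map p (relators a y z b x).
Proof. by rewrite /relators /map !rmorphB /= !rmorphD /= !linearZ /= !rmorphM. Qed.

End Relators.

Section Algebra.
Variables (K : fieldType) (g e k l : K) (dy dz : nat).
Hypotheses (el : e * e + l * l = 1).
Hypotheses (deg_e : e != 0 -> dy = 2%N /\ dz = 3%N) (deg_l : l != 0 -> dy = 2%N /\ dz = 2%N).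
Variables (A : algType K) (a y z b x : A) (G : nat -> A -> Prop).
Variable T : graded_iterated_ore [:: (a, 1); (y, dy); (z, dz); (b, 1); (x, 1)]%N G.
Hypotheses (inj : sigmas_injective T) (rel : relations g e k l a y z b x).
Hypothesis gen : forall u, subalgebra_generated_by (fun v => v \in [:: a; y; z; b; x]) u.
Hypothesis HP : forall (B : algType K) (a' y' z' b' x' : B), relations g e k l a' y' z' b' x' ->
      exists F : {lrmorphism A -> B}, [/\ F a = a', F y = y', F z = z', F b = b' & F x = x'].

Let tw : tower G [:: 1; dy; dz; 1; 1]%N.
Proof. by have [] := tower_of_ore inj. Qed.
Let gr : graded G := tower_graded tw.

Let var v : v \in [:: (a, 1); (y, dy); (z, dz); (b, 1); (x, 1)]%N -> G v.2 v.1.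
Proof. by have [_ h _] := tower_of_ore inj; apply: h. Qed.
Let Ga : G 1%N a. Proof. by apply: (var (v := (a, 1%N))); rewrite !inE eqxx. Qed.
Let Gy : G dy y. Proof. by apply: (var (v := (y, dy))); rewrite !inE eqxx ?orbT. Qed.
Let Gz : G dz z. Proof. by apply: (var (v := (z, dz))); rewrite !inE eqxx ?orbT. Qed.
Let Gb : G 1%N b. Proof. by apply: (var (v := (b, 1%N))); rewrite !inE eqxx ?orbT. Qed.
Let Gx : G 1%N x. Proof. by apply: (var (v := (x, 1%N))); rewrite !inE eqxx ?orbT. Qed.

(** As e e + l l = 1, one of the parameters e and l does not vanish. *)
Lemma family_dy : dy = 2%N /\ (1 < dz)%N.
Proof.
case: (eqVneq e 0) => [e0|/deg_e[-> ->] //].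
case: (eqVneq l 0) => [l0|/deg_l[-> ->] //].
by move: el; rewrite e0 l0 !mulr0 addr0 => /eqP; rewrite eq_sym oner_eq0.
Qed.

Lemma family_dim : subspace_dim (G 1%N) 3.
Proof.
have [_ h _ _] := tower_dim tw; have [dy2 dz1] := family_dy; move: h.
by rewrite /= dy2 (_ : (dz == 1)%N = false) //; apply/negbTE; rewrite neq_ltn dz1 orbT.
Qed.

(** Since [b,a] = e y and [x,a] - k b b = l y in A, and e e + l l = 1, this
combination of the two is y. *)
Definition elem_y (B : algType K) (a b x : B) : B := e *: (b * a - a * b) + l *: (x * a - a * x - k *: (b * b)).
Definition elem_z (B : algType K) (a b x : B) : B :=
  e *: (b * elem_y a b x - elem_y a b x * b) + l *: (x * b - b * x).

Lemma elem_yE : elem_y a b x = y.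
Proof.
case: rel => _ _ _ ba _ _ xa _ _ _; rewrite /elem_y ba xa.
rewrite [a * b + _]addrC addrK -[a * x + _ + _]addrA [a * x + _]addrC addrK [_ + l *: y]addrC addrK.
by rewrite !scalerA -scalerDl el scale1r.
Qed.

Lemma elem_zE : elem_z a b x = z.
Proof.
case: rel => _ _ _ _ by_ _ _ _ _ xb; rewrite /elem_z elem_yE by_ xb.
by rewrite [y * b + _]addrC addrK [b * x + _]addrC addrK !scalerA -scalerDl el scale1r.
Qed.

Lemma elem_y_hom (B C : algType K) (p : {lrmorphism B -> C}) a' b' x' :
  p (elem_y a' b' x') = elem_y (p a') (p b') (p x').
Proof. by rewrite /elem_y rmorphD /= [p (e *: _)]linearZ [p (l *: _)]linearZ /= !rmorphB /= [p (k *: _)]linearZ /= !rmorphM. Qed.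

Lemma elem_z_hom (B C : algType K) (p : {lrmorphism B -> C}) a' b' x' :
  p (elem_z a' b' x') = elem_z (p a') (p b') (p x').
Proof. by rewrite /elem_z -elem_y_hom rmorphD /= !linearZ /= !rmorphB /= !rmorphM. Qed.

Lemma family_generated : generated_in_degree_one G.
Proof.
have sub u v : subalgebra_generated_by (G 1%N) u -> subalgebra_generated_by (G 1%N) v ->
  subalgebra_generated_by (G 1%N) (u - v).
  by move=> hu hv; apply: SubalgAdd => //; rewrite -scaleN1r; apply: SubalgScale.
have sa : subalgebra_generated_by (G 1%N) a by apply: SubalgIn.
have sb : subalgebra_generated_by (G 1%N) b by apply: SubalgIn.
have sx : subalgebra_generated_by (G 1%N) x by apply: SubalgIn.
have sy : subalgebra_generated_by (G 1%N) y.
  rewrite -elem_yE /elem_y; apply: SubalgAdd; apply: SubalgScale; first by apply: (sub _ _); apply: SubalgMul.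
  by apply: (sub _ _); [apply: (sub _ _); apply: SubalgMul | apply: SubalgScale; apply: SubalgMul].
have sz : subalgebra_generated_by (G 1%N) z.
  rewrite -elem_zE /elem_z elem_yE; apply: SubalgAdd; apply: SubalgScale; by apply: (sub _ _); apply: SubalgMul.
move=> u; elim: (gen u) => {u} [v||u v _ hu _ hv|u v _ hu _ hv|c u _ hu].
- by rewrite !inE => /orP[|/orP[|/orP[|/orP[]]]] /eqP ->.
- exact: SubalgOne.
- exact: SubalgAdd.
- exact: SubalgMul.
exact: SubalgScale.
Qed.

Lemma family_AS_Ore : AS_Ore_extension 5 G.
Proof. by exists _, T; split=> //; apply: family_generated. Qed.

(** The images of the generators in F / S satisfy the relations, so that A maps
to F / S; the composite F -> A -> F / S is the projection. *)
Lemma family_kernel n (F : algType K) (W : word_basis n F) (pi : {lrmorphism F -> A})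
    (a' y' z' b' x' : F) (S : F -> Prop) :
  [/\ pi a' = a, pi y' = y, pi z' = z, pi b' = b & pi x' = x] ->
  (forall s, S s -> pi s = 0) ->
  (forall i, word W [:: i] \in [:: a'; y'; z'; b'; x']) ->
  (forall (Q : algType K) (p : {lrmorphism F -> Q}), (forall s, S s -> p s = 0) ->
     relations g e k l (p a') (p y') (p z') (p b') (p x')) ->
  forall f, pi f = 0 <-> ideal_generated_by S f.
Proof.
move=> [pa py pz pb px] S0 gens rels f.
have ker h : ideal_generated_by S h -> pi h = 0.
  elim=> {h} [h /S0 //||h h' _ e1 _ e2|h h' _ e1|h h' _ e1].
  - by rewrite rmorph0.
  - by rewrite rmorphD /= e1 e2 addr0.
  - by rewrite rmorphM /= e1 mulr0.
  - by rewrite rmorphM /= e1 mul0r.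
split=> [f0|]; last exact: ker.
have proper : ~ ideal_generated_by S 1 by move/ker/eqP; rewrite rmorph1 oner_eq0.
have [Q [p hp]] := quotient_exists proper.
have [|F' [Fa Fy Fz Fb Fx]] := HP (rels Q p _); first by move=> s Ss; apply/hp; apply: IdealIn.
apply/hp; have e1 : F' \o pi =1 p.
  apply: (free_hom_ext (W := W)) => i; have := gens i.
  by rewrite !inE => /orP[|/orP[|/orP[|/orP[]]]] /eqP -> /=; rewrite ?pa ?py ?pz ?pb ?px.
by rewrite -e1 /= f0 rmorph0.
Qed.

Section Presentation.
Variables (F : algType K) (W : word_basis 3 F).
Local Notation ga := (word W [:: 0%R]).
Local Notation gb := (word W [:: 1%R]).
Local Notation gx := (word W [:: 2%:R]).
Definition three_values (i : 'I_3) : A := nth 0 [:: a; b; x] i.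
Let pi : {lrmorphism F -> A} := free_eval W three_values.

Lemma value_a : pi ga = a. Proof. exact: free_eval_gen. Qed.
Lemma value_b : pi gb = b. Proof. exact: free_eval_gen. Qed.
Lemma value_x : pi gx = x. Proof. exact: free_eval_gen. Qed.
Lemma value_y : pi (elem_y ga gb gx) = y. Proof. by rewrite elem_y_hom value_a value_b value_x elem_yE. Qed.
Lemma value_z : pi (elem_z ga gb gx) = z. Proof. by rewrite elem_z_hom value_a value_b value_x elem_zE. Qed.

Lemma family_onto u : exists f, pi f = u.
Proof.
elim: (gen u) => {u} [v||u v _ [f <-] _ [h <-]|u v _ [f <-] _ [h <-]|c u _ [f <-]].
- rewrite !inE => /orP[|/orP[|/orP[|/orP[]]]] /eqP ->.
  + by exists ga; apply: value_a.
  + by exists (elem_y ga gb gx); apply: value_y.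
  + by exists (elem_z ga gb gx); apply: value_z.
  + by exists gb; apply: value_b.
  + by exists gx; apply: value_x.
- by exists 1; rewrite rmorph1.
- by exists (f + h); rewrite rmorphD.
- by exists (f * h); rewrite rmorphM.
by exists (c *: f); rewrite linearZ.
Qed.

Lemma family_minimal N (r : 'I_N -> F) (deg : 'I_N -> nat) :
  (forall i, homogeneous W (fun=> 1%N) (deg i) (r i)) ->
  (forall i, pi (r i) = 0) ->
  (forall (Q : algType K) (p : {lrmorphism F -> Q}), (forall i, p (r i) = 0) ->
     relations g e k l (p ga) (p (elem_y ga gb gx)) (p (elem_z ga gb gx)) (p gb) (p gx)) ->
  exists (t : seq nat) (r' : 'I_(size t) -> F),
  [/\ sorted leq t, (size t <= N)%N, forall k : 'I_(size t), homogeneous W (fun=> 1%N) (nth 0%N t k) (r' k)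
    & minimal_ideal_generators r' (fun f => pi f = 0)].
Proof.
move=> hr r0 rels.
have ker f : pi f = 0 <-> ideal_generated_by (fun h => exists i, h = r i) f.
  apply: (family_kernel (W := W) (a' := ga) (y' := elem_y ga gb gx) (z' := elem_z ga gb gx) (b' := gb) (x' := gx)).
  - by split; [exact: value_a | exact: value_y | exact: value_z | exact: value_b | exact: value_x].
  - by move=> s [i ->].
  - by move=> [[|[|[|]]] // h]; rewrite !inE; [have -> : Ordinal h = 0 | have -> : Ordinal h = 1 | have -> : Ordinal h = 2%:R];
      rewrite ?eqxx ?orbT //; apply: val_inj.
  by move=> Q p hp; apply: rels => i; apply: hp; exists i.
exact: (minimal_relations hr ker).
Qed.

Definition relator_degrees : seq nat :=
  [:: dy.+1; dz.+1; dy + dz; 2; dy.+1; dz.+1; 2; dy.+1; dz.+1; 2]%N.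

Local Notation H := (homogeneous W (fun=> 1%N)).
Let fy : F := elem_y ga gb gx.
Let fz : F := elem_z ga gb gx.

Lemma homZ_if d c (f : F) : (c != 0 -> H d f) -> H d (c *: f).
Proof.
move=> h; have hs := hom_subspace W (fun=> 1%N) d.
by case: (eqVneq c 0) => [->|/h hf]; [rewrite scale0r; apply: hom0 | apply: subspaceZ].
Qed.

Lemma homB d (f h : F) : H d f -> H d h -> H d (f - h).
Proof. exact: subspaceB (hom_subspace W (fun=> 1%N) d). Qed.

Lemma homD d (f h : F) : H d f -> H d h -> H d (f + h).
Proof. exact: subspaceD (hom_subspace W (fun=> 1%N) d). Qed.

Lemma hom_fy : H dy fy.
Proof.
have [-> _] := family_dy; have hg i : H 1%N (word W [:: i]) := word_hom W [:: i].
have hgg i j := homM (hg i) (hg j).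
by apply: homD; apply: homZ_if => _; apply: homB => //; [apply: homB | apply: homZ_if].
Qed.

Lemma hom_fz : H dz fz.
Proof.
have hg i : H 1%N (word W [:: i]) := word_hom W [:: i].
have := hom_fy; have [-> _] := family_dy => hy.
by apply: homD; apply: homZ_if; [move/deg_e | move/deg_l]; move=> [_ ->]; apply: homB;
  [exact: (homM (hg _) hy) | exact: (homM hy (hg _)) | exact: (homM (hg _) (hg _)) | exact: (homM (hg _) (hg _))].
Qed.

Definition family_relators : seq F := relators g e k l ga fy fz gb gx.

Lemma hom_relators i : H (nth 0%N relator_degrees i) (nth 0 family_relators i).
Proof.
have hg j : H 1%N (word W [:: j]) := word_hom W [:: j].
have hy := hom_fy; have hz := hom_fz; have [dy2 _] := family_dy.
have cM d d' f h : H d f -> H d' h -> H (d' + d)%N (f * h) by rewrite addnC; apply: homM.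
have hy2 : H 2 fy by move: hy; rewrite dy2.
have ey : H 2 (e *: fy) by apply: homZ_if.
have ez : H dy.+1 (e *: fz) by apply: homZ_if => /deg_e[-> dz3]; move: hz; rewrite dz3.
have ly : H 2 (l *: fy) by apply: homZ_if.
have lz : H 2 (l *: fz) by apply: homZ_if => /deg_l[_ dz2]; move: hz; rewrite dz2.
have hgg i' j' := homM (hg i') (hg j').
move: i => [|[|[|[|[|[|[|[|[|[|i]]]]]]]]]] /=; last by rewrite nth_nil nth_nil; apply: hom0.
- by apply: homB; [apply: cM (hg _) | apply: homM (hg _) _].
- by apply: homB; [apply: cM (hg _) | apply: homM (hg _) _].
- by apply: homB; [apply: cM | apply: homZ_if => _; apply: homM].
- by apply: homB => //; apply: homD.
- by apply: homB; [apply: homM (hg _) _ | apply: homD => //; apply: cM (hg _)].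
- by apply: homB; [apply: homM (hg _) _ | apply: homZ_if => _; apply: cM (hg _)].
- by apply: homB => //; apply: homD => //; apply: homD => //; apply: homZ_if.
- by apply: homB; [apply: homM (hg _) _ | apply: cM (hg _)].
- by apply: homB; [apply: homM (hg _) _ | apply: cM (hg _)].
by apply: homB => //; apply: homD.
Qed.

(** The generators y and z are eliminated: the ten relations, with y and z
replaced by their expressions in a, b, x, present A. *)
Lemma family_minimal_exists : exists (t : seq nat) (r' : 'I_(size t) -> F),
  [/\ sorted leq t, forall k : 'I_(size t), homogeneous W (fun=> 1%N) (nth 0%N t k) (r' k)
    & minimal_ideal_generators r' (fun f => pi f = 0)].
Proof.
have [||Q p hp|t [r' [st _ hr' min]]] := @family_minimal 10 (fun i => nth 0 family_relators i) (fun i => nth 0%N relator_degrees i).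
- by move=> i; apply: hom_relators.
- move=> i; apply: (proj1 (relatorsP g e k l a y z b x) rel).
  rewrite -value_a -value_b -value_x -value_y -value_z relators_hom.
  by apply: map_f; apply: mem_nth.
- apply/relatorsP; rewrite relators_hom => u /(nthP 0)[i lt <-].
  by rewrite (nth_map 0) //; apply: (hp (Ordinal lt)).
by exists t, r'.
Qed.
End Presentation.

Lemma family_relation_type t (r : 'I_(size t) -> free_alg K 3) :
  sorted leq t -> (forall k : 'I_(size t), homogeneous (malg_words K 3) (fun=> 1%N) (nth 0%N t k) (r k)) ->
  minimal_ideal_generators r (fun f => free_eval (malg_words K 3) three_values f = 0) ->
  relation_type G t.
Proof.
apply: relation_type_minimal; first exact: family_dim.
  by move=> [[|[|[|]]] // h].
exact: family_onto.
Qed.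
End Algebra.

(** * Lie algebras in the family *)

Section RowBasis.
Variables (K : fieldType) (n : nat).

Definition row_basis : n.-tuple 'rV[K]_n := [tuple delta_mx 0 i | i < n].

Lemma row_basis_free : free row_basis.
Proof.
apply/freeP => c h i; have := congr1 (fun v : 'rV_n => v 0 i) h; rewrite summxE mxE => e0.
rewrite -[RHS]e0 (bigD1 i) // -tnth_nth tnth_mktuple !mxE !eqxx mulr1 big1 => [|j ne]; first by rewrite /= addr0.
by rewrite -tnth_nth tnth_mktuple !mxE eqxx eq_sym (negPf ne) mulr0.
Qed.

Lemma row_basis_basis : basis_of fullv row_basis.
Proof.
by rewrite basisEfree row_basis_free subvf size_tuple dimvf /dim /= mul1n leqnn.
Qed.

Lemma row_basis_coord i (v : 'rV[K]_n) : coord row_basis i v = v 0 i.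
Proof.
have {1}-> : v = \sum_j v 0 j *: row_basis`_j.
  by rewrite [LHS]row_sum_delta; apply: eq_bigr => j _; rewrite -tnth_nth tnth_mktuple.
exact: (coord_sum_free _ _ row_basis_free).
Qed.

End RowBasis.

Section LieRelators.
Variables (K : fieldType) (L : vectType K) (br : L -> L -> L) (n : nat) (x : n.-tuple L).
Variables (F : algType K) (W : word_basis n F).

Definition lie_relation (i j : 'I_n) : F :=
  word W [:: j] * word W [:: i] - word W [:: i] * word W [:: j]
  - \sum_k coord x k (br (tnth x j) (tnth x i)) *: word W [:: k].

Lemma lie_relation_hom (B : algType K) (p : {lrmorphism F -> B}) i j :
  p (lie_relation i j) = p (word W [:: j]) * p (word W [:: i]) - p (word W [:: i]) * p (word W [:: j])
  - \sum_k coord x k (br (tnth x j) (tnth x i)) *: p (word W [:: k]).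
Proof.
rewrite /lie_relation !rmorphB !rmorphM /= linear_sum; congr (_ - _).
by apply: eq_bigr => k _; rewrite linearZ.
Qed.

End LieRelators.

Lemma lie_relatorE (K : fieldType) (L : vectType K) (br : L -> L -> L) (n : nat) (x : n.-tuple L) i j :
  lie_relator br x i j = lie_relation br x (malg_words K n) i j.
Proof.
pose form (h : 'I_n -> free_algebra K n) := h j * h i - h i * h j
  - \sum_k coord x k (br (tnth x j) (tnth x i)) *: h k.
suff -> : lie_relator br x i j = form (fun k => mword K [:: k]) by [].
by have -> : (fun k => mword K [:: k]) = free_gen K (n := n) by apply: functional_extensionality => k; apply: mword_gen.
Qed.

Section Bracket.
Variables (K : fieldType) (e l : K).
Hypothesis le : l * e = 0.
Local Notation L := 'rV[K]_5.
Local Notation o n := (@Ordinal 5 n isT).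

Definition bracket_y (u v : L) : K :=
  e * (u 0 (o 3) * v 0 (o 0) - u 0 (o 0) * v 0 (o 3)) + l * (u 0 (o 4) * v 0 (o 0) - u 0 (o 0) * v 0 (o 4)).
Definition bracket_z (u v : L) : K :=
  e * (u 0 (o 3) * v 0 (o 1) - u 0 (o 1) * v 0 (o 3)) + l * (u 0 (o 4) * v 0 (o 3) - u 0 (o 3) * v 0 (o 4)).
(** The commutators of the generators in the case g = 1, k = 0.  The Jacobi
identity amounts to l e = 0. *)
Definition bracket (u v : L) : L :=
  bracket_y u v *: delta_mx 0 (o 1) + bracket_z u v *: delta_mx 0 (o 2).

Lemma bracketE u v i :
  bracket u v 0 i = bracket_y u v * (i == o 1)%:R + bracket_z u v * (i == o 2)%:R.
Proof. by rewrite !mxE !eqxx. Qed.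

Lemma bracket_lie : lie_bracket bracket.
Proof.
split.
- move=> u c v w; apply/rowP => i; rewrite !mxE !eqxx /bracket_y /bracket_z !mxE; ring.
- move=> u c v w; apply/rowP => i; rewrite !mxE !eqxx /bracket_y /bracket_z !mxE; ring.
- move=> u; apply/rowP => i; rewrite !mxE !eqxx /bracket_y /bracket_z; ring.
move=> u v t; have y0 p q r : bracket_y p (bracket q r) = 0.
  by rewrite /bracket_y !bracketE /= !mulr0 !addr0 !mulr0 subrr !mulr0 addr0.
have z0 p q r : bracket_z p (bracket q r) = e * (p 0 (o 3) * bracket_y q r).
  by rewrite /bracket_z !bracketE /=; ring.
rewrite /bracket -/(bracket v t) -/(bracket t u) -/(bracket u v) !y0 !z0 !scale0r !add0r -!scalerDl.
rewrite (_ : _ + _ = l * e * (u 0 (o 3) * (v 0 (o 4) * t 0 (o 0) - v 0 (o 0) * t 0 (o 4))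
   + v 0 (o 3) * (t 0 (o 4) * u 0 (o 0) - t 0 (o 0) * u 0 (o 4))
   + t 0 (o 3) * (u 0 (o 4) * v 0 (o 0) - u 0 (o 0) * v 0 (o 4)))).
  by rewrite le mul0r scale0r.
by rewrite /bracket_y; ring.
Qed.

Lemma bracket_sum (V : lmodType K) (P : 'I_5 -> V) u v :
  \sum_k coord (row_basis K 5) k (bracket u v) *: P k = bracket_y u v *: P (o 1) + bracket_z u v *: P (o 2).
Proof.
rewrite !big_ord_recl big_ord0 !row_basis_coord !bracketE /= !mulr0 !mulr1 !addr0 !add0r !scale0r !add0r !addr0.
by congr (_ *: P _ + _ *: P _); apply: val_inj.
Qed.

Definition structure_y (j i : 'I_5) : K :=
  e * (((o 3 == j) && (o 0 == i))%:R - ((o 0 == j) && (o 3 == i))%:R)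
  + l * (((o 4 == j) && (o 0 == i))%:R - ((o 0 == j) && (o 4 == i))%:R).
Definition structure_z (j i : 'I_5) : K :=
  e * (((o 3 == j) && (o 1 == i))%:R - ((o 1 == j) && (o 3 == i))%:R)
  + l * (((o 4 == j) && (o 3 == i))%:R - ((o 3 == j) && (o 4 == i))%:R).

Lemma bracket_yE i j : bracket_y (tnth (row_basis K 5) j) (tnth (row_basis K 5) i) = structure_y j i.
Proof. by rewrite !tnth_mktuple /bracket_y !mxE /= -!natrM !mulnb /structure_y. Qed.

Lemma bracket_zE i j : bracket_z (tnth (row_basis K 5) j) (tnth (row_basis K 5) i) = structure_z j i.
Proof. by rewrite !tnth_mktuple /bracket_z !mxE /= -!natrM !mulnb /structure_z. Qed.

Lemma lie_relations_iff (B : algType K) (V : 'I_5 -> B) :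
  relations 1 e 0 l (V (o 0)) (V (o 1)) (V (o 2)) (V (o 3)) (V (o 4)) <->
  forall i j, V j * V i - V i * V j - (structure_y j i *: V (o 1) + structure_z j i *: V (o 2)) = 0.
Proof.
split=> [[h1 h2 h3 h4 h5 h6 h7 h8 h9 h10] i j|h]; last first.
  have hh i j : V j * V i = V i * V j + (structure_y j i *: V (o 1) + structure_z j i *: V (o 2)).
    by apply/eqP; rewrite -subr_eq0 opprD addrA h.
  split; rewrite hh /structure_y /structure_z /= ?subrr ?subr0 ?mulr0 ?mulr1 ?addr0 ?add0r ?scale0r ?addr0 ?add0r ?scale1r ?addr0 //.
rewrite scale1r in h3; rewrite scale1r in h6; rewrite scale0r addr0 in h7.
have ov (c : 'I_5) m (lt : (m < 5)%N) : val c = m -> c = @Ordinal 5 m lt by move=> ?; apply: val_inj.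
have vi := ltn_ord i; have vj := ltn_ord j.
have [Ei|[Ei|[Ei|[Ei|Ei]]]] : i = o 0 \/ i = o 1 \/ i = o 2 \/ i = o 3 \/ i = o 4
  by move: i vi {h1 h2 h3 h4 h5 h6 h7 h8 h9 h10 j vj} => [[|[|[|[|[|]]]]] p] //= _;
    [left | right; left | do 2!right; left | do 3!right; left | do 4!right]; apply: val_inj.
all: have [Ej|[Ej|[Ej|[Ej|Ej]]]] : j = o 0 \/ j = o 1 \/ j = o 2 \/ j = o 3 \/ j = o 4
  by move: j vj {h1 h2 h3 h4 h5 h6 h7 h8 h9 h10 i vi Ei} => [[|[|[|[|[|]]]]] p] //= _;
    [left | right; left | do 2!right; left | do 3!right; left | do 4!right]; apply: val_inj.
all: rewrite Ei Ej /structure_y /structure_z /= ?subrr ?subr0 ?sub0r ?mulr0 ?mulr1 ?addr0 ?add0r ?scale0r ?addr0 ?add0r.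
all: rewrite ?h1 ?h2 ?h3 ?h4 ?h5 ?h6 ?h7 ?h8 ?h9 ?h10 ?subrr ?addrK ?opprD ?addrA ?subrr ?add0r ?mulrN1 ?scaleNr ?opprK ?subrr //.
all: rewrite ?oppr0 ?addNr //.
all: by rewrite [X in X - _]addrAC subrr add0r subrr.
Qed.

End Bracket.

Section Enveloping.
Variables (K : fieldType) (e l : K) (dy dz : nat).
Hypotheses (le : l * e = 0) (dy0 : (0 < dy)%N) (dz0 : (0 < dz)%N).
Hypotheses (deg_e : e != 0 -> dy = 2%N /\ dz = 3%N) (deg_l : l != 0 -> dy = 2%N /\ dz = 2%N).
Variables (A : algType K) (a y z b x : A) (G : nat -> A -> Prop).
Variable T : graded_iterated_ore [:: (a, 1); (y, dy); (z, dz); (b, 1); (x, 1)]%N G.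
Hypotheses (inj : sigmas_injective T) (rel : relations 1 e 0 l a y z b x).
Hypothesis gen : forall u, subalgebra_generated_by (fun v => v \in [:: a; y; z; b; x]) u.
Hypothesis HP : forall (B : algType K) (a' y' z' b' x' : B), relations 1 e 0 l a' y' z' b' x' ->
      exists F : {lrmorphism A -> B}, [/\ F a = a', F y = y', F z = z', F b = b' & F x = x'].

Local Notation o n := (@Ordinal 5 n isT).
Definition five_values (i : 'I_5) : A := nth 0 [:: a; y; z; b; x] i.
Definition five_degrees (i : 'I_5) : nat := nth 0%N [:: 1; dy; dz; 1; 1]%N i.

Lemma five_graded : graded_lie_algebra (bracket e l) (row_basis K 5) five_degrees.
Proof.
split.
- exact: bracket_lie.
- exact: row_basis_basis.
- by move=> [[|[|[|[|[|]]]]] ?].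
move=> i j; rewrite /bracket bracket_yE bracket_zE.
have span_mem c (k : 'I_5) (w : nat) : (c != 0 -> w = five_degrees k) ->
    c *: delta_mx 0 k \in <<[seq tnth (row_basis K 5) k | k <- enum 'I_5 & five_degrees k == w]>>%VS.
  case: (eqVneq c 0) => [-> _|_ /(_ isT) ->]; first by rewrite scale0r mem0v.
  apply: memvZ; apply: memv_span; apply/mapP; exists k; last by rewrite tnth_mktuple.
  by rewrite mem_filter eqxx mem_enum.
have e_or c : e * c.1 + l * c.2 != 0 -> e * c.1 != 0 \/ l * c.2 != 0.
  by case: (eqVneq (e * c.1) 0) => [->|]; [rewrite add0r; right | left].
have nz c d : c * d != 0 :> K -> c != 0 /\ d != 0 by rewrite mulf_eq0 negb_or => /andP.
have bd (p q : bool) : p%:R - q%:R != 0 :> K -> p \/ q.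
  by case: p; case: q; rewrite ?subrr ?eqxx; auto.
apply: memvD; apply: span_mem => /(e_or (_, _)) [] /nz [c0 /bd].
- by have [dy2 _] := deg_e c0; rewrite /five_degrees; move=> [] /andP[/eqP<- /eqP<-]; rewrite /= dy2.
- by have [dy2 _] := deg_l c0; rewrite /five_degrees; move=> [] /andP[/eqP<- /eqP<-]; rewrite /= dy2.
- by have [dy2 dz3] := deg_e c0; rewrite /five_degrees; move=> [] /andP[/eqP<- /eqP<-]; rewrite /= dy2 dz3.
by have [dy2 dz2] := deg_l c0; rewrite /five_degrees; move=> [] /andP[/eqP<- /eqP<-]; rewrite /= dz2.
Qed.

Section Presentation.
Variables (F : algType K) (W : word_basis 5 F).
Let pi : {lrmorphism F -> A} := free_eval W five_values.
Let piE i : pi (word W [:: i]) = five_values i. Proof. exact: free_eval_gen. Qed.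

Lemma five_onto u : exists f, pi f = u.
Proof.
elim: (gen u) => {u} [v||u v _ [f <-] _ [h <-]|u v _ [f <-] _ [h <-]|c u _ [f <-]].
- rewrite !inE => /orP[|/orP[|/orP[|/orP[]]]] /eqP ->.
  + by exists (word W [:: o 0]); rewrite piE.
  + by exists (word W [:: o 1]); rewrite piE.
  + by exists (word W [:: o 2]); rewrite piE.
  + by exists (word W [:: o 3]); rewrite piE.
  by exists (word W [:: o 4]); rewrite piE.
- by exists 1; rewrite rmorph1.
- by exists (f + h); rewrite rmorphD.
- by exists (f * h); rewrite rmorphM.
by exists (c *: f); rewrite linearZ.
Qed.

Lemma five_relation_hom (Q : algType K) (p : {lrmorphism F -> Q}) i j :
  p (lie_relation (bracket e l) (row_basis K 5) W i j) =
  p (word W [:: j]) * p (word W [:: i]) - p (word W [:: i]) * p (word W [:: j]) -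
  (structure_y e l j i *: p (word W [:: o 1]) + structure_z e l j i *: p (word W [:: o 2])).
Proof. by rewrite lie_relation_hom bracket_sum bracket_yE bracket_zE. Qed.

Lemma five_kernel f : pi f = 0 <->
  ideal_generated_by (fun h => exists i j, h = lie_relation (bracket e l) (row_basis K 5) W i j) f.
Proof.
apply: (family_kernel HP (W := W) (a' := word W [:: o 0]) (y' := word W [:: o 1]) (z' := word W [:: o 2])
  (b' := word W [:: o 3]) (x' := word W [:: o 4])).
- by rewrite !piE.
- move=> s [i [j ->]]; rewrite five_relation_hom !piE.
  by apply: (proj1 (lie_relations_iff e l five_values)).
- move=> [[|[|[|[|[|]]]]] // lt]; rewrite !inE (bool_irrelevance lt isT) ?eqxx ?orbT //.
move=> Q p hp; apply/(lie_relations_iff e l (fun i => p (word W [:: i]))) => i j.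
by rewrite -five_relation_hom; apply: hp; exists i, j.
Qed.

Lemma five_grading d u : G d u <-> exists2 f, homogeneous W five_degrees d f & pi f = u.
Proof.
have [/tower_graded gr var hg] := tower_of_ore inj; split.
  move/hg; elim=> {d u} [d||v|d c u v _ [f hf <-] _ [h hh <-]|d d' u v _ [f hf <-] _ [h hh <-]].
  - by exists 0; [apply: hom0 | rewrite rmorph0].
  - by exists 1; [apply: hom1 | rewrite rmorph1].
  - rewrite !inE => /orP[|/orP[|/orP[|/orP[]]]] /eqP -> /=.
    + by exists (word W [:: o 0]); [apply: (hom_gen W five_degrees (o 0)) | rewrite piE].
    + by exists (word W [:: o 1]); [apply: (hom_gen W five_degrees (o 1)) | rewrite piE].
    + by exists (word W [:: o 2]); [apply: (hom_gen W five_degrees (o 2)) | rewrite piE].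
    + by exists (word W [:: o 3]); [apply: (hom_gen W five_degrees (o 3)) | rewrite piE].
    by exists (word W [:: o 4]); [apply: (hom_gen W five_degrees (o 4)) | rewrite piE].
  - by exists (c *: f + h); [have [_ hs] := hom_subspace W five_degrees d; apply: hs | rewrite linearP].
  by exists (f * h); [apply: homM | rewrite rmorphM].
move=> [f hf <-]; elim/homogeneous_ind: hf => [|c s {}f <- IH]; first by rewrite rmorph0; apply: gr0.
rewrite linearP /=; have [_ hs] := gr_sub gr (weight five_degrees s); apply: hs => //.
rewrite hom_word /weight; elim: s {IH} => [|i s IH]; first by rewrite !big_nil; apply: gr1.
rewrite !big_cons; apply: (gr_mul gr) => //; rewrite piE.
move: i => [[|[|[|[|[|]]]]] // lt]; rewrite /five_values /five_degrees /=.
- by apply: (var (a, 1%N)); rewrite !inE eqxx ?orbT.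
- by apply: (var (y, dy)); rewrite !inE eqxx ?orbT.
- by apply: (var (z, dz)); rewrite !inE eqxx ?orbT.
- by apply: (var (b, 1%N)); rewrite !inE eqxx ?orbT.
by apply: (var (x, 1%N)); rewrite !inE eqxx ?orbT.
Qed.
End Presentation.

Lemma family_enveloping : graded_enveloping_algebra 5 G.
Proof.
exists 'rV[K]_5, (bracket e l), (row_basis K 5), five_degrees.
exists (free_eval (malg_words K 5) five_values : {lrmorphism free_alg K 5 -> A}); split.
- exact: five_graded.
- split=> [u|f]; first by have [f hf] := five_onto (malg_words K 5) u; exists f.
  have [h1 h2] := five_kernel (malg_words K 5) f; split=> [/h1|h].
    apply: ideal_mono => h [i [j ->]]; apply: IdealIn; exists i, j; by rewrite lie_relatorE.
  by apply: h2; move: h; apply: ideal_mono => h [i [j ->]]; apply: IdealIn; exists i, j; rewrite lie_relatorE.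
apply: functional_extensionality => d; apply: functional_extensionality => u.
apply: propositional_extensionality; split=> [/(five_grading (malg_words K 5))[f hf <-]|[f hf <-]].
  by exists f => //; apply/free_homogeneousE.
by apply/(five_grading (malg_words K 5)); exists f => //; apply/free_homogeneousE.
Qed.
End Enveloping.

(** * The three examples *)

Section Examples.
Variable K : fieldType.

Lemma enveloping_example (e l : K) (dy dz : nat) : l * e = 0 -> e * e + l * l = 1 ->
  (e != 0 -> dy = 2%N /\ dz = 3%N) -> (l != 0 -> dy = 2%N /\ dz = 2%N) ->
  exists (A : algType K) (G : nat -> A -> Prop) (t : seq nat),
  [/\ AS_Ore_extension 5 G /\ graded_enveloping_algebra 5 G, tower G [:: 1; dy; dz; 1; 1]%N,
      generated_in_degree_one G, subspace_dim (G 1%N) 3 & relation_type G t].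
Proof.
move=> le el he hl; have [dy2 dz1] := family_dy el he hl.
have dy0 : (0 < dy)%N by rewrite dy2.
have dz0 : (0 < dz)%N := ltnW dz1.
have [||||A [a [y [z [b [x [G [T [inj rel gen HP]]]]]]]]] :=
  @family_exists K 1 e 0 l _ _ _ _ dy dz dy0 dz0 he hl.
- by rewrite mulr1.
- exact: le.
- by rewrite !mul0r.
- by rewrite subrr mulr0.
have [t [r [st hr min]]] := family_minimal_exists el he hl rel HP (malg_words K 3).
exists A, G, t; split.
- split; [exact: (family_AS_Ore el inj rel gen) | exact: (family_enveloping le dy0 dz0 he hl inj rel gen HP)].
- by have [] := tower_of_ore inj.
- exact: (family_generated el inj rel gen).
- exact: (family_dim el he hl inj).
exact: (family_relation_type el he hl inj rel gen st hr min).
Qed.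

(** The degrees 1, 2, 2, 1, 1 leave no other type. *)
Lemma type_233333 : exists (A : algType K) (G : nat -> A -> Prop),
  [/\ AS_Ore_extension 5 G, graded_enveloping_algebra 5 G,
      generated_in_degree_one G, subspace_dim (G 1%N) 3 & relation_type G [:: 2; 3; 3; 3; 3; 3]%N].
Proof.
have [||||A [G [t [[as_ env] tw gen dim rel]]]] := @enveloping_example 0 1 2 2.
- by rewrite mulr0.
- by rewrite mulr0 mulr1 add0r.
- by rewrite eqxx.
- by [].
exists A, G; split=> //.
by have [[_ <-]|[]] := tower_relation_type tw erefl gen dim rel.
Qed.

Lemma type_223_or_2234 : exists (A : algType K) (G : nat -> A -> Prop) (t : seq nat),
  [/\ AS_Ore_extension 5 G /\ graded_enveloping_algebra 5 G,
      generated_in_degree_one G, subspace_dim (G 1%N) 3,  relation_type G t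
    & t = [:: 2; 2; 3]%N \/ t = [:: 2; 2; 3; 4]%N].
Proof.
have [||||A [G [t [[as_ env] tw gen dim rel]]]] := @enveloping_example 1 0 2 3.
- by rewrite mul0r.
- by rewrite mulr0 mulr1 addr0.
- by [].
- by rewrite eqxx.
exists A, G, t; split=> //.
by have [[]|[_]] := tower_relation_type tw erefl gen dim rel.
Qed.

(** First x commutes with y and z.  Commuting x, and then b, past y a = a y gives
b z = - z b and z a = a z; commuting b past z a = a z gives z y = - y z. *)
Lemma type_223_relations (Q : algType K) (a b x : Q) :
  let y := b * a - a * b in let z := b * y - y * b in
  x * a = a * x + b * b -> x * b = b * x -> y * a = a * y ->
  relations (-1) 1 1 0 a y z b x.
Proof.
move=> y z xa xb ya.
have ba : b * a = a * b + y by rewrite /y addrC subrK.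
have by_ : b * y = y * b + z by rewrite /z addrC subrK.
have yE : y = b * a - a * b by []. have zE : z = b * y - y * b by [].
clearbody z; clearbody y.
have xy : x * y = y * x.
  rewrite yE mulrBr mulrBl; have -> : x * (b * a) = b * a * x + b * b * b.
    by rewrite mulrA xb -mulrA xa mulrDr !mulrA.
  have -> : x * (a * b) = a * b * x + b * b * b by rewrite mulrA xa mulrDl -mulrA xb !mulrA.
  by rewrite opprD addrACA subrr addr0.
have xz : x * z = z * x.
  rewrite zE mulrBr mulrBl; congr (_ - _).
    by rewrite mulrA xb -mulrA xy mulrA.
  by rewrite mulrA xy -mulrA xb mulrA.
have bby : b * b * y = y * (b * b).
  have : x * (y * a) = x * (a * y) by rewrite ya.
  rewrite mulrA xy -mulrA xa [x * (a * y)]mulrA xa mulrDr mulrDl -[a * x * y]mulrA xy mulrA ya mulrA.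
  by rewrite -[a * y * x]mulrA => /addrI ->.
have bz : b * z = - (z * b).
  apply/eqP; rewrite -addr_eq0; apply/eqP.
  have -> : b * z = b * b * y - b * y * b by rewrite zE mulrBr !mulrA.
  have -> : z * b = b * y * b - y * (b * b) by rewrite zE mulrBl !mulrA.
  by rewrite addrA subrK bby subrr.
have za : z * a = a * z.
  have : b * (y * a) = b * (a * y) by rewrite ya.
  rewrite mulrA by_ mulrDl -mulrA ba mulrDr mulrA ya [b * (a * y)]mulrA ba mulrDl -[a * b * y]mulrA by_ mulrDr.
  by rewrite -[a * y * b]mulrA addrAC => /addIr/addrI.
have zy : z * y = - (y * z).
  have : b * (z * a) = b * (a * z) by rewrite za.
  rewrite mulrA bz mulNr -mulrA ba mulrDr [z * (a * b)]mulrA za [b * (a * z)]mulrA ba mulrDl -[a * b * z]mulrA bz mulrN.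
  by rewrite opprD mulrA => /addrI/(congr1 -%R); rewrite opprK.
split; rewrite ?scaleN1r ?scale1r ?scale0r ?addr0 //.
Qed.

Section Presentation.
Variables (F : algType K) (W : word_basis 3 F).
Local Notation ga := (word W [:: 0%R]).
Local Notation gb := (word W [:: 1%R]).
Local Notation gx := (word W [:: 2%:R]).

Definition relators_223 : seq F :=
  let y := gb * ga - ga * gb in [:: gx * ga - (ga * gx + gb * gb); gx * gb - gb * gx; y * ga - ga * y].

Lemma relators_223_hom i : homogeneous W (fun=> 1%N) (nth 0%N [:: 2; 2; 3]%N i) (nth 0 relators_223 i).
Proof.
have hg j : homogeneous W (fun=> 1%N) 1 (word W [:: j]) := word_hom W [:: j].
have hgg i' j' := homM (hg i') (hg j').
have hy : homogeneous W (fun=> 1%N) 2 (gb * ga - ga * gb) by apply: homB.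
move: i => [|[|[|i]]] /=; last by rewrite !nth_nil; apply: hom0.
- by apply: homB => //; apply: homD.
- exact: homB.
by apply: homB; [apply: homM hy (hg _) | apply: homM (hg _) hy].
Qed.

Lemma elem_y10 (B : algType K) k (a b x : B) : elem_y 1 k 0 a b x = b * a - a * b.
Proof. by rewrite /elem_y scale1r scale0r addr0. Qed.

Lemma elem_z10 (B : algType K) k (a b x : B) :
  let y := b * a - a * b in elem_z 1 k 0 a b x = b * y - y * b.
Proof. by rewrite /elem_z elem_y10 scale1r scale0r addr0. Qed.

(** Three relations suffice, so that a minimal family has at most three members;
this excludes the type (2,2,3,4). *)
Lemma minimal_223 (A : algType K) (a y z b x : A) : relations (-1) 1 1 0 a y z b x ->
  (forall (B : algType K) (a' y' z' b' x' : B), relations (-1) 1 1 0 a' y' z' b' x' ->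
      exists F : {lrmorphism A -> B}, [/\ F a = a', F y = y', F z = z', F b = b' & F x = x']) ->
  exists (t : seq nat) (r' : 'I_(size t) -> F),
  [/\ sorted leq t, (size t <= 3)%N, forall k : 'I_(size t), homogeneous W (fun=> 1%N) (nth 0%N t k) (r' k)
    & minimal_ideal_generators r' (fun f => free_eval W (three_values a b x) f = 0)].
Proof.
move=> rel HP; have el : 1 * 1 + 0 * 0 = 1 :> K by rewrite mul1r mul0r addr0.
apply: (family_minimal el rel HP (r := fun i : 'I_3 => nth 0 relators_223 i) (deg := fun i : 'I_3 => nth 0%N [:: 2; 2; 3]%N i)).
- by move=> i; apply: relators_223_hom.
- have va := value_a a b x W; have vb := value_b a b x W; have vx := value_x a b x W.
  case: rel => ya _ _ ba _ _ xa _ _ xb.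
  rewrite scale1r in ba; rewrite scale1r scale0r addr0 in xa; rewrite scale0r addr0 in xb.
  have yE : b * a - a * b = y by rewrite ba addrC addKr.
  case=> [[|[|[|]]] // lt] /=; rewrite !(rmorphB, rmorphD) /= !(rmorphB, rmorphM) /= ?va ?vb ?vx.
  + by rewrite xa subrr.
  + by rewrite xb subrr.
  by rewrite yE ya subrr.
move=> Q p hp; rewrite elem_z10 elem_y10.
have h0 := hp 0; have h1 := hp 1; have h2 := hp 2%:R; move: h0 h1 h2.
rewrite /= !(rmorphB, rmorphD) /= !(rmorphB, rmorphM) /= => h0 h1 h2.
by apply: type_223_relations; apply/eqP; rewrite -subr_eq0; apply/eqP.
Qed.
End Presentation.

Lemma type_223 : exists (A : algType K) (G : nat -> A -> Prop),
  [/\ AS_Ore_extension 5 G, subspace_dim (G 1%N) 3 & relation_type G [:: 2; 2; 3]%N].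
Proof.
have he : 1 != 0 :> K -> 2 = 2%N /\ 3 = 3%N by [].
have hl : 0 != 0 :> K -> 2 = 2%N /\ 3 = 2%N by rewrite eqxx.
have el : 1 * 1 + 0 * 0 = 1 :> K by rewrite mul1r mul0r addr0.
have [||||A [a [y [z [b [x [G [T [inj rel gen HP]]]]]]]]] :=
  @family_exists K (-1) 1 1 0 _ _ _ _ 2 3 isT isT he hl.
- by rewrite mulrNN mulr1.
- by rewrite mul0r.
- by rewrite subrr mulr0.
- by rewrite mul0r.
have [t [r [st sz hr min]]] := minimal_223 (malg_words K 3) rel HP.
have rt := family_relation_type el he hl inj rel gen st hr min.
have dim := family_dim el he hl inj.
exists A, G; split=> //; first exact: (family_AS_Ore el inj rel gen).
have [tw _ _] := tower_of_ore inj.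
have := tower_relation_type tw erefl (family_generated el inj rel gen) dim rt.
by move=> [[]//|[_ [] tE]]; rewrite tE in rt sz.
Qed.
End Examples.

(** * Enveloping algebras *)

Lemma ord2_cases (i : 'I_2) : i = 0 \/ i = 1.
Proof. by case: i => [[|[|]] // lt]; [left | right]; apply: val_inj. Qed.

Lemma alternating3 (K : fieldType) (T : 'I_3 -> 'I_3 -> K) :
  (forall m, T m m = 0) -> (forall m m', T m m' = - T m' m) ->
  T 1 0 = 0 -> T 2%:R 0 = 0 -> T 2%:R 1 = 0 -> forall m m', T m m' = 0.
Proof.
move=> Tm Ta T10 T20 T21.
have c3 (m : 'I_3) : [\/ m = 0, m = 1 | m = 2%:R].
  by case: m => [[|[|[|]]] //= lt]; [apply: Or31 | apply: Or32 | apply: Or33]; apply: val_inj.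
move=> m m'; case: (c3 m) => ->; case: (c3 m') => -> //; by rewrite Ta ?T10 ?T20 ?T21 oppr0.
Qed.

Section MatrixUnits.
Variable K : fieldType.
Local Notation o n := (@Ordinal 5 n isT).

Definition unit_mx (i j : 'I_5) : 'M[K]_5 := delta_mx i j.
Local Notation e i j := (unit_mx (o i) (o j)).

Lemma unit_mxM i j k l : unit_mx i j * unit_mx k l = if j == k then unit_mx i l else 0.
Proof. by rewrite /unit_mx -mulmxE mul_delta_mx_cond; case: eqP. Qed.

(** With N the shift below, e 1 0, N e 1 0, N N e 1 0 and N N N e 1 0 are the
entries of the first column, and a product vanishes if N stands to the right of
one of them. *)
Definition shift_mx : 'M[K]_5 := e 2 1 + e 3 2 + e 4 3.
Local Notation N := shift_mx.

Definition unitE := (mulrDl, mulrDr, unit_mxM, mul0r, mulr0, add0r, addr0).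

Lemma shift10 : N * e 1 0 = e 2 0. Proof. by rewrite /shift_mx !unitE /= ?addr0 ?add0r. Qed.
Lemma shift20 : N * e 2 0 = e 3 0. Proof. by rewrite /shift_mx !unitE /= ?addr0 ?add0r. Qed.
Lemma shift30 : N * e 3 0 = e 4 0. Proof. by rewrite /shift_mx !unitE /= ?addr0 ?add0r. Qed.
Lemma shift40 : N * e 4 0 = 0. Proof. by rewrite /shift_mx !unitE /= ?addr0 ?add0r. Qed.
Lemma col0_shift i : unit_mx i (o 0) * N = 0. Proof. by rewrite /shift_mx !unitE /= ?addr0 ?add0r. Qed.
Lemma col0_unit i j : (j != o 0) -> unit_mx i (o 0) * unit_mx j (o 0) = 0.
Proof. by rewrite unit_mxM eq_sym => /negPf ->. Qed.
Lemma unit_mxE i j k l : unit_mx i j k l = ((k == i) && (l == j))%:R.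
Proof. exact: mxE. Qed.
Lemma shift_corner : N (o 4) (o 0) = 0.
Proof. by rewrite /shift_mx !mxE /= !mulr0n !addr0. Qed.
Lemma shift2_corner : (N * N) (o 4) (o 0) = 0.
Proof. by rewrite /shift_mx !unitE /= ?addr0 ?add0r ?unitE /= ?addr0 ?add0r !mxE /= ?mulr0n ?addr0. Qed.
Lemma shift40E : (N * N * N) (o 4) (o 0) = 0.
Proof. by rewrite /shift_mx !unitE /= ?addr0 ?add0r ?unitE /= ?addr0 ?add0r /unit_mx !mxE /= ?addr0. Qed.

End MatrixUnits.

Section LowDegrees.
Variables (K : fieldType) (n : nat) (F : algType K) (W : word_basis n F) (w : 'I_n -> nat).
Variables (S : F -> Prop).
Hypothesis S2 : forall s, S s -> exists2 d, (1 < d)%N & homogeneous W w d s.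
Local Notation comp := (component W w).

Lemma ideal_low f : ideal_generated_by S f -> comp 0 f = 0 /\ comp 1 f = 0.
Proof.
elim=> {f} [f /S2[d d1 hf]||f g _ [f0 f1] _ [g0 g1]|h f _ [f0 f1]|h f _ [f0 f1]].
- by rewrite !(component_id _ hf); case: d d1 {hf} => [|[|d]].
- by rewrite !linear0.
- by rewrite !linearD /= f0 f1 g0 g1 addr0.
- by rewrite !component_mul !big_ord_recl !big_ord0 /= ?subn0 ?subnn f0 f1 !mulr0 !addr0.
by rewrite !component_mul !big_ord_recl !big_ord0 /= ?subn0 ?subnn f0 f1 !mul0r !addr0.
Qed.

End LowDegrees.

Section PositiveWeights.
Variables (K : fieldType) (n : nat) (F : algType K) (W : word_basis n F) (w : 'I_n -> nat).
Hypothesis w0 : forall i, (0 < w i)%N.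
Local Notation H := (homogeneous W w).

Lemma size_weight s : (size s <= weight w s)%N.
Proof.
elim: s => [|i s IH] //=; rewrite /weight big_cons -add1n; apply: leq_add => //.
Qed.

Lemma weight0_scalar f : H 0 f -> exists c : K, f = c%:A.
Proof.
move=> hf; elim/homogeneous_ind: hf => [|c s {}f hs [a ->]]; first by exists 0; rewrite scale0r.
exists (c + a); have := size_weight s; rewrite hs leqn0 size_eq0 => /eqP ->.
by rewrite (word_nil W) scalerDl.
Qed.

Lemma weight1_expansion f : H 1 f -> f = \sum_(k | w k == 1%N) coef W f [:: k] *: word W [:: k].
Proof.
move=> hf; elim/homogeneous_ind: hf => [|c s {}f hs IH].
  by rewrite big1 // => k _; rewrite wcoef0 scale0r.
rewrite {1}IH; under [RHS]eq_bigr => k _ do rewrite wcoefD wcoefZ scalerDl coef_word.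
rewrite big_split /=; congr (_ + _).
have : (size s <= 1)%N by rewrite (leq_trans (size_weight s)) // hs.
case: s hs {IH} => [|i [|]] //; first by rewrite /weight big_nil.
rewrite /weight big_seq1 => hs _; rewrite (bigD1 i) ?hs //= eqxx mulr1 big1 ?addr0 // => j /andP[_ ne].
by rewrite eqseq_cons eqxx andbT eq_sym (negPf ne) mulr0 scale0r.
Qed.

End PositiveWeights.

Section StructureConstants.
Variables (K : fieldType) (L : vectType K) (br : L -> L -> L) (n : nat) (x : n.-tuple L) (w : 'I_n -> nat).
Hypothesis gl : graded_lie_algebra br x w.

Definition sc (k j i : 'I_n) : K := coord x k (br (tnth x j) (tnth x i)).

Let xfree : free x. Proof. by case: gl => _ /basis_free. Qed.

Lemma sc_expansion j i : br (tnth x j) (tnth x i) = \sum_k sc k j i *: tnth x k.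
Proof.
have [_ bx _ _] := gl; rewrite [LHS](coord_basis bx (memvf _)).
by apply: eq_bigr => k _; rewrite (tnth_nth 0 x k).
Qed.

Lemma coord_tnth k j : coord x k (tnth x j) = (k == j)%:R.
Proof. by rewrite (tnth_nth 0) coord_free // eq_sym. Qed.

Lemma sc_weight k j i : sc k j i != 0 -> w k = (w j + w i)%N.
Proof.
move=> nz; apply/eqP; apply: contraT => ne; case/eqP: nz.
have [_ _ _ /(_ i j)] := gl; set s := [seq _ | _ <- _ & _] => h.
rewrite /sc (coord_span (X := in_tuple s) h) linear_sum big1 // => m _; rewrite linearZ /=.
have : (in_tuple s)`_m \in s by apply: mem_nth.
move=> /mapP[l]; rewrite mem_filter => /andP[/eqP wl _] ->; rewrite coord_tnth.
by case: eqP => [e|]; rewrite ?mulr0 //; case/eqP: ne; rewrite e.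
Qed.

Lemma br_anti u v : br u v = - br v u.
Proof.
have [[l1 l2 alt _] _ _ _] := gl.
have D1 a b c : br a (b + c) = br a b + br a c by have := l1 a 1 b c; rewrite !scale1r.
have D2 a b c : br (a + b) c = br a c + br b c by have := l2 c 1 a b; rewrite !scale1r.
have := alt (u + v); rewrite D1 !D2 !alt add0r addr0 => /eqP.
by rewrite addr_eq0 => /eqP e; rewrite e opprK.
Qed.

Lemma sc_anti k j i : sc k j i = - sc k i j.
Proof. by rewrite /sc br_anti linearN. Qed.

Lemma sc_alt k i : sc k i i = 0.
Proof. by have [[_ _ alt _] _ _ _] := gl; rewrite /sc alt linear0. Qed.

Lemma sc_jacobi q u v t :
  \sum_k sc k v t * sc q u k + \sum_k sc k t u * sc q v k + \sum_k sc k u v * sc q t k = 0.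
Proof.
have [[l1 _ _ jac] _ _ _] := gl.
have lin a b c : coord x q (br (tnth x a) (br (tnth x b) (tnth x c))) = \sum_k sc k b c * sc q a k.
  rewrite (sc_expansion b c).
  have h (I : Type) (s : seq I) (f : I -> K) (e : I -> L) :
      br (tnth x a) (\sum_(k <- s) f k *: e k) = \sum_(k <- s) f k *: br (tnth x a) (e k).
    elim: s => [|k s IH]; last by rewrite !big_cons l1 IH.
    by rewrite !big_nil; have := l1 (tnth x a) (-1) 0 0; rewrite scaler0 addr0 scaleN1r addNr.
  by rewrite h linear_sum; apply: eq_bigr => k _; rewrite linearZ.
by rewrite -!lin -!linearD jac linear0.
Qed.

End StructureConstants.

Section Enveloping.
Variables (K : fieldType) (L : vectType K) (br : L -> L -> L) (n : nat) (x : n.-tuple L) (w : 'I_n -> nat).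
Hypothesis gl : graded_lie_algebra br x w.
Variables (F : algType K) (W : word_basis n F) (U : algType K) (pi : {lrmorphism F -> U}).
Local Notation rel := (lie_relation br x W).
Local Notation gen k := (word W [:: k]).
Local Notation c := (sc br x).
Hypothesis ker : forall f, pi f = 0 <-> ideal_generated_by (fun h => exists i j, h = rel i j) f.
Definition degree_one (u : U) : Prop := exists2 f, homogeneous W w 1 f & pi f = u.
Hypothesis gen1 : forall u, subalgebra_generated_by degree_one u.
Hypothesis dim1 : subspace_dim degree_one 3.

Lemma weight_gt0 i : (0 < w i)%N. Proof. by case: gl => _ _ h _. Qed.

Lemma relE i j : rel i j = gen j * gen i - gen i * gen j - \sum_k c k j i *: gen k.
Proof. by []. Qed.

Lemma rel_hom i j : homogeneous W w (w j + w i) (rel i j).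
Proof.
have hs := hom_subspace W w (w j + w i); have hg k : homogeneous W w (w k) (gen k) := hom_gen W w k.
rewrite relE; apply: subspaceB => //.
  by apply: subspaceB => //; [apply: homM | rewrite addnC; apply: homM].
apply: subspace_sum => // k _; case: (eqVneq (c k j i) 0) => [->|/(sc_weight gl) <-].
  by rewrite scale0r; case: hs.
by apply: (subspaceZ _ (hom_subspace W w (w k))).
Qed.

Lemma rel_weight s : (exists i j, s = rel i j) -> exists2 d, (1 < d)%N & homogeneous W w d s.
Proof.
move=> [i [j ->]]; exists (w j + w i)%N; last exact: rel_hom.
by have := weight_gt0 i; have := weight_gt0 j; lia.
Qed.

Lemma pi_rel j i : pi (gen j) * pi (gen i) - pi (gen i) * pi (gen j) = \sum_k c k j i *: pi (gen k).
Proof.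
have : pi (rel i j) = 0 by apply/ker; apply: IdealIn; exists i, j.
by rewrite lie_relation_hom => /eqP; rewrite subr_eq0 => /eqP.
Qed.

Lemma hom_kernel (B : algType K) (p : {lrmorphism F -> B}) :
  (forall i j, p (rel i j) = 0) -> forall f, pi f = 0 -> p f = 0.
Proof.
move=> h f /ker; elim=> {f} [f [i [j ->]]//||f g _ hf _ hg|g f _ hf|g f _ hf].
- by rewrite rmorph0.
- by rewrite rmorphD /= hf hg addr0.
- by rewrite rmorphM /= hf mulr0.
by rewrite rmorphM /= hf mul0r.
Qed.

Section Character.
Variables (phi : 'I_n -> K).
Let p : {lrmorphism F -> triangular K^o} := free_eval W (fun k => tri (0 : K^o) (phi k) 0).

Let pE k : p (gen k) = tri (0 : K^o) (phi k) 0. Proof. exact: free_eval_gen. Qed.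

Lemma character_sum (I : Type) (s : seq I) (P : pred I) (e : I -> K) (f : I -> 'I_n) :
  p (\sum_(k <- s | P k) e k *: gen (f k)) = tri (0 : K^o) (\sum_(k <- s | P k) e k * phi (f k)) 0.
Proof.
elim/big_rec2: _ => [|k u v _ IH]; first by rewrite rmorph0.
by rewrite linearP /= IH pE triZ triD !scaler0 !addr0.
Qed.

Hypothesis phi_br : forall j i, \sum_k c k j i * phi k = 0.

(** A linear form phi vanishing on [L,L] defines a homomorphism to the dual
numbers, realised as strictly triangular matrices. *)
Lemma character_rel i j : p (rel i j) = 0.
Proof.
rewrite relE rmorphB rmorphB !rmorphM /= !pE !triM !mulr0 !mul0r addr0 subrr sub0r.
by rewrite (character_sum _ _ (fun k => c k j i) id) phi_br oppr0.
Qed.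

Lemma character_free (e : 'I_n -> K) : pi (\sum_(k | w k == 1%N) e k *: gen k) = 0 ->
  \sum_(k | w k == 1%N) e k * phi k = 0.
Proof.
move/(hom_kernel character_rel); rewrite (character_sum _ _ e id).
by move/(congr1 (fun u : triangular K^o => u.1.2)).
Qed.

(** L is generated by its degree one part, so that everything of higher degree is
a sum of brackets. *)
Lemma character0 : (forall k, w k = 1%N -> phi k = 0) -> forall k, phi k = 0.
Proof.
move=> h1 k.
have lift u : subalgebra_generated_by degree_one u -> exists f, pi f = u /\ exists a : K, p f = a%:A.
  elim=> {u} [u [f hf <-]||u v _ [f [<- [a fa]]] _ [g [<- [b gb]]]|u v _ [f [<- [a fa]]] _ [g [<- [b gb]]]|a u _ [f [<- [b fb]]]].
  - exists f; split=> //; exists 0; rewrite (weight1_expansion weight_gt0 hf).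
    rewrite (character_sum _ _ (fun k => coef W f [:: k]) id) scale0r big1 // => i /eqP wi.
    by rewrite h1 // mulr0.
  - by exists 1; rewrite !rmorph1; split=> //; exists 1; rewrite scale1r.
  - by exists (f + g); rewrite !rmorphD /= fa gb; split=> //; exists (a + b); rewrite scalerDl.
  - by exists (f * g); rewrite !rmorphM /= fa gb; split=> //; exists (a * b); rewrite mulr_algl scalerA.
  by exists (a *: f); rewrite !linearZ /= fb; split=> //; exists (a * b); rewrite scalerA.
have [f [fk [a fa]]] := lift _ (gen1 (pi (gen k))).
have : p (f - gen k) = 0 by apply: (hom_kernel character_rel); rewrite rmorphB /= fk subrr.
rewrite rmorphB /= fa pE => /(congr1 (fun u : triangular K^o => u.1.2)) /= /eqP.
by rewrite scaler0 add0r oppr_eq0 => /eqP.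
Qed.
End Character.

Lemma not_bracket (phi : 'I_n -> K) : (forall k, w k = 1%N -> phi k = 0) ->
  (exists k, phi k != 0) -> exists j i, \sum_k c k j i * phi k != 0.
Proof.
move=> h [k nz]; apply: NNPP => no; case/eqP: nz; apply: character0 => // j i.
by apply/eqP; apply: contraT => nz; case: no; exists j, i.
Qed.

Lemma not_bracket1 p : w p != 1%N -> exists j i, c p j i != 0.
Proof.
move=> wp; have [|| j [i]] := @not_bracket (fun k => (k == p)%:R).
- by move=> k wk; case: eqP => // e; move: wp; rewrite -e wk.
- by exists p; rewrite eqxx oner_eq0.
rewrite (bigD1 p) //= eqxx mulr1 big1 ?addr0 => [nz|k /negPf ->]; last by rewrite mulr0.
by exists j, i.
Qed.

Lemma gens_free1 (e : 'I_n -> K) : pi (\sum_(k | w k == 1%N) e k *: gen k) = 0 ->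
  forall k, w k = 1%N -> e k = 0.
Proof.
move=> h k wk; have := @character_free (fun j => (j == k)%:R) _ e h.
rewrite (bigD1 k) /= ?wk // eqxx mulr1 big1 ?addr0 => [-> //|j /andP[_ /negPf ->]]; last by rewrite mulr0.
move=> j i; rewrite big1 // => m _; case: eqP => [->|]; rewrite ?mulr0 ?mulr1 //.
apply/eqP; apply: contraT => /(sc_weight gl); rewrite wk => e1.
by have := weight_gt0 i; have := weight_gt0 j; lia.
Qed.

Lemma card_weight1 : #|[set k | w k == 1%N]| = 3%N.
Proof.
pose D := {k | w k == 1%N}.
have b : basis (fun k : D => pi (gen (val k))) degree_one.
  split.
  - move=> e e0 k.
    pose e' k := if insub k is Some q then e q else 0.
    have <- : e' (val k) = e k by rewrite /e' valK.
    apply: gens_free1; last by apply/eqP; case: (k).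
    rewrite -[RHS]e0 (sum_subtype _ (fun k => e' k *: gen k)) linear_sum; apply: eq_bigr => i _.
    by rewrite linearZ /= /e' valK.
  - move=> [k wk]; exists (gen k) => //; have := hom_gen W w k; by rewrite (eqP wk).
  move=> u [f hf <-]; exists (fun k : D => coef W f [:: val k]).
  rewrite {1}(weight1_expansion weight_gt0 hf) (sum_subtype _ (fun k => coef W f [:: k] *: gen k)) linear_sum.
  by apply: eq_bigr => i _; rewrite linearZ.
rewrite (dim_uniq dim1 (basis_dim (dim_subspace dim1) b)) card_sig cardsE; apply: eq_card => k; by rewrite !inE.
Qed.

Hypothesis n5 : n = 5%N.

Lemma other_weights : exists p q, [/\ p != q, w p != 1%N, w q != 1%N, (w p <= w q)%N
  & forall k, w k != 1%N -> k = p \/ k = q].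
Proof.
have : #|[set k | w k != 1%N]| == 2%N.
  have cn : #|'I_n| = 5%N by rewrite card_ord.
  have := cardsC [set k | w k == 1%N]; rewrite card_weight1 cn.
  have -> : ~: [set k | w k == 1%N] = [set k | w k != 1%N] by apply/setP => k; rewrite !inE.
  by move=> e; apply/eqP; lia.
move=> /cards2P[p [q [ne e]]].
have h k : w k != 1%N -> k = p \/ k = q.
  have : (k \in [set k | w k != 1%N]) = (w k != 1%N) by rewrite inE.
  by move=> <-; rewrite e !inE => /orP[/eqP|/eqP]; auto.
have wp : w p != 1%N by have := set21 p q; rewrite -e inE.
have wq : w q != 1%N by have := set22 p q; rewrite -e inE.
case: (leqP (w p) (w q)) => [le|/ltnW le]; first by exists p, q.
by exists q, p; split=> //; [rewrite eq_sym | move=> k /h []; auto].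
Qed.

(** Elements of weight above one are brackets, so that their weights are 1 + 1 or
1 + 2. *)
Lemma weight_cases : exists p q, [/\ p != q, w p = 2%N, w q = 2%N \/ w q = 3%N
  & forall k, k <> p -> k <> q -> w k = 1%N].
Proof.
have [p [q [ne wp wq le h]]] := other_weights; exists p, q.
have h1 k : k <> p -> k <> q -> w k = 1%N.
  by move=> kp kq; apply/eqP; apply: contraT => /h [].
have wp2 : w p = 2%N.
  have [j [i /(sc_weight gl) e]] := not_bracket1 wp.
  have wj := weight_gt0 j; have wi := weight_gt0 i.
  have lt k : (w k < w p)%N -> w k = 1%N.
    by move=> lt; apply: h1 => ek; move: lt; rewrite ek ?ltnn // ltnNge le.
  have wj1 : w j = 1%N by apply: lt; rewrite e; lia.
  have wi1 : w i = 1%N by apply: lt; rewrite e wj1; lia.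
  by rewrite e wj1 wi1.
split=> //; have [j [i nz]] := not_bracket1 wq; have e := sc_weight gl nz.
have wj := weight_gt0 j; have wi := weight_gt0 i.
have cs k : (w k < w q)%N -> k = p \/ w k = 1%N.
  case: (k =P p) => [|kp lt]; first by auto.
  by right; apply: h1 => // kq; move: lt; rewrite kq ltnn.
have lj : (w j < w q)%N by rewrite e; lia.
have li : (w i < w q)%N by rewrite e; lia.
have [jp|j1] := cs j lj.
  have [ip|i1] := cs i li.
    by move: nz; rewrite jp ip (sc_alt gl) eqxx.
  by right; rewrite e jp i1 wp2.
have [ip|i1] := cs i li.
  by right; rewrite e ip j1 wp2.
by left; rewrite e i1 j1.
Qed.

Lemma weight1_enum : exists a : 'I_3 -> 'I_n, injective a /\ forall k, w k = 1%N <-> exists m, k = a m.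
Proof.
pose S := [set k | w k == 1%N]; have e : 3%N = #|S| := esym card_weight1.
exists (fun m => enum_val (cast_ord e m)); split; first by move=> m m' /enum_val_inj/cast_ord_inj.
move=> k; split=> [wk|[m ->]]; last by have := enum_valP (cast_ord e m); rewrite inE => /eqP.
have kS : k \in S by rewrite inE wk.
by exists (cast_ord (esym e) (enum_rank_in kS k)); rewrite cast_ordKV enum_rankK_in.
Qed.

(** The relators have degree at least two, so that only their scalar multiples
contribute to the quadratic part of an element of the ideal. *)
Lemma quadratic_kernel f : pi f = 0 -> exists t : 'I_n -> 'I_n -> K,
  (forall j i, t j i != 0 -> w j = 1%N /\ w i = 1%N) /\
  component W w 2 f = \sum_j \sum_i t j i *: rel i j.
Proof.
have cmp2 g h : component W w 0 g = 0 /\ component W w 1 g = 0 ->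
    (exists a, component W w 2 (h * g) = a *: component W w 2 g) /\
    (exists a, component W w 2 (g * h) = a *: component W w 2 g).
  move=> [g0 g1]; have [a ha] := weight0_scalar weight_gt0 (component_hom W w 0 h).
  rewrite !component_mul !big_ord_recl !big_ord0 /= ?subnn ?subn0 g0 g1 ha.
  rewrite !mulr0 !mul0r !addr0 !add0r; split; exists a; rewrite ?mulr_algl //.
  by rewrite /bump /= mulr_algr.
move/ker; elim=> {f} [f [i0 [j0 ->]]||f g _ [t [ht ft]] _ [t' [ht' gt']]|h f jf [t [ht ft]]|h f jf [t [ht ft]]].
- have hr := rel_hom i0 j0; rewrite (component_id _ hr).
  case: eqP => [e|_]; last first.
    exists (fun _ _ => 0); split=> [j i|]; first by rewrite eqxx.
    by rewrite big1 // => j _; rewrite big1 // => i _; rewrite scale0r.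
  exists (fun j i => ((j == j0) && (i == i0))%:R); split=> [j i|].
    case: andP => [[/eqP -> /eqP ->] _|_]; last by rewrite eqxx.
    by have := weight_gt0 i0; have := weight_gt0 j0; lia.
  rewrite (bigD1 j0) //= [X in _ + X]big1 => [|j /negPf nj]; last first.
    by rewrite big1 // => i _; rewrite nj scale0r.
  rewrite (bigD1 i0) //= !eqxx scale1r big1 ?addr0 // => i /negPf ->; by rewrite scale0r.
- exists (fun _ _ => 0); split=> [j i|]; first by rewrite eqxx.
  by rewrite linear0 big1 // => j _; rewrite big1 // => i _; rewrite scale0r.
- exists (fun j i => t j i + t' j i); split=> [j i nz|].
    case: (eqVneq (t j i) 0) => [t0|/ht //]; apply: ht'; move: nz; by rewrite t0 add0r.
  rewrite linearD /= ft gt' -big_split; apply: eq_bigr => j _; rewrite -big_split; apply: eq_bigr => i _.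
  by rewrite scalerDl.
- have [[a e] _] := cmp2 f h (ideal_low rel_weight jf); exists (fun j i => a * t j i); split=> [j i|].
    by rewrite mulf_eq0 negb_or => /andP[_ /ht].
  rewrite e ft scaler_sumr; apply: eq_bigr => j _; rewrite scaler_sumr; apply: eq_bigr => i _.
  by rewrite scalerA.
have [_ [a e]] := cmp2 f h (ideal_low rel_weight jf); exists (fun j i => a * t j i); split=> [j i|].
  by rewrite mulf_eq0 negb_or => /andP[_ /ht].
rewrite e ft scaler_sumr; apply: eq_bigr => j _; rewrite scaler_sumr; apply: eq_bigr => i _.
by rewrite scalerA.
Qed.

Section Generators.
Variables (F3 : algType K) (W3 : word_basis 3 F3) (pi3 : {lrmorphism F3 -> U}) (N : nat) (r : 'I_N -> F3)
  (deg : 'I_N -> nat).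
Local Notation gen3 i := (word W3 [:: i]).
Local Notation H3 := (homogeneous W3 (fun=> 1%N)).
Hypothesis hr : forall k, H3 (deg k) (r k).
Hypothesis deg2 : forall k, (1 < deg k)%N.
Hypothesis min : minimal_ideal_generators r (fun g => pi3 g = 0).
Hypothesis pi3_1 : forall i, degree_one (pi3 (gen3 i)).

Lemma low_kernel3 g : pi3 g = 0 -> component W3 (fun=> 1%N) 1 g = 0.
Proof.
move/(kernelP min) => h; have [|_ ->] // := ideal_low (W := W3) (w := fun=> 1%N) _ h.
by move=> s [k _ ->]; exists (deg k).
Qed.

Variables (a : 'I_3 -> 'I_n).
Hypotheses (ainj : injective a) (aP : forall k, w k = 1%N <-> exists m, k = a m).

(** There are no relations of degree one, so that the given generators are
combinations of the basis elements of degree one by an invertible matrix. *)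
Lemma lift_generators : exists (lam : {lrmorphism F3 -> F}) (mu : {lrmorphism F -> F3}) (h : 'I_3 -> F3),
  [/\ forall g, pi (lam g) = pi3 g, forall g, mu (lam g) = g, forall m, lam (h m) = gen (a m),
    forall m, H3 1 (h m)
    & exists P : 'I_3 -> 'I_3 -> K, forall i, lam (gen3 i) = \sum_m P i m *: gen (a m)].
Proof.
have [f hf] : exists f : 'I_3 -> F, forall i, homogeneous W w 1 (f i) /\ pi (f i) = pi3 (gen3 i).
  by apply: (fchoice (P := fun i g => homogeneous W w 1 g /\ pi g = pi3 (gen3 i))) => i; have [g] := pi3_1 i; exists g.
pose P : 'M[K]_3 := \matrix_(i, m) coef W (f i) [:: a m].
have fE i : f i = \sum_m P i m *: gen (a m).
  have [h1 _] := hf i; rewrite {1}(weight1_expansion weight_gt0 h1).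
  rewrite (eq_bigl (fun k => k \in [set a m | m : 'I_3])); last first.
    move=> k; apply/eqP/imsetP => [/aP[m ->]|[m _ ->]]; first by exists m.
    by apply/aP; exists m.
  rewrite big_imset /=; last by move=> m m' _ _; apply: ainj.
  by apply: eq_big => [m|m _]; rewrite ?inE // mxE.
have [lam lamE] : exists lam : {lrmorphism F3 -> F}, forall i, lam (gen3 i) = f i.
  by exists (free_eval W3 f) => i; apply: free_eval_gen.
have pil g : pi (lam g) = pi3 g.
  have := free_hom_ext (W := W3) (p := pi \o lam) (q := pi3); apply=> i /=.
  by rewrite lamE; case: (hf i).
have unitP : P \in unitmx.
  rewrite -row_free_unit -kermx_eq0; apply/rowV0P => v /sub_kermxP vP.
  pose g := \sum_i v 0 i *: gen3 i.
  have hg : H3 1 g.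
    apply: subspace_sum => [|i _]; first exact: hom_subspace.
    by apply: (subspaceZ _ (hom_subspace W3 _ 1)); apply: (hom_gen W3 (fun=> 1%N) i).
  have g0 : pi3 g = 0.
    rewrite -pil /g linear_sum (_ : \sum_i _ = 0) ?rmorph0 //.
    under eq_bigr => i _ do rewrite linearZ /= lamE fE scaler_sumr.
    rewrite exchange_big big1 // => m _; under eq_bigr => i _ do rewrite scalerA.
    by rewrite -scaler_suml (_ : \sum_i _ = 0) ?scale0r //; have := congr1 (fun u : 'rV_3 => u 0 m) vP; rewrite !mxE.
  have := low_kernel3 g0; rewrite (component_id _ hg) eqxx => gz.
  apply/rowP => i; have := congr1 (fun u => coef W3 u [:: i]) gz; rewrite wcoef0 mxE => <-.
  rewrite /g !big_ord_recl big_ord0 !wcoefD !wcoefZ wcoef0 !coef_word.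
  by case: i => [[|[|[|]]] // lt] /=; rewrite ?mulr1 ?mulr0 ?addr0 ?add0r; congr (v _ _); apply: val_inj.
pose h m := \sum_i invmx P m i *: gen3 i.
have lamh m : lam (h m) = gen (a m).
  rewrite /h linear_sum; under eq_bigr => i _ do rewrite linearZ /= lamE fE scaler_sumr.
  rewrite exchange_big (bigD1 m) //= [X in _ + X]big1 ?addr0 => [|m' ne].
    under eq_bigr => i _ do rewrite scalerA; rewrite -scaler_suml.
    by have := congr1 (fun M : 'M_3 => M m m) (mulVmx unitP); rewrite !mxE eqxx => ->; rewrite scale1r.
  under eq_bigr => i _ do rewrite scalerA; rewrite -scaler_suml.
  have := congr1 (fun M : 'M_3 => M m m') (mulVmx unitP); rewrite !mxE eq_sym (negPf ne) => ->.
  by rewrite scale0r.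
have [mu mua] : exists mu : {lrmorphism F -> F3}, forall m, mu (gen (a m)) = h m.
  exists (free_eval W (fun k => if [pick m | a m == k] is Some m then h m else 0)) => m.
  rewrite [LHS]free_eval_gen; case: pickP => [m' /eqP/ainj -> //|/(_ m)]; by rewrite eqxx.
exists lam, mu, h; split=> //.
- move=> g; have := free_hom_ext (W := W3) (p := mu \o lam) (q := idfun); apply=> i /=.
  rewrite lamE fE linear_sum; under eq_bigr => m _ do rewrite linearZ /= mua /h scaler_sumr.
  rewrite exchange_big (bigD1 i) //= [X in _ + X]big1 ?addr0 => [|m' ne].
    under eq_bigr => m _ do rewrite scalerA; rewrite -scaler_suml.
    by have := congr1 (fun M : 'M_3 => M i i) (mulmxV unitP); rewrite !mxE eqxx => ->; rewrite scale1r.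
  under eq_bigr => m _ do rewrite scalerA; rewrite -scaler_suml.
  have := congr1 (fun M : 'M_3 => M i m') (mulmxV unitP); rewrite !mxE eq_sym (negPf ne) => ->.
  by rewrite scale0r.
- move=> m; apply: subspace_sum => [|i _]; first exact: hom_subspace.
  by apply: (subspaceZ _ (hom_subspace W3 _ 1)); apply: (hom_gen W3 (fun=> 1%N) i).
by exists P => i; rewrite lamE fE.
Qed.

Lemma sum_weight1 (V : nmodType) (f : 'I_n -> V) : (forall k, w k <> 1%N -> f k = 0) ->
  \sum_k f k = \sum_m f (a m).
Proof.
move=> f0; rewrite (bigID (fun k => k \in [set a m | m : 'I_3])) /= [X in _ + X]big1 ?addr0.
  rewrite big_imset /=; last by move=> m m' _ _; apply: ainj.
  by apply: eq_bigl => m; rewrite inE.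
by move=> k ka; apply: f0 => /aP[m e]; case/imsetP: ka; exists m.
Qed.

Lemma coef_sum (I : Type) (l : seq I) (P : pred I) (f : I -> F) s :
  coef W (\sum_(i <- l | P i) f i) s = \sum_(i <- l | P i) coef W (f i) s.
Proof. by apply: (big_morph (fun g => coef W g s)) => [u v|]; rewrite ?wcoefD ?wcoef0. Qed.

Lemma rel_coef i j s : coef W (rel i j) s =
  ([:: j; i] == s)%:R - ([:: i; j] == s)%:R - \sum_k c k j i * ([:: k] == s)%:R.
Proof.
have B f g : coef W (f - g) s = coef W f s - coef W g s.
  by rewrite wcoefD -scaleN1r wcoefZ mulN1r.
rewrite relE !B -!(word_cons W) !coef_word coef_sum; congr (_ - _).
by apply: eq_bigr => k _; rewrite wcoefZ coef_word.
Qed.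

Lemma delta_sum2 (t : 'I_n -> 'I_n -> K) j i :
  \sum_j' \sum_i' t j' i' * ([:: j'; i'] == [:: j; i])%:R = t j i.
Proof.
rewrite (bigD1 j) //= [X in _ + X]big1 ?addr0 => [|j' /negPf nj]; last first.
  by rewrite big1 // => i' _; rewrite eqseq_cons nj mulr0.
rewrite (bigD1 i) //= eqxx mulr1 big1 ?addr0 // => i' /negPf ni.
by rewrite !eqseq_cons ni andbF mulr0.
Qed.

Lemma quadratic_coef f (t : 'I_n -> 'I_n -> K) :
  f = \sum_j \sum_i t j i *: rel i j ->
  (forall j i, coef W f [:: j; i] = t j i - t i j) /\
  (forall k, coef W f [:: k] = - \sum_j \sum_i t j i * c k j i).
Proof.
move=> ->; split=> [j i|k].
  rewrite -[t j i]delta_sum2 -[t i j]delta_sum2 -sumrB coef_sum.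
  apply: eq_bigr => j' _; rewrite -sumrB coef_sum; apply: eq_bigr => i' _.
  rewrite wcoefZ rel_coef [X in _ - X]big1 ?subr0 ?mulrBr; last by move=> k _; rewrite eqseq_cons andbF mulr0.
  by congr (_ - _ * (nat_of_bool _)%:R); rewrite !eqseq_cons !andbT andbC.
rewrite -sumrN coef_sum; apply: eq_bigr => j _; rewrite -sumrN coef_sum; apply: eq_bigr => i _.
rewrite wcoefZ rel_coef !eqseq_cons !andbF subrr sub0r mulrN; congr (- (_ * _)).
rewrite (bigD1 k) //= eqxx mulr1 big1 ?addr0 // => k' /negPf nk; by rewrite eqseq_cons nk mulr0.
Qed.

Lemma sum3 (V : zmodType) (f : 'I_3 -> V) : \sum_m f m = f 0 + f 1 + f 2%:R.
Proof.
rewrite !big_ord_recl big_ord0 addr0 addrA; congr (_ + f _ + f _); exact: val_inj.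
Qed.

Section Quadratic.
Variables (lam : {lrmorphism F3 -> F}) (mu : {lrmorphism F -> F3}) (P : 'I_3 -> 'I_3 -> K).
Hypotheses (pil : forall g, pi (lam g) = pi3 g) (mul : forall g, mu (lam g) = g).
Hypothesis lamE : forall i, lam (gen3 i) = \sum_m P i m *: gen (a m).

Let M g m m' := coef W (lam g) [:: a m; a m'].

Lemma quadratic_lift g : H3 2 g ->
  lam g = \sum_m \sum_m' M g m m' *: word W [:: a m; a m'].
Proof.
move=> hg; have [T hT] : exists T : 'I_3 -> 'I_3 -> K, lam g = \sum_m \sum_m' T m m' *: word W [:: a m; a m'].
  elim/homogeneous_ind: hg => [|e s {}g hs [T hT]].
    exists (fun _ _ => 0); rewrite rmorph0 big1 // => m _; rewrite big1 // => m' _; by rewrite scale0r.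
  rewrite weight1 in hs; case: s hs => [|i [|j []]] // _.
  exists (fun m m' => e * (P i m * P j m') + T m m'); rewrite linearP /= hT.
  rewrite (word_cons W3) rmorphM /= !lamE mulr_suml scaler_sumr -big_split; apply: eq_bigr => m _.
  rewrite mulr_sumr scaler_sumr -big_split; apply: eq_bigr => m' _ /=.
  by rewrite scalerDl -scalerAl -scalerAr !scalerA (word_cons W (a m) [:: a m']) mulrA.
rewrite {1}hT; apply: eq_bigr => m _; apply: eq_bigr => m' _; congr (_ *: _).
rewrite /M hT coef_sum (bigD1 m) //= [X in _ + X]big1 ?addr0 => [|j nj]; last first.
  rewrite coef_sum big1 // => i _; rewrite wcoefZ coef_word eqseq_cons (inj_eq ainj) (negPf nj) mulr0 //.
rewrite coef_sum (bigD1 m') //= wcoefZ coef_word eqxx mulr1 big1 ?addr0 // => i ni.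
by rewrite wcoefZ coef_word !eqseq_cons !(inj_eq ainj) (negPf ni) andbF mulr0.
Qed.

(** Quadratic relations are alternating tensors in the kernel of the bracket. *)
Lemma quadratic_relation g : H3 2 g -> pi3 g = 0 ->
  (forall m, M g m m = 0) /\ (forall m m', M g m m' = - M g m' m) /\
  forall k, M g 1 0 * c k (a 1) (a 0) + M g 2%:R 0 * c k (a 2%:R) (a 0)
    + M g 2%:R 1 * c k (a 2%:R) (a 1) = 0.
Proof.
move=> hg g0; have w1 m : w (a m) = 1%N by apply/aP; exists m.
have [t [ht ct]] : exists t : 'I_n -> 'I_n -> K, (forall j i, t j i != 0 -> w j = 1%N /\ w i = 1%N) /\
    lam g = \sum_j \sum_i t j i *: rel i j.
  have [|t [ht ct]] := @quadratic_kernel (lam g); first by rewrite pil.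
  suff hl : homogeneous W w 2 (lam g) by exists t; split=> //; rewrite -ct hl.
  rewrite (quadratic_lift hg); apply: subspace_sum => [|m _]; first exact: hom_subspace.
  apply: subspace_sum => [|m' _]; first exact: hom_subspace.
  apply: (subspaceZ _ (hom_subspace W w 2)); have := hom_word_weight W w [:: a m; a m'].
  by rewrite /weight !big_cons big_nil !w1.
have [c2 c1] := quadratic_coef ct.
split; first by move=> m; rewrite /M c2 subrr.
split; first by move=> m m'; rewrite /M !c2 opprB.
move=> k; have : coef W (lam g) [:: k] = 0.
  rewrite (quadratic_lift hg) coef_sum big1 // => m _; rewrite coef_sum big1 // => m' _.
  by rewrite wcoefZ coef_word eqseq_cons andbF mulr0.
rewrite c1 (sum_weight1 (f := fun j => \sum_i t j i * c k j i)); last first.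
  move=> j wj; rewrite big1 // => i _; case: (eqVneq (t j i) 0) => [->|/ht[]//]; by rewrite mul0r.
rewrite (eq_bigr (fun m => \sum_m' t (a m) (a m') * c k (a m) (a m'))) => [|m _]; last first.
  apply: (sum_weight1 (f := fun i => t (a m) i * c k (a m) i)) => i wi.
  by case: (eqVneq (t (a m) i) 0) => [->|/ht[]//]; rewrite mul0r.
rewrite !sum3 !(sc_alt gl) (sc_anti gl k (a 0) (a 1)) (sc_anti gl k (a 0) (a 2%:R)) (sc_anti gl k (a 1) (a 2%:R)).
move=> e; rewrite /M !c2 -[RHS]oppr0 -e; ring.
Qed.

(** The quadratic relations are alternating tensors of L_1 killed by the bracket,
which is onto the plane L_2.  The exterior square of L_1 has dimension three,
which leaves a line. *)
Lemma two_quadratic_weights p q k0 k1 : p != q -> w p = 2%N -> w q = 2%N ->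
  (forall k, k <> p -> k <> q -> w k = 1%N) -> k0 != k1 -> deg k0 = 2%N -> deg k1 = 2%N -> False.
Proof.
move=> pq wp wq w1 k01 d0 d1.
pose s1 (s : 'I_3) : 'I_3 := nth 0 [:: 1; 2%:R; 2%:R] s; pose s2 (s : 'I_3) : 'I_3 := nth 0 [:: 0; 0; 1] s.
pose rk (e : 'I_2) := if e == 0 then k0 else k1; pose pk (e : 'I_2) := if e == 0 then p else q.
pose X : 'M[K]_(2, 3) := \matrix_(e, s) M (r (rk e)) (s1 s) (s2 s).
pose C : 'M[K]_(3, 2) := \matrix_(s, e) c (pk e) (a (s1 s)) (a (s2 s)).
have hrk e : H3 2 (r (rk e)) by have h0 := hr k0; have h1 := hr k1; rewrite d0 in h0; rewrite d1 in h1; rewrite /rk; case: eqP.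
have rk0 e : pi3 (r (rk e)) = 0 by apply/(kernelP min); apply: IdealIn; exists (rk e); rewrite ?inE.
have XC : X *m C = 0.
  apply/matrixP => e e'; rewrite !mxE sum3 !mxE.
  by have [_ [_ h]] := quadratic_relation (hrk e) (rk0 e); apply: h.
(* the columns of C are independent because the bracket is onto L_2 *)
have rC : \rank C = 2%N.
  rewrite -mxrank_tr; apply/eqP; rewrite -/(row_free _) -kermx_eq0; apply/rowV0P => v /sub_kermxP vC.
  have vs s : v 0 0 * c p (a (s1 s)) (a (s2 s)) + v 0 1 * c q (a (s1 s)) (a (s2 s)) = 0.
    have := congr1 (fun u : 'rV_3 => u 0 s) vC; rewrite !mxE !big_ord_recl big_ord0 !mxE addr0.
    by rewrite (_ : lift ord0 ord0 = 1 :> 'I_2) //; apply: val_inj.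
  pose phi k := if k == p then v 0 0 else if k == q then v 0 1 else 0.
  have qp : (q == p) = false by rewrite eq_sym; apply/negbTE.
  have phi_sum j i : \sum_k c k j i * phi k = v 0 0 * c p j i + v 0 1 * c q j i.
    rewrite (bigD1 p) //= (bigD1 q) ?qp //= big1 ?addr0 /phi ?eqxx ?qp.
      by rewrite ![_ * v _ _]mulrC.
    by move=> k /andP[/negPf -> /negPf ->]; rewrite mulr0.
  have phi_br j i : \sum_k c k j i * phi k = 0.
    rewrite phi_sum; pose T j i := v 0 0 * c p j i + v 0 1 * c q j i; rewrite -/(T j i).
    have Ta j' i' : T j' i' = - T i' j'.
      by rewrite /T (sc_anti gl p j') (sc_anti gl q j') !mulrN opprD.
    case: (eqVneq (T j i) 0) => // nz; have [wj wi] : w j = 1%N /\ w i = 1%N.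
      have wji : (w j + w i)%N = 2%N.
        case: (eqVneq (c p j i) 0) => [e|/(sc_weight gl)]; last by rewrite wp.
        case: (eqVneq (c q j i) 0) => [e'|/(sc_weight gl)]; last by rewrite wq.
        by move: nz; rewrite /T e e' !mulr0 addr0 eqxx.
      by have := weight_gt0 j; have := weight_gt0 i; lia.
    move/aP: wj => [m ->]; move/aP: wi => [m' ->].
    apply: (alternating3 (T := fun m m' => T (a m) (a m'))) (vs 0) (vs 1) (vs 2%:R) m m' => k //.
    by rewrite /T !(sc_alt gl) !mulr0 addr0.
  have phi0 : forall k, phi k = 0.
    apply: (character0 phi_br) => k wk; rewrite /phi; case: eqP => [e|_]; first by move: wk; rewrite e wp.
    by case: eqP => [e|] //; move: wk; rewrite e wq.
  apply/rowP => e; rewrite [RHS]mxE; case: (ord2_cases e) => ->.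
    by have := phi0 p; rewrite /phi eqxx.
  by have := phi0 q; rewrite /phi eqxx qp.
have : \rank X != 2%N by apply/eqP => e; move: (mulmx0_rank_max XC); rewrite rC e.
rewrite -/(row_free X) -kermx_eq0 => /rowV0Pn[u /sub_kermxP uX unz].
pose g := u 0 0 *: r k0 + u 0 1 *: r k1.
have hg : H3 2 g.
  by apply: (subspaceD (hom_subspace W3 _ 2)); apply: (subspaceZ _ (hom_subspace W3 _ 2)); [apply: (hrk 0) | apply: (hrk 1)].
have g0 : pi3 g = 0 by have := rk0 0; have := rk0 1; rewrite /g linearP linearZ /= => -> ->; rewrite !scaler0 addr0.
have [Ma [Manti _]] := quadratic_relation hg g0.
have Ms s : M g (s1 s) (s2 s) = 0.
  have := congr1 (fun v : 'rV_3 => v 0 s) uX; rewrite !mxE !big_ord_recl big_ord0 !mxE addr0 => e.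
  rewrite /M /g linearP linearZ /= wcoefD !wcoefZ -[RHS]e; congr (_ + _ * _); congr (u _ _); exact: val_inj.
have M0 m m' : M g m m' = 0 by apply: alternating3 (Ms 0) (Ms 1) (Ms 2%:R) m m'.
have gz : g = 0.
  rewrite -(mul g) (quadratic_lift hg) (_ : \sum_m _ = 0) ?rmorph0 // big1 // => m _.
  by rewrite big1 // => m' _; rewrite M0 scale0r.
pose e k := if k == k0 then u 0 0 else if k == k1 then u 0 1 else 0.
have k10 : (k1 == k0) = false by rewrite eq_sym; apply/negbTE.
have esum : \sum_(k | deg k == 2%N) e k *: r k = g.
  rewrite (bigD1 k0) /= ?d0 // (bigD1 k1) /= ?d1 ?k10 // big1 ?addr0 => [|k /andP[/andP[_ /negPf n0] /negPf n1]].
    by rewrite /e !eqxx k10.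
  by rewrite /e n0 n1 scale0r.
have ez : forall k, deg k = 2%N -> e k = 0.
  apply: (generators_independent hr min); rewrite esum gz; by case: (decomposable_subspace W3 pi3 2).
case/eqP: unz; apply/rowP => i; rewrite [RHS]mxE; case: (ord2_cases i) => ->.
  by have := ez _ d0; rewrite /e eqxx.
by have := ez _ d1; rewrite /e eqxx k10.
Qed.
End Quadratic.

Section Cubic.
Variables (lam : {lrmorphism F3 -> F}) (h : 'I_3 -> F3) (P : 'I_3 -> 'I_3 -> K).
Hypotheses (pil : forall g, pi (lam g) = pi3 g) (lamh : forall m, lam (h m) = gen (a m)).
Hypothesis lamE : forall i, lam (gen3 i) = \sum_m P i m *: gen (a m).
Hypothesis deg3 : forall k, (deg k <= 3)%N.
Variables (p q : 'I_n).
Hypotheses (wp : w p = 2%N) (wq : w q = 3%N) (w1 : forall k, k <> p -> k <> q -> w k = 1%N).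

Let w2p k : w k = 2%N -> k = p.
Proof. by move=> wk; apply: NNPP => kp; have := w1 kp; rewrite wk => e; have //: 2%N = 1%N; apply: e => kq; move: wk; rewrite kq wq. Qed.
Let w3q k : w k = 3%N -> k = q.
Proof.
move=> wk; case: (k =P q) => // kq; case: (k =P p) => [kp|kp]; first by move: wp; rewrite -kp wk.
by have := w1 kp kq; rewrite wk.
Qed.
Let w_le3 k : (w k <= 3)%N.
Proof. by case: (k =P p) => [->|kp]; [rewrite wp | case: (k =P q) => [->|kq]; [rewrite wq | rewrite w1]]. Qed.

Lemma bracket2 (V : lmodType K) (f : 'I_n -> V) j i : w j = 1%N -> w i = 1%N ->
  \sum_k c k j i *: f k = c p j i *: f p.
Proof.
move=> wj wi; rewrite (bigD1 p) //= big1 ?addr0 // => k kp.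
case: (eqVneq (c k j i) 0) => [->|/(sc_weight gl)]; first by rewrite scale0r.
by rewrite wj wi => /w2p e; rewrite e eqxx in kp.
Qed.

Lemma bracket3 (V : lmodType K) (f : 'I_n -> V) j i : (w j + w i = 3)%N ->
  \sum_k c k j i *: f k = c q j i *: f q.
Proof.
move=> wji; rewrite (bigD1 q) //= big1 ?addr0 // => k kq.
case: (eqVneq (c k j i) 0) => [->|/(sc_weight gl)]; first by rewrite scale0r.
by rewrite wji => /w3q e; rewrite e eqxx in kq.
Qed.

Lemma bracket4 (V : lmodType K) (f : 'I_n -> V) j i : (3 < w j + w i)%N ->
  \sum_k c k j i *: f k = 0.
Proof.
move=> lt; rewrite big1 // => k _.
case: (eqVneq (c k j i) 0) => [->|/(sc_weight gl) e]; first by rewrite scale0r.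
by have := w_le3 k; rewrite e leqNgt lt.
Qed.

Lemma cubic_vector : exists k1, w k1 = 1%N /\ c q k1 p != 0.
Proof.
have [j [i nz]] : exists j i, c q j i != 0 by apply: not_bracket1; rewrite wq.
have := sc_weight gl nz; rewrite wq => e; have wj := weight_gt0 j; have wi := weight_gt0 i.
case: (eqVneq (w j) 1%N) => wj1; first by exists j; rewrite -(w2p (k := i)) //; lia.
have wi1 : w i = 1%N by lia.
by exists i; split=> //; move: nz; rewrite (sc_anti gl) oppr_eq0 (w2p (k := j)) //; lia.
Qed.

Variables (k1 : 'I_n).
Hypotheses (wk1 : w k1 = 1%N) (nz1 : c q k1 p != 0).
Local Notation nu k := (c q k p).
Local Notation beta k := (c p k1 k).

(** The Jacobi identity on x_k1, x_u, x_v: up to scaling, the bracket of two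
elements of degree one is the exterior product of nu and beta. *)
Lemma bracket_wedge u v : w u = 1%N -> w v = 1%N -> nu k1 * c p u v = beta v * nu u - beta u * nu v.
Proof.
move=> wu wv; have := sc_jacobi gl q u v k1.
rewrite (bracket2 (V := K^o) (fun k => c q u k)) // (bracket2 (V := K^o) (fun k => c q v k)) //.
rewrite (bracket2 (V := K^o) (fun k => c q k1 k)) // /GRing.scale /= (sc_anti gl p v k1) => e.
apply/eqP; rewrite -subr_eq0 -[X in _ == X]e; apply/eqP; ring.
Qed.

Lemma cubic_vector2 : exists k2, w k2 = 1%N /\ beta k2 != 0.
Proof.
have [j [i nz]] : exists j i, c p j i != 0 by apply: not_bracket1; rewrite wp.
have := sc_weight gl nz; rewrite wp => e; have wj0 := weight_gt0 j; have wi0 := weight_gt0 i.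
have wj : w j = 1%N by lia.
have wi : w i = 1%N by lia.
have := bracket_wedge wj wi; case: (eqVneq (beta i) 0) => [bi|]; last by exists i.
case: (eqVneq (beta j) 0) => [bj|]; last by exists j.
by rewrite bi bj !mul0r subrr => /eqP; rewrite mulf_eq0 (negPf nz1) (negPf nz).
Qed.

Local Notation o n := (@Ordinal 5 n isT).
Local Notation e i := (unit_mx K (o i) (o 0)).
Local Notation Sh := (shift_mx K).
(** A representation of L up to the corner entry (4,0): the bracket with an
element of degree one shifts the first column.  The corner is the place of a
bracket of degree four, which vanishes in L. *)
Definition rho (k : 'I_n) : 'M[K]_5 :=
  if w k == 1%N then nu k *: Sh + beta k *: e 1 else if w k == 2%N then nu k1 *: e 2 else nu k1 *: e 3.

Let rho1 k : w k = 1%N -> rho k = nu k *: Sh + beta k *: e 1.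
Proof. by rewrite /rho => ->. Qed.
Let rhop : rho p = nu k1 *: e 2. Proof. by rewrite /rho wp. Qed.
Let rhoq : rho q = nu k1 *: e 3. Proof. by rewrite /rho wq. Qed.

Lemma plane_mul (x1 y1 x2 y2 : K) : (x1 *: Sh + y1 *: e 1) * (x2 *: Sh + y2 *: e 1) =
  (x1 * x2) *: (Sh * Sh) + (x1 * y2) *: e 2.
Proof.
rewrite mulrDl (mulrDr (x1 *: Sh)) (mulrDr (y1 *: e 1)) -!scalerAl -!scalerAr shift10 col0_shift col0_unit //.
by rewrite !scaler0 !addr0 !scalerA.
Qed.

Lemma plane_e (x1 y1 : K) : (x1 *: Sh + y1 *: e 1) * e 2 = x1 *: e 3 /\
  (x1 *: Sh + y1 *: e 1) * e 3 = x1 *: e 4 /\ (x1 *: Sh + y1 *: e 1) * e 4 = 0.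
Proof.
by split; [|split]; rewrite mulrDl -!scalerAl ?shift20 ?shift30 ?shift40 col0_unit // ?scaler0 addr0.
Qed.

Lemma e_plane i (x1 y1 : K) : unit_mx K i (o 0) * (x1 *: Sh + y1 *: e 1) = 0.
Proof. by rewrite mulrDr -!scalerAr col0_shift col0_unit // !scaler0 addr0. Qed.

Lemma rho_relation j i : exists x0 : K,
  rho j * rho i - rho i * rho j - \sum_k c k j i *: rho k = x0 *: e 4.
Proof.
have ee x1 x2 (m m' : 'I_5) : m' != o 0 -> (x1 *: unit_mx K m (o 0)) * (x2 *: unit_mx K m' (o 0)) = 0.
  by move=> nm; rewrite -scalerAl -scalerAr col0_unit // !scaler0.
have cases k : w k = 1%N \/ k = p \/ k = q.
  by case: (k =P p) => [|kp]; auto; case: (k =P q) => [|kq]; auto.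
case: (cases j) => [wj|[->|->]]; case: (cases i) => [wi|[->|->]].
- exists 0; rewrite bracket2 // rhop !rho1 // !plane_mul scale0r scalerA [c p j i * _]mulrC bracket_wedge //.
  rewrite [nu i * nu j]mulrC opprD addrACA subrr add0r -scalerBl -scalerBl.
  by rewrite (_ : _ - _ = 0) ?scale0r //; ring.
- exists 0; rewrite bracket3 ?wj ?wp // rhoq rhop rho1 // -scalerAr -scalerAl e_plane scaler0 subr0.
  have [-> _] := plane_e (nu j) (beta j); rewrite !scalerA [nu k1 * _]mulrC subrr scale0r //.
- exists (nu k1 * nu j); rewrite bracket4 ?wj ?wq // rhoq rho1 // -scalerAr -scalerAl e_plane scaler0 !subr0.
  by have [_ [-> _]] := plane_e (nu j) (beta j); rewrite scalerA.
- exists 0; rewrite bracket3 ?wi ?wp // rhoq rhop rho1 // -scalerAr -scalerAl e_plane scaler0 sub0r.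
  have [-> _] := plane_e (nu i) (beta i); rewrite !scalerA (sc_anti gl q p i) mulNr scaleNr opprK.
  by rewrite [nu k1 * _]mulrC addNr scale0r.
- by exists 0; rewrite bracket4 ?wp // rhop !ee // scale0r !subr0.
- by exists 0; rewrite bracket4 ?wp ?wq // rhop rhoq !ee // scale0r !subr0.
- exists (- (nu k1 * nu i)); rewrite bracket4 ?wi ?wq // rhoq rho1 // -scalerAr -scalerAl e_plane scaler0 sub0r subr0.
  by have [_ [-> _]] := plane_e (nu i) (beta i); rewrite scalerA scaleNr.
- by exists 0; rewrite bracket4 ?wp ?wq // rhop rhoq !ee // scale0r !subr0.
by exists 0; rewrite bracket4 ?wq // rhoq !ee // scale0r !subr0.
Qed.

(** Relations of degree at most three are mapped to 0 by Phi, because products of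
at most three generators do not reach the corner.  If they generated all
relations, Phi would also vanish on [x1,[x1,[x1,x2]]], which is 0 in L. *)
Lemma cubic_contradiction : False.
Proof.
have [Phi PhiE] : exists Phi : {lrmorphism F -> 'M[K]_5}, forall k, Phi (gen k) = rho k.
  by exists (free_eval W rho) => k; apply: free_eval_gen.
have rho4 k : rho k * e 4 = 0 /\ e 4 * rho k = 0.
  rewrite /rho; case: ifP => _; first by rewrite e_plane; have [_ [_ ->]] := plane_e (nu k) (beta k).
  by case: ifP => _; rewrite -scalerAl -scalerAr !col0_unit // !scaler0.
(* e 4 spans a two-sided ideal of the image *)
have corner g : exists x1 x2 : K, Phi g * e 4 = x1 *: e 4 /\ e 4 * Phi g = x2 *: e 4.
  elim/(free_ind (W := W)): g => [|b s g [x1 [x2 [h1 h2]]]].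
    by exists 0, 0; rewrite rmorph0 mul0r mulr0 scale0r.
  have [y1 [y2 [g1 g2]]] : exists y1 y2 : K, Phi (word W s) * e 4 = y1 *: e 4 /\ e 4 * Phi (word W s) = y2 *: e 4.
    elim: s => [|k s [y1 [y2 [g1 g2]]]]; first by exists 1, 1; rewrite (word_nil W) rmorph1 mul1r mulr1 scale1r.
    exists 0, 0; rewrite (word_cons W) rmorphM /= PhiE -mulrA g1 mulrA; have [r1 ->] := rho4 k.
    by rewrite -scalerAr r1 scaler0 mul0r scale0r.
  exists (b * y1 + x1), (b * y2 + x2); rewrite linearP mulrDl mulrDr -scalerAl -scalerAr g1 g2 h1 h2.
  by rewrite !scalerA -!scalerDl.
have kerPhi g : pi g = 0 -> exists x0 : K, Phi g = x0 *: e 4.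
  move/ker; elim=> {g} [g [i [j ->]]||f g _ [x0 h1] _ [y0 h2]|f g _ [x0 h1]|f g _ [x0 h1]].
  - rewrite lie_relation_hom !PhiE; have [x0 e0] := rho_relation j i; exists x0; rewrite -e0; congr (_ - _).
    by apply: eq_bigr => k _; rewrite PhiE.
  - by exists 0; rewrite rmorph0 scale0r.
  - by exists (x0 + y0); rewrite rmorphD /= h1 h2 scalerDl.
  - have [y1 [_ [e1 _]]] := corner f; exists (x0 * y1); by rewrite rmorphM /= h1 -scalerAr e1 scalerA.
  by have [_ [y1 [_ e1]]] := corner f; exists (x0 * y1); rewrite rmorphM /= h1 -scalerAl e1 scalerA.
have T i : exists x1 y1 : K, Phi (lam (gen3 i)) = x1 *: Sh + y1 *: e 1.
  exists (\sum_m P i m * nu (a m)), (\sum_m P i m * beta (a m)); rewrite lamE linear_sum !scaler_suml -big_split.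
  apply: eq_bigr => m _; rewrite linearZ /= PhiE rho1; last by apply/aP; exists m.
  by rewrite scalerDr !scalerA.
have low g d : (d <= 3)%N -> H3 d g -> (Phi (lam g)) (o 4) (o 0) = 0.
  move=> le hg; elim/homogeneous_ind: hg => [|b s {}g hs IH]; first by rewrite !rmorph0 mxE.
  rewrite !linearP /= !mxE IH addr0; rewrite weight1 in hs; apply/eqP; rewrite mulf_eq0; apply/orP; right; apply/eqP.
  case: s hs => [|i1 [|i2 [|i3 [|i4 s]]]] hs; last by move: le; rewrite -hs.
  - by rewrite (word_nil W3) !rmorph1 mxE.
  - by have [x1 [y1 ->]] := T i1; rewrite mxE [X in X + _]mxE [X in _ + X]mxE shift_corner unit_mxE /= !mulr0 addr0.
  - have [x1 [y1 E1]] := T i1; have [x2 [y2 E2]] := T i2.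
    rewrite (word_cons W3 i1 [:: i2]) !rmorphM /= E1 E2 plane_mul.
    by rewrite mxE [X in X + _]mxE [X in _ + X]mxE shift2_corner unit_mxE /= !mulr0 addr0.
  have [x1 [y1 E1]] := T i1; have [x2 [y2 E2]] := T i2; have [x3 [y3 E3]] := T i3.
  rewrite (word_cons W3 i1 [:: i2; i3]) (word_cons W3 i2 [:: i3]) !rmorphM /= E1 E2 E3 plane_mul mulrDr -!scalerAr.
  have [-> _] := plane_e x1 y1; rewrite mulrDl -!scalerAl mulrA [e 1 * _]mulrA col0_shift mul0r scaler0 addr0.
  by rewrite !scalerA mxE [X in X + _]mxE [X in _ + X]mxE shift40E unit_mxE /= !mulr0 addr0.
have Phir g : pi3 g = 0 -> Phi (lam g) = 0.
  move/(kernelP min); elim=> {g} [g [k _ ->]||f g _ h1 _ h2|f g _ h1|f g _ h1].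
  - have [|x0 e0] := kerPhi (lam (r k)); first by rewrite pil; apply/(kernelP min); apply: IdealIn; exists k; rewrite ?inE.
    have := low _ _ (deg3 k) (hr k); rewrite e0 /unit_mx !mxE !eqxx mulr1 => ->; by rewrite scale0r.
  - by rewrite !rmorph0.
  - by rewrite !rmorphD /= h1 h2 addr0.
  - by rewrite !rmorphM /= h1 mulr0.
  by rewrite !rmorphM /= h1 mul0r.
have [k2 [wk2 b2]] := cubic_vector2.
move/aP: (wk1) => [m1 e1]; move/aP: (wk2) => [m2 e2].
pose ad (B : algType K) (u v : B) : B := u * v - v * u.
have ad_hom (B C : algType K) (f : {lrmorphism B -> C}) u v : f (ad _ u v) = ad _ (f u) (f v).
  by rewrite /ad rmorphB !rmorphM.
have adZ (B : algType K) (u v : B) b : ad _ u (b *: v) = b *: ad _ u v.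
  by rewrite /ad -scalerAl -scalerAr scalerBr.
(* beta vanishes on x_k1, so that the first bracket is already in the
   column, and each further one shifts it by nu k1 *)
pose g := ad _ (h m1) (ad _ (h m1) (ad _ (h m1) (h m2))).
have g0 : pi3 g = 0.
  rewrite -pil !ad_hom !lamh -e1 -e2 [X in ad _ _ (ad _ _ X)]pi_rel (bracket2 (fun k => pi (gen k))) // adZ.
  rewrite [X in ad _ _ (_ *: X)]pi_rel bracket3 ?wk1 ?wp // !adZ [ad _ _ _]pi_rel bracket4 ?wk1 ?wq //.
  by rewrite !scaler0.
have := Phir g g0; rewrite !ad_hom !lamh -e1 -e2 !PhiE !rho1 // (sc_alt gl) scale0r addr0.
have -> : ad _ (nu k1 *: Sh) (nu k2 *: Sh + beta k2 *: e 1) = (nu k1 * beta k2) *: e 2.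
  rewrite /ad mulrDr mulrDl -!scalerAl -!scalerAr shift10 col0_shift !scaler0 addr0 !scalerA [nu k2 * _]mulrC.
  by rewrite addrAC subrr add0r.
rewrite !adZ; have -> : ad _ (nu k1 *: Sh) (e 2) = nu k1 *: e 3.
  by rewrite /ad -scalerAl -scalerAr shift20 col0_shift scaler0 subr0.
rewrite adZ; have -> : ad _ (nu k1 *: Sh) (e 3) = nu k1 *: e 4.
  by rewrite /ad -scalerAl -scalerAr shift30 col0_shift scaler0 subr0.
rewrite !scalerA => /(congr1 (fun M : 'M[K]_5 => M (o 4) (o 0))); rewrite /unit_mx !mxE !eqxx mulr1 => /eqP.
by rewrite !mulf_eq0 (negPf nz1) (negPf b2).
Qed.
End Cubic.

End Generators.

Lemma not_type_223 (F3 : algType K) (W3 : word_basis 3 F3) (pi3 : {lrmorphism F3 -> U})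
    (r : 'I_3 -> F3) :
  (forall k : 'I_3, homogeneous W3 (fun=> 1%N) (nth 0%N [:: 2; 2; 3]%N k) (r k)) ->
  minimal_ideal_generators r (fun g => pi3 g = 0) ->
  (forall i, degree_one (pi3 (word W3 [:: i]))) -> False.
Proof.
move=> hr min pi31; have deg2 (k : 'I_3) : (1 < nth 0%N [:: 2; 2; 3]%N k)%N by case: k => [[|[|[|]]]].
have deg3 (k : 'I_3) : (nth 0%N [:: 2; 2; 3]%N k <= 3)%N by case: k => [[|[|[|]]]].
have [a [ainj aP]] := weight1_enum.
have [lam [mu [h [pil mul lamh _ [P lamE]]]]] := lift_generators hr deg2 min pi31 ainj aP.
have [p [q [pq wp [wq|wq] w1]]] := weight_cases.
  exact: (two_quadratic_weights hr min ainj aP pil mul lamE pq wp wq w1 (k0 := 0) (k1 := 1)).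
have [k1 [wk1 nz1]] := cubic_vector wp wq w1.
exact: (cubic_contradiction hr min aP pil lamh lamE deg3 wp wq w1 wk1 nz1).
Qed.

End Enveloping.

Theorem enveloping_not_223 (K : fieldType) (U : algType K) (G : nat -> U -> Prop) :
  graded_enveloping_algebra 5 G -> generated_in_degree_one G -> subspace_dim (G 1%N) 3 ->
  ~ relation_type G [:: 2; 2; 3]%N.
Proof.
move=> [L [br [x [w [pi0 [gl [_ ker0] GE]]]]]] gen dim [_ [b [pi3 [r [db pi31 _ hr min]]]]].
have b3 : b = 3%N := dim_uniq db dim; subst b.
pose pi : {lrmorphism free_alg K 5 -> U} := pi0.
have ker f : pi f = 0 <-> ideal_generated_by (fun h => exists i j, h = lie_relation br x (malg_words K 5) i j) f.
  rewrite (ker0 f); split; apply: ideal_mono => h [i [j ->]]; apply: IdealIn; exists i, j; by rewrite ?lie_relatorE.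
have G1 u : G 1%N u <-> degree_one w (malg_words K 5) pi u.
  by rewrite GE; split=> -[f hf <-]; exists f => //; apply/free_homogeneousE.
have gen' u : subalgebra_generated_by (degree_one w (malg_words K 5) pi) u.
  by apply: subalgebra_mono (gen u) => v /G1.
have dim' : subspace_dim (degree_one w (malg_words K 5) pi) 3 by apply: subspace_dim_eq dim => v; rewrite G1.
apply: (not_type_223 gl ker gen' dim' erefl (W3 := malg_words K 3) (pi3 := pi3) (r := r)) => //.
  by move=> k; apply/free_homogeneousE.
by move=> i; apply/G1; have := pi31 i; rewrite -mword_gen.
Qed.

(** * The classification *)

Close Scope ring_scope.

Theorem theorem1p3 (K : fieldType) :
  let AS_Ore_type (a : seq nat) :=
    exists (A : algType K) (G : nat -> A -> Prop),
      [/\ AS_Ore_extension 5 G, subspace_dim (G 1) 3 & relation_type G a] in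
  let enveloping_type (a : seq nat) :=
    exists (U : algType K) (G : nat -> U -> Prop),
      [/\ graded_enveloping_algebra 5 G, generated_in_degree_one G,
          subspace_dim (G 1) 3 & relation_type G a] in
  (forall a : seq nat,
     AS_Ore_type a <->
     a \in [:: [:: 2; 3; 3; 3; 3; 3]; [:: 2; 2; 3]; [:: 2; 2; 3; 4]]) /\
  [/\ ~ enveloping_type [:: 2; 2; 3],
      enveloping_type [:: 2; 2; 3; 4]
    & enveloping_type [:: 2; 3; 3; 3; 3; 3]].
Proof.
move=> AS_Ore_type enveloping_type.
have no_223 : ~ enveloping_type [:: 2; 2; 3].
  by move=> [U [G [env gen dim rel]]]; apply: (enveloping_not_223 env gen dim rel).
have [A1 [G1 [as1 env1 gen1 dim1 rel1]]] := type_233333 K.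
have [A2 [G2 [as2 dim2 rel2]]] := type_223 K.
have [A3 [G3 [t [[as3 env3] gen3 dim3 rel3 tE]]]] := type_223_or_2234 K.
have {tE} tE : t = [:: 2; 2; 3; 4].
  by case: tE => // tE; case: no_223; exists A3, G3; rewrite -tE.
rewrite tE in rel3; split; last by split=> //; [exists A3, G3 | exists A1, G1].
move=> a; split; last first.
  by rewrite !inE => /orP[|/orP[]] /eqP ->; [exists A1, G1 | exists A2, G2 | exists A3, G3].
move=> [A [G [[vars [T [sz inj gen]]] dim rel]]].
have [tw _ _] := tower_of_ore inj.
have sz' : size (unzip2 vars) = 5 by rewrite size_map.
by have [[_ ->]|[_ [->|->]]] := tower_relation_type tw sz' gen dim rel; rewrite !inE eqxx ?orbT.
Qed.
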